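(* Let $s=\frac12$ and let $u$ be a weak solution of the stationary fractional Navier--Stokes equations $$(-\Delta)^su+u\cdot\nabla u+\nabla P=0,\qquad\nabla\cdot u=0\qquad\text{in }\mathbb{R}^3,$$ with $\int_{\mathbb{R}^3}|(-\Delta)^{\frac s2}u|^2dx<\infty$. Then $$\int_{\mathbb{R}^3}|(-\Delta)^{\frac14}u|^2dx=\liminf_{k\to\infty}\Big\{\int_{\mathbb{R}^3}\sum_{l=k-1}^{k+2}\sum_{l'=l-2}^{k-1}\sum_{l''=0}^{k-1}\dot{S}_{l-2}\dot{\Delta}_{l''}u\cdot\nabla\dot{\Delta}_{l'}u\cdot\dot{\Delta}_lu^k\,dx+\int_{\mathbb{R}^3}\sum_{l=k-3}^{k}\sum_{l''=[\frac{k}{2}]}^{k-1}\dot{\Delta}_l\dot{S}_ku\cdot\nabla\dot{\Delta}_{l''}u\cdot\tilde{\dot{\Delta}}_lu^k\,dx+\int_{\mathbb{R}^3}\sum_{l''=[\frac{k}{2}]}^{k-1}\sum_{l\ge k-1}\tilde{\dot{\Delta}}_{l}u^k\cdot\nabla\dot{\Delta}_{l''}u\cdot\dot{\Delta}_lu^k\,dx\Big\},$$ where $k$ ranges over the integers. Furthermore, if $\|u^0\|_{L^\infty}<\infty$, where $u^0=u-\dot S_0u$, then $u\equiv0$.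
   Context: Fourier transform on $\mathcal{S}'(\mathbb{R}^3)$: $\hat f(\xi)=(2\pi)^{-3/2}\int_{\mathbb{R}^3} e^{-ix\cdot\xi}f(x)\,dx$, with inverse $\mathcal{F}^{-1}$; $(-\Delta)^{\sigma}f=\mathcal{F}^{-1}(|\xi|^{2\sigma}\hat f)$; $\|f\|_{\dot H^\sigma}=(\int_{\mathbb{R}^3}|\xi|^{2\sigma}|\hat f(\xi)|^2d\xi)^{1/2}$. Weak solution: a vector field $u\in\dot H^s(\mathbb{R}^3)$ is a weak solution of the stationary fractional Navier--Stokes equations $(-\Delta)^su+u\cdot\nabla u+\nabla P=0$, $\nabla\cdot u=0$ in $\mathbb{R}^3$ if $u$ is weakly divergence free and, for some $P\in\mathcal{S}'(\mathbb{R}^3)$ and all $\phi\in(C_0^\infty(\mathbb{R}^3))^3$, $$\int_{\mathbb{R}^3}(-\Delta)^{\frac s2}u\cdot(-\Delta)^{\frac s2}\phi\,dx=\int_{\mathbb{R}^3}(u\otimes u):\nabla\phi\,dx+\int_{\mathbb{R}^3}P\,\nabla\cdot\phi\,dx,$$ where $(\nabla\phi)_{i,j}=\partial_j\phi_i$ and the last integral is a duality pairing. Littlewood--Paley notation: $B_r=\{x\in\mathbb{R}^3:|x|\le r\}$. Fix a non-negative $\psi\in C_0^\infty(B_1)$ with $\psi(\xi)=1$ for $|\xi|\le\frac12$, and set $\varphi(\xi)=\psi(2^{-1}\xi)-\psi(\xi)$. For $k\in\mathbb{Z}$ put $\dot\Delta_ku=\mathcal{F}^{-1}(\varphi(2^{-k}\cdot)\hat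 u)$ and $\dot S_ku=\mathcal{F}^{-1}(\psi(2^{-k}\cdot)\hat u)$ (componentwise on vector fields). Also $u^k=u-\dot S_ku$ and $\tilde{\dot\Delta}_lu=\sum_{|l'-l|\le2}\dot\Delta_{l'}u$. For vector fields $a,b,c$: $a\cdot\nabla b\cdot c=\sum_{i,j=1}^3a_j\,\partial_jb_i\,c_i$. $[x]$ denotes the integer part (floor) of $x$. Empty sums are zero. *)

(* Defs.v *)
From HB Require Import structures.
From mathcomp Require Import all_boot all_order all_algebra.
From mathcomp Require Import all_classical all_reals all_analysis.
From mathcomp Require Import complex.

Set Implicit Arguments.
Unset Strict Implicit.
Unset Printing Implicit Defensive.

Import Order.TTheory GRing.Theory Num.Theory.
Import numFieldNormedType.Exports.

Local Open Scope classical_set_scope.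
Local Open Scope complex_scope.
Local Open Scope ring_scope.

(** * Three-dimensional Euclidean space *)

(* The norm that the library puts on a product is the maximum norm: it is used
   only for the topology and for differentiability, never as |x|. *)
Notation E3 R := (R * R * R)%type.

Definition leb3 (R : realType) : {measure set (E3 (measurableTypeR R)) -> \bar R} :=
  ((@lebesgue_measure R \x @lebesgue_measure R) \x @lebesgue_measure R)%E.

Definition coord3 (R : realType) (x : E3 R) (j : 'I_3) : R :=
  tnth [tuple x.1.1; x.1.2; x.2] j.

Definition basis_vec (R : realType) (j : 'I_3) : E3 R :=
  ((j == 0 :> nat)%:R, (j == 1 :> nat)%:R, (j == 2 :> nat)%:R).

Definition dot (R : realType) (x y : E3 R) : R :=
  \sum_(j < 3) coord3 x j * coord3 y j.

Definition enorm (R : realType) (x : E3 R) : R := Num.sqrt (dot x x).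

Definition cmod (R : realType) (z : R[i]) : R :=
  Num.sqrt (complex.Re z ^+ 2 + complex.Im z ^+ 2).

(** * Complex-valued functions on E3 *)

Definition cintegrable (R : realType) (f : E3 R -> R[i]) : Prop :=
  (leb3 R).-integrable setT (EFin \o (fun x => complex.Re (f x))) /\
  (leb3 R).-integrable setT (EFin \o (fun x => complex.Im (f x))).

Definition cintegral (R : realType) (f : E3 R -> R[i]) : R[i] :=
  (\int[leb3 R]_x complex.Re (f x))%R +i* (\int[leb3 R]_x complex.Im (f x))%R.

Definition cseries (R : realType) (a : nat -> R[i]) : R[i] :=
  limn (series (fun n => complex.Re (a n))) +i* limn (series (fun n => complex.Im (a n))).

Definition pd (R : realType) (j : 'I_3) (f : E3 R -> R) : E3 R -> R :=
  fun x => 'D_(basis_vec R j) f x.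

Definition cpd (R : realType) (j : 'I_3) (f : E3 R -> R[i]) : E3 R -> R[i] :=
  fun x => pd j (fun y => complex.Re (f y)) x +i* pd j (fun y => complex.Im (f y)) x.

(* C^oo: all iterated partial derivatives are differentiable. *)
Definition smooth (R : realType) (f : E3 R -> R) : Prop :=
  forall (a : seq 'I_3) (x : E3 R), differentiable (foldr (@pd R) f a) x.

(* C_0^oo with real values *)
Definition test_function (R : realType) (f : E3 R -> R) : Prop :=
  smooth f /\ compact (closure [set x | f x != 0]).

(** * Schwartz functions and tempered distributions *)

Definition schwartz_seminorm (R : realType) (N : nat) (f : E3 R -> R[i]) : \bar R :=
  ereal_sup [set y | exists (a : seq 'I_3) (x : E3 R), (size a <= N)%N /\
    y = ((1 + enorm x) ^+ N * cmod (foldr (@cpd R) f a x))%:E].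

Definition schwartz (R : realType) (f : E3 R -> R[i]) : Prop :=
  [/\ smooth (fun x => complex.Re (f x)), smooth (fun x => complex.Im (f x)) &
      forall N, (schwartz_seminorm N f < +oo)%E].

(* The values of a distribution outside the Schwartz space are irrelevant. *)
Notation distribution R := ((E3 R -> R[i]) -> R[i]).

(* S'(R^3): continuity with respect to the family of seminorms above, which is
   increasing in N. *)
Definition tempered (R : realType) (T : distribution R) : Prop :=
  (forall (c : R[i]) (f g : E3 R -> R[i]), schwartz f -> schwartz g ->
     T (fun x => c * f x + g x) = c * T f + T g) /\
  (exists (N : nat) (C : R), forall f : E3 R -> R[i], schwartz f ->
     ((cmod (T f))%:E <= C%:E * schwartz_seminorm N f)%E).

Definition of_fun (R : realType) (f : E3 R -> R[i]) : distribution R :=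
  fun phi => cintegral (fun x => f x * phi x).

Definition tempered_fun (R : realType) (f : E3 R -> R[i]) : Prop :=
  forall phi : E3 R -> R[i], schwartz phi -> cintegrable (fun x => f x * phi x).

Definition represents (R : realType) (f : E3 R -> R[i]) (T : distribution R) : Prop :=
  tempered_fun f /\ (forall phi : E3 R -> R[i], schwartz phi -> T phi = of_fun f phi).

(* A function representing T, unique up to a null set when there is one. *)
Definition fun_of (R : realType) (T : distribution R) : E3 R -> R[i] :=
  xget (fun _ => 0) [set f | represents f T].

Definition dpd (R : realType) (j : 'I_3) (T : distribution R) : distribution R :=
  fun phi => - T (cpd j phi).

Definition dmul (R : realType) (m : E3 R -> R) (T : distribution R) : distribution R :=
  fun phi => T (fun x => (m x)%:C * phi x).

(** * Fourier transform *)

Definition expi (R : realType) (t : R) : R[i] := cos t +i* sin t.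

Definition fourier_fun (R : realType) (f : E3 R -> R[i]) : E3 R -> R[i] :=
  fun xi => ((2 * pi) `^ (- (3 / 2)))%:C *
            cintegral (fun x => expi (- dot x xi) * f x).

Definition inv_fourier_fun (R : realType) (f : E3 R -> R[i]) : E3 R -> R[i] :=
  fun x => ((2 * pi) `^ (- (3 / 2)))%:C *
           cintegral (fun xi => expi (dot x xi) * f xi).

Definition fourier (R : realType) (T : distribution R) : distribution R :=
  fun phi => T (fourier_fun phi).

Definition inv_fourier (R : realType) (T : distribution R) : distribution R :=
  fun phi => T (inv_fourier_fun phi).

(* The symbol is singular at the origin, so it multiplies the function that
   represents the Fourier transform. *)
Definition frac_lap (R : realType) (sigma : R) (T : distribution R) : distribution R :=
  inv_fourier (of_fun (fun xi =>
    (enorm xi `^ (2 * sigma))%:C * fun_of (fourier T) xi)).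

Definition in_Hdot (R : realType) (sigma : R) (T : distribution R) : Prop :=
  [/\ tempered T,
      exists g : E3 R -> R[i], represents g (fourier T) &
      (\int[leb3 R]_xi
         (enorm xi `^ (2 * sigma) * cmod (fun_of (fourier T) xi) ^+ 2)%:E < +oo)%E].

(** * The stationary fractional Navier-Stokes equations *)

Notation vdist R := ('I_3 -> distribution R).

Definition dist_of_field (R : realType) (u : 'I_3 -> E3 R -> R) : vdist R :=
  fun i => of_fun (fun x => (u i x)%:C).

Definition vmod (R : realType) (a : vdist R) (x : E3 R) : R :=
  Num.sqrt (\sum_(i < 3) cmod (fun_of (a i) x) ^+ 2).

Definition vfrac_lap (R : realType) (sigma : R) (a : vdist R) : vdist R :=
  fun i => frac_lap sigma (a i).

Definition weakly_div_free (R : realType) (u : 'I_3 -> E3 R -> R) : Prop :=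
  forall phi : E3 R -> R, test_function phi ->
    (\int[leb3 R]_x (\sum_(i < 3) u i x * pd i phi x))%R = 0.

Definition weak_solution (R : realType) (s : R) (u : 'I_3 -> E3 R -> R) : Prop :=
  [/\ forall i, tempered_fun (fun x => (u i x)%:C),
      forall i, in_Hdot s (dist_of_field u i),
      weakly_div_free u &
      exists2 P : distribution R, tempered P &
        forall phi : 'I_3 -> E3 R -> R, (forall i, test_function (phi i)) ->
          cintegral (fun x => \sum_(i < 3)
            fun_of (vfrac_lap (s / 2) (dist_of_field u) i) x *
            fun_of (vfrac_lap (s / 2) (dist_of_field phi) i) x)
          = ((\int[leb3 R]_x (\sum_(i < 3) \sum_(j < 3)
               u i x * u j x * pd j (phi i) x))%R)%:C
            + P (fun x => (\sum_(i < 3) pd i (phi i) x)%:C)].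

(** * Littlewood-Paley decomposition *)

Definition LP_cutoff (R : realType) (psi : E3 R -> R) : Prop :=
  [/\ test_function psi,
      closure [set xi | psi xi != 0] `<=` [set xi | enorm xi <= 1],
      forall xi, 0 <= psi xi &
      forall xi, enorm xi <= 1 / 2 -> psi xi = 1].

Definition LP_phi (R : realType) (psi : E3 R -> R) (xi : E3 R) : R :=
  psi (2^-1 *: xi) - psi xi.

Definition Delta (R : realType) (psi : E3 R -> R) (k : int) (a : vdist R) : vdist R :=
  fun i => inv_fourier
    (dmul (fun xi => LP_phi psi (2 ^ (- k) *: xi)) (fourier (a i))).

Definition Slow (R : realType) (psi : E3 R -> R) (k : int) (a : vdist R) : vdist R :=
  fun i => inv_fourier
    (dmul (fun xi => psi (2 ^ (- k) *: xi)) (fourier (a i))).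

Definition high (R : realType) (psi : E3 R -> R) (k : int) (a : vdist R) : vdist R :=
  a - Slow psi k a.

(* The integers from a to b, both included; empty when b < a. *)
Definition zrange (a b : int) : seq int :=
  if a <= b then [seq a + n%:Z | n <- iota 0 `|b - a|%N.+1] else [::].

Definition tDelta (R : realType) (psi : E3 R -> R) (l : int) (a : vdist R) : vdist R :=
  \sum_(l' <- zrange (l - 2) (l + 2)) Delta psi l' a.

(* The integrand a . nabla b . c; no complex conjugation. *)
Definition trilinear (R : realType) (a b c : vdist R) (x : E3 R) : R[i] :=
  \sum_(i < 3) \sum_(j < 3)
    fun_of (a j) x * fun_of (dpd j (b i)) x * fun_of (c i) x.

Definition flux1 (R : realType) (psi : E3 R -> R) (u : vdist R) (k : int) : R[i] :=
  cintegral (fun x =>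
    \sum_(l <- zrange (k - 1) (k + 2)) \sum_(l' <- zrange (l - 2) (k - 1))
    \sum_(l'' <- zrange 0 (k - 1))
      trilinear (Slow psi (l - 2) (Delta psi l'' u)) (Delta psi l' u)
                (Delta psi l (high psi k u)) x).

Definition flux2 (R : realType) (psi : E3 R -> R) (u : vdist R) (k : int) : R[i] :=
  cintegral (fun x =>
    \sum_(l <- zrange (k - 3) k) \sum_(l'' <- zrange (k %/ 2)%Z (k - 1))
      trilinear (Delta psi l (Slow psi k u)) (Delta psi l'' u)
                (tDelta psi l (high psi k u)) x).

Definition flux3 (R : realType) (psi : E3 R -> R) (u : vdist R) (k : int) : R[i] :=
  cintegral (fun x =>
    \sum_(l'' <- zrange (k %/ 2)%Z (k - 1))
      cseries (fun n => let l := k - 1 + n%:Z in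
        trilinear (tDelta psi l (high psi k u)) (Delta psi l'' u)
                  (Delta psi l (high psi k u)) x)).

(* The cutoff psi is not assumed to be even, so the blocks of a real field may
   be complex-valued; the real part changes nothing when psi is even. *)
Definition flux (R : realType) (psi : E3 R -> R) (u : vdist R) (k : int) : R :=
  complex.Re (flux1 psi u k + flux2 psi u k + flux3 psi u k).

(* Main.v *)
(* Let g be the Fourier transform of u and G = |xi|^(1/2) g, which lies in L2.
   Testing the equation with divergence free fields eliminates the pressure and,
   by incompressibility, gives for almost every xi
     |xi| |g(xi)|^2 = c sum_ij i xi_j g_i(xi) (conv_ij)(xi),  c = (2 pi)^(-3/2),
   with conv_ij(xi) the integral of g_i(x) g_j(-xi-x) in x. Multiplying by the
   symbol p_k of S_k and integrating, the part of the trilinear form in which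
   both g_i carry p_k cancels by antisymmetry. What remains is
     E_k := int p_k |xi| |g|^2 = c sum_ij iint i z_j p_k(z) (1 - p_k(x)) g_i(z) g_i(x) g_j(-z-x),
   and E_k tends to the energy. The three fluxes have the same form with the
   symbol p_k(z) (1 - p_k(x)) replaced by m1, m2, m3. These three symbols add up
   to it except where |z + x| < 1 or |z| < 2^[k/2]; on that region p_k(z) (1 - p_k(x))
   forces |x| > 2^(k-1), and its contribution is bounded by the L2 norm of G on
   |x| > 2^(k-1), which tends to zero. So the fluxes converge to the energy.
   If u^0 is bounded then so is u, and the factor g_j can be put back in physical
   space: |E_k| <= C |u|_oo |grad S_k u|_2 |u^k|_2, where the first norm is
   O(2^(k/2)) and the second o(2^(-k/2)). Hence the energy vanishes. *)
Require Import Defs.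
From HB Require Import structures.
From mathcomp Require Import all_boot all_order all_algebra.
From mathcomp Require Import all_classical all_reals all_analysis.
From mathcomp Require Import measurable_realfun ess_sup_inf.
From mathcomp Require Import complex ring lra zify.
Import Order.TTheory GRing.Theory Num.Theory.
Import numFieldNormedType.Exports.
Local Open Scope classical_set_scope.
Local Open Scope complex_scope.
Local Open Scope ring_scope.
Set Implicit Arguments. Unset Strict Implicit. Unset Printing Implicit Defensive.

(** * Complex-valued functions and their integrals *)

Section complex_modulus.
Context {R : realType}.
Implicit Types (x y z : R[i]) (a : R).

(** A weak solution cannot be tested with itself: it lacks compact support, and it is only a bounded
    function plus an L2 one, since the energy gives no L2 control of g near the origin. The equation
    is therefore turned into an identity for almost every frequency, which may be multiplied by
    anything. Estimates on frequencies z + x + eta = 0 use two facts: the trilinear form is finite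
    when one factor is integrable and two are square integrable, and |z|^(1/2) <= |x|^(1/2) +
    |eta|^(1/2) moves half a derivative off the differentiated factor. The order s = 1/2 is
    critical: for |z| < 2^[k/2] the L1 norm of |z|^(1/2) G costs 2^(2[k/2]), and the weight (|x|
    |eta|)^(1/2) >= 2^(k-2) repays it up to a constant, so that smallness comes from the tail of G
    alone. The Fourier analysis rests on one principle: a linear functional on bounded functions,
    continuous for bounded pointwise limits, is zero once it kills all characters. Injectivity is a
    direct case; inversion and Plancherel follow with a Gaussian factor. *)

Lemma ReD x y : complex.Re (x + y) = complex.Re x + complex.Re y.
Proof. by case: x y => ? ? []. Qed.
Lemma ImD x y : complex.Im (x + y) = complex.Im x + complex.Im y.
Proof. by case: x y => ? ? []. Qed.
Lemma ReN x : complex.Re (- x) = - complex.Re x. Proof. by case: x. Qed.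
Lemma ImN x : complex.Im (- x) = - complex.Im x. Proof. by case: x. Qed.
Lemma ReB x y : complex.Re (x - y) = complex.Re x - complex.Re y.
Proof. by rewrite ReD ReN. Qed.
Lemma ImB x y : complex.Im (x - y) = complex.Im x - complex.Im y.
Proof. by rewrite ImD ImN. Qed.
Lemma ReM x y : complex.Re (x * y) =
  complex.Re x * complex.Re y - complex.Im x * complex.Im y.
Proof. by case: x y => ? ? []. Qed.
Lemma ImM x y : complex.Im (x * y) =
  complex.Re x * complex.Im y + complex.Im x * complex.Re y.
Proof. by case: x y => ? ? []. Qed.
Lemma Re_conj x : complex.Re (x^*%C) = complex.Re x. Proof. by case: x. Qed.
Lemma Im_conj x : complex.Im (x^*%C) = - complex.Im x. Proof. by case: x. Qed.

Lemma complex_ext x y :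
  complex.Re x = complex.Re y -> complex.Im x = complex.Im y -> x = y.
Proof. by case: x y => ? ? [] ? ? /= -> ->. Qed.

Lemma Re_sum (I : Type) (r : seq I) (P : pred I) (F : I -> R[i]) :
  complex.Re (\sum_(i <- r | P i) F i) = \sum_(i <- r | P i) complex.Re (F i).
Proof. by apply: (big_morph (@complex.Re R) ReD). Qed.
Lemma Im_sum (I : Type) (r : seq I) (P : pred I) (F : I -> R[i]) :
  complex.Im (\sum_(i <- r | P i) F i) = \sum_(i <- r | P i) complex.Im (F i).
Proof. by apply: (big_morph (@complex.Im R) ImD). Qed.

Lemma cmodE z : cmod z = Normc.normc z.
Proof. by case: z. Qed.
Lemma cmod_ge0 z : 0 <= cmod z. Proof. exact: sqrtr_ge0. Qed.
Lemma cmod0 : cmod (0 : R[i]) = 0.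
Proof. by rewrite /cmod /= expr0n /= addr0 sqrtr0. Qed.
Lemma cmodM x y : cmod (x * y) = cmod x * cmod y.
Proof. by rewrite !cmodE Normc.normcM. Qed.
Lemma cmodD x y : cmod (x + y) <= cmod x + cmod y.
Proof. by rewrite !cmodE; exact: le_normcD. Qed.
Lemma cmodN x : cmod (- x) = cmod x.
Proof. by rewrite !cmodE; exact: normcN. Qed.
Lemma cmodB x y : cmod (x - y) <= cmod x + cmod y.
Proof. by rewrite -(cmodN y); exact: cmodD. Qed.
Lemma cmodBC x y : cmod (x - y) = cmod (y - x).
Proof. by rewrite -cmodN opprB. Qed.
Lemma cmod_real a : cmod (a%:C) = `|a|.
Proof. by rewrite /cmod /= expr0n /= addr0 sqrtr_sqr. Qed.
Lemma cmod1 : cmod (1 : R[i]) = 1.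
Proof. by rewrite (_ : 1 = 1%:C) // cmod_real normr1. Qed.
Lemma cmod_conj x : cmod (x^*%C) = cmod x.
Proof. by case: x => a b; rewrite /cmod /= sqrrN. Qed.
Lemma cmod_sqr z : cmod z ^+ 2 = complex.Re z ^+ 2 + complex.Im z ^+ 2.
Proof. by rewrite /cmod sqr_sqrtr // addr_ge0 // sqr_ge0. Qed.
Lemma cmod_i : cmod ('i%C : R[i]) = 1.
Proof. by rewrite /cmod /= expr0n add0r expr1n sqrtr1. Qed.
Lemma cmod_eq0 z : cmod z = 0 -> z = 0.
Proof. by rewrite cmodE => /Normc.eq0_normc. Qed.
Lemma Re_le_cmod z : `|complex.Re z| <= cmod z.
Proof. by rewrite -sqrtr_sqr ler_sqrt ?lerDl ?sqr_ge0 // addr_ge0 // sqr_ge0. Qed.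
Lemma Im_le_cmod z : `|complex.Im z| <= cmod z.
Proof. by rewrite -sqrtr_sqr ler_sqrt ?lerDr ?sqr_ge0 // addr_ge0 // sqr_ge0. Qed.
Lemma cmod_le z : cmod z <= `|complex.Re z| + `|complex.Im z|.
Proof.
rewrite (complexE z) (le_trans (cmodD _ _)) // cmodM cmod_i mul1r !cmod_real.
by case: z => a b /=; rewrite /complex.Re /=; rewrite !mul0r ?mul1r ?subr0 ?addr0 ?add0r.
Qed.
Lemma mulC_conj z : z * z^*%C = (cmod z ^+ 2)%:C.
Proof.
by apply: complex_ext; rewrite ?ReM ?ImM Re_conj Im_conj /= ?cmod_sqr; ring.
Qed.
Lemma cmod_sum (I : Type) (r : seq I) (P : pred I) (F : I -> R[i]) :
  cmod (\sum_(i <- r | P i) F i) <= \sum_(i <- r | P i) cmod (F i).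
Proof.
elim/big_ind2 : _ => [|x a y b xa yb|//]; first by rewrite cmod0.
by rewrite (le_trans (cmodD _ _)) // lerD.
Qed.

Lemma expiD (s t : R) : expi (s + t) = expi s * expi t.
Proof.
by apply: complex_ext; rewrite ?ReM ?ImM /= ?cosD ?sinD //; ring.
Qed.
Lemma expi0 : expi (0 : R) = 1.
Proof. by apply: complex_ext; rewrite /= ?cos0 ?sin0. Qed.
Lemma cmod_expi (t : R) : cmod (expi t) = 1.
Proof. by rewrite /cmod /= cos2Dsin2 sqrtr1. Qed.
Lemma conj_expi (t : R) : (expi t)^*%C = expi (- t).
Proof. by apply: complex_ext; rewrite ?Re_conj ?Im_conj /= ?cosN ?sinN. Qed.

End complex_modulus.

Section complex_measurability.
Context {R : realType} {d : measure_display} {T : measurableType d}.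
Implicit Types (f g : T -> R[i]).

Definition cmeas f := measurable_fun setT (fun x => complex.Re (f x)) /\
  measurable_fun setT (fun x => complex.Im (f x)).

Lemma cmeas_ext f g : cmeas f -> f =1 g -> cmeas g.
Proof. by move=> mf /funext <-. Qed.
Lemma cmeas_cst (c : R[i]) : cmeas (fun=> c).
Proof. by split. Qed.
Lemma cmeas_real (h : T -> R) : measurable_fun setT h -> cmeas (fun x => (h x)%:C).
Proof. by move=> mh; split. Qed.
Lemma cmeasD f g : cmeas f -> cmeas g -> cmeas (fun x => f x + g x).
Proof.
move=> [f1 f2] [g1 g2]; split.
  by under eq_fun do rewrite ReD; exact: measurable_funD.
by under eq_fun do rewrite ImD; exact: measurable_funD.
Qed.
Lemma cmeasN f : cmeas f -> cmeas (fun x => - f x).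
Proof.
move=> [f1 f2]; split.
  by under eq_fun do rewrite ReN; exact: measurable_funN.
by under eq_fun do rewrite ImN; exact: measurable_funN.
Qed.
Lemma cmeasB f g : cmeas f -> cmeas g -> cmeas (fun x => f x - g x).
Proof. by move=> mf mg; apply: cmeasD => //; exact: cmeasN. Qed.
Lemma cmeasM f g : cmeas f -> cmeas g -> cmeas (fun x => f x * g x).
Proof.
move=> [f1 f2] [g1 g2]; split.
  under eq_fun do rewrite ReM.
  by apply: measurable_funB; exact: measurable_funM.
under eq_fun do rewrite ImM.
by apply: measurable_funD; exact: measurable_funM.
Qed.
Lemma cmeas_conj f : cmeas f -> cmeas (fun x => (f x)^*%C).
Proof.
move=> [f1 f2]; split.
  under eq_fun do rewrite Re_conj.
  exact: f1.
by under eq_fun do rewrite Im_conj; exact: measurable_funN.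
Qed.
Lemma cmeas_sum (I : Type) (r : seq I) (F : I -> T -> R[i]) :
  (forall i, cmeas (F i)) -> cmeas (fun x => \sum_(i <- r) F i x).
Proof.
move=> mF; elim: r => [|i r IH].
  by apply: (cmeas_ext (cmeas_cst 0)) => x; rewrite big_nil.
by apply: (cmeas_ext (cmeasD (mF i) IH)) => x; rewrite big_cons.
Qed.
Lemma measurable_cmod f : cmeas f -> measurable_fun setT (fun x => cmod (f x)).
Proof.
move=> [f1 f2]; rewrite /cmod.
apply: (measurableT_comp (f := @Num.sqrt R)).
  by apply: continuous_measurable_fun; exact: sqrt_continuous.
by apply: measurable_funD; exact: measurable_funX.
Qed.
Lemma cmeas_expi (h : T -> R) : measurable_fun setT h -> cmeas (fun x => expi (h x)).
Proof.
move=> mh; split => /=.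
  apply: measurableT_comp mh; by apply: continuous_measurable_fun; exact: continuous_cos.
apply: measurableT_comp mh; by apply: continuous_measurable_fun; exact: continuous_sin.
Qed.
Lemma cmeas_limit (F : nat -> T -> R[i]) (f : T -> R[i]) :
  (forall n, cmeas (F n)) ->
  (forall x, cmod (F n x - f x) @[n --> \oo] --> (0 : R)) -> cmeas f.
Proof.
move=> mF Ff; split.
  apply: (measurable_fun_cvg (h := fun n x => complex.Re (F n x))).
- by move=> n; have [+ _] := mF n.
- move=> x _; apply/cvgrPdist_le => e e0.
  have /cvgrPdist_le /(_ e e0) := Ff x.
  apply: filterS => n; rewrite sub0r normrN ger0_norm ?cmod_ge0 //.
  by apply: le_trans; rewrite cmodBC -ReB Re_le_cmod.
apply: (measurable_fun_cvg (h := fun n x => complex.Im (F n x))).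
- by move=> n; have [_ +] := mF n.
- move=> x _; apply/cvgrPdist_le => e e0.
  have /cvgrPdist_le /(_ e e0) := Ff x.
  apply: filterS => n; rewrite sub0r normrN ger0_norm ?cmod_ge0 //.
  by apply: le_trans; rewrite cmodBC -ImB Im_le_cmod.
Qed.

End complex_measurability.

Lemma cmeas_comp (R : realType) (d d' : measure_display) (T : measurableType d)
    (T' : measurableType d') (g : T' -> R[i]) (h : T -> T') :
  cmeas g -> measurable_fun setT h -> cmeas (fun x => g (h x)).
Proof.
by move=> [g1 g2] mh; split;
  [exact: (measurableT_comp g1 mh)|exact: (measurableT_comp g2 mh)].
Qed.

Section complex_integral.
Context {R : realType}.
Local Notation mu := (leb3 R).
Implicit Types (f g : E3 R -> R[i]).

(** Kept in the extended reals: Tonelli and monotonicity then need measurability only, and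
    finiteness becomes a statement to prove. *)
Definition N1 f : \bar R := (\int[mu]_x (cmod (f x))%:E)%E.

Lemma aeS (P Q : E3 R -> Prop) : (forall x, P x -> Q x) ->
  {ae mu, forall x, P x} -> {ae mu, forall x, Q x}.
Proof.
have F := ae_filter_ringOfSetsType mu.
by move=> PQ h; apply: filterS h.
Qed.

Lemma aeS2 (P P' Q : E3 R -> Prop) : (forall x, P x -> P' x -> Q x) ->
  {ae mu, forall x, P x} -> {ae mu, forall x, P' x} -> {ae mu, forall x, Q x}.
Proof.
have F := ae_filter_ringOfSetsType mu.
by move=> PQ h h'; apply: filterS2 h h'.
Qed.

Lemma N1_ge0 f : (0 <= N1 f)%E.
Proof. by apply: integral_ge0 => x _; rewrite lee_fin cmod_ge0. Qed.

Lemma cintegrable_meas f : cintegrable f -> cmeas f.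
Proof.
by move=> [/measurable_int/measurable_EFinP ? /measurable_int/measurable_EFinP ?].
Qed.

Lemma integrable_le (f g : E3 R -> R) : measurable_fun setT f ->
  mu.-integrable setT (EFin \o g) -> (forall x, `|f x| <= g x) ->
  mu.-integrable setT (EFin \o f).
Proof.
move=> mf ig fg; apply: le_integrable ig => //; first exact/measurable_EFinP.
by move=> x _ /=; rewrite lee_fin (le_trans (fg x)) // ler_norm.
Qed.

Lemma integrable_scale (a : R) (h : E3 R -> R) : mu.-integrable setT (EFin \o h) ->
  mu.-integrable setT (EFin \o (fun x => a * h x)).
Proof. exact: integrableZl. Qed.

Lemma cintegrable_le f (g : E3 R -> R) : cmeas f ->
  mu.-integrable setT (EFin \o g) -> (forall x, cmod (f x) <= g x) -> cintegrable f.
Proof.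
move=> [f1 f2] ig fg; split; apply: integrable_le ig _ => // x.
  exact: le_trans (Re_le_cmod _) (fg x).
exact: le_trans (Im_le_cmod _) (fg x).
Qed.

Lemma integrable_cmod f : cintegrable f ->
  mu.-integrable setT (EFin \o (fun x => cmod (f x))).
Proof.
move=> cf; have mf := cintegrable_meas cf; case: cf => f1 f2.
apply: (integrable_le (g := fun x => `|complex.Re (f x)| + `|complex.Im (f x)|)).
- exact: measurable_cmod.
- have := integrableD measurableT (integrable_norm f1) (integrable_norm f2).
  by apply: eq_integrable.
- by move=> x; rewrite ger0_norm ?cmod_ge0 // cmod_le.
Qed.

Lemma cintegrable_cmod f : cmeas f ->
  mu.-integrable setT (EFin \o (fun x => cmod (f x))) -> cintegrable f.
Proof. by move=> mf cf; apply: cintegrable_le cf _. Qed.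

Lemma cintegrableP f : cintegrable f <-> cmeas f /\ (N1 f < +oo)%E.
Proof.
split=> [cf|[mf nf]].
  split; first exact: cintegrable_meas.
  have /integrableP[_] := integrable_cmod cf.
  by under eq_integral do rewrite /= ger0_norm ?cmod_ge0 //.
apply: cintegrable_cmod => //; apply/integrableP; split.
  exact/measurable_EFinP/measurable_cmod.
by under eq_integral do rewrite /= ger0_norm ?cmod_ge0 //.
Qed.

Lemma N1_fin f : cintegrable f -> N1 f = (\int[mu]_x cmod (f x))%:E.
Proof.
move=> /cintegrableP [_ h]; rewrite /Rintegral fineK // ge0_fin_numE //; exact: N1_ge0.
Qed.

Lemma cintegrable0 : cintegrable (fun=> 0 : R[i]).
Proof. by split => /=; exact: integrable0. Qed.

Lemma cintegrableD f g : cintegrable f -> cintegrable g ->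
  cintegrable (fun x => f x + g x).
Proof.
move=> cf cg; apply: (cintegrable_le (g := fun x => cmod (f x) + cmod (g x))).
- by apply: cmeasD; exact: cintegrable_meas.
- have := integrableD measurableT (integrable_cmod cf) (integrable_cmod cg).
  exact: eq_integrable.
- by move=> x; exact: cmodD.
Qed.

Lemma cintegrableZ (c : R[i]) f : cintegrable f -> cintegrable (fun x => c * f x).
Proof.
move=> cf; apply: (cintegrable_le (g := fun x => cmod c * cmod (f x))).
- by apply: cmeasM; [exact: cmeas_cst|exact: cintegrable_meas].
- exact: integrableZl (integrable_cmod cf).
- by move=> x; rewrite cmodM.
Qed.

Lemma cintegrableN f : cintegrable f -> cintegrable (fun x => - f x).
Proof.
move=> cf; rewrite (_ : (fun x => - f x) = (fun x => (-1) * f x)).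
  exact: cintegrableZ.
by apply/funext => x; rewrite mulN1r.
Qed.

Lemma cintegrableB f g : cintegrable f -> cintegrable g ->
  cintegrable (fun x => f x - g x).
Proof. by move=> cf cg; apply: cintegrableD => //; exact: cintegrableN. Qed.

Lemma cintegrable_sum (I : Type) (r : seq I) (F : I -> E3 R -> R[i]) :
  (forall i, cintegrable (F i)) -> cintegrable (fun x => \sum_(i <- r) F i x).
Proof.
move=> cF; elim: r => [|i r IH].
  under eq_fun do rewrite big_nil; exact: cintegrable0.
by under eq_fun do rewrite big_cons; exact: cintegrableD.
Qed.

Lemma cintegrable_conj f : cintegrable f -> cintegrable (fun x => (f x)^*%C).
Proof.
move=> cf; apply: cintegrable_le (integrable_cmod cf) _.
  exact/cmeas_conj/cintegrable_meas.
by move=> x; rewrite cmod_conj.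
Qed.

Lemma cintegrable_boundM (b : E3 R -> R[i]) (M : R) f : cmeas b ->
  (forall x, cmod (b x) <= M) -> cintegrable f -> cintegrable (fun x => b x * f x).
Proof.
move=> mb bM cf; apply: (cintegrable_le (g := fun x => M * cmod (f x))).
- by apply: cmeasM => //; exact: cintegrable_meas.
- exact: integrableZl (integrable_cmod cf).
- by move=> x; rewrite cmodM ler_wpM2r ?cmod_ge0.
Qed.

Lemma eq_cintegral f g : f =1 g -> cintegral f = cintegral g.
Proof. by move=> /funext ->. Qed.

Lemma cintegral0 : cintegral (fun=> 0 : R[i]) = 0.
Proof. by apply: complex_ext; rewrite /= /Rintegral integral0. Qed.

Lemma cintegralD f g : cintegrable f -> cintegrable g ->
  cintegral (fun x => f x + g x) = cintegral f + cintegral g.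
Proof.
move=> [f1 f2] [g1 g2]; apply: complex_ext => /=.
  by rewrite -RintegralD //; apply: eq_Rintegral => x _; rewrite ReD.
by rewrite -RintegralD //; apply: eq_Rintegral => x _; rewrite ImD.
Qed.

Lemma cintegralZ (c : R[i]) f : cintegrable f ->
  cintegral (fun x => c * f x) = c * cintegral f.
Proof.
move=> [f1 f2]; apply: complex_ext; rewrite ?ReM ?ImM /=.
  rewrite -!RintegralZl // -RintegralB //; last 2 first.
  - exact: integrable_scale.
  - exact: integrable_scale.
  by apply: eq_Rintegral => x _; rewrite ReM.
rewrite -!RintegralZl // -RintegralD //; last 2 first.
- exact: integrable_scale.
- exact: integrable_scale.
by apply: eq_Rintegral => x _; rewrite ImM.
Qed.

Lemma cintegralN f : cintegrable f -> cintegral (fun x => - f x) = - cintegral f.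
Proof.
move=> cf; rewrite -mulN1r -cintegralZ //; apply: eq_cintegral => x.
by rewrite mulN1r.
Qed.

Lemma cintegralB f g : cintegrable f -> cintegrable g ->
  cintegral (fun x => f x - g x) = cintegral f - cintegral g.
Proof.
by move=> cf cg; rewrite cintegralD ?cintegralN //; exact: cintegrableN.
Qed.

Lemma cintegral_sum (I : Type) (r : seq I) (F : I -> E3 R -> R[i]) :
  (forall i, cintegrable (F i)) ->
  cintegral (fun x => \sum_(i <- r) F i x) = \sum_(i <- r) cintegral (F i).
Proof.
move=> cF; elim: r => [|i r IH].
  by rewrite big_nil (@eq_cintegral _ (fun=> 0)) ?cintegral0 // => x; rewrite big_nil.
rewrite big_cons -IH -cintegralD //; last exact: cintegrable_sum.
by apply: eq_cintegral => x; rewrite big_cons.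
Qed.

Lemma cintegral_conj f : cintegrable f ->
  cintegral (fun x => (f x)^*%C) = (cintegral f)^*%C.
Proof.
move=> [f1 f2]; apply: complex_ext; rewrite ?Re_conj ?Im_conj /=.
  by apply: eq_Rintegral => x _; rewrite Re_conj.
rewrite -[RHS]mulN1r -RintegralZl //.
by apply: eq_Rintegral => x _; rewrite Im_conj mulN1r.
Qed.

Lemma cintegral_real (h : E3 R -> R) :
  cintegral (fun x => (h x)%:C) = (\int[mu]_x h x)%:C.
Proof. by apply: complex_ext => //=; rewrite /Rintegral integral0. Qed.

(* Rotating by the phase of the integral reduces to the real inequality. *)
Lemma cmod_cintegral f : cintegrable f ->
  cmod (cintegral f) <= \int[mu]_x cmod (f x).
Proof.
move=> cf; have [z0|z0] := eqVneq (cintegral f) 0.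
  by rewrite z0 cmod0 Rintegral_ge0 // => x _; exact: cmod_ge0.
have nz : cmod (cintegral f) != 0 by apply: contraNneq z0 => /cmod_eq0 ->.
pose w := (cmod (cintegral f))^-1%:C * (cintegral f)^*%C.
have wz : w * cintegral f = (cmod (cintegral f))%:C.
  rewrite /w -mulrA (mulrC _^*%C) mulC_conj -rmorphM expr2 mulrA mulVf // mul1r.
  by [].
have w1 : cmod w = 1.
  by rewrite /w cmodM cmod_real cmod_conj ger0_norm ?invr_ge0 ?cmod_ge0 // mulVf.
rewrite (_ : cmod (cintegral f) = complex.Re (cintegral (fun x => w * f x))).
  have cwf : cintegrable (fun x => w * f x) by exact: cintegrableZ.
  apply: le_Rintegral => //; first by case: cwf.
    exact: integrable_cmod.
  move=> x _; rewrite (le_trans (ler_norm _)) // (le_trans (Re_le_cmod _)) //.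
  by rewrite cmodM w1 mul1r.
by rewrite cintegralZ // wz.
Qed.

Lemma cmod_cintegralE f : cintegrable f -> ((cmod (cintegral f))%:E <= N1 f)%E.
Proof. by move=> cf; rewrite N1_fin // lee_fin cmod_cintegral. Qed.

Lemma ae_eq_cintegral f g : cmeas f -> cmeas g -> {ae mu, forall x, f x = g x} ->
  cintegral f = cintegral g.
Proof.
move=> [f1 f2] [g1 g2] fg; apply: complex_ext => /=; congr fine.
  apply: ae_eq_integral => //; [exact/measurable_EFinP|exact/measurable_EFinP|].
  by apply: aeS fg => x -> _.
apply: ae_eq_integral => //; [exact/measurable_EFinP|exact/measurable_EFinP|].
by apply: aeS fg => x -> _.
Qed.

Lemma ae_eq_cintegrable f g : cmeas g -> {ae mu, forall x, f x = g x} ->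
  cintegrable f -> cintegrable g.
Proof.
move=> mg fg cf; apply/cintegrableP; split => //.
have /cintegrableP[mf] := cf; congr (_ < _)%E.
apply: ae_eq_integral => //; [exact/measurable_EFinP/measurable_cmod|
  exact/measurable_EFinP/measurable_cmod|].
by apply: aeS fg => x -> _.
Qed.

(** The scalar theorem is applied to the distance to the limit, with majorant 2 g. The hypotheses
    hold almost everywhere only, because limits and majorants will come from Fubini slices and from
    series. *)
Lemma dominated_N1 (F : nat -> E3 R -> R[i]) f (g : E3 R -> R) :
  (forall n, cmeas (F n)) -> cmeas f ->
  {ae mu, forall x, cmod (F n x - f x) @[n --> \oo] --> (0 : R)} ->
  mu.-integrable setT (EFin \o g) ->
  {ae mu, forall x, forall n, cmod (F n x) <= g x} ->
  cintegrable f /\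
  (\int[mu]_x cmod (F n x - f x)) @[n --> \oo] --> (0 : R).
Proof.
move=> mF mf Ff ig Fg.
have mFf n : cmeas (fun x => F n x - f x) by exact: cmeasB.
have fg : {ae mu, forall x, cmod (f x) <= g x}.
  apply: aeS2 Ff Fg => x Fx gx; rewrite -(addr0 (g x)).
  have -> : g x + 0 = lim ((g x + cmod (F n x - f x)) @[n --> \oo]).
    by apply/esym/cvg_lim => //; apply: cvgD => //; exact: cvg_cst.
  apply: limr_ge.
    by apply/cvg_ex; exists (g x + 0); apply: cvgD => //; exact: cvg_cst.
  apply: nearW => n.
  rewrite -{1}(subrK (F n x) (f x)) (le_trans (cmodD _ _)) // addrC cmodBC.
  by rewrite lerD2r.
have cf : cintegrable f.
  apply: cintegrable_cmod => //.
  apply/integrableP; split; first exact/measurable_EFinP/measurable_cmod.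
  have /integrableP[_] := ig; apply: le_lt_trans.
  apply: ae_ge0_le_integral => //.
  - by apply/measurable_EFinP/measurableT_comp => //; exact: measurable_cmod.
  - by case/integrableP : ig => mg _; exact: measurableT_comp.
  - apply: aeS fg => x fgx _; rewrite /= lee_fin ger0_norm ?cmod_ge0 //.
    by rewrite (le_trans fgx) // ler_norm.
split => //.
have [|||||_ _] := @dominated_convergence _ _ _ mu setT measurableT
   (fun n x => (cmod (F n x - f x))%:E) (cst 0%E) (EFin \o (fun x => 2 * g x)).
- by move=> n; apply/measurable_EFinP; exact: measurable_cmod (mFf n).
- by [].
- by apply: aeS Ff => x Fx _ /=; apply/cvg_EFin => //; exact: nearW.
- exact: integrable_scale.
- apply: aeS2 fg Fg => x fx Fx n _; rewrite /= lee_fin ger0_norm ?cmod_ge0 //.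
  by rewrite (le_trans (cmodB _ _)) // mulr_natl mulr2n lerD.
- rewrite /= integral0 => /fine_cvg; apply: cvg_trans.
  by [].
Qed.

Lemma dominated_cintegral (F : nat -> E3 R -> R[i]) f (g : E3 R -> R) :
  (forall n, cmeas (F n)) -> cmeas f ->
  {ae mu, forall x, cmod (F n x - f x) @[n --> \oo] --> (0 : R)} ->
  mu.-integrable setT (EFin \o g) ->
  {ae mu, forall x, forall n, cmod (F n x) <= g x} ->
  cmod (cintegral (F n) - cintegral f) @[n --> \oo] --> (0 : R).
Proof.
move=> mF mf Ff ig Fg; have [cf FfN] := dominated_N1 mF mf Ff ig Fg.
have cF n : cintegrable (F n).
  apply/cintegrableP; split => //; have /integrableP[mg] := ig.
  apply: le_lt_trans; apply: ae_ge0_le_integral => //.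
  - by move=> x _; rewrite lee_fin cmod_ge0.
  - by apply/measurable_EFinP; exact: measurable_cmod (mF n).
  - exact: measurableT_comp.
  - by apply: aeS Fg => x /(_ n) h _ /=; rewrite lee_fin (le_trans h) // ler_norm.
apply: squeeze_cvgr (cvg_cst 0) FfN.
apply: nearW => n; rewrite cmod_ge0 /= -cintegralB // cmod_cintegral //.
exact: cintegrableB.
Qed.

End complex_integral.

(** * Changes of variables and Fubini on E3 *)

Section measure_preserving.
Context {R : realType}.

Lemma ge0_integral_preserving (d : measure_display) (T : measurableType d)
    (m : {measure set T -> \bar R}) (phi : T -> T) (f : T -> \bar R) :
  measurable_fun setT phi ->
  (forall A, measurable A -> m (phi @^-1` A) = m A) ->
  measurable_fun setT f -> (forall x, 0 <= f x)%E ->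
  (\int[m]_x f (phi x) = \int[m]_x f x)%E.
Proof.
move=> mphi pres mf f0; pose phiM := isMeasurableFun.Build _ _ _ _ _ mphi.
pose phi' : {mfun T >-> T} := HB.pack phi phiM.
have := @ge0_integral_pushforward _ _ T T R phi mphi m setT f measurableT mf.
rewrite preimage_setT => /(_ (fun x _ => f0 x)) <-.
rewrite (@eq_measure_integral _ _ _ _ m (pushforward m phi')) // => A mA _.
exact: pres.
Qed.

(** The pushforward of the product measure agrees with it on rectangles, and a product measure is
    determined there. *)
Lemma product_preserving (d1 d2 : measure_display) (T1 : measurableType d1)
    (T2 : measurableType d2) (m1 : {sigma_finite_measure set T1 -> \bar R})
    (m2 : {sigma_finite_measure set T2 -> \bar R}) (phi1 : T1 -> T1) (phi2 : T2 -> T2) :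
  measurable_fun setT phi1 -> measurable_fun setT phi2 ->
  (forall A, measurable A -> m1 (phi1 @^-1` A) = m1 A) ->
  (forall A, measurable A -> m2 (phi2 @^-1` A) = m2 A) ->
  forall A : set (T1 * T2), measurable A ->
   (m1 \x m2)%E ((fun x => (phi1 x.1, phi2 x.2)) @^-1` A) = (m1 \x m2)%E A.
Proof.
move=> mphi1 mphi2 p1 p2 A mA.
have mphi : measurable_fun setT (fun x : T1 * T2 => (phi1 x.1, phi2 x.2)).
  apply: measurable_fun_pair; first exact: measurableT_comp mphi1 _.
  exact: measurableT_comp mphi2 _.
pose phiM := isMeasurableFun.Build _ _ _ _ _ mphi.
pose phi' : {mfun (T1 * T2)%type >-> (T1 * T2)%type} :=
  HB.pack (fun x : T1 * T2 => (phi1 x.1, phi2 x.2)) phiM.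
apply/esym; apply: (@product_measure_unique _ _ T1 T2 R m1 m2
  (pushforward (m1 \x m2)%E phi') _ A mA) => B C mB mC; transitivity ((m1 \x m2)%E ((phi1 @^-1` B) `*` (phi2 @^-1` C))); first by [].
rewrite product_measure1E.
- by congr (_ * _)%E; [exact: p1|exact: p2].
- by rewrite -[_ @^-1` _]setTI; apply: mphi1.
- by rewrite -[_ @^-1` _]setTI; apply: mphi2.
Qed.

Lemma lebesgue_measure_shift (a : R) (A : set (measurableTypeR R)) : measurable A ->
  lebesgue_measure ((fun x : measurableTypeR R => x + a : measurableTypeR R) @^-1` A)
   = lebesgue_measure A.
Proof.
move=> mA.
have mphi : measurable_fun setT (fun x : measurableTypeR R => x + a : measurableTypeR R).
  by apply: measurable_funD => //; exact: measurable_cst.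
pose phiM := isMeasurableFun.Build _ _ _ _ _ mphi.
pose phi' : {mfun (measurableTypeR R) >-> (measurableTypeR R)} :=
  HB.pack (fun x : measurableTypeR R => x + a : measurableTypeR R) phiM.
apply/esym; apply: (@lebesgue_measure_unique R
  (pushforward (@lebesgue_measure R) phi') _ A mA) => _ [[b c]] _ <-; transitivity (@lebesgue_measure R `]b - a, c - a]%classic); last first.
  congr (lebesgue_measure _).
  by apply/seteqP; split => x /=; rewrite !in_itv /= ltrBlDr lerBrDr.
rewrite !lebesgue_measure_itv /= !lte_fin ltrD2r -!EFinB.
by have -> : c - a - (b - a) = c - b by ring.
Qed.

End measure_preserving.

Section product_sigma_finite.
Context d1 d2 (T1 : measurableType d1) (T2 : measurableType d2) (R : realType).
Variable m1 : {sigma_finite_measure set T1 -> \bar R}.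
Variable m2 : {sigma_finite_measure set T2 -> \bar R}.
Lemma product_sigma_finite : sigma_finite setT (m1 \x m2)%E.
Proof.
have /sigma_finiteP[F [cF ndF oF]] := sigma_finiteT m1.
have /sigma_finiteP[G [cG ndG oG]] := sigma_finiteT m2.
exists (fun n => F n `*` G n); last first.
  move=> n; have [mF Fo] := oF n; have [mG Go] := oG n.
  split; first exact: measurableX.
  by rewrite product_measure1E // lte_mul_pinfty // ge0_fin_numE.
apply/esym/seteqP; split => // -[x y] _.
have [n _ Fx] : (\bigcup_n F n) x by rewrite -cF.
have [m _ Gy] : (\bigcup_n G n) y by rewrite -cG.
exists (maxn n m) => //; split => /=.
  by have /subsetPset := ndF _ _ (leq_maxl n m); exact.
by have /subsetPset := ndG _ _ (leq_maxr n m); exact.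
Qed.
Definition product_sf : {sigma_finite_measure set (T1 * T2)%type -> \bar R} :=
  HB.pack (m1 \x m2)%E (Measure_isSigmaFinite.Build _ _ _ (m1 \x m2)%E product_sigma_finite).
End product_sigma_finite.

Section euclidean_measure.
Context {R : realType}.
Local Notation mu := (leb3 R).
Local Notation RR := (measurableTypeR R).

(** The measure [leb3] again, packaged with its sigma-finiteness so that Fubini applies to pairs of
    points of space. *)
Definition leb3_sf : {sigma_finite_measure set (E3 RR) -> \bar R} :=
  product_sf (product_sf (@lebesgue_measure R) (@lebesgue_measure R)) (@lebesgue_measure R).

Lemma measurable_add3 (a : E3 R) : measurable_fun setT (fun x : E3 R => x + a).
Proof.
apply: measurable_fun_pair; first apply: measurable_fun_pair.
- apply: measurable_funD; last exact: measurable_cst.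
  exact: measurableT_comp measurable_fst measurable_fst.
- apply: measurable_funD; last exact: measurable_cst.
  exact: measurableT_comp measurable_snd measurable_fst.
- by apply: measurable_funD; [exact: measurable_snd|exact: measurable_cst].
Qed.

Lemma measurable_opp3 : measurable_fun setT (fun x : E3 R => - x).
Proof.
apply: measurable_fun_pair; first apply: measurable_fun_pair.
- by apply: measurable_funN; exact: measurableT_comp measurable_fst measurable_fst.
- by apply: measurable_funN; exact: measurableT_comp measurable_snd measurable_fst.
- by apply: measurable_funN; exact: measurable_snd.
Qed.

Lemma leb3_shift (a : E3 R) (A : set (E3 R)) : measurable A ->
  mu ((fun x : E3 R => x + a) @^-1` A) = mu A.
Proof.
move=> mA.
have mS (b : R) : measurable_fun setT (fun x : RR => x + b : RR).
  by apply: measurable_funD => //; exact: measurable_cst.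
have h := @product_preserving R _ _ _ _
   (product_sf (@lebesgue_measure R) (@lebesgue_measure R)) (@lebesgue_measure R)
   (fun x : (RR * RR)%type => (x.1 + a.1.1, x.2 + a.1.2)) (fun x : RR => x + a.2).
have := h _ _ _ _ A mA; apply => //.
- apply: measurable_fun_pair.
    exact: measurableT_comp (mS _) measurable_fst.
  exact: measurableT_comp (mS _) measurable_snd.
- move=> B mB.
  have h2 := @product_preserving R _ _ _ _
   (@lebesgue_measure R) (@lebesgue_measure R)
   (fun x : RR => x + a.1.1) (fun x : RR => x + a.1.2).
  have := h2 _ _ _ _ B mB; apply => // C mC; exact: lebesgue_measure_shift.
- by move=> C mC; exact: lebesgue_measure_shift.
Qed.

Lemma leb3_opp (A : set (E3 R)) : measurable A ->
  mu ((fun x : E3 R => - x) @^-1` A) = mu A.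
Proof.
move=> mA.
have mS : measurable_fun setT (fun x : RR => - x : RR) by exact: oppr_measurable.
have h := @product_preserving R _ _ _ _
   (product_sf (@lebesgue_measure R) (@lebesgue_measure R)) (@lebesgue_measure R)
   (fun x : (RR * RR)%type => (- x.1, - x.2)) (fun x : RR => - x).
have := h _ _ _ _ A mA; apply => //.
- apply: measurable_fun_pair.
    exact: measurableT_comp mS measurable_fst.
  exact: measurableT_comp mS measurable_snd.
- move=> B mB.
  have h2 := @product_preserving R _ _ _ _
   (@lebesgue_measure R) (@lebesgue_measure R) (fun x : RR => - x) (fun x : RR => - x).
  have := h2 _ _ _ _ B mB; apply => // C mC; exact: lebesgue_measureN.
- by move=> C mC; exact: lebesgue_measureN.
Qed.

Definition mpres (tau : E3 R -> E3 R) := measurable_fun setT tau /\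
  (forall A, measurable A -> mu (tau @^-1` A) = mu A).

Lemma mpres_shift (a : E3 R) : mpres (fun x => x + a).
Proof. by split; [exact: measurable_add3|exact: leb3_shift]. Qed.

Lemma mpres_opp : mpres (fun x => - x).
Proof. by split; [exact: measurable_opp3|exact: leb3_opp]. Qed.

Lemma mpres_comp s t : mpres s -> mpres t -> mpres (fun x => s (t x)).
Proof.
move=> [ms ps] [mt pt]; split; first exact: measurableT_comp ms mt.
move=> A mA; rewrite -(ps A mA) -(pt (s @^-1` A)) //.
by rewrite -[_ @^-1` _]setTI; apply: ms.
Qed.

Lemma mpres_sub (a : E3 R) : mpres (fun x => a - x).
Proof.
rewrite (_ : (fun x => a - x) = (fun x => (fun y => y + a) (- x))).
  exact: mpres_comp (mpres_shift a) mpres_opp.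
by apply/funext => x; rewrite addrC.
Qed.

Section change.
Variables (tau : E3 R -> E3 R) (pt : mpres tau).

Lemma ge0_integral_mpres (f : E3 R -> \bar R) :
  measurable_fun setT f -> (forall x, 0 <= f x)%E ->
  (\int[mu]_x f (tau x) = \int[mu]_x f x)%E.
Proof. by case: pt => mt pt0 mf f0; exact: ge0_integral_preserving. Qed.

Lemma integral_mpres (f : E3 R -> \bar R) : measurable_fun setT f ->
  (\int[mu]_x f (tau x) = \int[mu]_x f x)%E.
Proof.
move=> mf; rewrite integralE [RHS]integralE; congr (_ - _)%E.
  rewrite -(@ge0_integral_mpres (f^\+)%E (measurable_funepos mf) (funepos_ge0 f)).
  by apply: eq_integral => x _; rewrite !funeposE.
rewrite -(@ge0_integral_mpres (f^\-)%E (measurable_funeneg mf) (funeneg_ge0 f)).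
by apply: eq_integral => x _; rewrite !funenegE.
Qed.

Lemma Rintegral_mpres (f : E3 R -> R) : measurable_fun setT f ->
  \int[mu]_x f (tau x) = \int[mu]_x f x.
Proof. by move=> mf; congr fine; apply: integral_mpres; exact/measurable_EFinP. Qed.

Lemma cintegral_mpres (f : E3 R -> R[i]) : cmeas f ->
  cintegral (fun x => f (tau x)) = cintegral f.
Proof.
move=> [f1 f2]; apply: complex_ext => /=.
  exact: (Rintegral_mpres f1).
exact: (Rintegral_mpres f2).
Qed.

Lemma N1_mpres (f : E3 R -> R[i]) : cmeas f -> N1 (fun x => f (tau x)) = N1 f.
Proof.
move=> mf; apply: (@ge0_integral_mpres (fun x => (cmod (f x))%:E)).
  exact/measurable_EFinP/measurable_cmod.
by move=> x; rewrite lee_fin cmod_ge0.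
Qed.

Lemma cmeas_mpres (f : E3 R -> R[i]) : cmeas f -> cmeas (fun x => f (tau x)).
Proof. by move=> mf; case: pt => mt _; exact: cmeas_comp mt. Qed.

Lemma cintegrable_mpres (f : E3 R -> R[i]) : cintegrable f ->
  cintegrable (fun x => f (tau x)).
Proof.
move=> /cintegrableP[mf nf]; apply/cintegrableP; rewrite N1_mpres //.
by split => //; exact: cmeas_mpres.
Qed.

Lemma integrable_mpres (f : E3 R -> R) : mu.-integrable setT (EFin \o f) ->
  mu.-integrable setT (EFin \o (fun x => f (tau x))).
Proof.
move=> /integrableP[mf nf]; apply/integrableP; split.
  by apply: (measurableT_comp mf); case: pt.
rewrite (@ge0_integral_mpres (fun x => `|(f x)%:E|%E)) //.
exact: measurableT_comp.
Qed.

Lemma ae_mpres (P : E3 R -> Prop) : {ae mu, forall x, P x} -> {ae mu, forall x, P (tau x)}.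
Proof.
case: pt => mt pt' [N [mN N0 sub]]; exists (tau @^-1` N); split.
- by rewrite -[_ @^-1` _]setTI; apply: mt.
- by rewrite -N0; exact: pt'.
- by move=> x /= nP; apply: sub.
Qed.
End change.

Section fubini.
Implicit Types (F : E3 R * E3 R -> R[i]).

Lemma tonelli3 (f : E3 R * E3 R -> \bar R) : measurable_fun setT f ->
  (forall x, 0 <= f x)%E ->
  (\int[mu]_x \int[mu]_y f (x, y) = \int[mu]_y \int[mu]_x f (x, y))%E.
Proof. by move=> mf f0; exact: (@fubini_tonelli _ _ _ _ _ leb3_sf leb3_sf). Qed.

Lemma measurable_tonelli3 (f : E3 R * E3 R -> \bar R) : measurable_fun setT f ->
  (forall x, 0 <= f x)%E ->
  measurable_fun setT (fun x => \int[mu]_y f (x, y))%E.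
Proof.
by move=> mf f0; exact: (@measurable_fun_fubini_tonelli_F _ _ _ _ _ leb3_sf).
Qed.

Lemma Rfubini3 (f : E3 R * E3 R -> R) : measurable_fun setT f ->
  (\int[mu]_x \int[mu]_y `|f (x, y)|%:E < +oo)%E ->
  [/\ {ae mu, forall x, mu.-integrable setT (EFin \o (fun y => f (x, y)))},
      mu.-integrable setT (EFin \o (fun x => \int[mu]_y f (x, y))) &
      \int[mu]_x \int[mu]_y f (x, y) = \int[mu]_y \int[mu]_x f (x, y)].
Proof.
move=> mf fo.
have mEf : measurable_fun setT (EFin \o f) by exact/measurable_EFinP.
have fi : (leb3_sf \x leb3_sf)%E.-integrable setT (EFin \o f).
  by apply/integrable12ltyP.
(* The inner integral may be infinite on a null set, where [fine] replaces it by 0; integrability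
   and the value of the integral survive. *)
have aux (g : E3 R -> \bar R) : mu.-integrable setT g ->
    mu.-integrable setT (EFin \o (fine \o g)).
  move=> ig; have mg := measurable_int _ ig; apply: le_integrable ig => //.
    apply/measurable_EFinP; apply: (measurableT_comp (f := @fine R)) mg.
    exact: fine_measurable.
  by move=> x _ /=; case: (g x) => [r| |] /=; rewrite ?normr0 ?leey ?lexx.
have aux2 (g : E3 R -> \bar R) : mu.-integrable setT g ->
    (\int[mu]_x (fine (g x))%:E = \int[mu]_x g x)%E.
  move=> ig; apply: ae_eq_integral => //.
  - exact: measurable_int (aux _ ig).
  - exact: measurable_int ig.
  - have h := @integrable_ae _ _ _ mu _ measurableT _ ig.
    by apply: aeS h => x /(_ I) fg _; rewrite fineK.
have iF := integrable_fubini_F fi.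
have mfs : measurable_fun setT (fun p : E3 RR * E3 RR => f (p.2, p.1)).
  apply: (measurableT_comp mf).
  by apply: measurable_fun_pair; [exact: measurable_snd|exact: measurable_fst].
have fi2 : (leb3_sf \x leb3_sf)%E.-integrable setT
    (EFin \o (fun p : E3 RR * E3 RR => f (p.2, p.1))).
  apply/integrable12ltyP; first exact/measurable_EFinP.
  apply: le_lt_trans fo; rewrite le_eqVlt; apply/orP; left; apply/eqP.
  apply: (@tonelli3 (fun p => `|f (p.2, p.1)|%:E)) => //.
  by apply/measurable_EFinP; exact: measurableT_comp.
have iG := integrable_fubini_F fi2.
split.
- exact: (ae_integrable1 fi).
- exact: (aux _ iF).
- congr fine; have := Fubini fi.
  have -> : (\int[mu]_x (\int[mu]_y f (x, y))%:E = \int[leb3_sf]_x fubini_F leb3_sf (EFin \o f) x)%E.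
    exact: (aux2 _ iF).
  move=> ->; symmetry; exact: (aux2 _ iG).
Qed.

Lemma cfubini3 F : cmeas F ->
  (\int[mu]_x N1 (fun y => F (x, y)) < +oo)%E ->
  [/\ {ae mu, forall x, cintegrable (fun y => F (x, y))},
      cintegrable (fun x => cintegral (fun y => F (x, y))) &
      cintegral (fun x => cintegral (fun y => F (x, y))) =
      cintegral (fun y => cintegral (fun x => F (x, y)))].
Proof.
move=> mF Fo; have mc := measurable_cmod mF; have [F1 F2] := mF.
have mc' : measurable_fun setT (fun x => N1 (fun y => F (x, y))).
  apply: (@measurable_tonelli3 (fun p => (cmod (F p))%:E)).
    exact/measurable_EFinP.
  by move=> x; rewrite lee_fin cmod_ge0.
have b1 : (\int[mu]_x \int[mu]_y `|complex.Re (F (x, y))|%:E < +oo)%E.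
  apply: le_lt_trans Fo; apply: ge0_le_integral => //.
  - by move=> x _; apply: integral_ge0 => y _; rewrite lee_fin.
  - apply: (@measurable_tonelli3 (fun p => `|complex.Re (F p)|%:E)) => //.
    by apply/measurable_EFinP; exact: measurableT_comp.
  - move=> x _; apply: ge0_le_integral => //.
    + by apply/measurable_EFinP; apply: measurableT_comp => //; exact: measurableT_comp F1 _.
    + by apply/measurable_EFinP; exact: measurableT_comp mc _.
    + by move=> y _; rewrite lee_fin Re_le_cmod.
have b2 : (\int[mu]_x \int[mu]_y `|complex.Im (F (x, y))|%:E < +oo)%E.
  apply: le_lt_trans Fo; apply: ge0_le_integral => //.
  - by move=> x _; apply: integral_ge0 => y _; rewrite lee_fin.
  - apply: (@measurable_tonelli3 (fun p => `|complex.Im (F p)|%:E)) => //.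
    by apply/measurable_EFinP; exact: measurableT_comp.
  - move=> x _; apply: ge0_le_integral => //.
    + by apply/measurable_EFinP; apply: measurableT_comp => //; exact: measurableT_comp F2 _.
    + by apply/measurable_EFinP; exact: measurableT_comp mc _.
    + by move=> y _; rewrite lee_fin Im_le_cmod.
have [a1 i1 e1] := Rfubini3 F1 b1; have [a2 i2 e2] := Rfubini3 F2 b2.
split; last by apply: complex_ext.
- by apply: aeS2 a1 a2.
- by split.
Qed.
End fubini.

End euclidean_measure.

(** * Measurability of continuous functions and Euclidean geometry *)

Section continuous_measurable.
Context {R : realType}.
Local Notation RR := (measurableTypeR R).

Lemma norm3E (x : E3 R) : `|x| = Num.max (Num.max `|x.1.1| `|x.1.2|) `|x.2|.
Proof. by []. Qed.

Lemma norm3_le (x : E3 R) (c : R) :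
  (`|x| <= c) = [&& `|x.1.1| <= c, `|x.1.2| <= c & `|x.2| <= c].
Proof. by rewrite norm3E !ge_max -andbA. Qed.

Definition grid (n : nat) (x : E3 R) : E3 R :=
  let q := fun t => (Num.floor (t * n.+1%:R))%:~R / n.+1%:R in
  (q x.1.1, q x.1.2, q x.2).

Lemma grid_dist n (x : E3 R) : `|x - grid n x| <= n.+1%:R^-1.
Proof.
have q (t : R) : `|t - (Num.floor (t * n.+1%:R))%:~R / n.+1%:R| <= n.+1%:R^-1.
  have /andP[h1 h2] := floor_itv (t * n.+1%:R).
  have n0 : 0 < n.+1%:R^-1 :> R by rewrite invr_gt0 ltr0n.
  rewrite (_ : t - _ = (t * n.+1%:R - (Num.floor (t * n.+1%:R))%:~R) / n.+1%:R).
    rewrite normrM (ger0_norm (ltW n0)) ler_piMl ?(ltW n0) //.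
    rewrite ger0_norm ?subr_ge0 // lerBlDl; move: h2; rewrite intrD => /ltW.
    by [].
  by rewrite mulrBl mulfK // pnatr_eq0.
by rewrite norm3_le /= !q.
Qed.

(** Composed with the grid, any function is constant on each of countably many boxes. *)
Lemma measurable_grid (f : E3 R -> R) n : measurable_fun setT (f \o grid n).
Proof.
move=> _ A mA; rewrite setTI.
pose cell (k : int * int * int) : set (E3 RR) :=
  if f (k.1.1%:~R / n.+1%:R, k.1.2%:~R / n.+1%:R, k.2%:~R / n.+1%:R) \in A then
  [set x : E3 RR | [/\ Num.floor (x.1.1 * n.+1%:R) = k.1.1,
     Num.floor (x.1.2 * n.+1%:R) = k.1.2 & Num.floor (x.2 * n.+1%:R) = k.2]]
  else set0.
have -> : (f \o grid n) @^-1` A = \bigcup_k cell k.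
  apply/seteqP; split => [x /= fx|x [k _]].
    exists (Num.floor (x.1.1 * n.+1%:R), Num.floor (x.1.2 * n.+1%:R),
      Num.floor (x.2 * n.+1%:R)) => //.
    by rewrite /cell /= mem_set.
  rewrite /cell; case: ifPn => // /set_mem kA [/= h1 h2 h3].
  by rewrite /grid h1 h2 h3.
apply: countable_bigcupT_measurable; first exact: countableP.
move=> [[a b] c]; rewrite /cell /=; case: ifP => // _.
have fl (k : int) : measurable [set t : RR | Num.floor (t * n.+1%:R) = k].
  rewrite (_ : [set _ | _] = `[k%:~R / n.+1%:R, (k + 1)%:~R / n.+1%:R[%classic).
    exact: measurable_itv.
  apply/seteqP; split => t /=.
    move=> <-; rewrite in_itv /= ler_pdivrMr ?ltr0n // ltr_pdivlMr ?ltr0n //.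
    exact: floor_itv.
  rewrite in_itv /= ler_pdivrMr ?ltr0n // ltr_pdivlMr ?ltr0n // => h.
  by apply: floor_def.
rewrite (_ : [set _ | _] =
  ([set t | Num.floor (t * n.+1%:R) = a] `*`
   [set t | Num.floor (t * n.+1%:R) = b]) `*`
   [set t | Num.floor (t * n.+1%:R) = c]).
  by apply: measurableX; [apply: measurableX; exact: fl|exact: fl].
by apply/seteqP; split => x /= [] => [? ? ?|[? ?] ?].
Qed.

(** The sigma-algebra of the product comes from rectangles rather than from open sets, so a
    continuous function is reached as the pointwise limit of its samples on finer and finer
    grids. *)
Lemma continuous_measurable3 (f : E3 R -> R) : continuous f -> measurable_fun setT f.
Proof.
move=> cf; apply: (measurable_fun_cvg (h := fun n => f \o grid n)).
  by move=> n; exact: measurable_grid.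
move=> x _; apply: continuous_cvg; first exact: cf.
apply/cvgrPdist_le => e e0.
near=> n; apply: le_trans (grid_dist n x) _; apply: ltW.
by near: n; exact: (near_infty_natSinv_lt (PosNum e0)).
Unshelve. all: by end_near. Qed.

Lemma differentiable_measurable (f : E3 R -> R) :
  (forall x, differentiable f x) -> measurable_fun setT f.
Proof.
by move=> df; apply: continuous_measurable3 => x; exact: differentiable_continuous.
Qed.

Lemma measurable_coord3 j : measurable_fun setT (fun x : E3 R => coord3 x j).
Proof.
have m1 : measurable_fun setT (fun x : E3 R => x.1.1).
  exact: measurableT_comp measurable_fst measurable_fst.
have m2 : measurable_fun setT (fun x : E3 R => x.1.2).
  exact: measurableT_comp measurable_snd measurable_fst.
have m3 : measurable_fun setT (fun x : E3 R => x.2) by exact: measurable_snd.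
case: j => -[|[|[|//]]] h.
- exact: m1.
- exact: m2.
- exact: m3.
Qed.

Lemma measurable_sum3 (d : measure_display) (T : measurableType d) (F : 'I_3 -> T -> R) :
  (forall j, measurable_fun setT (F j)) -> measurable_fun setT (fun x => \sum_(j < 3) F j x).
Proof.
move=> mF; rewrite (_ : (fun _ => _) = (fun x => F ord0 x + F (lift ord0 ord0) x
   + F (lift ord0 (lift ord0 ord0)) x)); last first.
  by apply/funext => x; rewrite !big_ord_recl big_ord0 addr0 addrA.
by apply: measurable_funD; first apply: measurable_funD.
Qed.

Lemma measurable_dot (d : measure_display) (T : measurableType d) (s t : T -> E3 R) :
  measurable_fun setT s -> measurable_fun setT t ->
  measurable_fun setT (fun x => dot (s x) (t x)).
Proof.
move=> ms mt; apply: measurable_sum3 => j; apply: measurable_funM.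
  exact: measurableT_comp (measurable_coord3 j) ms.
exact: measurableT_comp (measurable_coord3 j) mt.
Qed.

Lemma measurable_enorm : measurable_fun setT (@enorm R).
Proof.
apply: (measurableT_comp (f := @Num.sqrt R)).
  by apply: continuous_measurable_fun; exact: sqrt_continuous.
by apply: measurable_dot; exact: measurable_id.
Qed.

End continuous_measurable.

Section euclidean_geometry.
Context {R : realType}.
Implicit Types (x y z : E3 R) (a : R).

Lemma dotE x y : dot x y = x.1.1 * y.1.1 + x.1.2 * y.1.2 + x.2 * y.2.
Proof. by rewrite /dot !big_ord_recl big_ord0 addr0 addrA. Qed.
Lemma dotC x y : dot x y = dot y x.
Proof. by rewrite !dotE; ring. Qed.
Lemma dotDl x y z : dot (x + y) z = dot x z + dot y z.
Proof. by rewrite !dotE /=; ring. Qed.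
Lemma dotDr x y z : dot x (y + z) = dot x y + dot x z.
Proof. by rewrite dotC dotDl !(dotC x). Qed.
Lemma dotNl x y : dot (- x) y = - dot x y.
Proof. by rewrite !dotE /=; ring. Qed.
Lemma dotNr x y : dot x (- y) = - dot x y.
Proof. by rewrite dotC dotNl dotC. Qed.
Lemma dotZl a x y : dot (a *: x) y = a * dot x y.
Proof. by rewrite !dotE /= /GRing.scale /=; ring. Qed.
Lemma dotZr a x y : dot x (a *: y) = a * dot x y.
Proof. by rewrite dotC dotZl dotC. Qed.
Lemma dot0l y : dot 0 y = 0 :> R.
Proof. by rewrite dotE /=; ring. Qed.
Lemma dot0r y : dot y 0 = 0 :> R.
Proof. by rewrite dotC dot0l. Qed.
Lemma dotxx_ge0 x : 0 <= dot x x.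
Proof. by rewrite dotE; rewrite !addr_ge0 // -expr2 sqr_ge0. Qed.
Lemma enorm_ge0 x : 0 <= enorm x. Proof. exact: sqrtr_ge0. Qed.
Lemma enorm_sqr x : enorm x ^+ 2 = dot x x.
Proof. by rewrite sqr_sqrtr // dotxx_ge0. Qed.
Lemma enormN x : enorm (- x) = enorm x.
Proof. by rewrite /enorm dotNl dotNr opprK. Qed.
Lemma enorm0 : enorm (0 : E3 R) = 0.
Proof. by rewrite /enorm dot0l sqrtr0. Qed.
Lemma enorm_eq0 x : enorm x = 0 -> x = 0.
Proof.
move=> x0; have := enorm_sqr x; rewrite x0 expr0n /= dotE => /esym h.
have s t : 0 <= t * t :> R by rewrite -expr2 sqr_ge0.
case: x x0 h => -[a b] c /= _ h.
have a0 : a = 0 by apply/eqP; rewrite -sqrf_eq0 expr2; apply/eqP; have := s a; have := s b; have := s c; lra.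
have b0 : b = 0 by apply/eqP; rewrite -sqrf_eq0 expr2; apply/eqP; have := s a; have := s b; have := s c; lra.
have c0 : c = 0 by apply/eqP; rewrite -sqrf_eq0 expr2; apply/eqP; have := s a; have := s b; have := s c; lra.
by rewrite a0 b0 c0.
Qed.
Lemma enormZ a x : enorm (a *: x) = `|a| * enorm x.
Proof. by rewrite /enorm dotZl dotZr mulrA -expr2 sqrtrM ?sqr_ge0 // sqrtr_sqr. Qed.
Lemma dot_le x y : `|dot x y| <= enorm x * enorm y.
Proof.
rewrite -ler_sqr ?nnegrE ?mulr_ge0 ?enorm_ge0 // exprMn !enorm_sqr.
rewrite real_normK ?num_real // !dotE.
set a := x.1.1; set b := x.1.2; set c := x.2.
set a' := y.1.1; set b' := y.1.2; set c' := y.2.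
rewrite -subr_ge0.
rewrite (_ : _ - _ = (a * b' - b * a') ^+ 2 + (a * c' - c * a') ^+ 2 +
  (b * c' - c * b') ^+ 2); last by ring.
by rewrite !addr_ge0 // sqr_ge0.
Qed.
Lemma enormD x y : enorm (x + y) <= enorm x + enorm y.
Proof.
rewrite -ler_sqr ?nnegrE ?addr_ge0 ?enorm_ge0 // sqrrD !enorm_sqr.
rewrite dotDl !dotDr (dotC y x).
have := le_trans (ler_norm _) (dot_le x y).
lra.
Qed.
Lemma coord3_le x j : `|coord3 x j| <= enorm x.
Proof.
rewrite -ler_sqr ?nnegrE ?enorm_ge0 // real_normK ?num_real // enorm_sqr dotE -!expr2.
have s t : 0 <= t ^+ 2 :> R by rewrite sqr_ge0.
by case: j => -[|[|[|//]]] h; rewrite /coord3 /tnth /=;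
  have := s x.1.1; have := s x.1.2; have := s x.2; lra.
Qed.
Lemma enorm_le_norm x : enorm x <= 2 * `|x|.
Proof.
rewrite -ler_sqr ?nnegrE ?mulr_ge0 ?enorm_ge0 ?normr_ge0 // enorm_sqr dotE exprMn.
have sq (a m : R) : `|a| <= m -> a * a <= m ^+ 2.
  move=> am; rewrite -expr2 -[leLHS]real_normK ?num_real //.
  by rewrite ler_sqr ?nnegrE ?normr_ge0 // (le_trans _ am).
have := lexx `|x|; rewrite {1}norm3_le => /and3P[/sq h1 /sq h2 /sq h3].
have := sqr_ge0 `|x|; lra.
Qed.
Lemma enormB_ge x y : enorm x - enorm y <= enorm (x + y).
Proof.
rewrite lerBlDr; have := enormD (x + y) (- y).
by rewrite addrK enormN.
Qed.

Lemma dot_basis x j : dot x (basis_vec R j) = coord3 x j.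
Proof.
by case: j => -[|[|[|//]]] h; rewrite dotE /basis_vec /coord3 /tnth /=; ring.
Qed.

Lemma coord3D x y j : coord3 (x + y) j = coord3 x j + coord3 y j.
Proof. by rewrite -!dot_basis dotDl. Qed.
Lemma coord3N x j : coord3 (- x) j = - coord3 x j.
Proof. by rewrite -!dot_basis dotNl. Qed.

End euclidean_geometry.

(** * Integrable weights and Gaussians *)

Section weights.
Context {R : realType}.
Local Notation mu := (leb3 R).
Local Notation RR := (measurableTypeR R).

Lemma ge0_integral_prod3 (f1 f2 f3 : R -> R) :
  measurable_fun setT f1 -> measurable_fun setT f2 -> measurable_fun setT f3 ->
  (forall t, 0 <= f1 t) -> (forall t, 0 <= f2 t) -> (forall t, 0 <= f3 t) ->
  (\int[mu]_x (f1 x.1.1 * f2 x.1.2 * f3 x.2)%:E =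
   \int[lebesgue_measure]_t (f1 t)%:E * \int[lebesgue_measure]_t (f2 t)%:E *
   \int[lebesgue_measure]_t (f3 t)%:E)%E.
Proof.
move=> m1 m2 m3 p1 p2 p3.
have mM12 : measurable_fun setT (fun p : RR * RR => f1 p.1 * f2 p.2).
  apply: measurable_funM; first exact: measurableT_comp m1 measurable_fst.
  exact: measurableT_comp m2 measurable_snd.
transitivity (\int[product_sf (@lebesgue_measure R) (@lebesgue_measure R)]_p
   \int[lebesgue_measure]_t (f1 p.1 * f2 p.2 * f3 t)%:E)%E.
  apply: (@fubini_tonelli1 _ _ _ _ _
    (product_sf (@lebesgue_measure R) (@lebesgue_measure R)) (@lebesgue_measure R)
    (fun x => (f1 x.1.1 * f2 x.1.2 * f3 x.2)%:E)).
    apply/measurable_EFinP; apply: measurable_funM.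
      exact: measurableT_comp mM12 measurable_fst.
    exact: measurableT_comp m3 measurable_snd.
  by move=> x; rewrite lee_fin !mulr_ge0.
transitivity (\int[product_sf (@lebesgue_measure R) (@lebesgue_measure R)]_p
   ((f1 p.1 * f2 p.2)%:E * \int[lebesgue_measure]_t (f3 t)%:E))%E.
  apply: eq_integral => p _; under eq_integral do rewrite EFinM.
  rewrite ge0_integralZl_EFin //; last by rewrite mulr_ge0.
  - by move=> t _; rewrite lee_fin.
  - exact/measurable_EFinP.
rewrite ge0_integralZr //; last 3 first.
- exact/measurable_EFinP.
- by move=> t _; rewrite lee_fin mulr_ge0.
- by apply: integral_ge0 => t _; rewrite lee_fin.
congr (_ * _)%E.
transitivity (\int[lebesgue_measure]_s \int[lebesgue_measure]_t (f1 s * f2 t)%:E)%E.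
  apply: (@fubini_tonelli1 _ _ _ _ _ (@lebesgue_measure R) (@lebesgue_measure R)
    (fun x => (f1 x.1 * f2 x.2)%:E)).
    exact/measurable_EFinP.
  by move=> x; rewrite lee_fin !mulr_ge0.
transitivity (\int[lebesgue_measure]_s ((f1 s)%:E * \int[lebesgue_measure]_t (f2 t)%:E))%E.
  apply: eq_integral => p _; under eq_integral do rewrite EFinM.
  rewrite ge0_integralZl_EFin //.
  - by move=> t _; rewrite lee_fin.
  - exact/measurable_EFinP.
rewrite ge0_integralZr //.
- exact/measurable_EFinP.
- by move=> t _; rewrite lee_fin.
- by apply: integral_ge0 => t _; rewrite lee_fin.
Qed.

(** An integrable majorant in product form, so that its integral splits into three one-dimensional
    ones. By [wt_decay] it dominates (1 + |x|)^(-6), hence every function of rapid decay up to a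
    constant. *)
Definition wt (x : E3 R) : R :=
  (1 + x.1.1 ^+ 2)^-1 * (1 + x.1.2 ^+ 2)^-1 * (1 + x.2 ^+ 2)^-1.

Let wt1_gt0 (t : R) : 0 < 1 + t ^+ 2.
Proof. by rewrite (lt_le_trans ltr01) // lerDl sqr_ge0. Qed.

Lemma wt_gt0 x : 0 < wt x.
Proof. by rewrite /wt !mulr_gt0 ?invr_gt0. Qed.

Lemma continuous_wt1 : continuous (fun t : R => (1 + t ^+ 2)^-1).
Proof.
move=> t; apply: cvgV; first by rewrite gt_eqF.
apply: cvgD; first exact: cvg_cst.
exact: exprn_continuous.
Qed.

Lemma integrable_wt : mu.-integrable setT (EFin \o wt).
Proof.
have mw : measurable_fun setT (fun t : R => (1 + t ^+ 2)^-1).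
  exact: continuous_measurable_fun continuous_wt1.
have fin : (\int[lebesgue_measure]_t ((1 + t ^+ 2)^-1)%:E = pi%:E :> \bar R)%E.
  rewrite ge0_symfun_integralT.
  - rewrite (_ : [set x | 0 <= x] = `[0, +oo[%classic); last first.
      by apply/seteqP; split => t /=; rewrite in_itv /= andbT.
    have := integral0y_oneDsqr R; rewrite /oneDsqr => ->.
    by rewrite -EFinM mulrC divfK.
  - by move=> t; rewrite invr_ge0 ltW.
  - exact: continuous_wt1.
  - by move=> t /=; rewrite sqrrN.
have mwt : measurable_fun setT wt.
  apply: measurable_funM; first apply: measurable_funM.
  - apply: (measurableT_comp mw).
    exact: measurableT_comp measurable_fst measurable_fst.
  - apply: (measurableT_comp mw).
    exact: measurableT_comp measurable_snd measurable_fst.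
  - by apply: (measurableT_comp mw); exact: measurable_snd.
apply/integrableP; split; first exact/measurable_EFinP.
rewrite (_ : (\int[mu]_x `|(EFin \o wt) x| = \int[mu]_x (wt x)%:E)%E); last first.
  by apply: eq_integral => x _ /=; rewrite ger0_norm // ltW // wt_gt0.
rewrite (@ge0_integral_prod3 (fun t => (1 + t ^+ 2)^-1) (fun t => (1 + t ^+ 2)^-1)
  (fun t => (1 + t ^+ 2)^-1)) ?fin -?EFinM ?ltry //; by move=> t; rewrite invr_ge0 ltW.
Qed.

Lemma wt_enorm x (r : R) : enorm x <= r -> 1 <= (1 + r ^+ 2) ^+ 3 * wt x.
Proof.
move=> xr; rewrite /wt -!invfM ler_pdivlMr ?mul1r; last by rewrite !mulr_gt0.
have r0 : 0 <= r := le_trans (enorm_ge0 x) xr.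
have c j : coord3 x j ^+ 2 <= r ^+ 2.
  rewrite -[leLHS]real_normK ?num_real // ler_sqr ?nnegrE ?normr_ge0 //.
  exact: le_trans (coord3_le x j) xr.
rewrite (_ : (1 + r ^+ 2) ^+ 3 = (1 + r ^+ 2) * (1 + r ^+ 2) * (1 + r ^+ 2)); last by ring.
apply: ler_pM; [exact/ltW/mulr_gt0|exact: ltW| |].
  apply: ler_pM; [exact: ltW|exact: ltW| |]; rewrite lerD2l.
    exact: (c ord0).
  exact: (c (lift ord0 ord0)).
rewrite lerD2l; exact: (c (lift ord0 (lift ord0 ord0))).
Qed.

Lemma wt_decay x : 1 <= (1 + enorm x) ^+ 6 * wt x.
Proof.
apply: le_trans (wt_enorm (lexx (enorm x))) _.
rewrite ler_wpM2r ?(ltW (wt_gt0 x)) // (_ : 6 = 2 * 3)%N // exprM.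
have e0 := enorm_ge0 x.
have h : 1 + enorm x ^+ 2 <= (1 + enorm x) ^+ 2 by nra.
by apply: lerXn2r => //; rewrite nnegrE // ?addr_ge0 ?sqr_ge0.
Qed.

(** Makes the weight usable for difference quotients. In one variable, 3 (1 + (s + t)^2) - (1 + s^2)
    = (2 s + 3 t)^2 / 2 + 2 - 3 t^2 / 2, which is nonnegative for |t| <= 1. *)
Lemma wt_shift x j (t : R) : `|t| <= 1 -> wt (x + t *: basis_vec R j) <= 3 * wt x.
Proof.
move=> t1.
have t2 : t ^+ 2 <= 1.
  by rewrite -[leLHS]real_normK ?num_real // expr_le1.
have one (s : R) : (1 + (s + t) ^+ 2)^-1 <= 3 * (1 + s ^+ 2)^-1.
  rewrite -lef_pV2 ?posrE ?invr_gt0 ?mulr_gt0 ?invr_gt0 // invrK invfM invrK.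
  rewrite ler_pdivrMl // ; have := sqr_ge0 (2 * s + 3 * t); rewrite !expr2 in t2 *; lra.
have p (s : R) : 0 <= (1 + s ^+ 2)^-1 by rewrite invr_ge0 ltW.
have reord (a b c a' : R) : 0 <= b -> 0 <= c -> a' <= 3 * a ->
  a' * b * c <= 3 * (a * b * c).
  by move=> b0 c0 aa; rewrite !mulrA !ler_wpM2r.
case: j => -[|[|[|//]]] h; rewrite /wt /basis_vec /= /GRing.scale /= !mulr1 ?mulr0 ?addr0.
- exact: reord.
- by rewrite (mulrC (_^-1)) (mulrC (1 + x.1.1 ^+ 2)^-1); exact: reord.
- by rewrite mulrCA ler_wpM2l ?mulr_ge0.
Qed.

Lemma integrable_support (f : E3 R -> R) (M r : R) : measurable_fun setT f ->
  (forall x, `|f x| <= M) -> (forall x, r < enorm x -> f x = 0) ->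
  mu.-integrable setT (EFin \o f).
Proof.
move=> mf fM f0; have M0 : 0 <= M := le_trans (normr_ge0 (f 0)) (fM 0).
apply: (integrable_le (g := fun x => M * (1 + r ^+ 2) ^+ 3 * wt x)) => //.
  exact: integrable_scale integrable_wt.
move=> x; have [xr|xr] := leP (enorm x) r.
  by rewrite (le_trans (fM x)) // -mulrA ler_peMr // wt_enorm.
have := wt_gt0 x; have : 0 <= (1 + r ^+ 2) ^+ 3 by rewrite exprn_ge0 // addr_ge0 // sqr_ge0.
by move=> h1 h2; rewrite f0 // normr0 mulr_ge0 ?(ltW h2) // mulr_ge0.
Qed.

Lemma cintegrable_wt (f : E3 R -> R[i]) (C : R) : cmeas f ->
  (forall x, cmod (f x) <= C * wt x) -> cintegrable f.
Proof.
move=> mf fC; apply: cintegrable_le fC => //; exact: integrable_scale integrable_wt.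
Qed.

(** The parameter is an inverse width: the Gaussian spreads out to the constant 1 as e tends to
    0. *)
Definition gauss (e : R) (x : E3 R) : R := expR (- (e ^+ 2 * dot x x / 2)).

Lemma gauss_gt0 e x : 0 < gauss e x. Proof. exact: expR_gt0. Qed.

Lemma gauss_le1 e x : gauss e x <= 1.
Proof.
rewrite /gauss -[leRHS]expR0 ler_expR oppr_le0 mulr_ge0 //.
by rewrite mulr_ge0 ?sqr_ge0 ?dotxx_ge0.
Qed.

Lemma measurable_gauss e : measurable_fun setT (gauss e).
Proof.
apply: (measurableT_comp (@measurable_expR R)).
apply: measurable_funN; apply: measurable_funM; last exact: measurable_cst.
apply: measurable_funM; first exact: measurable_cst.
by apply: measurable_dot; exact: measurable_id.
Qed.

(** One variable at a time, from the normal density of standard deviation 1/e. *)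
Lemma integral_gauss (e : R) : 0 < e ->
  (\int[mu]_x (gauss e x)%:E = ((Num.sqrt (2 * pi) / e) ^+ 3)%:E)%E.
Proof.
move=> e0; pose h (t : R) := expR (- (e ^+ 2 * t ^+ 2 / 2)).
have mh : measurable_fun setT h.
  apply: (measurableT_comp (@measurable_expR R)).
  apply: measurable_funN; apply: measurable_funM; last exact: measurable_cst.
  by apply: measurable_funM; [exact: measurable_cst|exact: measurable_funX].
have h0 t : 0 <= h t by exact: expR_ge0.
have hint : (\int[lebesgue_measure]_t (h t)%:E = (Num.sqrt (2 * pi) / e)%:E)%E.
  have s0 : e^-1 != 0 by rewrite invr_neq0 // gt_eqF.
  have E t : normal_pdf 0 e^-1 t = normal_peak e^-1 * h t.
    rewrite /normal_pdf (negbTE s0) /normal_fun subr0; congr (_ * expR _).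
    rewrite -mulr_natr; field; exact: lt0r_neq0.
  have := @integral_normal_pdf R 0 e^-1; under eq_integral do rewrite E EFinM.
  rewrite ge0_integralZl_EFin //; last exact: normal_peak_ge0; last first.
  - exact/measurable_EFinP.
  - by move=> t _; rewrite lee_fin.
  have pk : normal_peak e^-1 = e / Num.sqrt (2 * pi).
    rewrite /normal_peak -mulr_natr -mulrA sqrtrM ?sqr_ge0 // sqrtr_sqr.
    by rewrite ger0_norm ?invr_ge0 ?ltW // invfM invrK (mulrC pi).
  rewrite pk => hh.
  have q0 : 0 < Num.sqrt (2 * pi) :> R by rewrite sqrtr_gt0 mulr_gt0 // pi_gt0.
  transitivity ((Num.sqrt (2 * pi) / e)%:E * ((e / Num.sqrt (2 * pi))%:E *
     \int[lebesgue_measure]_t (h t)%:E))%E; last by rewrite hh mule1.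
  rewrite muleA -EFinM (_ : _ / _ * _ = 1) ?mul1e //.
  by field; apply/andP; split; exact: lt0r_neq0.
rewrite (_ : (\int[mu]_x (gauss e x)%:E = \int[mu]_x (h x.1.1 * h x.1.2 * h x.2)%:E)%E).
  by rewrite ge0_integral_prod3 // !hint -!EFinM 2!exprSr expr1.
apply: eq_integral => x _; congr EFin; rewrite /gauss /h -!expRD dotE; congr expR.
by field.
Qed.

Definition c0 : R := (2 * pi) `^ (- (3 / 2)).

Lemma c0_gt0 : 0 < c0. Proof. by rewrite powR_gt0 // mulr_gt0 // pi_gt0. Qed.

Lemma c0_sqrt : c0 * Num.sqrt (2 * pi) ^+ 3 = 1.
Proof.
have p0 : 0 < 2 * pi :> R by rewrite mulr_gt0 // pi_gt0.
rewrite -powR12_sqrt ?ltW // -powR_mulrn ?powR_ge0 // -powRrM /c0 -powRD.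
  by rewrite (_ : _ + _ = 0) ?powRr0 //; field.
by apply/implyP => _; rewrite gt_eqF.
Qed.

End weights.

(** * Partial derivatives and smooth functions *)

Section differential_expansion.
Context {R : realType} {V W : normedModType R}.

Lemma differentiable_expansion (f : V -> W) (df : {linear V -> W}) (x : V) :
  continuous df ->
  (forall e, 0 < e -> \forall h \near (0 : V), `|f (h + x) - (f x + df h)| <= e * `|h|) ->
  differentiable f x /\ 'd f x = df :> (V -> W).
Proof.
move=> cdf fdf.
have E : f \o shift x = cst (f x) + df +o_ 0 id.
  by apply/eqaddoP => e e0; apply: filterS (fdf e e0).
have D := diff_unique cdf E.
split; last by rewrite D.
apply/diff_locallyxP; rewrite D; split => //.
by move=> h; have := congr1 (fun F => F h) E; rewrite /= => ->.
Qed.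

End differential_expansion.

Section real_integrability.
Context {R : realType}.
Local Notation mu := (leb3 R).
Implicit Types f g : E3 R -> R.

Lemma integrable_add f g : mu.-integrable setT (EFin \o f) ->
  mu.-integrable setT (EFin \o g) -> mu.-integrable setT (EFin \o (fun x => f x + g x)).
Proof. by move=> fi gi; have := integrableD measurableT fi gi; exact: eq_integrable. Qed.

Lemma integrable_sub f g : mu.-integrable setT (EFin \o f) ->
  mu.-integrable setT (EFin \o g) -> mu.-integrable setT (EFin \o (fun x => f x - g x)).
Proof. by move=> fi gi; have := integrableB measurableT fi gi; exact: eq_integrable. Qed.

End real_integrability.

Section differentiability.
Context {R : realType}.
Implicit Types (f : E3 R -> R) (x h : E3 R).

Definition dotl (a h : E3 R) : R := dot a h.

Lemma dotl_is_linear a : linear (dotl a : E3 R -> R).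
Proof. by move=> c x y; rewrite /dotl dotDr dotZr. Qed.
HB.instance Definition _ a := GRing.isLinear.Build R (E3 R) R *:%R (dotl a) (dotl_is_linear a).

Lemma continuous_dotl a : continuous (dotl a).
Proof.
move=> x; apply/cvgrPdist_le => e e0.
have c0 : 0 < 2 * enorm a + 1 by rewrite ltr_wpDl // mulr_ge0 // enorm_ge0.
near=> y; rewrite -raddfB /=.
apply: le_trans (dot_le _ _) _; apply: le_trans (ler_wpM2l (enorm_ge0 a) (enorm_le_norm _)) _.
have : `|x - y| <= e / (2 * enorm a + 1).
  by near: y; apply: cvgr_dist_le => //; rewrite divr_gt0.
rewrite ler_pdivlMr //; have := normr_ge0 (x - y); have := enorm_ge0 a; nra.
Unshelve. all: by end_near. Qed.

Lemma differentiable_quad f x a (C : R) :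
  (forall h, `|f (h + x) - f x - dot a h| <= C * enorm h ^+ 2) ->
  differentiable f x /\ (forall h, 'd f x h = dot a h).
Proof.
move=> fC.
have [||df dE] := @differentiable_expansion R (E3 R : normedModType R)
    (R : normedModType R) f (dotl a) x.
- exact: continuous_dotl.
- move=> e e0.
  have c0 : 0 < 4 * `|C| + 1 by rewrite ltr_wpDl // mulr_ge0.
  near=> h.
  rewrite (_ : _ - _ = f (h + x) - f x - dot a h); last first.
    by rewrite opprD addrA.
  apply: le_trans (fC h) _.
  have hs : `|h| <= e / (4 * `|C| + 1).
    near: h; apply: cvgr0_norm_le; first exact: cvg_id.
    by rewrite divr_gt0.
  have h1 : enorm h ^+ 2 <= 4 * `|h| ^+ 2.
    have := enorm_le_norm h; have := enorm_ge0 h; have := normr_ge0 h; nra.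
  apply: (@le_trans _ _ (`|C| * (4 * `|h| ^+ 2))).
    apply: le_trans (ler_wpM2r (sqr_ge0 _) (ler_norm C)) _.
    exact: ler_wpM2l.
  move: hs; rewrite ler_pdivlMr //; have := normr_ge0 h; have := normr_ge0 C; nra.
- by split => // h; rewrite dE.
Unshelve. all: by end_near. Qed.

Lemma pd_quad f x a (C : R) :
  (forall h, `|f (h + x) - f x - dot a h| <= C * enorm h ^+ 2) ->
  forall j, pd j f x = coord3 a j.
Proof.
move=> /differentiable_quad[df dE] j.
by rewrite /pd deriveE // dE dot_basis.
Qed.

Lemma pd_line f x j (t : R) : differentiable f (x + t *: basis_vec R j) ->
  is_derive t 1 (fun s => f (x + s *: basis_vec R j)) (pd j f (x + t *: basis_vec R j)).
Proof.
move=> df; have E (k : R) : k *: (1 : R^o) + t = k + t by rewrite /GRing.scale /= mulr1.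
have EE : (fun k : R => k^-1 *: (((fun s => f (x + s *: basis_vec R j)) \o shift t)
      (k *: (1 : R^o)) - f (x + t *: basis_vec R j))) =
   (fun k : R => k^-1 *: ((f \o shift (x + t *: basis_vec R j)) (k *: basis_vec R j)
     - f (x + t *: basis_vec R j))).
  apply/funext => k /=; rewrite E; congr (_ *: (f _ - _)).
  by rewrite scalerDl addrCA.
apply: DeriveDef.
  rewrite /derivable EE; exact: diff_derivable df.
by rewrite /derive EE.
Qed.

Lemma pd_mvt f x j (t : R) : (forall y, differentiable f y) ->
  exists2 s, `|s| <= `|t| & f (x + t *: basis_vec R j) - f x =
    t * pd j f (x + s *: basis_vec R j).
Proof.
move=> df; pose g s := f (x + s *: basis_vec R j).
have dg (s : R) : is_derive s 1 g (pd j f (x + s *: basis_vec R j)) by exact: pd_line.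
have cg a b : {within `[a, b], continuous g}.
  apply: derivable_within_continuous => s _.
  by case: (dg s).
have g0 : g 0 = f x by rewrite /g scale0r addr0.
have [t0|t0|->] := ltgtP t 0.
- have [c + E] := MVT t0 (fun s _ => dg s) (cg _ _).
  rewrite in_itv /= => /andP[c1 c2]; exists c.
    by rewrite !ltr0_norm // lerN2 ltW.
  by rewrite -g0 -/(g t) -opprB E; ring.
- have [c + E] := MVT t0 (fun s _ => dg s) (cg _ _).
  rewrite in_itv /= => /andP[c1 c2]; exists c.
    by rewrite !gtr0_norm // ltW.
  by rewrite -g0 -/(g t) E; ring.
- by exists 0 => //; rewrite scale0r addr0 subrr mul0r.
Qed.

Lemma pd_cvg f x j : differentiable f x ->
  n.+1%:R * (f (x + n.+1%:R^-1 *: basis_vec R j) - f x) @[n --> \oo] --> pd j f x.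
Proof.
move=> df; have /cvgr_dnbhsP h := @diff_derivable _ _ _ f x (basis_vec R j) df.
have {}h := h (fun n => n.+1%:R^-1).
have : (forall n, n.+1%:R^-1 != 0 :> R) /\ n.+1%:R^-1 @[n --> \oo] --> (0 : R).
  split; first by move=> n; rewrite invr_neq0 // pnatr_eq0.
  exact: cvg_harmonic.
move=> /h {}h; apply: cvg_trans h; apply: near_eq_cvg; apply: nearW => n.
by rewrite /= invrK [_ + x]addrC.
Qed.

(* A difference quotient integrates to zero by translation invariance. *)
Lemma integral_pd (f : E3 R -> R) j (C : R) : (forall x, differentiable f x) ->
  (forall x, `|f x| <= C * wt x) -> (forall x, `|pd j f x| <= C * wt x) ->
  \int[leb3 R]_x pd j f x = 0.
Proof.
move=> df fC pC.
have C0 : 0 <= C.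
  have := le_trans (normr_ge0 _) (fC 0); have := wt_gt0 (0 : E3 R) => w0.
  by rewrite pmulr_lge0.
have mf := differentiable_measurable df.
pose F n x := n.+1%:R * (f (x + n.+1%:R^-1 *: basis_vec R j) - f x).
have mF n : measurable_fun setT (F n).
  apply: measurable_funM; first exact: measurable_cst.
  apply: measurable_funB => //; apply: (measurableT_comp mf); exact: measurable_add3.
have mp : measurable_fun setT (pd j f).
  by apply: (measurable_fun_cvg (h := F)) => // x _; exact: pd_cvg.
have ifn : (leb3 R).-integrable setT (EFin \o f).
  by apply: integrable_le fC => //; exact: integrable_scale integrable_wt.
have F0 n : \int[leb3 R]_x F n x = 0.
  have ish : (leb3 R).-integrable setT
      (EFin \o (fun x => f (x + n.+1%:R^-1 *: basis_vec R j))).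
    exact: (integrable_mpres (mpres_shift (n.+1%:R^-1 *: basis_vec R j)) ifn).
  rewrite RintegralZl //; last exact: integrable_sub.
  rewrite RintegralB // (Rintegral_mpres (mpres_shift _)) // subrr mulr0.
  by [].
have : cmod (cintegral (fun x => (F n x)%:C) - cintegral (fun x => (pd j f x)%:C))
    @[n --> \oo] --> (0 : R).
  apply: (@dominated_cintegral R (fun n x => (F n x)%:C) (fun x => (pd j f x)%:C)
    (fun x => C * 3 * wt x)).
- by move=> n; exact: cmeas_real.
- exact: cmeas_real.
- apply: aeW => x; apply: cvg_trans (_ : `|F n x - pd j f x| @[n --> \oo] --> 0).
    by apply: near_eq_cvg; apply: nearW => n; rewrite -rmorphB cmod_real.
  rewrite -(@normr0 _ R) -(subrr (pd j f x)); apply: cvg_norm.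
  by apply: cvgB; [exact: pd_cvg|exact: cvg_cst].
- exact: integrable_scale integrable_wt.
- apply: aeW => x n; rewrite cmod_real /F.
  (* The mean value theorem replaces the quotient by a derivative at distance at most 1, where the
     weight has grown by a factor of at most 3. *)
  have [s sn ->] := pd_mvt x j n.+1%:R^-1 df.
  have n1 : `|n.+1%:R^-1| <= 1 :> R.
    by rewrite ger0_norm ?invr_ge0 // invf_le1 // ler1n.
  rewrite mulrA mulfV ?pnatr_eq0 // mul1r.
  apply: le_trans (pC _) _; rewrite -mulrA ler_wpM2l // wt_shift //.
  exact: le_trans n1.
under eq_fun do rewrite !cintegral_real F0 sub0r cmodN cmod_real.
by move=> h; apply/normr0_eq0/(cvg_unique _ (cvg_cst _) h).
Qed.

End differentiability.

Section trigonometric_bounds.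
Context {R : realType}.

Let mvt0 (f df : R -> R) (t : R) : (forall s : R, is_derive s 1 f (df s)) ->
  exists2 s, `|s| <= `|t| & f t - f 0 = t * df s.
Proof.
move=> dg.
have cg a b : {within `[a, b], continuous f}.
  by apply: derivable_within_continuous => s _; case: (dg s).
have [t0|t0|->] := ltgtP t 0.
- have [c + E] := MVT t0 (fun s _ => dg s) (cg _ _).
  rewrite in_itv /= => /andP[c1 c2]; exists c.
    by rewrite !ltr0_norm // lerN2 ltW.
  by rewrite -opprB E; ring.
- have [c + E] := MVT t0 (fun s _ => dg s) (cg _ _).
  rewrite in_itv /= => /andP[c1 c2]; exists c.
    by rewrite !gtr0_norm // ltW.
  by rewrite E; ring.
- by exists 0 => //; rewrite subrr mul0r.
Qed.

Lemma sin_le_norm (t : R) : `|sin t| <= `|t|.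
Proof.
have [s _] := mvt0 t (fun s => is_derive_sin s).
rewrite sin0 subr0 => ->; rewrite normrM ler_piMr //.
by rewrite ler_norml cos_geN1 cos_le1.
Qed.

Lemma cosB1_le (t : R) : `|cos t - 1| <= t ^+ 2.
Proof.
have [s st] := mvt0 t (fun s => is_derive_cos s).
rewrite cos0 => ->; rewrite normrM normrN -[leRHS]real_normK ?num_real // expr2.
by rewrite ler_wpM2l // (le_trans (sin_le_norm s)).
Qed.

Lemma sinB_le (t : R) : `|sin t - t| <= t ^+ 2.
Proof.
have d (s : R) : is_derive s 1 (fun t => sin t - t) (cos s - 1).
  by apply: is_deriveB.
have [s st] := mvt0 t d.
rewrite sin0 subr0 subr0 => ->; rewrite normrM -[leRHS]real_normK ?num_real // expr2.
rewrite ler_wpM2l // (le_trans _ st) //.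
have [r _] := mvt0 s (fun s => is_derive_cos s).
rewrite cos0 => ->; rewrite normrM normrN ler_piMr //.
by rewrite ler_norml sin_geN1 sin_le1.
Qed.

Lemma expi_quad (t : R) : cmod (expi t - 1 - 'i%C * t%:C) <= 2 * t ^+ 2.
Proof.
apply: le_trans (cmod_le _) _; rewrite mulr_natl mulr2n.
rewrite !ReB !ImB !ReM !ImM /= !mul0r !mul1r ?subr0 ?addr0 ?add0r lerD //.
- exact: cosB1_le.
- exact: sinB_le.
Qed.

End trigonometric_bounds.

Section smooth_functions.
Context {R : realType}.
Implicit Types (f g : E3 R -> R) (j : 'I_3).

(** [smooth] speaks of all iterated derivatives at once, so it is proved by exhibiting a class of
    differentiable functions stable under each [pd]. *)
Lemma smooth_ind (P : (E3 R -> R) -> Prop) :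
  (forall f, P f -> forall x, differentiable f x) ->
  (forall f j, P f -> P (pd j f)) -> forall f, P f -> smooth f.
Proof.
move=> Pd Pp f Pf a; have : P (foldr (@pd R) f a) by elim: a => //= j a; exact: Pp.
exact: Pd.
Qed.

Lemma smooth_pd f j : smooth f -> smooth (pd j f).
Proof.
move=> sf a x; have := sf (rcons a j) x.
by rewrite -cats1 foldr_cat.
Qed.

Lemma smooth_diff f : smooth f -> forall x, differentiable f x.
Proof. by move=> /(_ [::]). Qed.

Lemma pd_from_line f x j (d : R) : differentiable f x ->
  is_derive (0 : R) 1 (fun s => f (x + s *: basis_vec R j)) d -> pd j f x = d.
Proof.
move=> df [_ <-]; have := @pd_line R f x j 0; rewrite scale0r addr0 => /(_ df) [_ ->].
by [].
Qed.

Lemma pd_cst (c : R) j : pd j (fun=> c) = fun=> 0.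
Proof. by apply/funext => x; rewrite /pd derive_cst. Qed.

Lemma pdD f g j : (forall x, differentiable f x) -> (forall x, differentiable g x) ->
  pd j (fun x => f x + g x) = fun x => pd j f x + pd j g x.
Proof.
by move=> df dg; apply/funext => x; rewrite /pd deriveD //; exact: diff_derivable.
Qed.

Lemma pdN f j : (forall x, differentiable f x) ->
  pd j (fun x => - f x) = fun x => - pd j f x.
Proof.
by move=> df; apply/funext => x; rewrite /pd deriveN //; exact: diff_derivable.
Qed.

Lemma pdM f g j : (forall x, differentiable f x) -> (forall x, differentiable g x) ->
  pd j (fun x => f x * g x) = fun x => pd j f x * g x + f x * pd j g x.
Proof.
move=> df dg; apply/funext => x.
rewrite /pd deriveM; [|exact: diff_derivable (df x)|exact: diff_derivable (dg x)].
by rewrite addrC /GRing.scale /= mulrC.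
Qed.

(** The algebra generated by the smooth functions: the derivative of a product is a sum of products,
    so stability under [pd] requires closing under both operations together. *)
Inductive smalg : (E3 R -> R) -> Prop :=
| SmBase f : smooth f -> smalg f
| SmCst c : smalg (fun=> c)
| SmAdd f g : smalg f -> smalg g -> smalg (fun x => f x + g x)
| SmMul f g : smalg f -> smalg g -> smalg (fun x => f x * g x).

Lemma smalg_diff f : smalg f -> forall x, differentiable f x.
Proof.
move=> sf; elim: sf => {f} [f sf|c|f g _ df _ dg|f g _ df _ dg] x.
- exact: smooth_diff.
- exact: differentiable_cst.
- exact: differentiableD.
- exact: differentiableM.
Qed.

Lemma smalg_smooth f : smalg f -> smooth f.
Proof.
apply: (smooth_ind smalg_diff) => {}f j sf.
elim: sf => {f} [f sf|c|f g sf df sg dg|f g sf df sg dg].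
- by apply: SmBase; exact: smooth_pd.
- by rewrite pd_cst; exact: SmCst.
- by rewrite pdD; [exact: SmAdd|exact: smalg_diff|exact: smalg_diff].
- rewrite pdM; [|exact: smalg_diff|exact: smalg_diff].
  by apply: SmAdd; exact: SmMul.
Qed.

Lemma smooth_cst (c : R) : smooth (fun=> c).
Proof. exact/smalg_smooth/SmCst. Qed.
Lemma smoothD f g : smooth f -> smooth g -> smooth (fun x => f x + g x).
Proof. by move=> sf sg; apply/smalg_smooth/SmAdd; exact: SmBase. Qed.
Lemma smoothM f g : smooth f -> smooth g -> smooth (fun x => f x * g x).
Proof. by move=> sf sg; apply/smalg_smooth/SmMul; exact: SmBase. Qed.
Lemma smoothN f : smooth f -> smooth (fun x => - f x).
Proof.
move=> sf; rewrite (_ : (fun x => - f x) = (fun x => (-1) * f x)).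
  by apply: smoothM => //; exact: smooth_cst.
by apply/funext => x; rewrite mulN1r.
Qed.

Lemma differentiable_dot (xi x : E3 R) : differentiable (fun y => dot y xi) x.
Proof.
rewrite (_ : (fun y => dot y xi) = dotl xi).
  by apply: linear_differentiable; exact: continuous_dotl.
by apply/funext => y; rewrite /dotl dotC.
Qed.

Lemma pd_comp_dot (h dh : R -> R) (xi : E3 R) j :
  (forall t : R, is_derive t 1 h (dh t)) ->
  (forall x, differentiable (fun y : E3 R => h (dot y xi)) x) /\
  pd j (fun y => h (dot y xi)) = fun y => coord3 xi j * dh (dot y xi).
Proof.
move=> hd.
have D x : differentiable (fun y : E3 R => h (dot y xi)) x.
  apply: (@differentiable_comp _ _ _ _ (fun y => dot y xi) h).
    exact: differentiable_dot.
  by apply/derivable1_diffP; case: (hd (dot x xi)).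
split => //; apply/funext => x; apply: pd_from_line; first exact: D.
have L : is_derive (0 : R) 1 (fun s : R => dot (x + s *: basis_vec R j) xi) (coord3 xi j).
  rewrite (_ : (fun _ => _) = (fun s : R => dot x xi + s * coord3 xi j)); last first.
    by apply/funext => s; rewrite dotDl dotZl (dotC _ xi) (dotC _ xi) dot_basis.
  rewrite -[X in is_derive _ _ _ X]add0r; apply: is_deriveD.
  rewrite -[X in is_derive _ _ _ X]mul1r.
  rewrite (_ : (fun s => s * coord3 xi j) = (fun s => coord3 xi j * s)).
    rewrite mulrC; exact: is_deriveZ.
  by apply/funext => s; rewrite mulrC.
have hd0 : is_derive (dot (x + (0 : R) *: basis_vec R j) xi) 1 h (dh (dot x xi)).
  by rewrite scale0r addr0.
have := @is_derive1_comp R h (fun s : R => dot (x + s *: basis_vec R j) xi) 0 _ _ hd0 L.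
by rewrite mulrC.
Qed.

(** For a fixed frequency the linear combinations of cosine and sine are stable under [pd]. *)
Lemma smooth_trig (xi : E3 R) :
  smooth (fun x => cos (dot x xi)) /\ smooth (fun x => sin (dot x xi)).
Proof.
pose P f := exists a b : R, f = fun x => a * cos (dot x xi) + b * sin (dot x xi).
have dc := pd_comp_dot xi _ (fun t => @is_derive_cos R t).
have ds := pd_comp_dot xi _ (fun t => @is_derive_sin R t).
have dcst (a : R) x : differentiable (fun=> a : R) (x : E3 R) by exact: differentiable_cst.
have dcM (a : R) x : differentiable (fun y => a * cos (dot y xi)) x.
  by apply: differentiableM => //; case: (dc ord0).
have dsM (a : R) x : differentiable (fun y => a * sin (dot y xi)) x.
  by apply: differentiableM => //; case: (ds ord0).
have smP f : P f -> smooth f.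
  apply: (@smooth_ind P) => {}f => [[a [b ->]] x|j [a [b ->]]].
    exact: differentiableD.
  exists (b * coord3 xi j), (- (a * coord3 xi j)); apply/funext => x.
  rewrite pdD // !pdM; try by [case: (dc j)|case: (ds j)|move=> ?; exact: dcst].
  by rewrite !pd_cst; case: (dc j) => _ ->; case: (ds j) => _ ->; ring.
split; apply: smP; [exists 1, 0|exists 0, 1]; apply/funext => x; ring.
Qed.

Lemma smooth_affine f (c : R) (y : E3 R) : smooth f -> smooth (fun x => f (c *: x + y)).
Proof.
move=> sf; pose P (h : E3 R -> R) := exists (a : R) (g : E3 R -> R),
  smooth g /\ h = fun x => a * g (c *: x + y).
have dA (g : E3 R -> R) x : smooth g -> differentiable (fun x => g (c *: x + y)) x.
  move=> sg; apply: (@differentiable_comp _ _ _ _ (fun x : E3 R => c *: x + y) g).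
    apply: differentiableD; last exact: differentiable_cst.
    by apply: differentiableZ; exact: (@ex_diff _ _ _ _ _ _ _ (is_diff_id x)).
  exact: smooth_diff.
have dcst (a : R) x : differentiable (fun=> a : R) (x : E3 R) by exact: differentiable_cst.
have : P (fun x => f (c *: x + y)).
  by exists 1, f; split => //; apply/funext => x; rewrite mul1r.
apply: (@smooth_ind P) => f' => [[a [g [sg ->]]] x|j [a [g [sg ->]]]].
  by apply: differentiableM => //; exact: dA.
exists (a * c), (pd j g); split; first exact: smooth_pd.
rewrite pdM //; last by move=> x; exact: dA.
apply/funext => x; rewrite pd_cst mul0r add0r -mulrA; congr (_ * _).
apply: pd_from_line; first exact: dA.
have := @pd_line R g (c *: x + y) j 0 _; rewrite scale0r addr0.
move=> /(_ (smooth_diff sg _)) h.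
have L : is_derive (0 : R) 1 (fun s : R => c * s) c.
  by rewrite -[X in is_derive _ _ _ X]mulr1; exact: is_deriveZ.
have h0 : is_derive (c * (0 : R)) 1 (fun s => g (c *: x + y + s *: basis_vec R j))
   (pd j g (c *: x + y)) by rewrite mulr0.
have := is_derive1_comp h0 L; rewrite mulrC.
rewrite (_ : _ \o _ = (fun s => g (c *: (x + s *: basis_vec R j) + y))) //.
by apply/funext => s /=; rewrite scalerDr scalerA addrAC.
Qed.

End smooth_functions.

Section complex_smooth.
Context {R : realType}.
Implicit Types (f g : E3 R -> R[i]) (j : 'I_3).

Definition cdiff f := (forall x, differentiable (fun x => complex.Re (f x)) x) /\
  (forall x, differentiable (fun x => complex.Im (f x)) x).
Definition csmooth f := smooth (fun x => complex.Re (f x)) /\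
  smooth (fun x => complex.Im (f x)).

Lemma csmooth_cdiff f : csmooth f -> cdiff f.
Proof. by move=> [s1 s2]; split; exact: smooth_diff. Qed.
Lemma csmooth_cpd f j : csmooth f -> csmooth (cpd j f).
Proof. by move=> [s1 s2]; split; exact: smooth_pd. Qed.
Lemma cdiff_meas f : cdiff f -> cmeas f.
Proof. by move=> [d1 d2]; split; exact: differentiable_measurable. Qed.
Lemma csmooth_meas f : csmooth f -> cmeas f.
Proof. by move=> /csmooth_cdiff/cdiff_meas. Qed.

Lemma csmoothM f g : csmooth f -> csmooth g -> csmooth (fun x => f x * g x).
Proof.
move=> [f1 f2] [g1 g2]; split.
  under eq_fun do rewrite ReM; apply: smoothD; first exact: smoothM.
  by apply: smoothN; exact: smoothM.
under eq_fun do rewrite ImM.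
by apply: smoothD; exact: smoothM.
Qed.
Lemma csmooth_real (h : E3 R -> R) : smooth h -> csmooth (fun x => (h x)%:C).
Proof. by move=> sh; split => //=; exact: smooth_cst. Qed.
Lemma csmooth_cst (c : R[i]) : csmooth (fun=> c).
Proof. by split; exact: smooth_cst. Qed.
Lemma csmooth_expi (xi : E3 R) : csmooth (fun x => expi (dot x xi)).
Proof. by have [sc ss] := smooth_trig xi; split. Qed.

Lemma cpd_expi (xi : E3 R) j : cpd j (fun x => expi (dot x xi)) =
  fun x => 'i%C * (coord3 xi j)%:C * expi (dot x xi).
Proof.
have [_ dc] := pd_comp_dot xi j (fun t => @is_derive_cos R t).
have [_ ds] := pd_comp_dot xi j (fun t => @is_derive_sin R t).
apply/funext => x; rewrite /cpd /= dc ds.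
by apply: complex_ext; rewrite ?ReM ?ImM /= ?ReM ?ImM /=; ring.
Qed.

Lemma cdiffM f g : cdiff f -> cdiff g -> cdiff (fun x => f x * g x).
Proof.
move=> [f1 f2] [g1 g2]; split => x.
  under eq_fun do rewrite ReM.
  by apply: differentiableB; exact: differentiableM.
under eq_fun do rewrite ImM.
by apply: differentiableD; exact: differentiableM.
Qed.

Lemma cpdM f g j : cdiff f -> cdiff g ->
  cpd j (fun x => f x * g x) = fun x => cpd j f x * g x + f x * cpd j g x.
Proof.
move=> [f1 f2] [g1 g2]; apply/funext => x.
have dM (a b : E3 R -> R) : (forall x, differentiable a x) ->
    (forall x, differentiable b x) -> forall x, differentiable (fun x => a x * b x) x.
  by move=> da db y; exact: differentiableM.
apply: complex_ext; rewrite ?ReD ?ImD !(ReM, ImM) /=.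
  rewrite /pd; under eq_fun do rewrite ReM.
  rewrite -!/(pd j _ _).
  rewrite pdD; [|exact: dM|by move=> y; apply: differentiableN; exact: dM].
  by rewrite pdN; [rewrite !pdM //; ring|exact: dM].
rewrite /pd; under eq_fun do rewrite ImM.
rewrite -!/(pd j _ _).
by rewrite pdD; [rewrite !pdM //; ring|exact: dM|exact: dM].
Qed.

Lemma cpd_real (h : E3 R -> R) j : cpd j (fun x => (h x)%:C) = fun x => (pd j h x)%:C.
Proof. by apply/funext => x; rewrite /cpd /= pd_cst. Qed.

Lemma cintegral_cpd f j (C : R) : cdiff f -> (forall x, cmod (f x) <= C * wt x) ->
  (forall x, cmod (cpd j f x) <= C * wt x) -> cintegral (cpd j f) = 0.
Proof.
move=> [f1 f2] fC pC; apply: complex_ext => /=.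
  apply: (integral_pd (C := C)) => // x; first exact: le_trans (Re_le_cmod _) (fC x).
  exact: le_trans (Re_le_cmod (cpd j f x)) (pC x).
apply: (integral_pd (C := C)) => // x; first exact: le_trans (Im_le_cmod _) (fC x).
exact: le_trans (Im_le_cmod (cpd j f x)) (pC x).
Qed.

End complex_smooth.

Lemma Re_scale (R : realType) (a : R) (z : R[i]) : complex.Re (a%:C * z) = a * complex.Re z.
Proof. by rewrite ReM /= mul0r subr0. Qed.
Lemma Im_scale (R : realType) (a : R) (z : R[i]) : complex.Im (a%:C * z) = a * complex.Im z.
Proof. by rewrite ImM /= mul0r addr0. Qed.

(** * Fourier integrals, moments and derivatives *)

Section inverse_fourier_derivative.
Context {R : realType}.
Local Notation mu := (leb3 R).
Implicit Types (f g F : E3 R -> R[i]) (x xi : E3 R) (j : 'I_3).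

Definition mom k F := cintegrable (fun xi => ((1 + enorm xi) ^+ k)%:C * F xi).

Lemma cmeas_expi_dot x : cmeas (fun xi : E3 R => expi (dot x xi)).
Proof.
by apply: cmeas_expi; apply: measurable_dot; [exact: measurable_cst|exact: measurable_id].
Qed.

Lemma cmeas_coord j : cmeas (fun xi : E3 R => (coord3 xi j)%:C).
Proof. by apply: cmeas_real; exact: measurable_coord3. Qed.

Lemma measurable_poly k : measurable_fun setT (fun xi : E3 R => (1 + enorm xi) ^+ k).
Proof.
apply: measurable_funX; apply: measurable_funD; first exact: measurable_cst.
exact: measurable_enorm.
Qed.

Lemma mom_meas k F : mom k F -> cmeas F.
Proof.
move=> /cintegrable_meas mF.
have mi : cmeas (fun xi : E3 R => (((1 + enorm xi) ^+ k)^-1)%:C).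
  apply: cmeas_real; rewrite (_ : (fun _ => _) = (fun x => ((1 + enorm x) ^+ k) `^ (-1))).
    exact: (measurableT_comp (measurable_powR (-1)) (measurable_poly k)).
  by apply/funext => x; rewrite powR_inv1 // exprn_ge0 // addr_ge0 // enorm_ge0.
apply: (cmeas_ext (cmeasM mi mF)) => x.
have h : (1 + enorm x) ^+ k != 0.
  by rewrite expf_neq0 // gt_eqF // ltr_pwDl // enorm_ge0.
by rewrite mulrA -rmorphM /= mulVf // rmorph1 mul1r.
Qed.

Lemma mom_dom k F (g : E3 R -> R[i]) : cmeas g ->
  (forall xi, cmod (g xi) <= (1 + enorm xi) ^+ k * cmod (F xi)) ->
  mom k F -> cintegrable g.
Proof.
move=> mg gF /integrable_cmod iF; apply: cintegrable_le iF _ => // xi.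
by rewrite cmodM cmod_real ger0_norm ?exprn_ge0 // addr_ge0 // enorm_ge0.
Qed.

Lemma momS k l F : (k <= l)%N -> mom l F -> mom k F.
Proof.
move=> kl mF; apply: mom_dom (mF).
  by apply: cmeasM; [by apply: cmeas_real; exact: measurable_poly|exact: mom_meas mF].
move=> xi; rewrite cmodM cmod_real ger0_norm ?exprn_ge0 ?addr_ge0 ?enorm_ge0 //.
by rewrite ler_wpM2r ?cmod_ge0 // ler_weXn2l // lerDl enorm_ge0.
Qed.

Lemma mom0 F : mom 0 F <-> cintegrable F.
Proof.
by rewrite /mom; split; under eq_fun do rewrite expr0 mul1r.
Qed.

Lemma mom_int k F : mom k F -> cintegrable F.
Proof. by move=> /(momS (leq0n k))/mom0. Qed.

Lemma mom_coord k j F : mom k.+1 F ->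
  mom k (fun xi => 'i%C * (coord3 xi j)%:C * F xi).
Proof.
move=> mF; apply: mom_dom (mF).
  apply: cmeasM; first by apply: cmeas_real; exact: measurable_poly.
  apply: cmeasM; last exact: mom_meas mF.
  by apply: cmeasM; [exact: cmeas_cst|exact: cmeas_coord].
move=> xi; have e0 := enorm_ge0 xi.
rewrite !cmodM !cmod_real cmod_i mul1r ger0_norm ?exprn_ge0 ?addr_ge0 //.
rewrite exprSr -mulrA ler_wpM2l ?exprn_ge0 ?addr_ge0 //.
by rewrite ler_wpM2r ?cmod_ge0 // (le_trans (coord3_le _ _)) // lerDr.
Qed.

Lemma cintegrable_expi x F : cintegrable F -> cintegrable (fun xi => expi (dot x xi) * F xi).
Proof.
move=> iF; apply: (cintegrable_boundM (M := 1)) => //; first exact: cmeas_expi_dot.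
by move=> y; rewrite cmod_expi.
Qed.

Lemma inv_fourierE F x :
  inv_fourier_fun F x = c0%:C * cintegral (fun xi => expi (dot x xi) * F xi).
Proof. by []. Qed.

Lemma fourierE F x : fourier_fun F x = inv_fourier_fun F (- x).
Proof.
rewrite inv_fourierE /fourier_fun; congr (_ * _).
by apply: eq_cintegral => y; rewrite dotNl dotC.
Qed.

Lemma inv_fourier_bound F x : cintegrable F ->
  cmod (inv_fourier_fun F x) <= c0 * \int[mu]_xi cmod (F xi).
Proof.
move=> iF; rewrite inv_fourierE cmodM cmod_real ger0_norm ?(ltW c0_gt0) //.
rewrite ler_wpM2l ?(ltW c0_gt0) // (le_trans (cmod_cintegral _)) //.
  exact: cintegrable_expi.
rewrite le_eqVlt; apply/orP; left; apply/eqP; apply: eq_Rintegral => y _.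
by rewrite cmodM cmod_expi mul1r.
Qed.

(** From |exp(it) - 1 - it| <= 2 t^2, integrated against the second moment. A quadratic remainder
    yields differentiability and the derivative at once, without differentiating under the
    integral. *)
Lemma inv_fourier_quad F x h : mom 2 F ->
  cmod (inv_fourier_fun F (h + x) - inv_fourier_fun F x -
     \sum_(j < 3) (coord3 h j)%:C * inv_fourier_fun (fun xi => 'i%C * (coord3 xi j)%:C * F xi) x)
  <= (c0 * 2 * \int[mu]_xi cmod (((1 + enorm xi) ^+ 2)%:C * F xi)) * enorm h ^+ 2.
Proof.
move=> mF; have iF := mom_int mF.
have iFj j : cintegrable (fun xi => 'i%C * (coord3 xi j)%:C * F xi).
  by apply/mom0; apply: mom_coord; exact: momS mF.
pose D xi := (expi (dot h xi) - 1 - 'i%C * (dot h xi)%:C) * (expi (dot x xi) * F xi).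
have DE xi : D xi = expi (dot (h + x) xi) * F xi - expi (dot x xi) * F xi -
   \sum_(j < 3) (coord3 h j)%:C * (expi (dot x xi) * ('i%C * (coord3 xi j)%:C * F xi)).
  rewrite /D dotDl expiD /dot rmorph_sum /= !big_ord_recl !big_ord0 !rmorphM /=; ring.
have mD : cmeas D.
  apply: cmeasM; last by apply: cintegrable_meas; exact: cintegrable_expi.
  apply: cmeasB; first by apply: cmeasB; [exact: cmeas_expi_dot|exact: cmeas_cst].
  apply: cmeasM; [exact: cmeas_cst|apply: cmeas_real].
  by apply: measurable_dot; [exact: measurable_cst|exact: measurable_id].
have Db xi : cmod (D xi) <= 2 * enorm h ^+ 2 * cmod (((1 + enorm xi) ^+ 2)%:C * F xi).
  rewrite !cmodM cmod_expi mul1r cmod_real mulrA ler_wpM2r ?cmod_ge0 //.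
  apply: le_trans (expi_quad _) _; rewrite -mulrA ler_wpM2l //.
  have p0 : 0 <= (1 + enorm xi) ^+ 2 by rewrite sqr_ge0.
  rewrite (ger0_norm p0) -[leLHS]real_normK ?num_real // -exprMn.
  rewrite lerXn2r ?nnegrE ?mulr_ge0 ?addr_ge0 ?enorm_ge0 //.
  apply: le_trans (dot_le _ _) _; rewrite ler_wpM2l ?enorm_ge0 //.
  by rewrite lerDr.
have bi : mu.-integrable setT (EFin \o (fun xi => 2 * enorm h ^+ 2 *
     cmod (((1 + enorm xi) ^+ 2)%:C * F xi))).
  by apply: integrable_scale; exact: integrable_cmod.
have iD : cintegrable D by exact: cintegrable_le bi Db.
have -> : inv_fourier_fun F (h + x) - inv_fourier_fun F x -
     \sum_(j < 3) (coord3 h j)%:C * inv_fourier_fun (fun xi => 'i%C * (coord3 xi j)%:C * F xi) x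
   = c0%:C * cintegral D.
  rewrite (eq_cintegral DE) cintegralB; last 2 first.
  - by apply: cintegrableB; exact: cintegrable_expi.
  - by apply: cintegrable_sum => j; apply: cintegrableZ; exact: cintegrable_expi.
  rewrite cintegralB; try exact: cintegrable_expi.
  rewrite cintegral_sum; last first.
    by move=> j; apply: cintegrableZ; exact: cintegrable_expi.
  rewrite !mulrBr mulr_sumr; congr (_ - _); apply: eq_bigr => j _.
  by rewrite cintegralZ ?inv_fourierE; [rewrite mulrCA|exact: cintegrable_expi].
rewrite cmodM cmod_real ger0_norm ?(ltW c0_gt0) // -!mulrA ler_wpM2l ?(ltW c0_gt0) //.
apply: le_trans (cmod_cintegral iD) _.
apply: le_trans (le_Rintegral measurableT _ bi (fun x _ => Db x)) _.
  exact: integrable_cmod.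
rewrite RintegralZl //; last exact: integrable_cmod.
by rewrite -mulrA [X in _ <= 2 * X]mulrC.
Qed.

Lemma inv_fourier_diff F j : mom 2 F -> cdiff (inv_fourier_fun F) /\
  cpd j (inv_fourier_fun F) = inv_fourier_fun (fun xi => 'i%C * (coord3 xi j)%:C * F xi).
Proof.
move=> mF.
pose A x i := inv_fourier_fun (fun xi => 'i%C * (coord3 xi i)%:C * F xi) x.
pose vec (p : 'I_3 -> R) : E3 R :=
  (p ord0, p (lift ord0 ord0), p (lift ord0 (lift ord0 ord0))).
have vecE p i : coord3 (vec p) i = p i.
  by case: i => -[|[|[|//]]] h; rewrite /coord3 (tnth_nth 0) /=; congr p; exact: val_inj.
have dvec p h : dot (vec p) h = \sum_(i < 3) coord3 h i * p i.
  by rewrite /dot; apply: eq_bigr => i _; rewrite vecE mulrC.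
have qr x h : `|complex.Re (inv_fourier_fun F (h + x)) - complex.Re (inv_fourier_fun F x)
     - dot (vec (fun i => complex.Re (A x i))) h| <=
   (c0 * 2 * \int[mu]_xi cmod (((1 + enorm xi) ^+ 2)%:C * F xi)) * enorm h ^+ 2.
  apply: le_trans (inv_fourier_quad x h mF); apply: le_trans (Re_le_cmod _).
  rewrite !ReB Re_sum dvec le_eqVlt; apply/orP; left; apply/eqP.
  congr (`|_ - _|); apply: eq_bigr => i _; by rewrite [RHS]Re_scale.
have qi x h : `|complex.Im (inv_fourier_fun F (h + x)) - complex.Im (inv_fourier_fun F x)
     - dot (vec (fun i => complex.Im (A x i))) h| <=
   (c0 * 2 * \int[mu]_xi cmod (((1 + enorm xi) ^+ 2)%:C * F xi)) * enorm h ^+ 2.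
  apply: le_trans (inv_fourier_quad x h mF); apply: le_trans (Im_le_cmod _).
  rewrite !ImB Im_sum dvec le_eqVlt; apply/orP; left; apply/eqP.
  congr (`|_ - _|); apply: eq_bigr => i _; by rewrite [RHS]Im_scale.
split.
  split => x.
    by have [] := differentiable_quad (f := fun x => complex.Re (inv_fourier_fun F x)) (qr x).
  by have [] := differentiable_quad (f := fun x => complex.Im (inv_fourier_fun F x)) (qi x).
apply/funext => x; apply: complex_ext => /=.
  by rewrite (pd_quad (f := fun x => complex.Re (inv_fourier_fun F x)) (qr x)) vecE.
by rewrite (pd_quad (f := fun x => complex.Im (inv_fourier_fun F x)) (qi x)) vecE.
Qed.

Lemma inv_fourier_smooth F : (forall k, mom k F) -> csmooth (inv_fourier_fun F).
Proof.
move=> mF.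
pose P1 (f : E3 R -> R) := exists2 G, (forall k, mom k G) &
  f = (fun x => complex.Re (inv_fourier_fun G x)).
pose P2 (f : E3 R -> R) := exists2 G, (forall k, mom k G) &
  f = (fun x => complex.Im (inv_fourier_fun G x)).
split.
  apply: (@smooth_ind R P1); last by exists F.
    by move=> f [G mG ->]; have [[]] := inv_fourier_diff ord0 (mG 2).
  move=> f j [G mG ->]; exists (fun xi => 'i%C * (coord3 xi j)%:C * G xi).
    by move=> k; exact: mom_coord.
  by have [_ <-] := inv_fourier_diff j (mG 2).
apply: (@smooth_ind R P2); last by exists F.
  by move=> f [G mG ->]; have [[]] := inv_fourier_diff ord0 (mG 2).
move=> f j [G mG ->]; exists (fun xi => 'i%C * (coord3 xi j)%:C * G xi).
  by move=> k; exact: mom_coord.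
by have [_ <-] := inv_fourier_diff j (mG 2).
Qed.

Definition wdecay f := exists C : R, forall x, cmod (f x) <= C * wt x.

Lemma wdecay_ge0 f : wdecay f -> exists2 C : R, 0 <= C & forall x, cmod (f x) <= C * wt x.
Proof.
move=> [C fC]; exists C => //.
have := le_trans (cmod_ge0 _) (fC 0); have := wt_gt0 (0 : E3 R) => w0.
by rewrite pmulr_lge0.
Qed.

Lemma wdecay_dom f g (M : R) : (forall x, cmod (g x) <= M * cmod (f x)) -> 0 <= M ->
  wdecay f -> wdecay g.
Proof.
move=> gf M0 [C fC]; exists (M * C) => x.
by rewrite (le_trans (gf x)) // -mulrA ler_wpM2l.
Qed.

Lemma wdecayD f g : wdecay f -> wdecay g -> wdecay (fun x => f x + g x).
Proof.
move=> [C fC] [D gD]; exists (C + D) => x.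
by rewrite (le_trans (cmodD _ _)) // mulrDl lerD.
Qed.

Lemma wdecay_int f : cmeas f -> wdecay f -> cintegrable f.
Proof. by move=> mf [C fC]; exact: cintegrable_wt fC. Qed.

(** The derivative of the product of f with a character is dominated by a multiple of [wt], so its
    integral vanishes by [cintegral_cpd]. *)
Lemma inv_fourier_ibp f j x : cdiff f -> wdecay f -> wdecay (cpd j f) ->
  cmeas (cpd j f) ->
  inv_fourier_fun (cpd j f) x = - ('i%C * (coord3 x j)%:C) * inv_fourier_fun f x.
Proof.
move=> df wf wpf mpf.
have de : cdiff (fun y : E3 R => expi (dot y x)) by exact/csmooth_cdiff/csmooth_expi.
have wef : wdecay (fun y => expi (dot y x) * f y).
  by apply: (wdecay_dom (f := f) (M := 1)) => // y; rewrite cmodM cmod_expi.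
have P : cpd j (fun y => expi (dot y x) * f y) =
  (fun y => 'i%C * (coord3 x j)%:C * (expi (dot y x) * f y) + expi (dot y x) * cpd j f y).
  by rewrite cpdM // cpd_expi; apply/funext => y; rewrite mulrA.
have w1 : wdecay (fun y => 'i%C * (coord3 x j)%:C * (expi (dot y x) * f y)).
  apply: (wdecay_dom (f := f) (M := `|coord3 x j|)) => // y.
  by rewrite !cmodM cmod_expi cmod_i cmod_real !mul1r.
have w2 : wdecay (fun y => expi (dot y x) * cpd j f y).
  apply: (wdecay_dom (f := cpd j f) (M := 1)) => // y.
  by rewrite !cmodM cmod_expi.
have [C C0 hC] := wdecay_ge0 wef.
have wP : wdecay (cpd j (fun y => expi (dot y x) * f y)) by rewrite P; exact: wdecayD.
have [D D0 hD] := wdecay_ge0 wP.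
have : cintegral (cpd j (fun y => expi (dot y x) * f y)) = 0.
  apply: (cintegral_cpd (C := C + D)).
  - exact: cdiffM.
  - by move=> y; rewrite (le_trans (hC y)) // ler_wpM2r ?(ltW (wt_gt0 _)) // lerDl.
  - by move=> y; rewrite (le_trans (hD y)) // ler_wpM2r ?(ltW (wt_gt0 _)) // lerDr.
have ee : cmeas (fun y : E3 R => expi (dot y x)) by exact: cdiff_meas.
have i1 : cintegrable (fun y => expi (dot y x) * f y).
  by apply: wdecay_int wef; apply: cmeasM => //; exact: cdiff_meas.
have i2 : cintegrable (fun y => expi (dot y x) * cpd j f y).
  by apply: wdecay_int w2; apply: cmeasM.
rewrite P cintegralD //; last exact: cintegrableZ.
rewrite cintegralZ // => E.
have E' : cintegral (fun y => expi (dot y x) * cpd j f y) =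
    - ('i%C * (coord3 x j)%:C) * cintegral (fun y => expi (dot y x) * f y).
  by apply/eqP; rewrite mulNr -addr_eq0 addrC E.
rewrite !inv_fourierE.
rewrite (@eq_cintegral _ _ (fun y => expi (dot y x) * cpd j f y)); last first.
  by move=> y; rewrite dotC.
rewrite E' [in RHS](@eq_cintegral _ _ (fun y => expi (dot y x) * f y)); last first.
  by move=> y; rewrite dotC.
by rewrite mulrCA.
Qed.

End inverse_fourier_derivative.

(* Unfolding these during unification is prohibitively expensive. *)
Opaque inv_fourier_fun fourier_fun cintegral.

(** * Compactly supported and Schwartz functions *)

Section compactly_supported.
Context {R : realType}.
Local Notation mu := (leb3 R).
Implicit Types (f g F : E3 R -> R[i]) (x xi : E3 R) (j : 'I_3).

Lemma continuous_bounded3 (f : E3 R -> R) (r : R) : continuous f ->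
  exists C, forall x, enorm x <= r -> `|f x| <= C.
Proof.
move=> cf; pose K : set (E3 R) := (`[-r, r] `*` `[-r, r]) `*` `[-r, r].
have cK : compact K by do 2?apply: compact_setX; exact: segment_compact.
have : compact (f @` K).
  by apply: continuous_compact => //; exact: continuous_subspaceT.
move=> /compact_bounded [M [_ hM]]; exists (M + 1) => x xr.
apply: (hM (M + 1)); first by rewrite ltrDl.
exists x => //.
by split; [split|]; rewrite /= in_itv /= -ler_norml; apply: le_trans xr;
  [exact: (coord3_le x ord0)|exact: (coord3_le x (lift ord0 ord0))|
   exact: (coord3_le x (lift ord0 (lift ord0 ord0)))].
Qed.

Definition Cc f := csmooth f /\ exists r : R, forall x, r < enorm x -> f x = 0.

Lemma enorm_basis j : enorm (basis_vec R j) <= 1.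
Proof.
rewrite -ler_sqr ?nnegrE ?enorm_ge0 // enorm_sqr dot_basis expr1n.
by case: j => -[|[|[|//]]] ? /=; rewrite /coord3 (tnth_nth 0).
Qed.

(** Outside the ball the difference quotients are eventually zero. *)
Lemma pd_support (f : E3 R -> R) j (r : R) : (forall x, differentiable f x) ->
  (forall x, r < enorm x -> f x = 0) -> forall x, r < enorm x -> pd j f x = 0.
Proof.
move=> df f0 x xr; have h := @pd_cvg R f x j (df x).
suff hz : n.+1%:R * (f (x + n.+1%:R^-1 *: basis_vec R j) - f x) @[n --> \oo] --> (0 : R).
  exact: (cvg_unique _ h hz).
apply: cvg_near_cst; near=> n.
have sn : n.+1%:R^-1 < enorm x - r.
  near: n; have p : 0 < enorm x - r by rewrite subr_gt0.
  exact: (near_infty_natSinv_lt (PosNum p)).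
have s1 : enorm (n.+1%:R^-1 *: basis_vec R j) <= n.+1%:R^-1.
  by rewrite enormZ ger0_norm ?invr_ge0 // ler_piMr ?invr_ge0 // enorm_basis.
have z : f (x + n.+1%:R^-1 *: basis_vec R j) = 0.
  apply: f0; apply: lt_le_trans (enormB_ge x _).
  have := le_lt_trans s1 sn; rewrite ltrBrDr addrC -ltrBrDr; exact.
by rewrite (f0 x) // z subr0 mulr0.
Unshelve. all: by end_near. Qed.

Lemma Cc_smooth f : Cc f -> csmooth f. Proof. by case. Qed.

Lemma Cc_cpd f j : Cc f -> Cc (cpd j f).
Proof.
move=> [sf [r fr]]; split; first exact: csmooth_cpd.
have [d1 d2] := csmooth_cdiff sf.
exists r => x xr; apply: complex_ext => /=.
  by apply: (@pd_support _ j r) => // y yr; rewrite fr.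
by apply: (@pd_support _ j r) => // y yr; rewrite fr.
Qed.

Lemma CcMl f g : csmooth f -> Cc g -> Cc (fun x => f x * g x).
Proof.
move=> sf [sg [r gr]]; split; first exact: csmoothM.
by exists r => x xr; rewrite gr // mulr0.
Qed.

Lemma Cc_bounded f : Cc f -> exists2 C : R, 0 <= C & forall x, cmod (f x) <= C.
Proof.
move=> [sf [r fr]]; have [d1 d2] := csmooth_cdiff sf.
have c1 : continuous (fun x => complex.Re (f x)).
  by move=> x; exact: differentiable_continuous.
have c2 : continuous (fun x => complex.Im (f x)).
  by move=> x; exact: differentiable_continuous.
have [C hC] := continuous_bounded3 r c1; have [D hD] := continuous_bounded3 r c2.
exists (`|C| + `|D|) => [|x]; first by rewrite addr_ge0.
have [xr|xr] := leP (enorm x) r; last by rewrite fr // cmod0 addr_ge0.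
apply: le_trans (cmod_le _) _.
by rewrite lerD // (le_trans _ (ler_norm _)) ?hC ?hD.
Qed.

Lemma Cc_poly f k : Cc f -> exists C : R, forall x, (1 + enorm x) ^+ k * cmod (f x) <= C.
Proof.
move=> cf; have [C C0 hC] := Cc_bounded cf; case: cf => sf [r fr].
exists ((1 + `|r|) ^+ k * C) => x; have [xr|xr] := leP (enorm x) r.
  apply: ler_pM => //; rewrite ?exprn_ge0 ?addr_ge0 ?enorm_ge0 ?cmod_ge0 //.
  rewrite lerXn2r ?nnegrE ?addr_ge0 ?enorm_ge0 // lerD2l.
  exact: le_trans xr (ler_norm _).
by rewrite fr // cmod0 mulr0 mulr_ge0 // exprn_ge0 // addr_ge0.
Qed.

Lemma poly_wdecay f k (C : R) : (forall x, (1 + enorm x) ^+ (k + 6) * cmod (f x) <= C) ->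
  forall x, (1 + enorm x) ^+ k * cmod (f x) <= C * wt x.
Proof.
move=> fC x; have w0 := ltW (wt_gt0 x).
have p : 0 <= (1 + enorm x) ^+ k * cmod (f x).
  by rewrite mulr_ge0 ?cmod_ge0 // exprn_ge0 // addr_ge0 // enorm_ge0.
apply: le_trans (ler_wpM2r w0 (fC x)).
have := ler_wpM2l p (wt_decay x); rewrite mulr1 => h; apply: le_trans h _.
by rewrite exprD le_eqVlt; apply/orP; left; apply/eqP; ring.
Qed.

Lemma poly_mom f k (C : R) : cmeas f ->
  (forall x, (1 + enorm x) ^+ (k + 6) * cmod (f x) <= C) -> mom k f.
Proof.
move=> mf /poly_wdecay fC; apply: cintegrable_wt.
  by apply: cmeasM => //; apply: cmeas_real; exact: measurable_poly.
move=> x; rewrite cmodM cmod_real ger0_norm ?exprn_ge0 ?addr_ge0 ?enorm_ge0 //.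
Qed.

Lemma Cc_mom f k : Cc f -> mom k f.
Proof.
move=> cf; have [C hC] := Cc_poly (k + 6) cf; apply: poly_mom hC.
by apply: csmooth_meas; exact: Cc_smooth.
Qed.

Lemma Cc_wdecay f : Cc f -> wdecay f.
Proof.
move=> cf; have [C hC] := Cc_poly 6 cf; exists C => x.
by have := @poly_wdecay f 0 C hC x; rewrite expr0 mul1r.
Qed.

(* Peeling off the innermost derivative reduces bounds on all derivatives of
   members of a class closed under derivation to bounds on its members. *)
Lemma schwartz_class (P : (E3 R -> R[i]) -> Prop) :
  (forall f, P f -> csmooth f) -> (forall f j, P f -> P (cpd j f)) ->
  (forall f k, P f -> exists C : R, forall x, (1 + enorm x) ^+ k * cmod (f x) <= C) ->
  forall f, P f -> schwartz f.
Proof.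
move=> Ps Pd Pb f Pf; have [s1 s2] := Ps f Pf; split => // N.
have [C hC] : exists C : R, forall a x, (size a <= N)%N ->
    (1 + enorm x) ^+ N * cmod (foldr (@cpd R) f a x) <= C.
  move: {1}N => n; elim: n f Pf {s1 s2} => [|n IH] f Pf.
    have [C hC] := Pb f N Pf; exists C => a x.
    by rewrite leqn0 size_eq0 => /eqP ->.
  have [C hC] := Pb f N Pf.
  have [C0 h0] := IH _ (Pd f ord0 Pf).
  have [C1 h1] := IH _ (Pd f (lift ord0 ord0) Pf).
  have [C2 h2] := IH _ (Pd f (lift ord0 (lift ord0 ord0)) Pf).
  exists (Num.max (Num.max C C0) (Num.max C1 C2)) => a x.
  case: (lastP a) => [_|{}a j].
    by rewrite /= !le_max hC.
  rewrite size_rcons ltnS -cats1 foldr_cat /= => sa.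
  rewrite !le_max.
  have [->|[->|->]] : j = ord0 \/ j = lift ord0 ord0 \/ j = lift ord0 (lift ord0 ord0).
  - case: j => -[|[|[|//]]] h; [left|right;left|right;right]; exact: val_inj.
  - by rewrite h0 // orbT.
  - by rewrite h1 // orbT.
  - by rewrite h2 // !orbT.
apply: (@le_lt_trans _ _ C%:E); last exact: ltry.
apply: ge_ereal_sup => y [a [x [sa ->]]].
by rewrite lee_fin hC.
Qed.

Lemma Cc_schwartz f : Cc f -> schwartz f.
Proof.
apply: schwartz_class => {}f => [|j|k]; [exact: Cc_smooth|exact: Cc_cpd|exact: Cc_poly].
Qed.

Lemma inv_fourier_ibp_Cc f j x : Cc f ->
  inv_fourier_fun (cpd j f) x = - ('i%C * (coord3 x j)%:C) * inv_fourier_fun f x.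
Proof.
move=> cf; apply: inv_fourier_ibp.
- exact/csmooth_cdiff/Cc_smooth.
- exact: Cc_wdecay.
- by apply: Cc_wdecay; exact: Cc_cpd.
- by apply: csmooth_meas; apply: csmooth_cpd; exact: Cc_smooth.
Qed.

(** Each derivative of f pays for one power of |x|, through |x| <= |x_1| + |x_2| + |x_3|;
    derivatives stay compactly supported, so the induction can go on. *)
Lemma inv_fourier_Cc_poly f k : Cc f ->
  exists C : R, forall x, (1 + enorm x) ^+ k * cmod (inv_fourier_fun f x) <= C.
Proof.
elim: k f => [|k IH] f cf.
  exists (c0 * \int[mu]_xi cmod (f xi)) => x; rewrite expr0 mul1r.
  by apply: inv_fourier_bound; apply/mom0; exact: Cc_mom.
have [C hC] := IH f cf.
have [C0 h0] := IH _ (Cc_cpd ord0 cf).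
have [C1 h1] := IH _ (Cc_cpd (lift ord0 ord0) cf).
have [C2 h2] := IH _ (Cc_cpd (lift ord0 (lift ord0 ord0)) cf).
exists (C + C0 + C1 + C2) => x.
have E j : cmod (inv_fourier_fun (cpd j f) x) =
    `|coord3 x j| * cmod (inv_fourier_fun f x).
  by rewrite (inv_fourier_ibp_Cc j x cf) cmodM cmodN cmodM cmod_i mul1r cmod_real.
move: (h0 x).
rewrite (E ord0).
move: (h1 x).
rewrite (E (lift ord0 ord0)).
move: (h2 x).
rewrite (E (lift ord0 (lift ord0 ord0))).
move: (hC x).
set a := cmod (inv_fourier_fun f x); set p := (1 + enorm x) ^+ k => g g2 g1 g0.
have p0 : 0 <= p by rewrite exprn_ge0 // addr_ge0 // enorm_ge0.
have a0 : 0 <= a by exact: cmod_ge0.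
have e3 : enorm x <= `|coord3 x ord0| + `|coord3 x (lift ord0 ord0)| +
    `|coord3 x (lift ord0 (lift ord0 ord0))|.
  rewrite -ler_sqr ?nnegrE ?enorm_ge0 ?addr_ge0 // enorm_sqr.
  rewrite /dot !big_ord_recl big_ord0 -!expr2.
  set b0 := coord3 x _; set b1 := coord3 x _; set b2 := coord3 x _.
  rewrite -(real_normK (num_real b0)) -(real_normK (num_real b1)) -(real_normK (num_real b2)).
  have := normr_ge0 b0; have := normr_ge0 b1; have := normr_ge0 b2; nra.
rewrite exprSr -/p; move: e3 g0 g1 g2 g.
set b0 := `|_|; set b1 := `|_|; set b2 := `|_| => e3 g0 g1 g2 g.
apply: (@le_trans _ _ (p * (1 + (b0 + b1 + b2)) * a)).
  by rewrite ler_wpM2r // ler_wpM2l // lerD2l.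
by move: g0 g1 g2 g; rewrite !mulrDr !mulrDl !mulr1 -!mulrA; lra.
Qed.

Lemma smooth_dot (xi : E3 R) : smooth (fun x => dot x xi).
Proof.
pose P (f : E3 R -> R) := f = (fun x => dot x xi) \/ exists c : R, f = fun=> c.
have [dd pdd] : (forall x, differentiable (fun y : E3 R => dot y xi) x) /\
    forall j, pd j (fun y => dot y xi) = fun=> coord3 xi j.
  have H j := @pd_comp_dot R id (fun=> 1) xi j (fun t => is_derive_id t 1).
  split; first by have [] := H ord0.
  by move=> j; have [_ ->] := H j; apply/funext => x; rewrite mulr1.
apply: (@smooth_ind R P); last by left.
- by move=> f [->|[c ->]] x //; exact: differentiable_cst.
- move=> f j [->|[c ->]]; right; first by exists (coord3 xi j); rewrite pdd.
  by exists 0; rewrite pd_cst.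
Qed.

Lemma smooth_coord j : smooth (fun x : E3 R => coord3 x j).
Proof. by under eq_fun do rewrite -dot_basis; exact: smooth_dot. Qed.

(** Differentiating the transform multiplies f by i xi_j, which keeps it smooth and compactly
    supported; these transforms thus form a class to which [schwartz_class] applies. *)
Lemma inv_fourier_Cc_schwartz f : Cc f -> schwartz (inv_fourier_fun f).
Proof.
move=> cf; pose P g := exists2 f, Cc f & g = inv_fourier_fun f.
apply: (@schwartz_class P); last by exists f.
- by move=> g [h ch ->]; apply: inv_fourier_smooth => k; exact: Cc_mom.
- move=> g j [h ch ->]; exists (fun xi => 'i%C * (coord3 xi j)%:C * h xi).
    apply: CcMl => //; apply: csmoothM; first exact: csmooth_cst.
    by apply: csmooth_real; exact: smooth_coord.
  by have [_ <-] := inv_fourier_diff j (Cc_mom 2 ch).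
- by move=> g k [h ch ->]; exact: inv_fourier_Cc_poly.
Qed.

Lemma schwartz_bound f N a : schwartz f -> (size a <= N)%N ->
  exists C : R, forall x, (1 + enorm x) ^+ N * cmod (foldr (@cpd R) f a x) <= C.
Proof.
move=> [_ _ /(_ N)]; rewrite /schwartz_seminorm; set S := [set _ | _] => SN sa.
have ub x : (((1 + enorm x) ^+ N * cmod (foldr (@cpd R) f a x))%:E <= ereal_sup S)%E.
  by apply: ereal_sup_ubound; exists a, x.
exists (fine (ereal_sup S)) => x; rewrite -lee_fin fineK //.
rewrite fin_numE; apply/andP; split; last by rewrite lt_eqF.
by rewrite gt_eqF // (lt_le_trans _ (ub x)) // ltNyr.
Qed.

Lemma schwartz_smooth f : schwartz f -> csmooth f.
Proof. by case. Qed.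

Lemma schwartz_poly f k : schwartz f ->
  exists C : R, forall x, (1 + enorm x) ^+ k * cmod (f x) <= C.
Proof. by move=> sf; exact: (@schwartz_bound f k [::] sf). Qed.

Lemma schwartz_mom f k : schwartz f -> mom k f.
Proof.
move=> sf; have [C hC] := schwartz_poly (k + 6) sf; apply: poly_mom hC.
by apply: csmooth_meas; exact: schwartz_smooth.
Qed.

Lemma schwartz_wdecay f : schwartz f -> wdecay f.
Proof.
move=> sf; have [C hC] := schwartz_poly 6 sf; exists C => x.
by have := @poly_wdecay f 0 C hC x; rewrite expr0 mul1r.
Qed.

Lemma schwartz_cpd_wdecay f j : schwartz f -> wdecay (cpd j f).
Proof.
move=> sf; have [C hC] := @schwartz_bound f 6 [:: j] sf isT; exists C => x.
by have := @poly_wdecay (cpd j f) 0 C hC x; rewrite expr0 mul1r.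
Qed.

Lemma schwartz_int f : schwartz f -> cintegrable f.
Proof. by move=> sf; apply/mom0; exact: schwartz_mom. Qed.

Lemma inv_fourier_ibp_schwartz f j x : schwartz f ->
  inv_fourier_fun (cpd j f) x = - ('i%C * (coord3 x j)%:C) * inv_fourier_fun f x.
Proof.
move=> sf; apply: inv_fourier_ibp.
- exact/csmooth_cdiff/schwartz_smooth.
- exact: schwartz_wdecay.
- exact: schwartz_cpd_wdecay.
- by apply: csmooth_meas; apply: csmooth_cpd; exact: schwartz_smooth.
Qed.

Lemma schwartz_cpd f j : schwartz f -> schwartz (cpd j f).
Proof.
move=> sf; have [s1 s2] := csmooth_cpd j (schwartz_smooth sf); split => // N.
have [_ _ /(_ N.+1)] := sf; apply: le_lt_trans; apply: ge_ereal_sup => y [a [x [sa ->]]].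
apply: (@le_trans _ _ ((1 + enorm x) ^+ N.+1 * cmod (foldr (@cpd R) (cpd j f) a x))%:E).
  rewrite lee_fin ler_wpM2r ?cmod_ge0 // exprSr ler_peMr //.
    by rewrite exprn_ge0 // addr_ge0 // enorm_ge0.
  by rewrite lerDl enorm_ge0.
apply: ereal_sup_ubound; exists (rcons a j), x; split; first by rewrite size_rcons.
by rewrite -cats1 foldr_cat.
Qed.

Lemma Cc_inv_fourier_mul F f : Cc F -> schwartz f ->
  Cc (fun xi => F xi * inv_fourier_fun f xi).
Proof.
move=> cF sf; rewrite (_ : (fun _ => _) = (fun xi => inv_fourier_fun f xi * F xi)).
  by apply: CcMl => //; apply: inv_fourier_smooth => k; exact: schwartz_mom.
by apply/funext => x; rewrite mulrC.
Qed.


Lemma test_Cc (th : E3 R -> R) : test_function th -> Cc (fun x => (th x)%:C).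
Proof.
move=> [sth cth]; split; first exact: csmooth_real.
have /compact_bounded [M [_ hM]] := cth; exists (2 * (M + 1)) => x xM.
apply: contraPeq xM => thx; apply/negP; rewrite -leNgt.
apply: le_trans (enorm_le_norm x) _; rewrite ler_wpM2l //.
apply: (hM (M + 1)); first by rewrite ltrDl.
apply: subset_closure => /=; apply: contraNneq thx => ->.
by [].
Qed.

Lemma test_affine (th : E3 R -> R) (c : R) (y : E3 R) : c != 0 -> test_function th ->
  test_function (fun x => th (c *: x + y)).
Proof.
move=> c0 [sth cth]; split; first exact: smooth_affine.
pose K := closure [set x | th x != 0].
pose h (z : E3 R) := c^-1 *: (z - y).
have ch : continuous h.
  move=> z; apply: cvgZl_tmp; apply: cvgB; first exact: cvg_id.
  exact: cvg_cst.
have cK : compact (h @` K).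
  by apply: continuous_compact => //; exact: continuous_subspaceT.
apply: (subclosed_compact _ cK); first exact: closed_closure.
have clK : closed (h @` K) by apply: compact_closed => //; exact: norm_hausdorff.
rewrite -[X in _ `<=` X]/(h @` K) (closure_id (h @` K)).1 //.
apply: closure_subset => x /= thx; exists (c *: x + y).
  exact: subset_closure.
by rewrite /h addrK scalerA mulVf // scale1r.
Qed.

Lemma pd_test (th : E3 R -> R) j : test_function th -> test_function (pd j th).
Proof.
move=> [sth cth]; split; first exact: smooth_pd.
apply: (subclosed_compact _ cth); first exact: closed_closure.
rewrite -[X in _ `<=` X]/(closure _).
set K := closure [set x | th x != 0].
have clK : closed K by exact: closed_closure.
have -> : K = closure K by rewrite -(closure_id K).1.
apply: closure_subset => x /= px; apply: contrapT => nKx.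
have : open (~` K) by exact: closed_openC.
rewrite openE => /(_ x nKx) /= nb.
suff : pd j th x = 0 by move/eqP; rewrite (negbTE px).
have h := @pd_cvg R th x j (smooth_diff sth x).
suff hz : n.+1%:R * (th (x + n.+1%:R^-1 *: basis_vec R j) - th x) @[n --> \oo] --> (0 : R).
  exact: (cvg_unique _ h hz).
have z0 z : (~` K) z -> th z = 0.
  by move=> nK; apply: contrapT => /eqP tz; apply: nK; exact: subset_closure.
have cx : x + n.+1%:R^-1 *: basis_vec R j @[n --> \oo] --> x.
  rewrite -[X in _ --> X]addr0; apply: cvgD; first exact: cvg_cst.
  rewrite -(scale0r (basis_vec R j)); apply: cvgZr_tmp; exact: cvg_harmonic.
apply: cvg_near_cst; near=> n.
rewrite (z0 x nKx) z0 ?subr0 ?mulr0 //.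
near: n; exact: (cx _ nb).
Unshelve. all: by end_near. Qed.

Lemma testD (th ph : E3 R -> R) : test_function th -> test_function ph ->
  test_function (fun x => th x + ph x).
Proof.
move=> [sth cth] [sph cph]; split; first exact: smoothD.
have cU := compactU cth cph.
apply: (subclosed_compact _ cU); first exact: closed_closure.
rewrite -closureU; apply: closure_subset => x /=.
have [->|/eqP t0] := eqVneq (th x) 0; first by rewrite add0r; right.
by left.
Qed.

Lemma testZ (th : E3 R -> R) (c : R) : test_function th ->
  test_function (fun x => c * th x).
Proof.
move=> [sth cth]; split; first by apply: smoothM => //; exact: smooth_cst.
apply: (subclosed_compact _ cth); first exact: closed_closure.
by apply: closure_subset => x /=; apply: contraNneq => ->; rewrite mulr0.
Qed.

Lemma test0 : test_function (fun=> 0 : R).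
Proof.
split; first exact: smooth_cst.
rewrite (_ : [set x | _] = set0) ?closure0; first exact: compact0.
by apply/seteqP; split => x //=; rewrite eqxx.
Qed.

Lemma test_sum (F : 'I_3 -> E3 R -> R) : (forall j, test_function (F j)) ->
  test_function (fun x => \sum_(j < 3) F j x).
Proof.
move=> tF; rewrite (_ : (fun _ => _) = (fun x => (F ord0 x + F (lift ord0 ord0) x)
   + F (lift ord0 (lift ord0 ord0)) x)); last first.
  by apply/funext => x; rewrite !big_ord_recl big_ord0 addr0 addrA.
by apply: testD => //; exact: testD.
Qed.

End compactly_supported.

Transparent inv_fourier_fun fourier_fun cintegral.

Lemma cvg_cmod_le (R : realType) (z : nat -> R[i]) (w : R[i]) (M : R) :
  (forall n, cmod (z n) <= M) -> cmod (z n - w) @[n --> \oo] --> (0 : R) -> cmod w <= M.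
Proof.
move=> zM zw; rewrite leNgt; apply/negP => Mw.
have e0 : 0 < cmod w - M by rewrite subr_gt0.
have /cvgrPdist_lt /(_ _ e0) [N _ /(_ N (leqnn N))] := zw.
rewrite /= sub0r normrN ger0_norm ?cmod_ge0 // => h.
have := cmodB (z N) (z N - w); rewrite opprB addrC subrK => h2.
by have := zM N; lra.
Qed.

(** * Square integrable functions *)

Section square_integrable.
Context {R : realType}.
Local Notation mu := (leb3 R).
Implicit Types (f g : E3 R -> R[i]).

Definition L2 f := cmeas f /\ mu.-integrable setT (EFin \o (fun x => cmod (f x) ^+ 2)).
Definition nn2 f : R := \int[mu]_x (cmod (f x) ^+ 2).

Lemma nn2_ge0 f : 0 <= nn2 f.
Proof. by apply: Rintegral_ge0 => x _; rewrite sqr_ge0. Qed.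

Lemma L2_dom f (g : E3 R -> R) : cmeas f -> mu.-integrable setT (EFin \o g) ->
  (forall x, cmod (f x) ^+ 2 <= g x) -> L2 f.
Proof.
move=> mf ig fg; split => //; apply: integrable_le ig _.
  by apply: measurable_funX; exact: measurable_cmod.
by move=> x; rewrite ger0_norm ?sqr_ge0.
Qed.

Lemma L2_le f g (M : R) : cmeas f -> (forall x, cmod (f x) <= M * cmod (g x)) -> L2 g -> L2 f.
Proof.
move=> mf fg [mg ig]; apply: (@L2_dom f (fun x => M ^+ 2 * cmod (g x) ^+ 2)) => //.
  exact: integrable_scale.
by move=> x; rewrite -exprMn lerXn2r ?nnegrE ?cmod_ge0 // (le_trans (cmod_ge0 _) (fg x)).
Qed.

Lemma nn2_le f g : L2 f -> L2 g -> (forall x, cmod (f x) <= cmod (g x)) -> nn2 f <= nn2 g.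
Proof.
move=> [mf iF] [mg ig] fg; apply: le_Rintegral => // x _.
by rewrite lerXn2r ?nnegrE ?cmod_ge0.
Qed.

Lemma L2D f g : L2 f -> L2 g -> L2 (fun x => f x + g x).
Proof.
move=> [mf iF] [mg ig].
apply: (@L2_dom _ (fun x => 2 * cmod (f x) ^+ 2 + 2 * cmod (g x) ^+ 2)).
- exact: cmeasD.
- by apply: integrable_add; exact: integrable_scale.
- move=> x; have := cmodD (f x) (g x); have := cmod_ge0 (f x); have := cmod_ge0 (g x).
  by have := cmod_ge0 (f x + g x); have := sqr_ge0 (cmod (f x) - cmod (g x)); nra.
Qed.

Lemma nn2D f g : L2 f -> L2 g -> nn2 (fun x => f x + g x) <= 2 * nn2 f + 2 * nn2 g.
Proof.
move=> Lf Lg; have [_ iD] := L2D Lf Lg; case: Lf Lg => [mf iF] [mg ig].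
rewrite -!RintegralZl // -RintegralD //; try exact: integrable_scale.
apply: le_Rintegral => //.
  by apply: integrable_add; exact: integrable_scale.
move=> x _; have := cmodD (f x) (g x); have := cmod_ge0 (f x); have := cmod_ge0 (g x).
by have := cmod_ge0 (f x + g x); have := sqr_ge0 (cmod (f x) - cmod (g x)); nra.
Qed.

Lemma L2Z (c : R[i]) f : L2 f -> L2 (fun x => c * f x).
Proof.
move=> Lf; apply: (@L2_le _ f (cmod c)) => //.
  by apply: cmeasM; [exact: cmeas_cst|case: Lf].
by move=> x; rewrite cmodM.
Qed.

Lemma L2N f : L2 f -> L2 (fun x => - f x).
Proof.
move=> Lf; apply: (@L2_le _ f 1) => //; first by apply: cmeasN; case: Lf.
by move=> x; rewrite cmodN mul1r.
Qed.

Lemma L2B f g : L2 f -> L2 g -> L2 (fun x => f x - g x).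
Proof. by move=> Lf Lg; apply: L2D => //; exact: L2N. Qed.

Lemma L2_conj f : L2 f -> L2 (fun x => (f x)^*%C).
Proof.
move=> Lf; apply: (@L2_le _ f 1) => //; first by apply: cmeas_conj; case: Lf.
by move=> x; rewrite cmod_conj mul1r.
Qed.

Lemma nn2_conj f : nn2 (fun x => (f x)^*%C) = nn2 f.
Proof. by apply: eq_Rintegral => x _; rewrite cmod_conj. Qed.

Lemma L2_mpres tau f : mpres tau -> L2 f -> L2 (fun x => f (tau x)).
Proof.
move=> pt [mf iF]; split; first exact: cmeas_mpres.
exact: (integrable_mpres pt iF).
Qed.

Lemma nn2_mpres tau f : mpres tau -> cmeas f -> nn2 (fun x => f (tau x)) = nn2 f.
Proof.
move=> pt mf; apply: (Rintegral_mpres pt (f := fun x => cmod (f x) ^+ 2)).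
by apply: measurable_funX; exact: measurable_cmod.
Qed.

Lemma L2_boundM (b : E3 R -> R[i]) (M : R) f : cmeas b -> (forall x, cmod (b x) <= M) ->
  L2 f -> L2 (fun x => b x * f x).
Proof.
move=> mb bM Lf; apply: (@L2_le _ f M) => //; first by apply: cmeasM => //; case: Lf.
by move=> x; rewrite cmodM ler_wpM2r ?cmod_ge0.
Qed.

Lemma L2_mulr f g : L2 f -> L2 g -> mu.-integrable setT (EFin \o (fun x => cmod (f x) * cmod (g x))).
Proof.
move=> [mf iF] [mg ig].
apply: (integrable_le (g := fun x => cmod (f x) ^+ 2 + cmod (g x) ^+ 2)).
- by apply: measurable_funM; exact: measurable_cmod.
- exact: integrable_add.
- move=> x; rewrite ger0_norm ?mulr_ge0 ?cmod_ge0 //.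
  by have := sqr_ge0 (cmod (f x) - cmod (g x)); nra.
Qed.

Lemma L2_mul f g : L2 f -> L2 g -> cintegrable (fun x => f x * g x).
Proof.
move=> Lf Lg; apply: cintegrable_le (L2_mulr Lf Lg) _.
  by apply: cmeasM; [case: Lf|case: Lg].
by move=> x; rewrite cmodM.
Qed.

Lemma cauchy_schwarz f g : L2 f -> L2 g ->
  \int[mu]_x (cmod (f x) * cmod (g x)) <= Num.sqrt (nn2 f * nn2 g).
Proof.
move=> Lf Lg; set I := \int[mu]_x _.
have I0 : 0 <= I by apply: Rintegral_ge0 => x _; rewrite mulr_ge0 ?cmod_ge0.
have h (l : R) : 2 * l * I <= l ^+ 2 * nn2 f + nn2 g.
  rewrite -!RintegralZl //; [|by case: Lf|exact: L2_mulr].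
  rewrite -RintegralD //; [|by apply: integrable_scale; case: Lf|by case: Lg].
  apply: le_Rintegral => //.
  - by apply: integrable_scale; exact: L2_mulr.
  - by apply: integrable_add; [apply: integrable_scale; case: Lf|case: Lg].
  - by move=> x _; have := sqr_ge0 (l * cmod (f x) - cmod (g x)); nra.
rewrite -[leLHS]ger0_norm // -sqrtr_sqr ler_sqrt; last by rewrite mulr_ge0 ?nn2_ge0.
have f0 := nn2_ge0 f; have g0 := nn2_ge0 g.
have [F0|F0] := eqVneq (nn2 f) 0.
  rewrite F0 mul0r.
  have hz l : 2 * l * I <= nn2 g by have := h l; rewrite F0 mulr0 add0r.
  have [->|In] := eqVneq I 0; first by rewrite expr0n.
  have Ip : 0 < I by rewrite lt_def In.
  (* When f has norm 0 every slope l is allowed; this one gives 2 (nn2 g + 1) <= nn2 g, which is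
     absurd. *)
  by have := hz ((nn2 g + 1) / I); rewrite -mulrA mulfVK // => ?; lra.
have Fp : 0 < nn2 f by rewrite lt_def F0.
(* The slope that minimises the quadratic l^2 nn2 f - 2 l I + nn2 g. *)
set l := I / nn2 f; have lE : l * nn2 f = I by rewrite /l divfK.
have := ler_wpM2r f0 (h l).
rewrite (_ : 2 * l * I * nn2 f = 2 * (l * nn2 f) * I); last by ring.
rewrite (_ : (l ^+ 2 * nn2 f + nn2 g) * nn2 f = (l * nn2 f) ^+ 2 + nn2 f * nn2 g); last by ring.
by rewrite lE; nra.
Qed.

Lemma cmod_cintegral_mul f g : L2 f -> L2 g ->
  cmod (cintegral (fun x => f x * g x)) <= Num.sqrt (nn2 f * nn2 g).
Proof.
move=> Lf Lg; apply: le_trans (cauchy_schwarz Lf Lg).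
apply: le_trans (cmod_cintegral (L2_mul Lf Lg)) _.
by rewrite le_eqVlt; apply/orP; left; apply/eqP; apply: eq_Rintegral => x _; rewrite cmodM.
Qed.

Lemma nn2E f : L2 f -> (nn2 f)%:C = cintegral (fun x => f x * (f x)^*%C).
Proof.
move=> [mf iF]; rewrite -cintegral_real; apply: eq_cintegral => x.
by rewrite mulC_conj.
Qed.

Lemma dominated_nn2 (F : nat -> E3 R -> R[i]) f g :
  (forall n, cmeas (F n)) -> cmeas f ->
  (forall x, cmod (F n x - f x) @[n --> \oo] --> (0 : R)) ->
  L2 g -> (forall n x, cmod (F n x) <= cmod (g x)) ->
  L2 f /\ nn2 (fun x => F n x - f x) @[n --> \oo] --> (0 : R).
Proof.
move=> mF mf Ff [mg ig] Fg.
have fg x : cmod (f x) <= cmod (g x) by apply: cvg_cmod_le (Ff x).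
have Lf : L2 f.
  by apply: (@L2_le _ g 1) => //= x; rewrite mul1r.
split => //; pose S n x := (cmod (F n x - f x) ^+ 2)%:C.
have mS n : cmeas (S n).
  by apply/cmeas_real/measurable_funX/measurable_cmod/cmeasB.
have : cmod (cintegral (S n) - cintegral (fun=> 0)) @[n --> \oo] --> (0 : R).
  apply: (@dominated_cintegral R S (fun=> 0) (fun x => 4 * cmod (g x) ^+ 2)).
  - exact: mS.
  - exact: cmeas_cst.
  - apply: aeW => x; rewrite /S; under eq_fun do rewrite subr0 cmod_real normrX expr2 ger0_norm ?cmod_ge0 //.
    by have h := cvgM (Ff x) (Ff x); rewrite mulr0 in h; exact: h.
  - exact: integrable_scale.
  - apply: aeW => x n; rewrite /S cmod_real ger0_norm ?sqr_ge0 //.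
    have := cmodB (F n x) (f x); have := fg x; have := Fg n x.
    have := cmod_ge0 (F n x - f x); have := cmod_ge0 (g x); nra.
have E n : cmod (cintegral (S n)) = nn2 (fun x => F n x - f x).
  by rewrite cintegral_real cmod_real ger0_norm // -/(nn2 _) nn2_ge0.
by rewrite cintegral0; under eq_fun do rewrite subr0 E.
Qed.

End square_integrable.

(** * Functionals on bounded functions and characters *)

Section step_function.
Context {R : realType}.

(* With [p = (1 + sin t)/2], [N = n^3] and [t = (n y - 1) / n^2], the polynomial
   [(1 - p^N)^(2^N)] in [p] tends to the indicator of [y <= 0] at every point. *)
Definition step_poly (n : nat) (y : R) : R :=
  (1 - ((1 + sin ((n.+1%:R * y - 1) / n.+1%:R ^+ 2)) / 2) ^+ (n.+1 ^ 3)) ^+ (2 ^ (n.+1 ^ 3)).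

Let sin_range (t : R) : 0 <= (1 + sin t) / 2 <= 1.
Proof. by have := sin_geN1 t; have := sin_le1 t; lra. Qed.

Lemma step_range n y : 0 <= step_poly n y <= 1.
Proof.
rewrite /step_poly; set t := _ / _ ^+ 2; have /andP[h0 h1] := sin_range t.
have p0 : 0 <= ((1 + sin t) / 2) ^+ (n.+1 ^ 3) by rewrite exprn_ge0.
have p1 : ((1 + sin t) / 2) ^+ (n.+1 ^ 3) <= 1 by rewrite exprn_ile1.
by apply/andP; split; [rewrite exprn_ge0 // subr_ge0|rewrite exprn_ile1 ?subr_ge0 // gerBl].
Qed.

Lemma bernoulli (t : R) k : 0 <= t -> 1 + k%:R * t <= (1 + t) ^+ k.
Proof.
move=> t0; elim: k => [|k IH]; first by rewrite mul0r addr0 expr0.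
rewrite exprS; apply: le_trans (ler_wpM2l _ IH); last by rewrite addr_ge0.
rewrite -natr1; have : 0 <= k%:R * t * t by rewrite !mulr_ge0.
lra.
Qed.

Lemma bernoulli_sub (t : R) k : 0 <= t <= 1 -> 1 - k%:R * t <= (1 - t) ^+ k.
Proof.
move=> /andP[t0 t1]; elim: k => [|k IH]; first by rewrite mul0r subr0 expr0.
rewrite exprS; apply: le_trans (ler_wpM2l _ IH); last by rewrite subr_ge0.
rewrite -natr1; have : 0 <= k%:R * t * t by rewrite !mulr_ge0.
lra.
Qed.

Lemma bernoulli_inv (t : R) k : 0 <= t <= 1 -> (1 - t) ^+ k * (1 + k%:R * t) <= 1.
Proof.
move=> /andP[t0 t1]; apply: (@le_trans _ _ ((1 - t) ^+ k * (1 + t) ^+ k)).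
  by rewrite ler_wpM2l ?bernoulli // exprn_ge0 // subr_ge0.
by rewrite -exprMn exprn_ile1 //; nra.
Qed.

Lemma cvg_rate (u : nat -> R) (l C D : R) :
  (forall n, C <= n.+1%:R -> `|l - u n| <= D / n.+1%:R) -> u @ \oo --> l.
Proof.
move=> uC; have hD : D / n.+1%:R @[n --> \oo] --> (0 : R).
  by have h := cvgM (cvg_cst D) (@cvg_harmonic R); rewrite mulr0 in h; exact: h.
apply/cvgrPdist_le => e e0; have /cvgrPdist_le /(_ e e0) he := hD.
near=> n; apply: le_trans (uC n _) _.
  near: n; exists (Num.truncn `|C|) => // n /= hn.
  apply: le_trans (ler_norm C) _; apply: ltW; apply: lt_le_trans (truncnS_gt _) _.
  by rewrite ler_nat ltnS.
have : `|0 - D / n.+1%:R| <= e by near: n; exact: he.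
by rewrite sub0r normrN => h; apply: le_trans h; rewrite ler_norm.
Unshelve. all: by end_near. Qed.

(** Write M = n + 1 and N = M^3; then 2^N p^N = (2 p)^N with 2 p = 1 + sin t. If y <= 0 then t <=
    -1/M^2, so (2 p)^N <= 2/M, and the polynomial is at least 1 - (2 p)^N. If y > 0 then t >= y/(2
    M) for large M, so (2 p)^N >= 1 + M^2 y/4, and the polynomial is at most the inverse of 1 + (2
    p)^N. The shift by -1 in t settles the value at y = 0. *)
Lemma step_limit (y : R) : step_poly n y @[n --> \oo] --> ((y <= 0)%R%:R : R).
Proof.
pose C : R := 4 * (`|y| + 1) + 2 * `|y|^-1; pose D : R := 4 * `|y|^-1 + 2.
have iy0 : 0 <= `|y|^-1 by rewrite invr_ge0.
(* C forces |t| <= 1/2, where sin t and t agree within t^2, and M y >= 2 when y > 0; D collects the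
   two error rates. *)
apply: (@cvg_rate _ _ C D) => n; set M := n.+1%:R => CM.
have MN : (n.+1 ^ 3)%:R = M ^+ 3 :> R by rewrite natrX.
have M0 : 0 < M by rewrite ltr0n.
have M4 : 4 * (`|y| + 1) <= M by rewrite /C in CM; lra.
have M1 : 1 <= M by rewrite ler1n.
pose N := (n.+1 ^ 3)%N; pose t := (M * y - 1) / M ^+ 2; pose p := (1 + sin t) / 2.
have := step_range n y; rewrite /step_poly -/M -/t -/N -/p.
have /andP[p0 p1] := sin_range t; rewrite -/p in p0 p1.
have pN0 : 0 <= p ^+ N by rewrite exprn_ge0.
have pN1 : p ^+ N <= 1 by rewrite exprn_ile1.
have sE : 1 + sin t = 2 * p by rewrite /p; field.
have tM : t * M ^+ 2 = M * y - 1 by rewrite /t divfK // expf_neq0 // gt_eqF.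
have NR : N%:R = M ^+ 3 :> R by [].
have th : `|t| <= 1 / 2.
  rewrite /t normrM normfV (ger0_norm (sqr_ge0 M)) ler_pdivrMr ?exprn_gt0 //.
  apply: le_trans (ler_normB _ _) _; rewrite normr1 normrM (ger0_norm (ltW M0)).
  have : M * (4 * (`|y| + 1)) <= M * M by rewrite ler_pM2l.
  nra.
have /ler_normlP [st1 st2] := sinB_le t.
have two : (2 ^ N)%:R * p ^+ N = (2 * p) ^+ N.
  by rewrite [RHS]exprMn natrX.
have [y0|y0] := leP y 0 => /andP[q0 q1].
- have [w wE] : exists w, w = (M ^+ 2)^-1 by exists (M ^+ 2)^-1.
  have w0 : 0 <= w by rewrite wE invr_ge0 sqr_ge0.
  have w1 : w <= 1 by rewrite wE invf_le1 ?exprn_gt0 // exprn_ege1.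
  have tneg : t <= - w.
    rewrite wE /t mulrDl mulN1r gerDr mulr_le0_ge0 ?invr_ge0 ?sqr_ge0 //.
    by rewrite mulr_ge0_le0 // ltW.
  have sneg : sin t <= t / 2.
    have t0 : t <= 0 by lra.
    by move: th; rewrite ler0_norm // => th; nra.
  pose r := w / 2.
  have r0 : 0 <= r by rewrite /r; lra.
  have r1 : r <= 1 by rewrite /r; lra.
  have pr : (2 * p) ^+ N <= (1 - r) ^+ N.
    rewrite lerXn2r ?nnegrE ?subr_ge0 ?mulr_ge0 // -sE /r.
    by lra.
  have := @bernoulli_inv r N; rewrite r0 r1 => /(_ isT) bi.
  have Nr : N%:R * r = M / 2 by rewrite NR /r wE; field; exact: lt0r_neq0.
  rewrite Nr in bi.
  have b2 : (2 * p) ^+ N * M <= 2.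
    have : 0 <= (2 * p) ^+ N by rewrite exprn_ge0 // mulr_ge0.
    nra.
  have := @bernoulli_sub (p ^+ N) (2 ^ N); rewrite pN0 pN1 => /(_ isT).
  rewrite two; set q := (1 - p ^+ N) ^+ _ in q0 q1 *; move=> bs.
  rewrite /= mulr1n ger0_norm ?subr_ge0 // ler_pdivlMr //.
  apply: (@le_trans _ _ ((2 * p) ^+ N * M)).
    by rewrite ler_pM2r //; move: bs; set z := (2 * p) ^+ N; lra.
  by rewrite /D; lra.
- have yn : `|y| = y by rewrite gtr0_norm.
  have My : 2 <= M * y.
    have : 2 * `|y|^-1 <= M by rewrite /C in CM; have := normr_ge0 y; lra.
    by rewrite yn ler_pdivrMr.
  have [v vE] : exists v, v = y / (2 * M) by exists (y / (2 * M)).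
  have v0 : 0 < v by rewrite vE divr_gt0 // mulr_gt0.
  have tpos : v <= t.
    rewrite /t ler_pdivlMr ?exprn_gt0 //.
    rewrite (_ : v * M ^+ 2 = M * y / 2); first lra.
    by rewrite vE; field; exact: lt0r_neq0.
  have spos : t / 2 <= sin t.
    have t0 : 0 <= t by lra.
    by move: th; rewrite ger0_norm // => th; nra.
  pose r := v / 2.
  have r0 : 0 <= r by rewrite /r; lra.
  have pr : (1 + r) ^+ N <= (2 * p) ^+ N.
    apply: lerXn2r; rewrite ?nnegrE; [lra|lra|].
    by rewrite -sE /r; lra.
  have b1 := le_trans (bernoulli N r0) pr.
  have Nr : N%:R * r = M ^+ 2 * y / 4 by rewrite NR /r vE; field; exact: lt0r_neq0.
  rewrite Nr in b1.
  have := @bernoulli_inv (p ^+ N) (2 ^ N); rewrite pN0 pN1 => /(_ isT).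
  rewrite two; set q := (1 - p ^+ N) ^+ _ in q0 q1 *; move=> bi.
  rewrite sub0r normrN ger0_norm // ler_pdivlMr //.
  apply: (@le_trans _ _ (4 * `|y|^-1)); last by rewrite /D; lra.
  rewrite yn -(ler_pM2r y0) mulfVK ?gt_eqF //.
  have : q * (M ^+ 2 * y / 4) <= 1.
    apply: le_trans bi; rewrite ler_wpM2l //; lra.
  have : q * (M * y) <= q * (M ^+ 2 * y).
    rewrite ler_wpM2l // ler_wpM2r ?(ltW y0) //; nra.
  lra.
Qed.

End step_function.

Section vanishing_functionals.
Context {R : realType}.
Local Notation RR := (measurableTypeR R).
Implicit Types (b m : E3 R -> R[i]).

Definition bmeas b := cmeas b /\ exists M : R, forall x, cmod (b x) <= M.

Lemma bmeasM b m : bmeas b -> bmeas m -> bmeas (fun x => b x * m x).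
Proof.
move=> [mb [M hM]] [mm [K hK]]; split; first exact: cmeasM.
by exists (M * K) => x; rewrite cmodM ler_pM ?cmod_ge0.
Qed.
Lemma bmeasD b m : bmeas b -> bmeas m -> bmeas (fun x => b x + m x).
Proof.
move=> [mb [M hM]] [mm [K hK]]; split; first exact: cmeasD.
by exists (M + K) => x; rewrite (le_trans (cmodD _ _)) // lerD.
Qed.
Lemma bmeas_cst (c : R[i]) : bmeas (fun=> c).
Proof. by split; [exact: cmeas_cst|exists (cmod c)]. Qed.
Lemma bmeas_expi (xi : E3 R) : bmeas (fun x => expi (dot x xi)).
Proof.
split; last by exists 1 => x; rewrite cmod_expi.
by apply: cdiff_meas; apply: csmooth_cdiff; exact: csmooth_expi.
Qed.

Variable L : (E3 R -> R[i]) -> R[i].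
Hypothesis L_linear : forall c b b', bmeas b -> bmeas b' ->
  L (fun x => c * b x + b' x) = c * L b + L b'.
Hypothesis L_continuous : forall (B : nat -> E3 R -> R[i]) b (M : R),
  (forall n, cmeas (B n)) -> cmeas b -> (forall n x, cmod (B n x) <= M) ->
  (forall x, cmod (B n x - b x) @[n --> \oo] --> (0 : R)) ->
  cmod (L (B n) - L b) @[n --> \oo] --> (0 : R).
Hypothesis L_expi : forall xi, L (fun x => expi (dot x xi)) = 0.

Let P b := bmeas b /\ forall xi, L (fun x => b x * expi (dot x xi)) = 0.
(** The multipliers of [P] form an algebra stable under bounded pointwise limits. It contains the
    characters, hence the step polynomials, hence the indicators of half-spaces, boxes and
    measurable sets, hence all bounded measurable functions. *)
Let Mult m := forall b, P b -> P (fun x => b x * m x).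

Let L0 : L (fun=> 0) = 0.
Proof.
have b0 := bmeas_cst 0; have := L_linear 1 b0 b0.
rewrite (_ : (fun=> 1 * 0 + 0) = fun=> 0); last by apply/funext => x; rewrite mulr0 addr0.
by rewrite mul1r => /eqP; rewrite -subr_eq0 opprD addrA subrr sub0r oppr_eq0 => /eqP.
Qed.

Let P_lin c b b' : P b -> P b' -> P (fun x => c * b x + b' x).
Proof.
move=> [hb Pb] [hb' Pb']; split.
  by apply: bmeasD => //; apply: bmeasM => //; exact: bmeas_cst.
move=> xi.
rewrite (_ : (fun _ => _) = (fun x => c * (b x * expi (dot x xi)) + b' x * expi (dot x xi))).
  rewrite L_linear ?Pb ?Pb' ?mulr0 ?addr0 //; apply: bmeasM => //; exact: bmeas_expi.
by apply/funext => x; ring.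
Qed.

Let P1 : P (fun=> 1).
Proof.
split; first exact: bmeas_cst.
by move=> xi; under eq_fun do rewrite mul1r; exact: L_expi.
Qed.

Let P_lim (B : nat -> E3 R -> R[i]) b (M : R) : (forall n, P (B n)) -> cmeas b ->
  (forall n x, cmod (B n x) <= M) ->
  (forall x, cmod (B n x - b x) @[n --> \oo] --> (0 : R)) -> P b.
Proof.
move=> PB mb BM Bb; split.
  by split => //; exists M => x; apply: cvg_cmod_le (Bb x) => n.
move=> xi.
have me : cmeas (fun x : E3 R => expi (dot x xi)) by case: (bmeas_expi xi).
have h : cmod (L (fun x => B n x * expi (dot x xi)) - L (fun x => b x * expi (dot x xi)))
    @[n --> \oo] --> (0 : R).
  apply: (@L_continuous (fun n x => B n x * expi (dot x xi)) _ M).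
  - by move=> n; apply: cmeasM => //; case: (PB n) => [[]].
  - exact: cmeasM.
  - by move=> n x; rewrite cmodM cmod_expi mulr1.
  - by move=> x; under eq_fun do rewrite -mulrBl cmodM cmod_expi mulr1; exact: Bb.
have E : (fun n => cmod (L (fun x => B n x * expi (dot x xi)) -
    L (fun x => b x * expi (dot x xi)))) = fun=> cmod (L (fun x => b x * expi (dot x xi))).
  by apply/funext => n; have [_ ->] := PB n; rewrite sub0r cmodN.
rewrite E in h; exact: cmod_eq0 (cvg_unique _ (cvg_cst _) h).
Qed.

Let Mult1 : Mult (fun=> 1).
Proof. by move=> b Pb; under eq_fun do rewrite mulr1. Qed.

Let MultM m m' : Mult m -> Mult m' -> Mult (fun x => m x * m' x).
Proof. by move=> Hm Hm' b Pb; under eq_fun do rewrite mulrA; apply: Hm'; exact: Hm. Qed.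

Let MultD c m m' : Mult m -> Mult m' -> Mult (fun x => c * m x + m' x).
Proof.
move=> Hm Hm' b Pb.
rewrite (_ : (fun _ => _) = fun x => c * (b x * m x) + b x * m' x).
  by apply: P_lin; [exact: Hm|exact: Hm'].
by apply/funext => x; ring.
Qed.

Let Mult_cst c : Mult (fun=> c).
Proof.
move=> b Pb; have := @P_lin (c - 1) b b Pb Pb.
by rewrite (_ : (fun x => (c - 1) * b x + b x) = fun x => b x * c) //; apply/funext => x; ring.
Qed.

Let Mult_expi eta : Mult (fun x => expi (dot x eta)).
Proof.
move=> b [hb Pb]; split; first by apply: bmeasM => //; exact: bmeas_expi.
move=> xi; rewrite (_ : (fun _ => _) = fun x => b x * expi (dot x (eta + xi))) //.
by apply/funext => x; rewrite dotDr expiD mulrA.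
Qed.

Let MultX m k : Mult m -> Mult (fun x => m x ^+ k).
Proof.
move=> Hm; elim: k => [|k IH]; first exact: Mult1.
by under eq_fun do rewrite exprS; exact: MultM.
Qed.

Let Mult_lim (B : nat -> E3 R -> R[i]) m (M : R) : (forall n, Mult (B n)) -> cmeas m ->
  (forall n x, cmod (B n x) <= M) ->
  (forall x, cmod (B n x - m x) @[n --> \oo] --> (0 : R)) -> Mult m.
Proof.
move=> HB mm BM Bm b Pb; have [[mb [K hK]] _] := Pb.
apply: (@P_lim (fun n x => b x * B n x) _ (K * M)).
- by move=> n; exact: HB.
- exact: cmeasM.
- by move=> n x; rewrite cmodM ler_pM ?cmod_ge0.
- move=> x; under eq_fun do rewrite -mulrBr cmodM.
  have h := cvgM (cvg_cst (cmod (b x))) (Bm x); rewrite mulr0 in h; exact: h.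
Qed.

Let Mult_sin (eta : E3 R) (c : R) : Mult (fun x => (sin (dot x eta + c))%:C).
Proof.
have sinE t : (sin t)%:C = (- 'i%C * (2^-1)%:C) * expi t + ('i%C * (2^-1)%:C) * expi (- t).
  by apply: complex_ext; rewrite !(ReD, ImD, ReM, ImM, ReN, ImN) /= ?cosN ?sinN; field.
rewrite (_ : (fun _ => _) = fun x => (- 'i%C * (2^-1)%:C * expi c) * expi (dot x eta) +
  ('i%C * (2^-1)%:C * expi (- c)) * expi (dot x (- eta))).
  apply: MultD; first exact: Mult_expi.
  by apply: MultM; [exact: Mult_cst|exact: Mult_expi].
by apply/funext => x; rewrite sinE opprD !expiD dotNr; ring.
Qed.

(** [step_poly] is a polynomial in the sine of an affine function of one coordinate. *)
Let Mult_step n j (a : R) : Mult (fun x => (step_poly n (coord3 x j - a))%:C).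
Proof.
pose eta : E3 R := n.+1%:R^-1 *: basis_vec R j.
pose c : R := - ((n.+1%:R * a + 1) / n.+1%:R ^+ 2).
have tE (x : E3 R) : (n.+1%:R * (coord3 x j - a) - 1) / n.+1%:R ^+ 2 = dot x eta + c.
  rewrite /eta dotZr dot_basis /c; field; by rewrite lt0r_neq0 // ltr0n.
have sM := Mult_sin eta c.
have MB m k : Mult m -> Mult (fun x => (1 - m x ^+ k)).
  move=> Hm; rewrite (_ : (fun _ => _) = fun x => (-1) * m x ^+ k + 1).
    by apply: MultD; [exact: MultX|exact: Mult_cst].
  by apply/funext => x; ring.
have Mp : Mult (fun x => ((1 + sin (dot x eta + c)) / 2)%:C).
  rewrite (_ : (fun _ => _) = fun x => (2^-1)%:C * (sin (dot x eta + c))%:C + (2^-1)%:C).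
    by apply: MultD => //; exact: Mult_cst.
  by apply/funext => x; rewrite -rmorphM -rmorphD /=; congr _%:C; field.
have := MultX (2 ^ (n.+1 ^ 3))%N (MB _ (n.+1 ^ 3)%N Mp).
rewrite (_ : (fun _ => _) = fun x => (step_poly n (coord3 x j - a))%:C) //.
by apply/funext => x; rewrite /step_poly tE rmorphXn rmorphB rmorph1 rmorphXn.
Qed.

Let ind (T : Type) (phi : E3 R -> T) (A : set T) : E3 R -> R[i] :=
  fun x => (\1_A (phi x) : R)%:C.

Let ind_meas d (T : measurableType d) (phi : E3 R -> T) (A : set T) :
  measurable_fun setT phi -> measurable A -> cmeas (ind phi A).
Proof.
move=> mphi mA; apply: cmeas_real.
exact: (measurableT_comp (measurable_indic mA) mphi).
Qed.

Let cmod_ind (T : Type) (phi : E3 R -> T) (A : set T) x : cmod (ind phi A x) <= 1.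
Proof. by rewrite /ind cmod_real indicE; case: (_ \in _); rewrite ?normr1 ?normr0. Qed.

Let MultC (T : Type) (phi : E3 R -> T) (A : set T) :
  Mult (ind phi A) -> Mult (ind phi (~` A)).
Proof.
move=> HA; rewrite (_ : ind phi (~` A) = fun x => (-1) * ind phi A x + 1).
  by apply: MultD => //; exact: Mult_cst.
apply/funext => x; rewrite /ind !indicE in_setC.
by case: (_ \in _) => /=; rewrite ?mulr0 ?add0r // rmorph1 mulr1 addNr.
Qed.

Let MultI (T : Type) (phi : E3 R -> T) (A B : set T) :
  Mult (ind phi A) -> Mult (ind phi B) -> Mult (ind phi (A `&` B)).
Proof.
move=> HA HB; rewrite (_ : ind phi (A `&` B) = fun x => ind phi A x * ind phi B x).
  exact: MultM.
by apply/funext => x; rewrite /ind !indicE in_setI -rmorphM -natrM mulnb.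
Qed.

Let MultU (T : Type) (phi : E3 R -> T) (A B : set T) :
  Mult (ind phi A) -> Mult (ind phi B) -> Mult (ind phi (A `|` B)).
Proof.
move=> HA HB; rewrite -[A `|` B]setCK setCU; apply: MultC; apply: MultI; exact: MultC.
Qed.

(** Complements are algebraic and countable unions are bounded limits, so the sets whose indicators
    are multipliers form a Dynkin system containing the generators. *)
Let Mult_generated d (T : measurableType d) (phi : E3 R -> T) (G : set (set T)) :
  measurable_fun setT phi -> @measurable _ T = <<s G >> -> setI_closed G ->
  (forall A, G A -> Mult (ind phi A)) ->
  forall A, measurable A -> Mult (ind phi A).
Proof.
move=> mphi GE GI HG A; rewrite GE; move: A.
have M0 : Mult (ind phi set0).
  rewrite (_ : ind phi set0 = fun=> 0); first exact: Mult_cst.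
  by apply/funext => x; rewrite /ind indic0.
apply: (dynkin_induction GE GI).
- by rewrite -setC0; exact: MultC.
- by move=> A /HG.
- by move=> S _; exact: MultC.
- move=> F mF _ HF.
  pose U n := \big[setU/set0]_(k < n) F k.
  have MU n : Mult (ind phi (U n)).
    rewrite /U; elim: n => [|n IH]; first by rewrite big_ord0.
    by rewrite big_ord_recr; exact: MultU.
  apply: (@Mult_lim (fun n => ind phi (U n)) _ 1) => //.
    by apply: ind_meas => //; exact: bigcup_measurable.
  move=> x; have [[k _ Fk]|nF] := pselect ((\bigcup_k F k) (phi x)).
    apply: cvg_near_cst; exists k.+1 => // n /= kn.
    rewrite /ind !indicE !mem_set ?subrr ?cmod0 //; first by exists k.
    by rewrite /U -bigcup_mkord; exists k.
  rewrite (_ : (fun _ => _) = fun=> 0); first exact: cvg_cst.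
  apply/funext => n; rewrite /ind !indicE !memNset ?subrr ?cmod0 //.
  by rewrite /U -bigcup_mkord => -[k _ Fk]; apply: nF; exists k.
Qed.

Let Mult_halfline j (a : R) : Mult (ind (fun x => coord3 x j : RR) `]-oo, a]).
Proof.
apply: (@Mult_lim (fun n x => (step_poly n (coord3 x j - a))%:C) _ 1).
- by move=> n; exact: Mult_step.
- by apply: ind_meas; [exact: measurable_coord3|exact: measurable_itv].
- move=> n x; rewrite cmod_real; have /andP[h0 h1] := step_range n (coord3 x j - a).
  by rewrite ger0_norm.
- move=> x; rewrite /ind indicE.
  rewrite (_ : (coord3 x j \in _) = (coord3 x j - a <= 0)); last first.
    by rewrite subr_le0 mem_setE in_itv.
  have h := @step_limit R (coord3 x j - a).
  under eq_fun do rewrite -rmorphB /= cmod_real.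
  have h2 := cvg_norm (cvgB h (cvg_cst ((coord3 x j - a <= 0)%R%:R : R))).
  rewrite subrr normr0 in h2; exact: h2.
Qed.

Let Mult_coord j (A : set RR) : measurable A -> Mult (ind (fun x => coord3 x j : RR) A).
Proof.
move: A.
refine (@Mult_generated _ RR (fun x => coord3 x j) (@RGenOInfty.G R) _ _ _ _).
- exact: measurable_coord3.
- exact: RGenOInfty.measurableE.
- move=> _ _ [x ->] [y ->]; exists (Num.max x y).
  apply/seteqP; split => z /=; rewrite !in_itv /= !andbT.
    by move=> [zx zy]; rewrite gt_max zx zy.
  by rewrite gt_max => /andP[].
- move=> _ [x ->]; rewrite -setCitvl; apply: MultC; exact: Mult_halfline.
Qed.

Let Mult_prod d1 (T1 : measurableType d1) d2 (T2 : measurableType d2)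
    (phi1 : E3 R -> T1) (phi2 : E3 R -> T2) :
  measurable_fun setT phi1 -> measurable_fun setT phi2 ->
  (forall A, measurable A -> Mult (ind phi1 A)) ->
  (forall A, measurable A -> Mult (ind phi2 A)) ->
  forall A, measurable A -> Mult (ind (fun x => (phi1 x, phi2 x)) A).
Proof.
move=> m1 m2 H1 H2.
apply: (@Mult_generated _ _ _ [set A `*` B | A in measurable & B in measurable]).
- by apply/measurable_fun_pairP; split.
- by rewrite measurable_prod_measurableType.
- move=> _ _ [A1 mA1 [A2 mA2 <-]] [B1 mB1 [B2 mB2 <-]].
  exists (A1 `&` B1); first exact: measurableI.
  by exists (A2 `&` B2); [exact: measurableI|rewrite setXI].
- move=> _ [A mA [B mB <-]].
  rewrite (_ : ind _ _ = fun x => ind phi1 A x * ind phi2 B x).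
    by apply: MultM; [exact: H1|exact: H2].
  by apply/funext => x; rewrite /ind !indicE in_setX /= -rmorphM -natrM mulnb.
Qed.

Let Mult_indic (A : set (E3 RR)) : measurable A -> Mult (fun x => (\1_A x : R)%:C).
Proof.
have m j := @measurable_coord3 R j.
have H := Mult_prod (m 0) (m 1) (@Mult_coord 0) (@Mult_coord 1).
have m01 : measurable_fun setT (fun x : E3 R => (coord3 x 0 : RR, coord3 x 1 : RR)).
  by apply/measurable_fun_pairP; split; exact: m.
have H' := Mult_prod m01 (m ord_max) H (@Mult_coord ord_max).
move=> /H'; rewrite (_ : ind _ A = fun x => (\1_A x : R)%:C) //.
by apply/funext => -[[x1 x2] x3].
Qed.

(** The sum counts the integers between 1 and y, so it is the integer part of y. *)
Let staircase K (y : R) : 0 <= y -> y <= K%:R ->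
  `|\sum_(k < K) (k.+1%:R <= y)%R%:R - y| <= 1.
Proof.
elim: K y => [|K IH] y y0 yK.
  by rewrite big_ord0 sub0r normrN ger0_norm // (le_trans yK).
rewrite big_ord_recl /=; have [y1|y1] := leP 1 y.
  rewrite (_ : \sum_(i < K) _ = \sum_(k < K) (k.+1%:R <= y - 1)%R%:R).
    have := IH (y - 1); rewrite subr_ge0 y1 lerBlDr natr1 yK => /(_ isT isT).
    by rewrite opprB addrA [_ + 1]addrC.
  by apply: eq_bigr => k _; rewrite /bump /= -[in LHS]natr1 lerBrDr.
rewrite big1 ?add0r ?sub0r ?normrN ?ger0_norm // ?(ltW y1) // => k _.
by rewrite leNgt (lt_le_trans y1) // ler1n.
Qed.

(** The superlevel sets of r at the heights k/(n + 1) add up to a staircase within 1/(n + 1) of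
    r. *)
Let Mult_unit (r : E3 R -> R) : measurable_fun setT r -> (forall x, 0 <= r x <= 1) ->
  Mult (fun x => (r x)%:C).
Proof.
move=> mr r01.
pose S n (x : E3 R) : R := \sum_(k < n.+1) (k.+1%:R <= n.+1%:R * r x)%R%:R.
have SP n x : `|S n x / n.+1%:R - r x| <= n.+1%:R^-1.
  have n0 : (0 : R) < n.+1%:R by [].
  have /andP[r0 r1] := r01 x.
  have := @staircase n.+1 (n.+1%:R * r x); rewrite mulr_ge0 // ler_piMr // => /(_ isT isT).
  rewrite -/(S n x) -(ler_pM2r (_ : 0 < n.+1%:R^-1)) ?invr_gt0 // mul1r.
  by rewrite -[X in _ * X]ger0_norm ?invr_ge0 // -normrM mulrBl mulrAC divff ?gt_eqF // mul1r.
have MultS (c : R) N : Mult (fun x => \sum_(k < N) (\1_[set x | k.+1%:R <= c * r x] x : R)%:C).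
  elim: N => [|N IH].
    by under eq_fun do rewrite big_ord0; exact: Mult_cst.
  rewrite (_ : (fun x => _) = fun x => 1 * (\sum_(i < N) (\1_[set x | i.+1%:R <= c * r x] x : R)%:C)
     + (\1_[set x | N.+1%:R <= c * r x] x : R)%:C); last by apply/funext => x; rewrite big_ord_recr mul1r.
  apply: MultD => //; apply: Mult_indic; rewrite -[X in measurable X]setTI.
  have -> : [set x | N.+1%:R <= c * r x] =
      (fun x => c * r x) @^-1` `[N.+1%:R, +oo[%classic.
    by apply/seteqP; split => x /=; rewrite in_itv /= andbT.
  apply: (measurable_funM (measurable_cst _) mr) => //; exact: measurable_itv.
have MS n : Mult (fun x => (S n x / n.+1%:R)%:C).
  have E : (fun x => (S n x / n.+1%:R)%:C) = fun x =>
    (n.+1%:R^-1)%:C * (\sum_(k < n.+1) (\1_[set x | k.+1%:R <= n.+1%:R * r x] x : R)%:C) + 0.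
    apply/funext => x; rewrite addr0 -rmorph_sum -rmorphM mulrC; congr (_ * _)%:C.
    by apply: eq_bigr => k _; rewrite indicE mem_setE.
  rewrite E; apply: MultD; last exact: Mult_cst.
  exact: MultS.
apply: (@Mult_lim (fun n x => (S n x / n.+1%:R)%:C) _ 2).
- exact: MS.
- exact: cmeas_real.
- move=> n x; rewrite cmod_real; have := SP n x; have /andP[r0 r1] := r01 x.
  have : (n.+1%:R^-1 : R) <= 1 by rewrite invf_le1 // ler1n.
  have [w ->] : exists w : R, S n x / n.+1%:R = w by eexists.
  move=> n1 /(le_trans)/(_ n1); rewrite !ler_norml => /andP[h1 h2].
  by apply/andP; split; lra.
- move=> x; under eq_fun do rewrite -rmorphB /= cmod_real.
  apply: (@squeeze_cvgr _ _ _ _ (fun=> 0) (fun n => n.+1%:R^-1)).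
  + by near=> n; rewrite normr_ge0 /=; exact: SP.
  + exact: cvg_cst.
  + exact: cvg_harmonic.
Unshelve. all: by end_near. Qed.

Let Mult_real (r : E3 R -> R) (M : R) : measurable_fun setT r -> (forall x, `|r x| <= M) ->
  Mult (fun x => (r x)%:C).
Proof.
move=> mr rM; have [K [K0 KM]] : exists K : R, 0 < K /\ M <= K.
  by exists (`|M| + 1); split; [rewrite ltr_pwDr|rewrite (le_trans (ler_norm M)) // lerDl].
pose q x := (r x + K) / (2 * K).
have K2 : 0 < 2 * K by rewrite mulr_gt0.
have mq : Mult (fun x => (q x)%:C).
  apply: Mult_unit.
    apply: measurable_funM; last exact: measurable_cst.
    by apply: measurable_funD => //; exact: measurable_cst.
  move=> x; have := le_trans (rM x) KM; rewrite ler_norml => /andP[h1 h2].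
  rewrite /q; apply/andP; split; first by apply: divr_ge0; lra.
  by rewrite ler_pdivrMr // mul1r; lra.
rewrite (_ : (fun _ => _) = fun x => (2 * K)%:C * (q x)%:C + (- K)%:C).
  by apply: MultD => //; exact: Mult_cst.
by apply/funext => x; rewrite -rmorphM -rmorphD /= /q; congr _%:C; field; rewrite gt_eqF.
Qed.

(* A bounded-pointwise continuous functional is determined by its values on
   the characters. *)
Lemma vanishing_functional b : bmeas b -> L b = 0.
Proof.
move=> [mb [M hM]].
have mRe := @Mult_real (fun x => complex.Re (b x)) M (proj1 mb) (fun x => le_trans (Re_le_cmod _) (hM x)).
have mIm := @Mult_real (fun x => complex.Im (b x)) M (proj2 mb) (fun x => le_trans (Im_le_cmod _) (hM x)).
have := @MultD 'i%C _ _ mIm mRe _ P1; rewrite (_ : (fun _ => _) = b).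
  case=> _ /(_ 0); rewrite (_ : (fun _ => _) = b) //.
  by apply/funext => x; rewrite dot0r expi0 mulr1.
apply/funext => x; rewrite mul1r; apply: complex_ext;
  by rewrite !(ReD, ImD, ReM, ImM) /=; ring.
Qed.

End vanishing_functionals.

(** * Injectivity of the Fourier transform *)

Section uniqueness.
Context {R : realType}.
Local Notation mu := (leb3 R).
Local Notation RR := (measurableTypeR R).
Implicit Types (f g A B F : E3 R -> R[i]) (x xi : E3 R) (j : 'I_3).

Lemma nonneg_integral_eq0 (h : E3 R -> R) : measurable_fun setT h -> (forall x, 0 <= h x) ->
  \int[mu]_x h x = 0 -> mu.-integrable setT (EFin \o h) -> {ae mu, forall x, h x = 0}.
Proof.
move=> mh h0 ih hint.
have mE : measurable_fun setT (EFin \o h) by exact/measurable_EFinP.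
have e : (\int[mu]_x `|(EFin \o h) x| = 0)%E.
  have -> : (\int[mu]_x `|(EFin \o h) x| = \int[mu]_x (h x)%:E)%E.
    by apply: eq_integral => x _ /=; rewrite ger0_norm.
  have := integrable_fin_num measurableT hint; rewrite fin_numElt /= => /andP[h1 h2].
  by rewrite -[LHS]fineK ?fin_numElt ?h1 ?h2 //; move: ih; rewrite /Rintegral /= => ->.
have := (ae_eq_integral_abs mu measurableT mE).1 e.
by apply: aeS => x /(_ I) [].
Qed.

Lemma box_measure_gt0 (x : E3 R) (e : R) : 0 < e ->
  ~ {ae mu, forall y, ~ (`|x - y| < e)}.
Proof.
move=> e0 hae.
pose I (t : R) : set RR := `]t - e, t + e[%classic.
have mI t : measurable (I t) by exact: measurable_itv.
have muI t : lebesgue_measure (I t) = (2 * e)%:E.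
  rewrite lebesgue_measure_itv /= lte_fin ifT; first by rewrite -EFinB; congr EFin; ring.
  by rewrite ltrD2l gtrN.
pose Bx : set (E3 RR) := (I x.1.1 `*` I x.1.2) `*` I x.2.
have mB : measurable Bx by apply: measurableX => //; exact: measurableX.
have B0 : mu Bx = 0%E.
  apply: measure_negligible => //; apply: negligibleS hae => y /= [[]].
  rewrite /I /= !in_itv /= => /andP[a1 a2] /andP[b1 b2] /andP[c1 c2]; apply.
  rewrite norm3E !gt_max /= !ltr_norml; apply/andP; split; first (apply/andP; split).
  - by apply/andP; split; lra.
  - by apply/andP; split; lra.
  - by apply/andP; split; lra.
have : mu Bx = ((2 * e) * (2 * e) * (2 * e))%:E.
  have -> : mu Bx = ((@lebesgue_measure R \x @lebesgue_measure R)%E (I x.1.1 `*` I x.1.2) *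
      lebesgue_measure (I x.2))%E by apply: product_measure1E => //; exact: measurableX.
  have -> : (@lebesgue_measure R \x @lebesgue_measure R)%E (I x.1.1 `*` I x.1.2) =
      (lebesgue_measure (I x.1.1) * lebesgue_measure (I x.1.2))%E by exact: product_measure1E.
  by rewrite !muI -!EFinM.
rewrite B0 => -[] /esym /eqP; rewrite !mulf_eq0 !orbb => /orP[]; first by rewrite pnatr_eq0.
by rewrite gt_eqF.
Qed.

Lemma continuous_ae_eq (f g : E3 R -> R) : continuous f -> continuous g ->
  {ae mu, forall x, f x = g x} -> f = g.
Proof.
move=> cf cg fg; apply/funext => x; apply: contrapT => /eqP nfg.
have d0 : 0 < `|f x - g x| by rewrite normr_gt0 subr_eq0.
have c : (f - g) y @[y --> x] --> (f - g) x by apply: cvgB; [exact: cf|exact: cg].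
have : \forall y \near x, `|(f - g) x - (f - g) y| < `|f x - g x|.
  by move/cvgrPdist_lt : c; exact.
rewrite -nbhs_nearE => /nbhs_ballP [e /= e0 he].
apply: (@box_measure_gt0 x e e0); apply: aeS fg => y fgy xy.
have yb : ball x e y by rewrite -ball_normE.
have := he y yb; rewrite /= !fctE fgy subrr subr0 ltxx //.
Qed.

Lemma cdiff_continuous f : cdiff f -> continuous (fun x => complex.Re (f x)) /\
  continuous (fun x => complex.Im (f x)).
Proof. by move=> [h1 h2]; split=> x; apply: differentiable_continuous. Qed.

Lemma cdiff_ae_eq f g : cdiff f -> cdiff g -> {ae mu, forall x, f x = g x} -> f = g.
Proof.
move=> /cdiff_continuous[f1 f2] /cdiff_continuous[g1 g2] fg; apply/funext => x.
have e1 : {ae mu, forall x, complex.Re (f x) = complex.Re (g x)} by apply: aeS fg => y ->.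
have e2 : {ae mu, forall x, complex.Im (f x) = complex.Im (g x)} by apply: aeS fg => y ->.
apply: complex_ext; first exact: (congr1 (@^~ x) (continuous_ae_eq f1 g1 e1)).
exact: (congr1 (@^~ x) (continuous_ae_eq f2 g2 e2)).
Qed.

(** The test function conj(f) / (1 + |f|^2) has modulus at most 1 and turns the integral into that
    of |f|^2 / (1 + |f|^2). *)
Lemma ae_eq0_of_tests f (g : E3 R -> R) :
  cintegrable f -> (forall b, cmeas b -> (forall x, cmod (b x) <= 1) ->
    cintegral (fun x => f x * b x) = 0) -> {ae mu, forall x, f x = 0}.
Proof.
move=> fi H; have mf := cintegrable_meas fi.
pose h x := (1 + cmod (f x) ^+ 2)^-1.
have mh : measurable_fun setT h.
  apply: (measurableT_comp (continuous_measurable_fun (@continuous_wt1 R))).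
  exact: measurable_cmod.
have h01 x : 0 < h x by rewrite invr_gt0 ltr_pwDl // sqr_ge0.
have hcm x : h x * (1 + cmod (f x) ^+ 2) = 1.
  by rewrite mulVf // gt_eqF // -invr_gt0 h01.
pose b x := (h x)%:C * (f x)^*%C.
have mb : cmeas b by apply: cmeasM; [exact: cmeas_real|exact: cmeas_conj].
have b1 x : cmod (b x) <= 1.
  rewrite cmodM cmod_real cmod_conj gtr0_norm //.
  have := hcm x; have := h01 x; have := cmod_ge0 (f x); set c := cmod _; set d := h x.
  have : 0 <= (1 - c) ^+ 2 by rewrite sqr_ge0.
  by nra.
have fb x : f x * b x = (h x * cmod (f x) ^+ 2)%:C.
  by rewrite rmorphM /b mulrCA mulC_conj.
have := H b mb b1; rewrite (eq_cintegral fb) cintegral_real => -[] h0.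
have mhc : measurable_fun setT (fun x => h x * cmod (f x) ^+ 2).
  by apply: measurable_funM => //; apply: measurable_funX; exact: measurable_cmod.
have : {ae mu, forall x, h x * cmod (f x) ^+ 2 = 0}.
  apply: nonneg_integral_eq0 => //.
    by move=> x; rewrite mulr_ge0 ?sqr_ge0 // ltW.
  apply: integrable_le (integrable_cmod fi) _ => // x.
  rewrite ger0_norm; last by apply: mulr_ge0; [exact: ltW|exact: sqr_ge0].
  have := hcm x; have := h01 x; have := cmod_ge0 (f x); set c := cmod _; set d := h x.
  move=> c0 d0 q; have h1 : 0 <= d * ((1 - c) ^+ 2 + c).
    by rewrite mulr_ge0 ?addr_ge0 ?sqr_ge0 // ltW.
  have h2 : d * ((1 - c) ^+ 2 + c) = d * (1 + c ^+ 2) - d * c by ring.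
  rewrite h2 q in h1; have : 0 <= c * (1 - d * c) by rewrite mulr_ge0.
  by rewrite (_ : c * _ = c - d * c ^+ 2); [rewrite subr_ge0|ring].
apply: aeS => x /eqP; rewrite mulf_eq0 gt_eqF //= sqrf_eq0 => /eqP; exact: cmod_eq0.
Qed.

(** Integration against f is linear and, by dominated convergence, continuous for bounded pointwise
    limits; vanishing on characters, it vanishes on every bounded function. *)
Lemma fourier_injective f : cintegrable f ->
  (forall xi, cintegral (fun x => f x * expi (dot x xi)) = 0) -> {ae mu, forall x, f x = 0}.
Proof.
move=> fi Hf; have mf := cintegrable_meas fi.
have fbi b : bmeas b -> cintegrable (fun x => f x * b x).
  move=> [mb [M bM]]; under eq_fun do rewrite mulrC; exact: cintegrable_boundM bM fi.
apply: (ae_eq0_of_tests (fun=> 0)) => // b mb b1.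
apply: (@vanishing_functional R (fun b => cintegral (fun x => f x * b x))) => //.
- move=> c b1' b2 h1 h2; rewrite -cintegralZ; last exact: fbi.
  rewrite -cintegralD; [|by apply: cintegrableZ; exact: fbi|exact: fbi].
  by apply: eq_cintegral => x; ring.
- move=> B b' M mB mb' BM Bb.
  apply: (@dominated_cintegral R (fun n x => f x * B n x) _ (fun x => M * cmod (f x))).
  + by move=> n; exact: cmeasM.
  + exact: cmeasM.
  + apply: aeW => x; under eq_fun do rewrite -mulrBr cmodM.
    have h := cvgM (cvg_cst (cmod (f x))) (Bb x); rewrite mulr0 in h; exact: h.
  + by apply: integrable_scale; exact: integrable_cmod.
  + by apply: aeW => x n; rewrite cmodM mulrC ler_wpM2r ?cmod_ge0.
- by split => //; exists 1.
Qed.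
End uniqueness.

(** * Gaussians and Fourier inversion *)

Section gaussian.
Context {R : realType}.
Local Notation mu := (leb3 R).
Implicit Types (f g A B F : E3 R -> R[i]) (x xi : E3 R) (j : 'I_3).

Lemma inv_fourierZ (c : R[i]) F x : cintegrable F ->
  inv_fourier_fun (fun xi => c * F xi) x = c * inv_fourier_fun F x.
Proof.
move=> iF; rewrite !inv_fourierE [RHS]mulrCA -(cintegralZ _ (cintegrable_expi x iF)).
by congr (_ * _); apply: eq_cintegral => xi; ring.
Qed.

Lemma inv_fourierD F f x : cintegrable F -> cintegrable f ->
  inv_fourier_fun (fun xi => F xi + f xi) x = inv_fourier_fun F x + inv_fourier_fun f x.
Proof.
move=> iF If; rewrite !inv_fourierE -mulrDr -cintegralD; try exact: cintegrable_expi.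
by congr (_ * _); apply: eq_cintegral => xi; ring.
Qed.

Lemma inv_fourierB F f x : cintegrable F -> cintegrable f ->
  inv_fourier_fun (fun xi => F xi - f xi) x = inv_fourier_fun F x - inv_fourier_fun f x.
Proof.
move=> iF If; rewrite !inv_fourierE -mulrBr -cintegralB; try exact: cintegrable_expi.
by congr (_ * _); apply: eq_cintegral => xi; ring.
Qed.

(** Either sign of a is allowed: negative values give the Gaussians, positive ones their
    reciprocals, by which Gaussian factors are divided out. *)
Definition expquad (a : R) (x : E3 R) : R := expR (a * dot x x / 2).

Lemma expquad_pd (a : R) : (forall x, differentiable (expquad a) x) /\
  forall j, pd j (expquad a) = fun x => a * coord3 x j * expquad a x.
Proof.
pose h (t : R) := expR (a * t ^+ 2 / 2).
pose dh (t : R) := a * t * h t.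
have dhh (t : R) : is_derive t 1 h (dh t).
  have dq : is_derive t (1 : R) (fun s : R => a * s ^+ 2 / 2) (a * t).
    have -> : (fun s : R => a * s ^+ 2 / 2) = (a / 2) \*: ((@id R : R -> R) ^+ 2).
      by apply/funext => s; rewrite /= !fctE /GRing.scale /= expr2; ring.
    have -> : a * t = (a / 2) *: ((2%:R * (@id R t) ^+ 1) *: 1).
      by rewrite /GRing.scale /=; field.
    by apply: is_deriveZ; exact: is_deriveX.
  have := @is_derive1_comp R expR (fun s : R => a * s ^+ 2 / 2) t _ _ (is_derive_expR _) dq.
  by rewrite (_ : dh t = expR (a * t ^+ 2 / 2) * (a * t)) // /dh mulrC.
have H k j := pd_comp_dot (basis_vec R k) j dhh.
have E : expquad a = fun x => h (dot x (basis_vec R 0)) * h (dot x (basis_vec R 1)) *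
    h (dot x (basis_vec R ord_max)).
  apply/funext => x; rewrite /expquad /h !dot_basis -!expRD; congr expR.
  rewrite /dot !big_ord_recl big_ord0 addr0 /= !expr2.
  rewrite (_ : lift ord0 (lift ord0 ord0) = ord_max); last exact: val_inj.
  rewrite (_ : lift ord0 ord0 = 1); last exact: val_inj.
  by field.
have D01 x : differentiable (fun y => h (dot y (basis_vec R 0)) * h (dot y (basis_vec R 1))) x.
  by apply: differentiableM; [exact: (H 0 0).1|exact: (H 1 0).1].
have D x : differentiable (expquad a) x.
  by rewrite E; apply: differentiableM; [exact: D01|exact: (H ord_max 0).1].
split => // j.
rewrite {1}E (pdM j D01 (H ord_max 0).1) (pdM j (H 0 0).1 (H 1 0).1).
rewrite (H 0 j).2 (H 1 j).2 (H ord_max j).2 E; apply/funext => x.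
rewrite /dh !dot_basis.
have -> : coord3 x j = coord3 (basis_vec R 0) j * coord3 x 0 + coord3 (basis_vec R 1) j * coord3 x 1
   + coord3 (basis_vec R ord_max) j * coord3 x ord_max.
  have : j = 0 \/ j = 1 \/ j = ord_max.
    by case: j => -[|[|[|//]]] jP; [left|right;left|right;right]; exact: val_inj.
  by rewrite /coord3 !(tnth_nth 0) /= => -[->|[->|->]] /=;
    rewrite ?mul1r ?mul0r ?addr0 ?add0r.
ring.
Qed.

Lemma gaussE e : gauss e = expquad (- e ^+ 2) :> (E3 R -> R).
Proof. by apply/funext => x; rewrite /gauss /expquad; congr expR; ring. Qed.

(** From exp(m y) >= (1 + y)^m with m = k + 1 and y = a |x|^2, together with 1 + r <= (2 + 1/a)(1 +
    a r^2). *)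
Lemma gauss_poly (e : R) k : 0 < e ->
  exists C : R, forall x, (1 + enorm x) ^+ k * cmod (gauss e x)%:C <= C.
Proof.
move=> e0; pose m := k.+1.
have [a aE] : exists a : R, a = e ^+ 2 / (2 * m%:R) by eexists.
have a0 : 0 < a by rewrite aE divr_gt0 ?exprn_gt0 // mulr_gt0.
have [i iE] : exists i, i = a^-1 by eexists.
have ai : a * i = 1 by rewrite iE divff // gt_eqF.
have i0 : 0 < i by rewrite iE invr_gt0.
exists ((2 + i) ^+ m) => x; rewrite cmod_real gtr0_norm ?gauss_gt0 //.
have r0 := enorm_ge0 x; set r := enorm x in r0 *.
have h1 : (1 + r) ^+ k <= (1 + r) ^+ m by rewrite ler_weXn2l // lerDl.
have h2 : (1 + r) ^+ m <= ((2 + i) * (1 + a * r ^+ 2)) ^+ m.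
  apply: lerXn2r; rewrite ?nnegrE; [lra|by rewrite mulr_ge0 ?addr_ge0 ?mulr_ge0 ?sqr_ge0 ?(ltW a0) ?(ltW i0)|].
  have q : (2 + i) * (1 + a * r ^+ 2) = 2 + i + 2 * (a * r ^+ 2) + (a * i) * r ^+ 2 by ring.
  rewrite ai in q; rewrite q.
  have : 0 <= (1 - r) ^+ 2 by rewrite sqr_ge0.
  have : 0 <= a * r ^+ 2 by rewrite mulr_ge0 ?sqr_ge0 ?(ltW a0).
  by nra.
have h3 : (1 + a * r ^+ 2) ^+ m <= expR (e ^+ 2 * dot x x / 2).
  have -> : e ^+ 2 * dot x x / 2 = m%:R * (a * r ^+ 2).
    by rewrite aE -enorm_sqr -/r; field; rewrite pnatr_eq0.
  rewrite expRM_natl lerXn2r ?nnegrE ?expR_ge0 ?expR_ge1Dx //.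
  by rewrite addr_ge0 // mulr_ge0 ?sqr_ge0 ?(ltW a0).
rewrite /gauss expRN ler_pdivrMr ?expR_gt0 //.
rewrite (le_trans h1) // (le_trans h2) // exprMn ler_wpM2l // exprn_ge0 // addr_ge0 // ltW //.
Qed.

Definition cgauss (e : R) (x : E3 R) : R[i] := (gauss e x)%:C.

Lemma cgauss_cdiff e : cdiff (cgauss e).
Proof.
split => x; last exact: differentiable_cst.
by rewrite /cgauss /= gaussE; exact: (expquad_pd _).1.
Qed.

Lemma cgauss_meas e : cmeas (cgauss e).
Proof. by apply: cdiff_meas; exact: cgauss_cdiff. Qed.

Lemma cgauss_mom e k : 0 < e -> mom k (cgauss e).
Proof.
move=> e0; have [C hC] := gauss_poly (k + 6) e0.
by apply: (@poly_mom _ _ _ C) => //; exact: cgauss_meas.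
Qed.

Lemma cgauss_int e : 0 < e -> cintegrable (cgauss e).
Proof. by move=> e0; exact: (mom_int (cgauss_mom 0 e0)). Qed.

Lemma cgauss_cpd e j : cpd j (cgauss e) = fun x => (- e ^+ 2)%:C * ((coord3 x j)%:C * cgauss e x).
Proof.
rewrite /cgauss cpd_real gaussE (expquad_pd _).2; apply/funext => x.
by rewrite -!rmorphM mulrA.
Qed.

Lemma cgauss_wdecay e : 0 < e -> wdecay (cgauss e).
Proof.
move=> e0; have [C hC] := gauss_poly (0 + 6) e0; exists C => x.
by have := @poly_wdecay R (cgauss e) 0 C hC x; rewrite expr0 mul1r.
Qed.

Lemma cgauss_cpd_wdecay e j : 0 < e -> wdecay (cpd j (cgauss e)).
Proof.
move=> e0; have [C hC] := gauss_poly (1 + 6) e0.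
exists (e ^+ 2 * C) => x; rewrite cgauss_cpd !cmodM !cmod_real normrN ger0_norm ?sqr_ge0 //.
rewrite -[leRHS]mulrA ler_wpM2l ?sqr_ge0 //.
apply: le_trans (@poly_wdecay R (cgauss e) 1 C hC x).
rewrite expr1 /cgauss cmod_real ler_wpM2r // (le_trans (coord3_le _ _)) // lerDr //.
Qed.

(** The transform F satisfies d_j F = -e^(-2) x_j F, so its product with exp(|x|^2 / (2 e^2)) has
    zero gradient and is constant. The constant is [c0] times the mass of the Gaussian. *)
Lemma inv_fourier_cgauss e : 0 < e ->
  inv_fourier_fun (cgauss e) = fun x => ((e^-1) ^+ 3 * gauss e^-1 x)%:C.
Proof.
move=> e0; have e2 : e ^+ 2 != 0 by rewrite gt_eqF // exprn_gt0.
pose F := inv_fourier_fun (cgauss e).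
have [dF _] := inv_fourier_diff 0 (cgauss_mom 2 e0).
have dFj j : cpd j F = fun x => (- (e^-1) ^+ 2)%:C * ((coord3 x j)%:C * F x).
  rewrite (inv_fourier_diff j (cgauss_mom 2 e0)).2.
  have mg : cdiff (cgauss e) by exact: cgauss_cdiff.
  have -> : (fun xi : E3 R => 'i%C * (coord3 xi j)%:C * cgauss e xi) =
     fun xi => (- 'i%C * ((e^-1) ^+ 2)%:C) * cpd j (cgauss e) xi.
    apply/funext => xi; rewrite cgauss_cpd.
    have : ((e^-1) ^+ 2)%:C * (- e ^+ 2)%:C = -1 :> R[i].
      by rewrite -rmorphM mulrN -exprMn mulVf ?gt_eqF // expr1n rmorphN rmorph1.
    move=> q; transitivity (- 'i%C * (((e^-1) ^+ 2)%:C * (- e ^+ 2)%:C) * ((coord3 xi j)%:C * cgauss e xi)).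
      by rewrite q; ring.
    by ring.
  apply/funext => x.
  have cI : cintegrable (cpd j (cgauss e)).
    apply: wdecay_int; last exact: cgauss_cpd_wdecay.
    rewrite cgauss_cpd; apply: cmeasM; first exact: cmeas_cst.
    by apply: cmeasM; [exact: cmeas_coord|exact: cgauss_meas].
  have -> : inv_fourier_fun (fun xi : E3 R => - 'i%C * ((e^-1) ^+ 2)%:C * cpd j (cgauss e) xi) x =
      (- 'i%C * ((e^-1) ^+ 2)%:C) * inv_fourier_fun (cpd j (cgauss e)) x.
    exact: inv_fourierZ.
  rewrite (inv_fourier_ibp x mg (cgauss_wdecay e0) (cgauss_cpd_wdecay j e0) (cintegrable_meas cI)).
  rewrite -/F rmorphN; have ii : 'i%C * 'i%C = -1 :> R[i] by rewrite -expr2 sqr_i.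
  rewrite [RHS](_ : _ = (-1) * ((e^-1 ^+ 2)%:C * (coord3 x j)%:C * F x)); last by ring.
  by rewrite -ii; ring.
pose E x : R[i] := (expquad ((e^-1) ^+ 2) x)%:C.
have dE : cdiff E by split => x; [exact: (expquad_pd _).1|exact: differentiable_cst].
have dG : cdiff (fun x => F x * E x) by exact: cdiffM.
have G0 j : cpd j (fun x => F x * E x) = fun=> 0.
  rewrite (cpdM j dF dE) dFj {2}/E cpd_real (expquad_pd _).2; apply/funext => x.
  rewrite -/F /E rmorphN; have -> : (e^-1 ^+ 2 * coord3 x j * expquad (e^-1 ^+ 2) x)%:C =
    (e^-1 ^+ 2)%:C * (coord3 x j)%:C * (expquad (e^-1 ^+ 2) x)%:C by rewrite -!rmorphM.
  by ring.
have Gc x : F x * E x = F 0 * E 0.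
  (* A zero gradient gives constancy along each axis, and three moves parallel to the axes join any
     point to the origin. *)
  have key (f : E3 R -> R) : (forall y, differentiable f y) -> (forall j y, pd j f y = 0) ->
      forall y, f y = f 0.
    move=> df f0 y.
    have st z j (t : R) : f (z + t *: basis_vec R j) = f z.
      by have [s _] := pd_mvt z j t df; rewrite f0 mulr0 => /eqP; rewrite subr_eq0 => /eqP.
    have -> : y = 0 + y.1.1 *: basis_vec R 0 + y.1.2 *: basis_vec R 1 + y.2 *: basis_vec R ord_max.
      case: y => [[y1 y2] y3]; congr (_, _, _);
        by rewrite /basis_vec /= /GRing.scale /= ?mulr1 ?mulr0 ?addr0 ?add0r.
    by rewrite !st.
  have pG j y : pd j (fun x => complex.Re (F x * E x)) y = 0 /\ pd j (fun x => complex.Im (F x * E x)) y = 0.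
    by have := congr1 (@^~ y) (G0 j); rewrite /cpd => -[-> ->].
  apply: complex_ext.
    by apply: (key (fun x => complex.Re (F x * E x)) dG.1) => j y; exact: (pG j y).1.
  by apply: (key (fun x => complex.Im (F x * E x)) dG.2) => j y; exact: (pG j y).2.
have E0 : E 0 = 1 by rewrite /E /expquad dot0l mulr0 mul0r expR0.
have F0 : F 0 = ((e^-1) ^+ 3)%:C.
  rewrite /F inv_fourierE.
  have -> : cintegral (fun xi : E3 R => expi (dot 0 xi) * cgauss e xi) = (\int[mu]_x gauss e x)%:C.
    by rewrite -cintegral_real; apply: eq_cintegral => xi; rewrite dot0l expi0 mul1r.
  rewrite /Rintegral integral_gauss //= -rmorphM; congr _%:C.
  by rewrite exprMn mulrA c0_sqrt mul1r.
apply/funext => x; transitivity (F 0 * E 0 * (gauss e^-1 x)%:C); last by rewrite E0 mulr1 F0 -rmorphM.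
have EG : E x * (gauss e^-1 x)%:C = 1.
  rewrite /E -rmorphM /expquad /gauss -expRD (_ : _ + _ = 0) ?expR0 ?rmorph1 //; ring.
by rewrite -(Gc x) -mulrA EG mulr1.
Qed.
End gaussian.

Opaque cintegrable.

Section fourier_inversion.
Context {R : realType}.
Local Notation mu := (leb3 R).
Local Notation RR := (measurableTypeR R).
Implicit Types (f g A B C F H : E3 R -> R[i]) (x xi a : E3 R) (j : 'I_3).

Lemma conjM (z w : R[i]) : (z * w)^*%C = z^*%C * w^*%C.
Proof. by apply: complex_ext; rewrite !(ReM, ImM, Re_conj, Im_conj); ring. Qed.

Lemma realCM (s t : R) : (s * t)%:C = s%:C * t%:C :> R[i].
Proof. exact: rmorphM. Qed.

Lemma conj_realC (t : R) : (t%:C)^*%C = t%:C.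
Proof. by apply: complex_ext => /=; rewrite ?oppr0. Qed.

Lemma measurable_addNN : measurable_fun setT (fun p : E3 RR * E3 RR => - p.1 - p.2).
Proof.
have m1 : measurable_fun setT (fun p : E3 RR * E3 RR => p.1) by exact: measurable_fst.
have m2 : measurable_fun setT (fun p : E3 RR * E3 RR => p.2) by exact: measurable_snd.
have aux (q : E3 RR -> RR) : measurable_fun setT q ->
    measurable_fun setT (fun p : E3 RR * E3 RR => - q p.1 - q p.2 : RR).
  move=> mq; apply: measurable_funB.
    by apply: (measurableT_comp (measurable_funN (@measurable_id _ R setT))); exact: measurableT_comp mq m1.
  exact: measurableT_comp mq m2.
have k1 : measurable_fun setT (fun x : E3 RR => x.1.1 : RR).
  by apply: (measurableT_comp measurable_fst); exact: measurable_fst.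
have k2 : measurable_fun setT (fun x : E3 RR => x.1.2 : RR).
  by apply: (measurableT_comp measurable_snd); exact: measurable_fst.
have k3 : measurable_fun setT (fun x : E3 RR => x.2 : RR) by exact: measurable_snd.
have h12 := measurable_fun_pair (aux _ k1) (aux _ k2).
exact: measurable_fun_pair h12 (aux _ k3).
Qed.

Lemma cmeas_prodM A (F : E3 R * E3 R -> R[i]) : cmeas A -> cmeas F ->
  cmeas (fun p : E3 R * E3 R => A p.1 * F p).
Proof.
move=> mA mF; apply: cmeasM => //.
exact: (cmeas_comp mA (@measurable_fst _ _ (E3 RR) (E3 RR))).
Qed.

Lemma cmeas_expi_prod : cmeas (fun p : E3 R * E3 R => expi (dot p.1 p.2)).
Proof. by apply: cmeas_expi; apply: measurable_dot; [exact: measurable_fst|exact: measurable_snd]. Qed.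

Lemma cmeas_snd B : cmeas B -> cmeas (fun p : E3 R * E3 R => B p.2).
Proof. by move=> mB; exact: (cmeas_comp mB (@measurable_snd _ _ (E3 RR) (E3 RR))). Qed.

Lemma N1Z (c : R[i]) F : cmeas F -> N1 (fun x => c * F x) = ((cmod c)%:E * N1 F)%E.
Proof.
move=> mF; rewrite /N1; under eq_integral do rewrite cmodM EFinM.
rewrite ge0_integralZl ?lee_fin ?cmod_ge0 //.
  by apply/measurable_EFinP; exact: measurable_cmod.
by move=> x _; rewrite lee_fin cmod_ge0.
Qed.

Lemma N1_prod A F (b : E3 R -> E3 R -> R[i]) : cintegrable A -> cintegrable F ->
  (forall x xi, cmod (b x xi) = 1) ->
  (\int[mu]_x N1 (fun xi => (A x * (b x xi * F xi))%R) < +oo)%E.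
Proof.
move=> iA iF hb.
have E x : N1 (fun xi => A x * (b x xi * F xi)) = ((cmod (A x))%:E * N1 F)%E.
  rewrite -N1Z; last exact: cintegrable_meas.
  by apply: eq_integral => xi _; rewrite !cmodM hb mul1r.
under eq_integral do rewrite E.
have [mA fA] := (cintegrableP _).1 iA; have [mF fF] := (cintegrableP _).1 iF.
rewrite ge0_integralZr ?N1_ge0 //.
- by rewrite -/(N1 A) lte_mul_pinfty ?N1_ge0 // ge0_fin_numE ?N1_ge0.
- by apply/measurable_EFinP; exact: measurable_cmod.
- by move=> x _; rewrite lee_fin cmod_ge0.
Qed.

(** The multiplication formula: Fubini for the symmetric kernel exp(i x . xi). *)
Lemma inv_fourier_mult A B : cintegrable A -> cintegrable B ->
  cintegral (fun x => A x * inv_fourier_fun B x) =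
  cintegral (fun xi => B xi * inv_fourier_fun A xi).
Proof.
move=> iA iB.
have mF : cmeas (fun p : E3 R * E3 R => A p.1 * (expi (dot p.1 p.2) * B p.2)).
  apply: cmeas_prodM; first exact: cintegrable_meas.
  apply: cmeasM; first exact: cmeas_expi_prod.
  by apply: cmeas_snd; exact: cintegrable_meas.
have [_ _ E] := cfubini3 mF (N1_prod iA iB (fun x xi => cmod_expi (dot x xi))).
have E1 (A' B' : E3 R -> R[i]) : cintegrable A' -> cintegrable B' ->
    (fun x => cintegral (fun xi => A' x * (expi (dot x xi) * B' xi))) =
    fun x => A' x * cintegral (fun xi => expi (dot x xi) * B' xi).
  by move=> _ iB'; apply/funext => x; rewrite (cintegralZ _ (cintegrable_expi x iB')).
have E2 : (fun y => cintegral (fun x => A x * (expi (dot x y) * B y))) =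
    fun y => B y * cintegral (fun x => expi (dot y x) * A x).
  apply/funext => y; rewrite -cintegralZ; last exact: cintegrable_expi.
  by apply: eq_cintegral => x; rewrite [dot y x]dotC; ring.
rewrite /= (E1 A B iA iB) E2 in E.
have P (A' B' : E3 R -> R[i]) :
    cintegrable (fun x => A' x * cintegral (fun xi => expi (dot x xi) * B' xi)) ->
    cintegral (fun x => A' x * inv_fourier_fun B' x) =
    c0%:C * cintegral (fun x => A' x * cintegral (fun xi => expi (dot x xi) * B' xi)).
  move=> iAB; rewrite -(cintegralZ _ iAB).
  by apply: eq_cintegral => x; rewrite inv_fourierE mulrCA.
have Q (A' B' : E3 R -> R[i]) : cintegrable A' -> cintegrable B' ->
    cintegrable (fun x => A' x * cintegral (fun xi => expi (dot x xi) * B' xi)).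
  move=> iA' iB'; rewrite -(E1 A' B' iA' iB').
  have mF' : cmeas (fun p : E3 R * E3 R => A' p.1 * (expi (dot p.1 p.2) * B' p.2)).
    apply: cmeas_prodM; first exact: cintegrable_meas.
    apply: cmeasM; first exact: cmeas_expi_prod.
    by apply: cmeas_snd; exact: cintegrable_meas.
  by have [] := cfubini3 mF' (N1_prod iA' iB' (fun x xi => cmod_expi (dot x xi))).
by rewrite (P A B (Q _ _ iA iB)) (P B A (Q _ _ iB iA)) E.
Qed.

(** Fubini yields a measurable inner integral for an integrand integrable in both variables; a
    Gaussian in x provides this and is then divided out. *)
Lemma cmeas_inv_fourier F : cintegrable F -> cmeas (inv_fourier_fun F).
Proof.
move=> iF; have iG : cintegrable (cgauss 1 : E3 R -> R[i]) by exact: cgauss_int.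
have mF : cmeas (fun p : E3 R * E3 R => cgauss 1 p.1 * (expi (dot p.1 p.2) * F p.2)).
  apply: cmeas_prodM; first exact: cintegrable_meas.
  apply: cmeasM; first exact: cmeas_expi_prod.
  by apply: cmeas_snd; exact: cintegrable_meas.
have [_ /cintegrable_meas mI _] :=
  cfubini3 mF (N1_prod iG iF (fun x xi => cmod_expi (dot x xi))).
have m2 : cmeas (fun x : E3 R => (expquad 1 x)%:C * c0%:C).
  apply: cmeasM; last exact: cmeas_cst.
  by apply: cmeas_real; apply: differentiable_measurable; exact: (expquad_pd 1).1.
apply: cmeas_ext (cmeasM m2 mI) _ => x /=.
rewrite cintegralZ; last exact: cintegrable_expi.
rewrite inv_fourierE mulrA; congr (_ * _); rewrite mulrAC /cgauss -rmorphM /expquad /gauss -expRD.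
by rewrite (_ : _ + _ = 0) ?expR0 ?mul1r //; ring.
Qed.

Lemma inv_fourier_bounded F : cintegrable F ->
  exists2 M : R, 0 <= M & forall x, cmod (inv_fourier_fun F x) <= M.
Proof.
move=> iF; exists (c0 * \int[mu]_xi cmod (F xi)); last by move=> x; exact: inv_fourier_bound.
by rewrite mulr_ge0 ?(ltW c0_gt0) // Rintegral_ge0 // => x _; exact: cmod_ge0.
Qed.

Lemma inv_fourier_modulate F a x :
  inv_fourier_fun (fun xi => expi (dot a xi) * F xi) x = inv_fourier_fun F (x + a).
Proof.
rewrite !inv_fourierE; congr (_ * _); apply: eq_cintegral => xi.
by rewrite mulrA -expiD dotDl.
Qed.

Lemma inv_fourier_shift F a x : cintegrable F ->
  inv_fourier_fun (fun xi => F (xi + a)) x = expi (- dot x a) * inv_fourier_fun F x.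
Proof.
move=> iF; rewrite !inv_fourierE mulrCA; congr (_ * _).
rewrite -cintegralZ; last exact: cintegrable_expi.
have mE : cmeas (fun xi => expi (- dot x a) * (expi (dot x xi) * F xi)).
  by apply: cintegrable_meas; apply: cintegrableZ; exact: cintegrable_expi.
rewrite -(cintegral_mpres (mpres_shift a) mE); apply: eq_cintegral => xi.
by rewrite mulrA -expiD dotDr; congr (expi _ * _); ring.
Qed.

Lemma inv_fourier_reflect F x : cintegrable F ->
  inv_fourier_fun (fun xi => F (- xi)) x = inv_fourier_fun F (- x).
Proof.
move=> iF; rewrite !inv_fourierE; congr (_ * _).
rewrite -(cintegral_mpres mpres_opp (cintegrable_meas (cintegrable_expi (- x) iF))).
by apply: eq_cintegral => xi; rewrite dotNl dotNr opprK.
Qed.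

Lemma inv_fourier_conj F x : cintegrable F ->
  (inv_fourier_fun F x)^*%C = inv_fourier_fun (fun xi => (F (- xi))^*%C) x.
Proof.
move=> iF; rewrite (inv_fourier_reflect x (cintegrable_conj iF)) !inv_fourierE.
rewrite conjM conj_realC -cintegral_conj; last exact: cintegrable_expi.
by congr (_ * _); apply: eq_cintegral => xi; rewrite conjM conj_expi dotNl.
Qed.

Lemma gauss1E x : inv_fourier_fun (cgauss 1) x = cgauss 1 x.
Proof. by rewrite inv_fourier_cgauss // invr1 expr1n mul1r. Qed.

Lemma inv_fourier_cgauss_modulate a x :
  inv_fourier_fun (fun xi => expi (dot a xi) * cgauss 1 xi) x = cgauss 1 (x + a).
Proof. by rewrite inv_fourier_modulate gauss1E. Qed.

Lemma inv_fourier_cgauss_shift a x :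
  inv_fourier_fun (fun xi => cgauss 1 (xi + a)) x = expi (- dot x a) * cgauss 1 x.
Proof. by rewrite inv_fourier_shift ?gauss1E //; exact: cgauss_int. Qed.

Lemma cgaussN e x : cgauss e (- x) = cgauss e x.
Proof. by rewrite /cgauss /gauss dotNl dotNr opprK. Qed.

Lemma fourier_fun_int f : cintegrable (inv_fourier_fun f) -> cintegrable (fourier_fun f).
Proof.
move=> /(cintegrable_mpres mpres_opp); rewrite (_ : (fun _ => _) = fourier_fun f) //.
by apply/funext => x; rewrite fourierE.
Qed.

(* Both sides have the same integrals against Gaussians modulated by characters. *)
Lemma inversion_ae f : cintegrable f -> cintegrable (inv_fourier_fun f) -> cmeas f ->
  {ae mu, forall x, inv_fourier_fun (fourier_fun f) x = f x}.
Proof.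
move=> fi Ifi mf; have Ffi := fourier_fun_int Ifi.
have gi : cintegrable (cgauss 1 : E3 R -> R[i]) by exact: cgauss_int.
have g1 x : cmod (cgauss 1 x : R[i]) <= 1.
  by rewrite cmod_real gtr0_norm ?gauss_gt0 // gauss_le1.
have [M M0 hM] := inv_fourier_bounded Ffi.
have mH := cmeas_inv_fourier Ffi.
set H := inv_fourier_fun (fourier_fun f) in hM mH *.
have iH : cintegrable (fun x => H x * cgauss 1 x) by exact: (cintegrable_boundM mH hM gi).
have ifg : cintegrable (fun x => f x * cgauss 1 x).
  by under eq_fun do rewrite mulrC; exact: (cintegrable_boundM (cgauss_meas 1) g1 fi).
have key a : cintegral (fun x => (H x * cgauss 1 x - f x * cgauss 1 x) * expi (dot x a)) = 0.
  have ie (G : E3 R -> R[i]) : cintegrable G -> cintegrable (fun x => G x * expi (dot x a)).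
    by move=> iG; under eq_fun do rewrite mulrC dotC; exact: cintegrable_expi.
  rewrite (@eq_cintegral _ _ (fun x => H x * cgauss 1 x * expi (dot x a) - f x * cgauss 1 x * expi (dot x a)));
    last by move=> x; rewrite mulrBl.
  rewrite cintegralB; [|exact: ie|exact: ie]; apply/eqP; rewrite subr_eq0; apply/eqP.
  pose Ag x : R[i] := expi (dot a x) * cgauss 1 x.
  have iA : cintegrable Ag by exact: cintegrable_expi.
  transitivity (cintegral (fun x => Ag x * H x)).
    by apply: eq_cintegral => x; rewrite /Ag dotC; ring.
  rewrite inv_fourier_mult //.
  have iS : cintegrable (fun x : E3 R => cgauss 1 (- x + a) : R[i]).
    have := cintegrable_mpres mpres_opp (cintegrable_mpres (mpres_shift a) gi); exact.
  transitivity (cintegral (fun x => cgauss 1 (- x + a) * inv_fourier_fun f x)).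
    have mS : cmeas (fun x => cgauss 1 (- x + a) * inv_fourier_fun f x).
      by apply: cmeasM; [exact: cintegrable_meas iS|exact: cintegrable_meas Ifi].
    rewrite -(cintegral_mpres mpres_opp mS); apply: eq_cintegral => x.
    by rewrite opprK fourierE /Ag inv_fourier_cgauss_modulate mulrC.
  rewrite inv_fourier_mult //; apply: eq_cintegral => x.
  rewrite (@inv_fourier_reflect (fun x => cgauss 1 (x + a))); last exact: (cintegrable_mpres (mpres_shift a) gi).
  by rewrite inv_fourier_cgauss_shift cgaussN dotNl opprK; ring.
have := fourier_injective (cintegrableB iH ifg) key.
apply: aeS => x /eqP; rewrite -mulrBl mulf_eq0 subr_eq0 => /orP[/eqP //|/eqP].
by move/(congr1 (@complex.Re R)) => /= /eqP; rewrite gt_eqF // gauss_gt0.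
Qed.

(** Both sides are differentiable, so their almost everywhere equality holds at every point. *)
Lemma inversion f : Cc f -> inv_fourier_fun (fourier_fun f) = f.
Proof.
move=> cf; have fi : cintegrable f by exact: (mom_int (Cc_mom 0 cf)).
have Is := inv_fourier_Cc_schwartz cf.
have mF k : mom k (fourier_fun f).
  have := cintegrable_mpres mpres_opp (schwartz_mom k Is).
  rewrite (_ : (fun _ => _) = fun xi => ((1 + enorm xi) ^+ k)%:C * fourier_fun f xi) //.
  by apply/funext => x; rewrite enormN fourierE.
apply: cdiff_ae_eq; first exact: (inv_fourier_diff 0 (mF 2)).1.
  by apply: csmooth_cdiff; exact: Cc_smooth.
apply: inversion_ae => //; last exact: cintegrable_meas.
exact: (mom_int (schwartz_mom 0 Is)).
Qed.

Lemma inversion' f : Cc f -> fourier_fun (inv_fourier_fun f) = f.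
Proof.
move=> cf; apply/funext => x; rewrite -[in RHS](inversion cf) fourierE.
have -> : fourier_fun f = fun xi => inv_fourier_fun f (- xi).
  by apply/funext => xi; rewrite fourierE.
rewrite inv_fourier_reflect //.
exact: (mom_int (schwartz_mom 0 (inv_fourier_Cc_schwartz cf))).
Qed.

End fourier_inversion.

(** * Trilinear forms in frequency *)

Section trilinear_form.
Context {R : realType}.
Local Notation mu := (leb3 R).
Implicit Types (f g A B C F H : E3 R -> R[i]) (x xi a : E3 R) (j : 'I_3).

(** The arguments z, x and -z - x sum to zero, which makes the form invariant under all permutations
    of A, B and C: [tri_swap] is Tonelli, [tri_rot] is the substitution of -z - x for x. *)
Definition tri A B C : \bar R :=
  (\int[mu]_z N1 (fun x => (A z * (B x * C (- z - x)))%R))%E.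

Lemma tri_meas A B C : cmeas A -> cmeas B -> cmeas C ->
  cmeas (fun p : E3 R * E3 R => A p.1 * (B p.2 * C (- p.1 - p.2))).
Proof.
move=> mA mB mC; apply: cmeas_prodM => //; apply: cmeasM; first exact: cmeas_snd.
exact: (cmeas_comp mC measurable_addNN).
Qed.

Lemma tri_swap A B C : cmeas A -> cmeas B -> cmeas C -> tri A B C = tri B A C.
Proof.
move=> mA mB mC; rewrite /tri /N1.
have mF := (@measurable_EFinP _ _ R setT _).2 (measurable_cmod (tri_meas mA mB mC)).
have F0 (p : E3 R * E3 R) : (0 <= (cmod (A p.1 * (B p.2 * C (- p.1 - p.2))))%:E)%E.
  by rewrite lee_fin cmod_ge0.
have E := tonelli3 mF F0; rewrite /= in E; rewrite E.
apply: eq_integral => y _; apply: eq_integral => x _.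
by congr (cmod _)%:E; rewrite mulrCA [- x - y]addrC.
Qed.

Lemma tri_rot A B C : cmeas A -> cmeas B -> cmeas C -> tri A B C = tri A C B.
Proof.
move=> mA mB mC; apply: eq_integral => z _.
have mI : cmeas (fun x => A z * (B x * C (- z - x))).
  apply: cmeasM; first exact: cmeas_cst.
  by apply: cmeasM => //; exact: (cmeas_mpres (mpres_sub (- z)) mC).
rewrite -(N1_mpres (mpres_sub (- z)) mI); apply: eq_integral => x _.
by congr (cmod (_ * _))%:E; rewrite mulrC; congr (_ * _); congr C; rewrite opprB addrCA subrr addr0.
Qed.

Lemma tri_measurable A B C : cmeas A -> cmeas B -> cmeas C ->
  measurable_fun setT (fun z => N1 (fun x => A z * (B x * C (- z - x)))).
Proof.
move=> m1 m2 m3; apply: (measurable_tonelli3 (f := fun p => (cmod (A p.1 * (B p.2 * C (- p.1 - p.2))))%:E)).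
  by apply/measurable_EFinP; apply: measurable_cmod; exact: tri_meas.
by move=> p; rewrite lee_fin cmod_ge0.
Qed.

(** Young's inequality with exponents 1, 2, 2: Cauchy-Schwarz in x for fixed z, since reflection and
    translation preserve the norm of C. *)
Lemma tri_le A B C : cintegrable A -> L2 B -> L2 C ->
  (tri A B C <= (\int[mu]_x cmod (A x) * Num.sqrt (nn2 B * nn2 C))%:E)%E.
Proof.
move=> iA l2B l2C; have [mA fA] := (cintegrableP _).1 iA.
have [[mB _] [mC _]] := (l2B, l2C).
have lC z : L2 (fun x => C (- z - x)) by exact: (L2_mpres (mpres_sub (- z)) l2C).
have nC z : nn2 (fun x => C (- z - x)) = nn2 C by exact: (nn2_mpres (mpres_sub (- z)) mC).
have E z : (N1 (fun x => (A z * (B x * C (- z - x)))%R) <=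
    (cmod (A z))%:E * (Num.sqrt (nn2 B * nn2 C))%:E)%E.
  have iBC := L2_mul l2B (lC z).
  rewrite N1Z; last exact: cintegrable_meas.
  rewrite lee_wpmul2l ?lee_fin ?cmod_ge0 // (N1_fin iBC) lee_fin -(nC z).
  apply: le_trans (cauchy_schwarz l2B (lC z)).
  by under eq_Rintegral do rewrite cmodM.
apply: (@le_trans _ _ (\int[mu]_z ((cmod (A z))%:E * (Num.sqrt (nn2 B * nn2 C))%:E))%E).
  apply: ge0_le_integral => //.
  - by move=> *; exact: N1_ge0.
  - exact: tri_measurable.
  - by apply: emeasurable_funM => //; apply/measurable_EFinP; exact: measurable_cmod.
rewrite ge0_integralZr ?lee_fin ?sqrtr_ge0 //.
- by rewrite -/(N1 A) (N1_fin iA) -EFinM.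
- by apply/measurable_EFinP; exact: measurable_cmod.
- by move=> x _; rewrite lee_fin cmod_ge0.
Qed.

End trilinear_form.

Transparent cintegrable.

Section null_sequences.
Context {R : realType}.
Implicit Types (u v : nat -> R).

Lemma cvg_continuous (f : R -> R) u (l : R) : {for l, continuous f} ->
  u n @[n --> \oo] --> l -> f (u n) @[n --> \oo] --> f l.
Proof. by move=> cf ul; exact: (@cvg_comp _ _ _ u f _ _ _ ul cf). Qed.

Lemma null_le u v : (forall n, 0 <= u n <= v n) -> v n @[n --> \oo] --> (0 : R) ->
  u n @[n --> \oo] --> (0 : R).
Proof. by move=> h v0; apply: (squeeze_cvgr _ (cvg_cst (0 : R)) v0); apply: nearW. Qed.

Lemma null_scale (a : R) u : u n @[n --> \oo] --> (0 : R) -> a * u n @[n --> \oo] --> (0 : R).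
Proof. by move=> h; have h2 := cvgM (cvg_cst a) h; rewrite mulr0 in h2; exact: h2. Qed.

Lemma null_add u v : u n @[n --> \oo] --> (0 : R) -> v n @[n --> \oo] --> (0 : R) ->
  u n + v n @[n --> \oo] --> (0 : R).
Proof. by move=> h k; have h2 := cvgD h k; rewrite addr0 in h2; exact: h2. Qed.

Lemma null_sqrt u : u n @[n --> \oo] --> (0 : R) -> Num.sqrt (u n) @[n --> \oo] --> (0 : R).
Proof.
by move=> h; have := cvg_continuous (@sqrt_continuous R 0) h; rewrite sqrtr0.
Qed.

Lemma null_const (c : R) u : 0 <= c -> (forall n, c <= u n) ->
  u n @[n --> \oo] --> (0 : R) -> c = 0.
Proof.
move=> c0 cu u0; have h : (fun=> c) n @[n --> \oo] --> (0 : R).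
  by apply: null_le u0 => n; rewrite c0 cu.
exact: (cvg_unique _ (cvg_cst _) h).
Qed.

End null_sequences.

(** * Plancherel and the Fourier transform on L2 *)

Section bessel.
Context {R : realType}.
Local Notation mu := (leb3 R).
Local Notation RR := (measurableTypeR R).
Implicit Types (f g A B C F H : E3 R -> R[i]) (x xi a : E3 R) (j : 'I_3).

Lemma fatou_bound (h : nat -> E3 R -> R) (g : E3 R -> R) (M : R) :
  (forall n, measurable_fun setT (h n)) -> (forall n x, 0 <= h n x) ->
  (forall x, h n x @[n --> \oo] --> g x) ->
  (forall n, (\int[mu]_x (h n x)%:E <= M%:E)%E) -> (\int[mu]_x (g x)%:E <= M%:E)%E.
Proof.
move=> mh h0 hg hM.
have E x : limn_einf (fun n => (h n x)%:E) = (g x)%:E.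
  apply: (fst (cvg_limn_einf_sup _)); apply: cvg_EFin; last exact: hg.
  by apply: nearW.
have F := @fatou _ _ R mu setT measurableT (fun n x => (h n x)%:E).
have : (\int[mu]_x limn_einf (fun n => (h n x)%:E) <=
    limn_einf (fun n => \int[mu]_x (h n x)%:E))%E.
  apply: F; first by move=> n; apply/measurable_EFinP; exact: mh.
  by move=> n x _; rewrite lee_fin.
under eq_integral do rewrite E.
move=> /le_trans; apply; rewrite limn_einf_lim.
apply: lime_le; first exact: is_cvg_einfs.
apply: nearW => n; apply: le_trans (hM n).
by apply: ereal_inf_lbound; exists n => /=.
Qed.

Lemma gauss_cvg x : gauss n.+1%:R^-1 x @[n --> \oo] --> (1 : R).
Proof.
have h : n.+1%:R^-1 @[n --> \oo] --> (0 : R) by exact: cvg_harmonic.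
pose f (t : R) := expR (- (t ^+ 2 * dot x x / 2)).
have cf : {for 0, continuous f}.
  move=> /=; apply: (@continuous_comp _ _ _ (fun t : R => - (t ^+ 2 * dot x x / 2)) expR).
    apply: continuousN; apply: continuousM; last exact: cvg_cst.
    by apply: continuousM; [exact: exprn_continuous|exact: cvg_cst].
  exact: continuous_expR.
have := cvg_continuous cf h; rewrite {2}/f expr0n /= !mul0r oppr0 expR0; exact.
Qed.

Let conjr H := fun xi => (H (- xi))^*%C.

Lemma conjr_int H : cintegrable H -> cintegrable (conjr H).
Proof. by move=> iH; apply: cintegrable_conj; exact: (cintegrable_mpres mpres_opp iH). Qed.

Lemma conjr_L2 H : L2 H -> L2 (conjr H).
Proof. by move=> iH; apply: L2_conj; exact: (L2_mpres mpres_opp iH). Qed.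

Lemma conjr_nn2 H : cmeas H -> nn2 (conjr H) = nn2 H.
Proof. by move=> mH; rewrite /conjr nn2_conj; exact: (nn2_mpres mpres_opp mH). Qed.

(** With the Gaussian weight, the integral of the squared transform becomes c0 times the trilinear
    integral of H, its reflected conjugate and the transform k of the Gaussian; [tri_le] then puts k
    in L1. *)
Lemma bessel_gauss H (e : R) : 0 < e -> cintegrable H -> L2 H ->
  (\int[mu]_x (gauss e x * cmod (inv_fourier_fun H x) ^+ 2)%:E <= (nn2 H)%:E)%E.
Proof.
move=> e0 iH lH; have mH := cintegrable_meas iH.
have iHc := conjr_int iH.
have [M M0 hM] := inv_fourier_bounded iH; have [K K0 hK] := inv_fourier_bounded iHc.
have ig : cintegrable (cgauss e : E3 R -> R[i]) by exact: cgauss_int.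
pose A x := cgauss e x * inv_fourier_fun (conjr H) x.
have iA : cintegrable A.
  by rewrite /A; under eq_fun do rewrite mulrC; exact: (cintegrable_boundM (cmeas_inv_fourier iHc) hK ig).
have AE x : A x * inv_fourier_fun H x = (gauss e x * cmod (inv_fourier_fun H x) ^+ 2)%:C.
  have cE : inv_fourier_fun (conjr H) x = (inv_fourier_fun H x)^*%C by rewrite inv_fourier_conj.
  by rewrite /A cE realCM -mulC_conj /cgauss -mulrA; congr (_ * _); rewrite mulrC.
have [N N0 hN] := inv_fourier_bounded iA.
have iHA : cintegrable (fun x => H x * inv_fourier_fun A x).
  by under eq_fun do rewrite mulrC; exact: (cintegrable_boundM (cmeas_inv_fourier iA) hN iH).
have iAH : cintegrable (fun x => A x * inv_fourier_fun H x).
  by under eq_fun do rewrite mulrC; exact: (cintegrable_boundM (cmeas_inv_fourier iH) hM iA).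
have [k kE] : exists k : E3 R -> R[i], forall x, k x = ((e^-1) ^+ 3 * gauss e^-1 x)%:C.
  by exists (fun x => ((e^-1) ^+ 3 * gauss e^-1 x)%:C).
have ei0 : 0 < e^-1 by rewrite invr_gt0.
have e3 : 0 <= e^-1 ^+ 3 by rewrite exprn_ge0 // ltW.
have ik : cintegrable k.
  rewrite (_ : k = fun x => (e^-1 ^+ 3)%:C * cgauss e^-1 x); first exact: cintegrableZ (cgauss_int ei0).
  by apply/funext => x; rewrite kE realCM.
have mk := cintegrable_meas ik.
have k1 x : cmod (k x) <= e^-1 ^+ 3.
  rewrite kE cmod_real ger0_norm; last by apply: mulr_ge0 => //; exact: (ltW (gauss_gt0 _ _)).
  by rewrite -[leRHS]mulr1 ler_wpM2l // gauss_le1.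
have IA z : H z * inv_fourier_fun A z =
    c0%:C * cintegral (fun x => H z * (conjr H x * k (- z - x))).
  have iin : cintegrable (fun x => conjr H x * k (- z - x)).
    under eq_fun do rewrite mulrC.
    by apply: (cintegrable_boundM (cmeas_mpres (mpres_sub (- z)) mk) _ iHc) => x; exact: k1.
  rewrite cintegralZ // [RHS]mulrCA; congr (_ * _).
  rewrite inv_fourierE; congr (_ * _).
  transitivity (cintegral (fun x => expi (dot z x) * cgauss e x * inv_fourier_fun (conjr H) x)).
    by apply: eq_cintegral => x; rewrite /A mulrA.
  rewrite (@inv_fourier_mult R (fun x => expi (dot z x) * cgauss e x)) //; last exact: cintegrable_expi.
  apply: eq_cintegral => x; rewrite inv_fourier_modulate inv_fourier_cgauss // kE.
  by rewrite /gauss -opprD dotNl dotNr opprK addrC.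
have -> : (\int[mu]_x (gauss e x * cmod (inv_fourier_fun H x) ^+ 2)%:E =
    (cmod (cintegral (fun x => A x * inv_fourier_fun H x)))%:E)%E.
  rewrite (eq_cintegral AE) cintegral_real cmod_real ger0_norm; last first.
    by apply: Rintegral_ge0 => x _; rewrite mulr_ge0 ?sqr_ge0 // ltW // gauss_gt0.
  have cA x : cmod (A x * inv_fourier_fun H x) = gauss e x * cmod (inv_fourier_fun H x) ^+ 2.
    rewrite AE cmod_real ger0_norm // mulr_ge0 ?sqr_ge0 //; exact: (ltW (gauss_gt0 _ _)).
  have := N1_fin iAH; rewrite /N1; under eq_integral do rewrite cA.
  by under eq_Rintegral do rewrite cA.
rewrite inv_fourier_mult //; apply: le_trans (cmod_cintegralE iHA) _.
have T : (tri H (conjr H) k <= (\int[mu]_x cmod (k x) * nn2 H)%:E)%E.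
  have mc := cintegrable_meas iHc.
  rewrite (tri_rot mH mc mk) (tri_swap mH mk mc).
  apply: le_trans (tri_le ik lH (conjr_L2 lH)) _.
  by rewrite conjr_nn2 // -expr2 sqrtr_sqr ger0_norm // nn2_ge0.
apply: (@le_trans _ _ (c0%:E * tri H (conjr H) k)%E).
  rewrite /tri -ge0_integralZl ?lee_fin ?(ltW c0_gt0) //; [|by apply: tri_measurable => //; exact: cintegrable_meas|by move=> *; exact: N1_ge0].
  apply: ge0_le_integral => //.
  - by move=> x _; rewrite lee_fin cmod_ge0.
  - by apply/measurable_EFinP; apply: measurable_cmod; exact: cintegrable_meas.
  - by apply: emeasurable_funM => //; apply: tri_measurable => //; exact: cintegrable_meas.
  - move=> z _; rewrite IA cmodM cmod_real gtr0_norm ?c0_gt0 // EFinM.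
    rewrite lee_wpmul2l ?lee_fin ?(ltW c0_gt0) //; apply: cmod_cintegralE.
    apply: cintegrableZ; under eq_fun do rewrite mulrC.
    by apply: (cintegrable_boundM (cmeas_mpres (mpres_sub (- z)) mk) _ iHc) => x; exact: k1.
apply: (@le_trans _ _ (c0%:E * (\int[mu]_x cmod (k x) * nn2 H)%:E)%E).
  by rewrite lee_wpmul2l ?lee_fin ?(ltW c0_gt0).
rewrite -EFinM lee_fin mulrA.
(* The mass of k is 1/c0 for every e, so the bound is uniform and survives the limit e -> 0. *)
have -> : c0 * \int[mu]_x cmod (k x) = 1; last by rewrite mul1r.
have -> : \int[mu]_x cmod (k x) = e^-1 ^+ 3 * (Num.sqrt (2 * pi) / e^-1) ^+ 3.
  have cg x : cmod (cgauss e^-1 x : R[i]) = gauss e^-1 x.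
    by rewrite /cgauss cmod_real gtr0_norm // gauss_gt0.
  have ck x : cmod (k x) = e^-1 ^+ 3 * cmod (cgauss e^-1 x : R[i]).
    rewrite kE realCM cmodM cmod_real ger0_norm //.
  under eq_Rintegral do rewrite ck.
  rewrite RintegralZl //; last exact: (integrable_cmod (cgauss_int ei0)).
  congr (_ * _); under eq_Rintegral do rewrite cg.
  by rewrite /Rintegral integral_gauss.
by rewrite -exprMn [_^-1 * _]mulrC divfK ?gt_eqF // c0_sqrt.
Qed.

Lemma L2E f (M : R) : cmeas f -> (\int[mu]_x (cmod (f x) ^+ 2)%:E <= M%:E)%E -> L2 f /\ nn2 f <= M.
Proof.
move=> mf hM.
have m2 : measurable_fun setT (fun x => cmod (f x) ^+ 2) by apply: measurable_funX; exact: measurable_cmod.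
have i2 : mu.-integrable setT (EFin \o (fun x => cmod (f x) ^+ 2)).
  apply/integrableP; split; first exact/measurable_EFinP.
  under eq_integral do rewrite /= ger0_norm ?sqr_ge0 //.
  by rewrite (le_lt_trans hM) // ltry.
split => //; rewrite /nn2 /Rintegral -lee_fin fineK //.
exact: integrable_fin_num.
Qed.

(** Fatou removes the Gaussian weight as its width grows. *)
Lemma bessel H : cintegrable H -> L2 H ->
  L2 (inv_fourier_fun H) /\ nn2 (inv_fourier_fun H) <= nn2 H.
Proof.
move=> iH lH; apply: L2E; first exact: cmeas_inv_fourier.
apply: (@fatou_bound (fun n x => gauss n.+1%:R^-1 x * cmod (inv_fourier_fun H x) ^+ 2)).
- move=> n; apply: measurable_funM; first exact: measurable_gauss.
  by apply: measurable_funX; apply: measurable_cmod; exact: cmeas_inv_fourier.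
- by move=> n x; rewrite mulr_ge0 ?sqr_ge0 // ltW // gauss_gt0.
- move=> x; have h := cvgM (gauss_cvg x) (cvg_cst (cmod (inv_fourier_fun H x) ^+ 2)).
  rewrite mul1r in h; exact: h.
- by move=> n; apply: bessel_gauss => //; rewrite invr_gt0.
Qed.

Lemma cmeas_le0 (h : E3 R -> R) : measurable_fun setT h ->
  cmeas (fun x => ((h x <= 0)%R%:R)%:C : R[i]).
Proof.
move=> mh; apply: cmeas_real.
rewrite (_ : (fun x => (h x <= 0)%R%:R) = (\1_(`]-oo, 0]%classic : set RR) : R -> R) \o h).
  by apply: measurableT_comp => //; apply: measurable_indic; exact: measurable_itv.
by apply/funext => x /=; rewrite indicE mem_setE in_itv.
Qed.

(** Crude, but it makes the difference of the two sides of Plancherel continuous in L2. *)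
Lemma plancherel_bound H1 H2 : cintegrable H1 -> L2 H1 -> cintegrable H2 -> L2 H2 ->
  cmod (cintegral (fun x => inv_fourier_fun H1 x * inv_fourier_fun H2 x) -
        cintegral (fun x => H1 x * H2 (- x))) <= 2 * Num.sqrt (nn2 H1 * nn2 H2).
Proof.
move=> i1 l1 i2 l2; have [f1 n1] := bessel i1 l1; have [f2 n2] := bessel i2 l2.
apply: le_trans (cmodB _ _) _; rewrite mulr_natl mulr2n; apply: lerD.
  apply: le_trans (cmod_cintegral_mul f1 f2) _; rewrite ler_wsqrtr // ler_pM ?nn2_ge0 //.
have lo := L2_mpres mpres_opp l2.
apply: le_trans (cmod_cintegral_mul l1 lo) _.
by rewrite (nn2_mpres mpres_opp (proj1 l2)).
Qed.

(** As a functional of H2 the difference of the two sides is linear and continuous in L2. It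
    vanishes on modulated Gaussians by the multiplication formula, hence by [vanishing_functional]
    on a Gaussian times any bounded function, and such products approximate H2 in L2. *)
Lemma plancherel H1 H2 : cintegrable H1 -> L2 H1 -> cintegrable H2 -> L2 H2 ->
  cintegral (fun x => inv_fourier_fun H1 x * inv_fourier_fun H2 x) =
  cintegral (fun x => H1 x * H2 (- x)).
Proof.
move=> i1 l1 i2 l2.
pose M H := cintegral (fun x => inv_fourier_fun H1 x * inv_fourier_fun H x) -
            cintegral (fun x => H1 x * H (- x)).
have M_lin c H H' : cintegrable H -> L2 H -> cintegrable H' -> L2 H' ->
    M (fun x => c * H x + H' x) = c * M H + M H'.
  move=> iH lH iH' lH'.
  have [k1 _] := bessel i1 l1; have [kH _] := bessel iH lH; have [kH' _] := bessel iH' lH'.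
  have oH := L2_mpres mpres_opp lH; have oH' := L2_mpres mpres_opp lH'.
  have E1 : cintegral (fun x => inv_fourier_fun H1 x * inv_fourier_fun (fun x => c * H x + H' x) x) =
    c * cintegral (fun x => inv_fourier_fun H1 x * inv_fourier_fun H x) +
    cintegral (fun x => inv_fourier_fun H1 x * inv_fourier_fun H' x).
    rewrite -(cintegralZ c (L2_mul k1 kH)) -(cintegralD (cintegrableZ c (L2_mul k1 kH)) (L2_mul k1 kH')).
    apply: eq_cintegral => x; rewrite (inv_fourierD x (cintegrableZ c iH) iH') (inv_fourierZ c x iH).
    ring.
  have E2 : cintegral (fun x => H1 x * (c * H (- x) + H' (- x))) =
    c * cintegral (fun x => H1 x * H (- x)) + cintegral (fun x => H1 x * H' (- x)).
    rewrite -(cintegralZ c (L2_mul l1 oH)) -(cintegralD (cintegrableZ c (L2_mul l1 oH)) (L2_mul l1 oH')).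
    by apply: eq_cintegral => x; ring.
  by rewrite /M E1 E2 mulrBr opprD addrACA.
have gi : cintegrable (cgauss 1 : E3 R -> R[i]) by exact: cgauss_int.
have g1 x : cmod (cgauss 1 x : R[i]) <= 1.
  by rewrite cmod_real gtr0_norm ?gauss_gt0 // gauss_le1.
have gl : L2 (cgauss 1 : E3 R -> R[i]).
  apply: (L2_dom (cgauss_meas 1) (integrable_cmod gi)) => x.
  by rewrite expr2 ler_piMr ?cmod_ge0.
have gb b : bmeas b -> cintegrable (fun x => cgauss 1 x * b x) /\ L2 (fun x => cgauss 1 x * b x).
  move=> [mb [K hK]]; split; under eq_fun do rewrite mulrC.
    exact: (cintegrable_boundM mb hK gi).
  exact: (L2_boundM mb hK gl).
have Mg b : bmeas b -> M (fun x => cgauss 1 x * b x) = 0.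
  move=> hb; apply: (@vanishing_functional R (fun b => M (fun x => cgauss 1 x * b x))) => //.
  - move=> c b1 b2 h1 h2; rewrite -M_lin; try (by have [] := gb _ h1); try by have [] := gb _ h2.
    by congr M; apply/funext => x; ring.
  - move=> B b' K mB mb' BK Bb.
    have hb' : bmeas b' by split => //; exists K => x; apply: cvg_cmod_le (Bb x) => n.
    have hB n : bmeas (B n) by split => //; exists K.
    have [ib lb] := gb _ hb'.
    have hd n : M (fun x => cgauss 1 x * B n x) - M (fun x => cgauss 1 x * b' x) =
        M (fun x => cgauss 1 x * B n x - cgauss 1 x * b' x).
      have [iB lB] := gb _ (hB n).
      have := M_lin (-1) _ _ ib lb iB lB; rewrite mulN1r addrC => <-; congr M.
      by apply/funext => x; ring.
    have nz : nn2 (fun x => cgauss 1 x * B n x - cgauss 1 x * b' x) @[n --> \oo] --> (0 : R).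
      refine (proj2 (@dominated_nn2 R (fun n x => cgauss 1 x * B n x) _ (fun x => K%:C * cgauss 1 x) _ _ _ _ _)).
      + by move=> n; apply: cmeasM => //; exact: cgauss_meas.
      + by apply: cmeasM => //; exact: cgauss_meas.
      + move=> x; under eq_fun do rewrite -mulrBr cmodM.
        have h := cvgM (cvg_cst (cmod (cgauss 1 x : R[i]))) (Bb x); rewrite mulr0 in h; exact: h.
      + exact: L2Z.
      + move=> n x; rewrite !cmodM mulrC ler_wpM2r ?cmod_ge0 // cmod_real.
        by rewrite (le_trans (BK n x)) // ler_norm.
    under eq_fun do rewrite hd.
    apply: null_le (null_scale 2 (null_sqrt (null_scale (nn2 H1) nz))) => n; rewrite cmod_ge0 /=.
    have [iB lB] := gb _ (hB n).
    by apply: plancherel_bound => //; [exact: cintegrableB|exact: L2B].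
  - move=> xi; rewrite /M.
    have -> : (fun x => cgauss 1 x * expi (dot x xi)) = fun x => expi (dot xi x) * cgauss 1 x.
      by apply/funext => x; rewrite mulrC dotC.
    apply/eqP; rewrite subr_eq0; apply/eqP.
    transitivity (cintegral (fun x => cgauss 1 (x + xi) * inv_fourier_fun H1 x)).
      by apply: eq_cintegral => x; rewrite inv_fourier_cgauss_modulate mulrC.
    have iS : cintegrable (fun x => cgauss 1 (x + xi) : R[i]) by exact: (cintegrable_mpres (mpres_shift xi) gi).
    rewrite (inv_fourier_mult iS i1); apply: eq_cintegral => x.
    by congr (_ * _); rewrite inv_fourier_cgauss_shift dotNl cgaussN mulrC.
apply/eqP; rewrite -subr_eq0 -/(M H2); apply/eqP; apply: cmod_eq0.
(* Truncation to the set where |H2| is at most n times the Gaussian; there the quotient of H2 by the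
   Gaussian is bounded by n. *)
pose h n x := cmod (H2 x) - n%:R * gauss 1 x.
have m2 := cintegrable_meas i2.
have mh n : measurable_fun setT (h n).
  apply: measurable_funB; first exact: measurable_cmod.
  by apply: measurable_funM => //; exact: measurable_gauss.
pose b n x := ((h n x <= 0)%R%:R)%:C * ((expquad 1 x)%:C * H2 x).
have Eg x : cgauss 1 x * (expquad 1 x)%:C = 1 :> R[i].
  rewrite /cgauss -rmorphM /gauss /expquad -expRD (_ : _ + _ = 0) ?expR0 //; ring.
have bE n x : cgauss 1 x * b n x = ((h n x <= 0)%R%:R)%:C * H2 x.
  by rewrite /b mulrCA [cgauss 1 x * _]mulrA Eg mul1r.
have hb n : bmeas (b n).
  split.
    apply: cmeasM; first exact: cmeas_le0.
    apply: cmeasM => //; apply: cmeas_real.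
    by apply: differentiable_measurable; exact: (expquad_pd 1).1.
  exists n%:R => x; rewrite /b !cmodM !cmod_real; case: (leP (h n x) 0) => hx /=; last by rewrite mulr0n normr0 mul0r.
  rewrite mulr1n normr1 mul1r; have e0 : 0 < expquad 1 x by exact: expR_gt0.
  move: hx; rewrite /h subr_le0 => hx; rewrite gtr0_norm //.
  rewrite mulrC -ler_pdivlMr //; apply: (le_trans hx); rewrite ler_wpM2l //.
  by rewrite /expquad /gauss -expRN expr1n.
have nz : nn2 (fun x => cgauss 1 x * b n x - H2 x) @[n --> \oo] --> (0 : R).
  refine (proj2 (@dominated_nn2 R (fun n x => cgauss 1 x * b n x) H2 H2 _ _ _ _ _)) => //.
  - by move=> n; have [/cintegrable_meas] := gb _ (hb n).
  - move=> x; apply: cvg_near_cst.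
    have [N NP] : exists N : nat, cmod (H2 x) <= N%:R * gauss 1 x.
      have q0 : 0 <= cmod (H2 x) / gauss 1 x.
        by apply: divr_ge0; [exact: cmod_ge0|exact: (ltW (gauss_gt0 _ _))].
      exists (Num.bound (cmod (H2 x) / gauss 1 x)).
      by have := ltW (archi_boundP q0); rewrite ler_pdivrMr // gauss_gt0.
    exists N => // n /= Nn; rewrite bE.
    have -> : h n x <= 0.
      rewrite /h subr_le0; apply: (le_trans NP); apply: ler_wpM2r; first exact: (ltW (gauss_gt0 _ _)).
      by rewrite ler_nat.
    by rewrite mul1r subrr cmod0.
  - move=> n x; rewrite bE cmodM cmod_real; case: (leP (h n x) 0) => _ /=; first by rewrite mulr1n normr1 mul1r.
    by rewrite mulr0n normr0 mul0r cmod_ge0.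
apply: (null_const (cmod_ge0 _) _ (null_scale 2 (null_sqrt (null_scale (nn2 H1) nz)))) => n.
  have [ib lb] := gb _ (hb n).
  have -> : cmod (M H2) = cmod (M (fun x => cgauss 1 x * b n x - H2 x)).
    have := M_lin (-1) _ _ i2 l2 ib lb; rewrite Mg // addr0 mulN1r => E.
    rewrite -cmodN -E; congr (cmod (M _)); apply/funext => x; ring.
  by apply: plancherel_bound => //; [exact: cintegrableB|exact: L2B].
Qed.

(** The multiplication formula takes the transform off A, and Plancherel turns the transform of the
    remaining product into a convolution of B and C. *)
Lemma inv_fourier_trilinear A B C : cintegrable A -> cintegrable B -> L2 B ->
  cintegrable C -> L2 C ->
  cintegral (fun x => inv_fourier_fun A x * (inv_fourier_fun B x * inv_fourier_fun C x)) =
  c0%:C * cintegral (fun z => cintegral (fun x => A z * (B x * C (- z - x)))).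
Proof.
move=> iA iB lB iC lC; have [kB _] := bessel iB lB; have [kC _] := bessel iC lC.
have iP := L2_mul kB kC.
transitivity (cintegral (fun x => (inv_fourier_fun B x * inv_fourier_fun C x) * inv_fourier_fun A x)).
  by apply: eq_cintegral => x; rewrite mulrC.
rewrite (inv_fourier_mult iP iA).
have [N N0 hN] := inv_fourier_bounded iP.
have E z : A z * inv_fourier_fun (fun x => inv_fourier_fun B x * inv_fourier_fun C x) z =
    c0%:C * cintegral (fun x => A z * (B x * C (- z - x))).
  rewrite (cintegralZ (A z) (L2_mul lB (L2_mpres (mpres_sub (- z)) lC))) [RHS]mulrCA; congr (_ * _).
  rewrite inv_fourierE; congr (_ * _).
  have iCz := cintegrable_mpres (mpres_shift (- z)) iC.
  have lCz := L2_mpres (mpres_shift (- z)) lC.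
  transitivity (cintegral (fun x => B x * C (- x + - z))).
    rewrite -(plancherel iB lB iCz lCz); apply: eq_cintegral => x.
    by rewrite inv_fourier_shift // dotNr opprK [dot z x]dotC; ring.
  by apply: eq_cintegral => x; rewrite addrC.
have iAI : cintegrable (fun z => A z * inv_fourier_fun (fun x => inv_fourier_fun B x * inv_fourier_fun C x) z).
  by under eq_fun do rewrite mulrC; exact: (cintegrable_boundM (cmeas_inv_fourier iP) hN iA).
have c0n : c0%:C != 0 :> R[i].
  by apply/eqP => /(congr1 (@complex.Re R)) /= /eqP; rewrite gt_eqF // c0_gt0.
rewrite -cintegralZ; first by apply: eq_cintegral => z; rewrite E.
rewrite (_ : (fun z => _) = fun z => (c0%:C)^-1 * (A z * inv_fourier_fun (fun x => inv_fourier_fun B x * inv_fourier_fun C x) z)).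
  exact: cintegrableZ.
by apply/funext => z; rewrite E mulKf.
Qed.

End bessel.

(** * Completeness and the transform of square integrable functions *)

Section completeness.
Context {R : realType}.
Local Notation mu := (leb3 R).
Local Notation RR := (measurableTypeR R).
Implicit Types (f g A B C F H : E3 R -> R[i]) (x xi a : E3 R) (j : 'I_3).

Lemma nn2BC f g : nn2 (fun x => f x - g x) = nn2 (fun x => g x - f x).
Proof. by apply: eq_Rintegral => x _; rewrite cmodBC. Qed.

Lemma ae_eq_nn2 f g : cmeas f -> cmeas g -> {ae mu, forall x, f x = g x} -> nn2 f = nn2 g.
Proof.
move=> mf mg fg; rewrite /nn2 /Rintegral; congr fine; apply: ae_eq_integral => //.
- by apply/measurable_EFinP; apply: measurable_funX; exact: measurable_cmod.
- by apply/measurable_EFinP; apply: measurable_funX; exact: measurable_cmod.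
- by apply: aeS fg => x -> _.
Qed.

Lemma ae_eq_L2 f g : cmeas g -> {ae mu, forall x, f x = g x} -> L2 f -> L2 g.
Proof.
move=> mg fg [mf /integrableP[_ hf]]; split => //; apply/integrableP; split.
  by apply/measurable_EFinP; apply: measurable_funX; exact: measurable_cmod.
apply: le_lt_trans hf; rewrite le_eqVlt; apply/orP; left; apply/eqP.
apply: ae_eq_integral => //.
- apply: measurableT_comp => //; apply/measurable_EFinP.
  by apply: measurable_funX; exact: measurable_cmod.
- apply: measurableT_comp => //; apply/measurable_EFinP.
  by apply: measurable_funX; exact: measurable_cmod.
- by apply: aeS fg => x /= fgx _; rewrite fgx.
Qed.

Lemma pair_cvg (F G : nat -> E3 R -> R[i]) f g : (forall n, L2 (F n)) -> (forall n, L2 (G n)) ->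
  L2 f -> L2 g -> nn2 (fun x => F n x - f x) @[n --> \oo] --> (0 : R) ->
  nn2 (fun x => G n x - g x) @[n --> \oo] --> (0 : R) ->
  cmod (cintegral (fun x => F n x * G n x) - cintegral (fun x => f x * g x))
    @[n --> \oo] --> (0 : R).
Proof.
move=> lF lG lf lg hF hG.
pose p n := nn2 (fun x => F n x - f x); pose q n := nn2 (fun x => G n x - g x).
have p0 n : 0 <= p n by exact: nn2_ge0.
have q0 n : 0 <= q n by exact: nn2_ge0.
apply: (@null_le _ _ (fun n => Num.sqrt (nn2 g * p n) + (Num.sqrt (nn2 f * q n) +
    (p n + q n)))); last first.
  apply: null_add; first by apply: null_sqrt; exact: null_scale.
  apply: null_add; first by apply: null_sqrt; exact: null_scale.
  exact: null_add.
move=> n; rewrite cmod_ge0 /=.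
have dF := L2B (lF n) lf; have dG := L2B (lG n) lg.
have -> : cintegral (fun x => F n x * G n x) - cintegral (fun x => f x * g x) =
   cintegral (fun x => (F n x - f x) * g x) + (cintegral (fun x => f x * (G n x - g x)) +
   cintegral (fun x => (F n x - f x) * (G n x - g x))).
  rewrite -(cintegralB (L2_mul (lF n) (lG n)) (L2_mul lf lg)).
  rewrite -(cintegralD (L2_mul lf dG) (L2_mul dF dG)).
  rewrite -(cintegralD (L2_mul dF lg) (cintegrableD (L2_mul lf dG) (L2_mul dF dG))).
  by apply: eq_cintegral => x; ring.
apply: le_trans (cmodD _ _) _; apply: lerD.
  by apply: le_trans (cmod_cintegral_mul dF lg) _; rewrite mulrC.
apply: le_trans (cmodD _ _) _; apply: lerD; first exact: cmod_cintegral_mul.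
apply: le_trans (cmod_cintegral_mul dF dG) _; rewrite -/(p n) -/(q n).
rewrite -[leRHS]ger0_norm ?addr_ge0 // -sqrtr_sqr ler_wsqrtr //.
have := p0 n; have := q0 n; set s := p n; set t := q n; nra.
Qed.

(** The lower envelopes u n - 2 c / 2^n increase, the upper ones decrease, and every lower one lies
    below every upper one. The limit is thus an explicit supremum, which can be written down at
    every point of space. *)
Lemma geometric_limit (u : nat -> R) (c : R) : 0 <= c ->
  (forall n, `|u n.+1 - u n| <= c / 2 ^+ n) ->
  forall n, `|u n - sup (range (fun n => u n - 2 * c / 2 ^+ n))| <= 2 * c / 2 ^+ n.
Proof.
move=> c0 h; pose lo n := u n - 2 * c / 2 ^+ n; pose up n := u n + 2 * c / 2 ^+ n.
have st n : lo n <= lo n.+1 /\ up n.+1 <= up n.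
  rewrite /lo /up exprS; have := h n; rewrite ler_norml.
  have [w wE] : exists w : R, w = (2 ^+ n)^-1 by eexists.
  have w0 : 0 < w by rewrite wE invr_gt0 exprn_gt0.
  by rewrite invfM -wE => /andP[h1 h2]; split; lra.
have lomono m n : (m <= n)%N -> lo m <= lo n.
  move=> /subnK <-; elim: (n - m)%N => [|k IH]; first by rewrite add0n.
  by rewrite addSn (le_trans IH) //; exact: (st _).1.
have upmono m n : (m <= n)%N -> up n <= up m.
  move=> /subnK <-; elim: (n - m)%N => [|k IH]; first by rewrite add0n.
  by rewrite addSn (le_trans _ IH) //; exact: (st _).2.
have loup m n : lo m <= up n.
  have q k : lo k <= up k.
    rewrite /lo /up; have : 0 <= 2 * c / 2 ^+ k by rewrite divr_ge0 ?mulr_ge0 // exprn_ge0.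
    by set z := _ / _; lra.
  have [mn|/ltnW mn] := leqP m n; first exact: le_trans (lomono _ _ mn) (q n).
  exact: le_trans (q m) (upmono _ _ mn).
have ub n : ubound (range lo) (up n) by move=> _ [m _ <-].
have hs : has_sup (range lo) by split; [exists (lo 0%N), 0%N|exists (up 0%N)].
move=> n; rewrite -/lo; set l := sup _.
have h1 : lo n <= l by apply: (sup_upper_bound hs); exists n.
have h2 : l <= up n by apply: (sup_le_ub hs.1); exact: ub.
by move: h1 h2; rewrite /lo /up ler_norml => *; apply/andP; split; lra.
Qed.

(** Put d_n = 4^n |F_(n+1) - F_n|^2. The rate 16^(-n) bounds the integral of d_n by 4^(-n), so the
    sum T of the d_n is integrable, and |F_(n+1) - F_n| <= T^(1/2) / 2^n wherever T is finite. *)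
Lemma riesz_fischer (F : nat -> E3 R -> R[i]) : (forall n, L2 (F n)) ->
  (forall n, nn2 (fun x => F n.+1 x - F n x) <= (16 ^+ n)^-1) ->
  exists f, L2 f /\ nn2 (fun x => F n x - f x) @[n --> \oo] --> (0 : R).
Proof.
move=> lF hF.
pose d n x : R := 4 ^+ n * cmod (F n.+1 x - F n x) ^+ 2.
have d0 n x : 0 <= d n x by rewrite mulr_ge0 ?sqr_ge0 ?exprn_ge0.
have lD n := L2B (lF n.+1) (lF n).
have md n : measurable_fun setT (EFin \o d n).
  apply/measurable_EFinP; apply: measurable_funM => //.
  by apply: measurable_funX; apply: measurable_cmod; exact: (lD n).1.
pose T x : \bar R := (\sum_(0 <= n <oo) (d n x)%:E)%E.
have mT : measurable_fun setT T.
  apply: (@ge0_emeasurable_sum _ _ _ _ (fun n x => (d n x)%:E) xpredT); last by move=> n _; exact: md.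
  by move=> n x _ _; rewrite lee_fin.
have T0 x : (0 <= T x)%E by apply: nneseries_ge0 => n _ _; rewrite lee_fin.
have iT : (\int[mu]_x T x <= 2%:E)%E.
  rewrite integral_nneseries //; last by move=> n x _; rewrite lee_fin.
  apply: lime_le.
    by apply: is_cvg_nneseries => n _ _; apply: integral_ge0 => x _; rewrite lee_fin.
  apply: nearW => n.
  apply: (@le_trans _ _ (\sum_(0 <= i < n) ((4 ^+ i)^-1)%:E)%E).
    apply: lee_sum => i _.
    have -> : (\int[mu]_x (d i x)%:E = (4 ^+ i * nn2 (fun x => F i.+1 x - F i x))%:E)%E.
      rewrite /nn2 -RintegralZl //; last exact: (lD i).2.
      by rewrite /Rintegral fineK //; apply: integrable_fin_num => //; apply: integrable_scale; exact: (lD i).2.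
    rewrite lee_fin; apply: le_trans (ler_wpM2l _ (hF i)) _; first by rewrite exprn_ge0.
    rewrite (_ : 16 = 4 * 4 :> R); last by ring.
    by rewrite exprMn invfM mulrA divff ?mul1r // expf_neq0.
  rewrite sumEFin lee_fin.
  have : \sum_(0 <= i < n) (4 ^+ i)^-1 <= 2 - 2 * (4 ^+ n)^-1 :> R.
    elim: n => [|n IH]; first by rewrite big_geq // expr0 invr1; lra.
    rewrite big_nat_recr //= exprS invfM; move: IH.
    have : 0 < (4 ^+ n)^-1 :> R by rewrite invr_gt0 exprn_gt0.
    have [z ->] : exists z : R, (4 ^+ n)^-1 = z by eexists.
    by set s := \sum_(_ <= _ < _) _; lra.
  have : 0 < (4 ^+ n)^-1 :> R by rewrite invr_gt0 exprn_gt0.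
  by move=> h1 h2; rewrite (le_trans h2) // lerBlDr lerDl mulr_ge0 // ltW.
have intT : mu.-integrable setT T.
  apply/integrableP; split => //; under eq_integral do rewrite gee0_abs //.
  by rewrite (le_lt_trans iT) // ltry.
pose S x := fine (T x).
have S0 x : 0 <= S x by exact: fine_ge0.
have mS : measurable_fun setT S by apply: measurableT_comp.
have aeT : {ae mu, forall x, T x \is a fin_num}.
  by have := integrable_ae measurableT intT; apply: aeS => x /(_ I).
(* On the null set where T is infinite all functions are replaced by 0, so that the pointwise bound
   holds everywhere. *)
pose E : set (E3 RR) := T @^-1` [set +oo%E].
have mE : measurable E by rewrite -[E]setTI; apply: mT => //; exact: emeasurable_set1.
have iS : mu.-integrable setT (EFin \o S).
  apply/integrableP; split; first exact/measurable_EFinP.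
  under eq_integral do rewrite /= ger0_norm //.
  rewrite (le_lt_trans _ (ltry 2)) //; apply: le_trans iT; apply: ge0_le_integral => //.
  - by move=> x _; rewrite lee_fin.
  - exact/measurable_EFinP.
  - by move=> x _; rewrite /S; case: (T x) (T0 x) => //= *; rewrite ?leey.
pose F' n x : R[i] := (1 - (\1_E x : R)%:C) * F n x.
have Fin x : ~ E x -> T x \is a fin_num.
  by move=> nE; rewrite ge0_fin_numE // ltey; apply/eqP => h; exact: nE.
have F'0 n x : E x -> F' n x = 0 by move=> Ex; rewrite /F' indicE mem_set // subrr mul0r.
have F'1 n x : ~ E x -> F' n x = F n x.
  by move=> Ex; rewrite /F' indicE memNset // subr0 mul1r.
have step n x : cmod (F' n.+1 x - F' n x) <= Num.sqrt (S x) / 2 ^+ n.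
  have [Ex|nE] := pselect (E x).
    by rewrite !F'0 // subrr cmod0 divr_ge0 ?sqrtr_ge0 // exprn_ge0.
  rewrite !F'1 // ler_pdivlMr ?exprn_gt0 //.
  rewrite -[leLHS]ger0_norm ?mulr_ge0 ?cmod_ge0 ?exprn_ge0 // -sqrtr_sqr ler_wsqrtr //.
  rewrite exprMn -exprM mulnC exprM (_ : 2 ^+ 2 = 4 :> R); last by ring.
  rewrite mulrC -/(d n x) -lee_fin /S fineK ?Fin // /T.
  apply: (@le_trans _ _ (\sum_(0 <= i < n.+1) (d i x)%:E)%E).
    by rewrite big_nat_recr //= leeDr // sume_ge0 // => i _; rewrite lee_fin.
  by apply: nneseries_lim_ge => k _ _; rewrite lee_fin.
pose lim (u : nat -> R) (c : R) := sup (range (fun n => u n - 2 * c / 2 ^+ n)).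
pose f x := lim (fun n => complex.Re (F' n x)) (Num.sqrt (S x)) +i*
            lim (fun n => complex.Im (F' n x)) (Num.sqrt (S x)).
have fF n x : cmod (F' n x - f x) <= 4 * Num.sqrt (S x) / 2 ^+ n.
  have s0 := sqrtr_ge0 (S x).
  have h1 := @geometric_limit (fun n => complex.Re (F' n x)) _ s0.
  have h2 := @geometric_limit (fun n => complex.Im (F' n x)) _ s0.
  apply: le_trans (cmod_le _) _; rewrite ReB ImB.
  have e1 m : `|complex.Re (F' m.+1 x) - complex.Re (F' m x)| <= Num.sqrt (S x) / 2 ^+ m.
    by rewrite -ReB (le_trans (Re_le_cmod _)).
  have e2 m : `|complex.Im (F' m.+1 x) - complex.Im (F' m x)| <= Num.sqrt (S x) / 2 ^+ m.
    by rewrite -ImB (le_trans (Im_le_cmod _)).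
  rewrite (_ : 4 * Num.sqrt (S x) / 2 ^+ n = 2 * Num.sqrt (S x) / 2 ^+ n + 2 * Num.sqrt (S x) / 2 ^+ n); last by ring.
  by apply: lerD; [exact: (h1 e1 n)|exact: (h2 e2 n)].
have mF' n : cmeas (F' n).
  apply: cmeasM; last exact: (lF n).1.
  apply: cmeasB; first exact: cmeas_cst.
  by apply: cmeas_real; exact: measurable_indic.
have half0 : (2 ^+ n)^-1 @[n --> \oo] --> (0 : R).
  by under eq_fun do rewrite -exprVn; apply: cvg_expr; rewrite ger0_norm // invf_lt1 // ltr1n.
have mf : cmeas f.
  apply: (@cmeas_limit _ _ _ F') => // x.
  by apply: null_le (null_scale (4 * Num.sqrt (S x)) half0) => n; rewrite cmod_ge0 /=.
have sq n x : cmod (F' n x - f x) ^+ 2 <= 16 / 4 ^+ n * S x.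
  have h := fF n x; have := cmod_ge0 (F' n x - f x) => h0.
  have : cmod (F' n x - f x) ^+ 2 <= (4 * Num.sqrt (S x) / 2 ^+ n) ^+ 2.
    by rewrite lerXn2r ?nnegrE // divr_ge0 ?mulr_ge0 ?sqrtr_ge0 // exprn_ge0.
  move=> /le_trans; apply; rewrite !exprMn sqr_sqrtr // exprVn -exprM mulnC exprM.
  have e4 : 2 ^+ 2 = 4 :> R by ring.
  have e16 : 4 ^+ 2 = 16 :> R by ring.
  by rewrite e4 e16 mulrAC.
have lDF n : L2 (fun x => F' n x - f x).
  apply: (L2_dom _ (integrable_scale (16 / 4 ^+ n) iS)) => //; exact: cmeasB.
have aeF n : {ae mu, forall x, F n x = F' n x}.
  apply: aeS aeT => x fT; rewrite F'1 // => Ex; by rewrite /E /= in Ex; rewrite Ex in fT.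
have lF' n : L2 (F' n) by exact: ae_eq_L2 (aeF n) (lF n).
have lf : L2 f.
  have := L2B (lF' 0%N) (lDF 0%N); congr L2; apply/funext => x; ring.
exists f; split => //.
apply: (@null_le _ _ (fun n => (16 * \int[mu]_x S x) * (2 ^+ n)^-1)); last exact: null_scale.
move=> n; rewrite nn2_ge0 /=.
have -> : nn2 (fun x => F n x - f x) = nn2 (fun x => F' n x - f x).
  apply: ae_eq_nn2; [by apply: cmeasB => //; exact: (lF n).1|exact: cmeasB|].
  by apply: aeS (aeF n) => x ->.
have S00 : 0 <= \int[mu]_x S x by apply: Rintegral_ge0.
apply: (@le_trans _ _ (16 / 4 ^+ n * \int[mu]_x S x)).
  rewrite -RintegralZl // /nn2; apply: le_Rintegral => //; first exact: (lDF n).2.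
  exact: integrable_scale.
rewrite mulrAC ler_wpM2l ?mulr_ge0 // lef_pV2 ?posrE ?exprn_gt0 // lerXn2r ?nnegrE //.
by rewrite ler_nat.
Qed.

End completeness.

Section square_integrable_transform.
Context {R : realType}.
Implicit Types (f g A B C F G H : E3 R -> R[i]) (x xi a : E3 R) (j : 'I_3).

Lemma le_null (c a : R) (u : nat -> R) : (forall n, c <= a + u n) ->
  u n @[n --> \oo] --> (0 : R) -> c <= a.
Proof.
move=> h u0; rewrite leNgt; apply/negP => ac.
have : c - a = 0; last by move/eqP; rewrite subr_eq0 gt_eqF.
apply: (null_const _ _ u0) => [|n]; first by rewrite subr_ge0 ltW.
by rewrite lerBlDl.
Qed.

Lemma null_ext (u v : nat -> R) : u =1 v -> u n @[n --> \oo] --> (0 : R) ->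
  v n @[n --> \oo] --> (0 : R).
Proof. by move=> /funext ->. Qed.

Lemma null_sum3 (f : 'I_3 -> nat -> R) : (forall i, f i n @[n --> \oo] --> (0 : R)) ->
  \sum_(i < 3) f i n @[n --> \oo] --> (0 : R).
Proof.
move=> h; have := null_add (h ord0) (null_add (h (lift ord0 ord0)) (h (lift ord0 (lift ord0 ord0)))).
by apply: null_ext => n; rewrite !big_ord_recl big_ord0 addr0.
Qed.

Lemma null_unique (z w : R[i]) (u : nat -> R[i]) :
  cmod (u n - z) @[n --> \oo] --> (0 : R) -> cmod (u n - w) @[n --> \oo] --> (0 : R) -> z = w.
Proof.
move=> hz hw; apply/eqP; rewrite -subr_eq0; apply/eqP; apply: cmod_eq0.
apply: (null_const (cmod_ge0 _) _ (null_add hz hw)) => n.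
by rewrite [cmod (u n - z)]cmodBC (le_trans _ (cmodD _ _)) // addrA subrK.
Qed.

Definition ball3 (n : nat) (xi : E3 R) : R[i] := ((enorm xi - n%:R <= 0)%R%:R)%:C.
(** The truncation of a square integrable function is also integrable, so its transform is an honest
    integral. *)
Definition cut (n : nat) H : E3 R -> R[i] := fun xi => ball3 n xi * H xi.

Lemma ball3_meas n : cmeas (ball3 n).
Proof.
by apply: cmeas_le0; apply: measurable_funB; [exact: measurable_enorm|exact: measurable_cst].
Qed.

Lemma ball3_in n xi : enorm xi <= n%:R -> ball3 n xi = 1.
Proof. by rewrite /ball3 -subr_le0 => ->. Qed.

Lemma ball3_out n xi : n%:R < enorm xi -> ball3 n xi = 0.
Proof. by move=> h; rewrite /ball3 subr_le0 leNgt h. Qed.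

Lemma ball3_le1 n xi : cmod (ball3 n xi) <= 1.
Proof. by rewrite /ball3 cmod_real; case: (_ <= 0); rewrite /= ?normr1 ?normr0. Qed.

Lemma cut_le n H xi : cmod (cut n H xi) <= cmod (H xi).
Proof. by rewrite cmodM ler_piMl ?cmod_ge0 // ball3_le1. Qed.

Lemma cut_meas n H : cmeas H -> cmeas (cut n H).
Proof. by move=> mH; apply: cmeasM => //; exact: ball3_meas. Qed.

Lemma ball3_cvg H xi : cmod (cut n H xi - H xi) @[n --> \oo] --> (0 : R).
Proof.
apply: cvg_near_cst; exists (Num.bound (enorm xi)) => // n /= hn.
rewrite /cut ball3_in ?mul1r ?subrr ?cmod0 //.
by apply: (le_trans (ltW (archi_boundP (enorm_ge0 _)))); rewrite ler_nat.
Qed.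

Lemma cut_L2 n H : L2 H -> L2 (cut n H).
Proof. by move=> lH; apply: (@L2_boundM _ (ball3 n) 1) => //; [exact: ball3_meas|exact: ball3_le1]. Qed.

Lemma ball3_L2 n : L2 (ball3 n).
Proof.
split; first exact: ball3_meas.
apply: (@integrable_support _ _ 1 n%:R).
- by apply: measurable_funX; apply: measurable_cmod; exact: ball3_meas.
- by move=> x; rewrite ger0_norm ?sqr_ge0 // expr_le1 ?cmod_ge0 // ball3_le1.
- by move=> x nx; rewrite ball3_out // cmod0 expr0n.
Qed.

Lemma cut_int n H : L2 H -> cintegrable (cut n H).
Proof. by move=> lH; apply: L2_mul => //; exact: ball3_L2. Qed.

Lemma cut_cvg H : L2 H -> nn2 (fun xi => cut n H xi - H xi) @[n --> \oo] --> (0 : R).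
Proof.
move=> lH; refine (proj2 (@dominated_nn2 R (fun n => cut n H) H H _ _ _ _ _)) => //.
- by move=> n; apply: cut_meas; exact: lH.1.
- exact: lH.1.
- by move=> x; exact: ball3_cvg.
- by move=> n x; exact: cut_le.
Qed.

(* [f] is the inverse Fourier transform of the square integrable function [H]. *)
Definition FT2 H f := [/\ L2 H, L2 f &
  nn2 (fun x => inv_fourier_fun (cut n H) x - f x) @[n --> \oo] --> (0 : R)].

Lemma bessel_sub H G : cintegrable H -> L2 H -> cintegrable G -> L2 G ->
  nn2 (fun x => inv_fourier_fun H x - inv_fourier_fun G x) <= nn2 (fun x => H x - G x).
Proof.
move=> iH lH iG lG; have := (bessel (cintegrableB iH iG) (L2B lH lG)).2.
by congr (_ <= _); apply: eq_Rintegral => x _; rewrite inv_fourierB.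
Qed.

Lemma nn2_mid f g h : L2 f -> L2 g -> L2 h ->
  nn2 (fun x => f x - g x) <= 2 * nn2 (fun x => f x - h x) + 2 * nn2 (fun x => h x - g x).
Proof.
move=> lf lg lh; have := nn2D (L2B lf lh) (L2B lh lg).
by congr (_ <= _); apply: eq_Rintegral => x _; rewrite addrA subrK.
Qed.

(** Truncated transforms are Cauchy by Bessel. A subsequence fast enough for [riesz_fischer]
    provides the limit f, and letting its index tend to infinity bounds the squared distance of
    every truncated transform to f by 4 q n. *)
Lemma FT2_exists H : L2 H -> exists f, FT2 H f.
Proof.
move=> lH; pose q n := nn2 (fun xi => cut n H xi - H xi).
have q0 : q n @[n --> \oo] --> (0 : R) by exact: cut_cvg.
(* Two truncations within e k of H in squared norm differ by at most 4 e k, which is the rate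
   16^(-k) asked for. *)
pose e k : R := (16 ^+ k)^-1 / 4.
have e0 k : 0 < e k by rewrite divr_gt0 // invr_gt0 exprn_gt0.
have ch k : exists n, q n <= e k.
  move/cvgrPdist_lt : q0 => /(_ (e k) (e0 k)) [n _ hn]; exists n.
  by have := hn n (leqnn n); rewrite /= sub0r normrN ger0_norm ?nn2_ge0 // => /ltW.
have [N NP] := choice ch.
pose F k := inv_fourier_fun (cut (N k) H).
have bF n := bessel (cut_int n lH) (cut_L2 n lH).
have lF k : L2 (F k) by exact: (bF _).1.
have qd m n : nn2 (fun x => inv_fourier_fun (cut m H) x - inv_fourier_fun (cut n H) x) <=
    2 * q m + 2 * q n.
  apply: le_trans (bessel_sub (cut_int m lH) (cut_L2 m lH) (cut_int n lH) (cut_L2 n lH)) _.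
  apply: le_trans (nn2_mid (cut_L2 m lH) (cut_L2 n lH) lH) _.
  by rewrite lerD2l ler_wpM2l // nn2BC.
have FS k : nn2 (fun x => F k.+1 x - F k x) <= (16 ^+ k)^-1.
  apply: le_trans (qd _ _) _; have h1 := NP k; have h2 := NP k.+1.
  have h3 : e k.+1 <= e k.
    rewrite /e exprS invfM; have : 0 < (16 ^+ k)^-1 :> R by rewrite invr_gt0 exprn_gt0.
    have [z ->] : exists z : R, (16 ^+ k)^-1 = z by eexists.
    by move=> z0; rewrite ler_wpM2r // ler_piMl ?ltW // invf_lt1 // ltr1n.
  have h4 : 4 * e k = (16 ^+ k)^-1 by rewrite /e mulrC divfK.
  by rewrite -h4; lra.
have [f [lf hf]] := riesz_fischer lF FS.
exists f; split; [exact: lH|exact: lf|].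
have h n : nn2 (fun x => inv_fourier_fun (cut n H) x - f x) <= 4 * q n.
  apply: (@le_null _ _ (fun k => 4 * e k + 2 * nn2 (fun x => F k x - f x))).
    move=> k; apply: le_trans (nn2_mid (bF n).1 lf (lF k)) _.
    have := qd n (N k); have := NP k; rewrite -/(F k).
    by set z := nn2 _; set w := nn2 _ ; lra.
  apply: null_add; last exact: null_scale.
  apply: null_scale; rewrite /e.
  have : (16 ^+ n)^-1 @[n --> \oo] --> (0 : R).
    by under eq_fun do rewrite -exprVn; apply: cvg_expr; rewrite ger0_norm // invf_lt1 // ltr1n.
  by move/(null_scale 4^-1); under eq_fun do rewrite mulrC.
by apply: null_le (null_scale 4 q0) => n; rewrite nn2_ge0 h.
Qed.

Lemma FT2_pair H1 H2 f1 f2 : FT2 H1 f1 -> FT2 H2 f2 ->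
  cintegral (fun x => f1 x * f2 x) = cintegral (fun xi => H1 xi * H2 (- xi)).
Proof.
move=> [lH1 lf1 h1] [lH2 lf2 h2].
have bF H n : L2 H -> L2 (inv_fourier_fun (cut n H)).
  by move=> lH; exact: (bessel (cut_int n lH) (cut_L2 n lH)).1.
have P1 := pair_cvg (fun n => bF _ n lH1) (fun n => bF _ n lH2) lf1 lf2 h1 h2.
have lo2 n := L2_mpres mpres_opp (cut_L2 n lH2).
have c2 : nn2 (fun xi => cut n H2 (- xi) - H2 (- xi)) @[n --> \oo] --> (0 : R).
  apply: null_ext (cut_cvg lH2) => n.
  exact: esym (nn2_mpres mpres_opp (L2B (cut_L2 n lH2) lH2).1).
have P2 := pair_cvg (fun n => cut_L2 n lH1) lo2 lH1 (L2_mpres mpres_opp lH2) (cut_cvg lH1) c2.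
apply: null_unique P1 _.
have E n := plancherel (cut_int n lH1) (cut_L2 n lH1) (cut_int n lH2) (cut_L2 n lH2).
by under eq_fun do rewrite E.
Qed.

Lemma conjB (z w : R[i]) : (z - w)^*%C = z^*%C - w^*%C.
Proof. by apply: complex_ext; rewrite !(ReB, ImB, Re_conj, Im_conj) // opprB opprK addrC. Qed.

Lemma FT2_conj H f : FT2 H f -> FT2 (fun xi => (H (- xi))^*%C) (fun x => (f x)^*%C).
Proof.
move=> [lH lf h]; split.
- by apply: L2_conj; exact: (L2_mpres mpres_opp lH).
- exact: L2_conj.
- apply: null_ext h => n.
  apply: eq_Rintegral => x _; rewrite -[in LHS]cmod_conj; congr (cmod _ ^+ 2).
  rewrite conjB; congr (_ - _); rewrite inv_fourier_conj; last exact: cut_int.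
  congr (inv_fourier_fun _ x); apply/funext => xi; rewrite /cut conjM; congr (_ * _).
  by rewrite /ball3 enormN conj_realC.
Qed.

Lemma FT2_nn2 H f : FT2 H f -> nn2 f = nn2 H.
Proof.
move=> hf; have [lH lf _] := hf; have := FT2_pair hf (FT2_conj hf).
under [X in _ = cintegral X]eq_fun do rewrite opprK.
by rewrite -!nn2E // => -[].
Qed.

End square_integrable_transform.

(** * Distributions represented by functions *)

Section temperate.
Context {R : realType}.
Variable psi : E3 R -> R.
Hypothesis hpsi : LP_cutoff psi.
Local Notation mu := (leb3 R).
Implicit Types (f g A B C F G H K : E3 R -> R[i]) (x xi a : E3 R) (j : 'I_3).
Implicit Types (T : Defs.distribution R).

Definition scaled (c : R) (y x : E3 R) : R := psi (c *: x + y).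

Lemma psi_test : test_function psi. Proof. by case: hpsi. Qed.

Lemma scaled_test c y : c != 0 -> test_function (scaled c y).
Proof. by move=> c0; apply: test_affine => //; exact: psi_test. Qed.

Lemma psi_supp x : psi x != 0 -> enorm x <= 1.
Proof. case: hpsi => _ h _ _ px; have cx : closure [set xi | psi xi != 0] x by exact: subset_closure.
exact: (h x cx). Qed.

Lemma psi_ge0 x : 0 <= psi x. Proof. by case: hpsi. Qed.
Lemma psi_one x : enorm x <= 1 / 2 -> psi x = 1. Proof. by case: hpsi => _ _ _; exact. Qed.

Lemma tempered_cut f n : tempered_fun f -> cintegrable (cut n f).
Proof.
move=> tf; pose c : R := (2 * n.+1%:R)^-1.
have c0 : 0 < c by rewrite invr_gt0 mulr_gt0.
have iF := tf _ (Cc_schwartz (test_Cc (scaled_test 0 (lt0r_neq0 c0)))).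
have := cintegrable_boundM (ball3_meas n) (ball3_le1 n) iF.
congr cintegrable; apply/funext => x; rewrite /cut.
have [xn|xn] := leP (enorm x) n%:R; last by rewrite ball3_out // !mul0r.
rewrite ball3_in // /scaled addr0 psi_one ?mulr1 //.
rewrite enormZ gtr0_norm // /c invfM -mulrA mul1r ler_piMr ?invr_ge0 //.
by rewrite mulrC ler_pdivrMr // mul1r (le_trans xn) // ler_nat.
Qed.

Lemma tempered_meas f : tempered_fun f -> cmeas f.
Proof.
move=> tf; apply: (@cmeas_limit _ _ _ (fun n => cut n f)).
  by move=> n; apply: cintegrable_meas; exact: tempered_cut.
by move=> x; exact: ball3_cvg.
Qed.

Lemma ae_all (P : nat -> E3 R -> Prop) : (forall n, {ae mu, forall x, P n x}) ->
  {ae mu, forall x, forall n, P n x}.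
Proof. by move=> h; apply/ae_foralln. Qed.

(** For n large compared with |xi| the rescaled bump lives where |xi . x| <= 1/4, and there the
    character differs from 1 by at most 1/2. The bump has positive mass, so the transform cannot
    vanish. *)
Lemma transform_scaled_neq0 xi : exists n,
  inv_fourier_fun (fun x => (scaled n.+1%:R 0 x)%:C) xi != 0.
Proof.
pose n := Num.bound (4 * enorm xi); exists n.
have nb : 4 * enorm xi <= n.+1%:R.
  by apply: (le_trans (ltW (archi_boundP _))); rewrite ?mulr_ge0 ?enorm_ge0 // ler_nat.
pose th x := scaled n.+1%:R 0 x.
have n0 : n.+1%:R != 0 :> R by rewrite pnatr_eq0.
have tth : test_function th by exact: scaled_test.
have cth := test_Cc tth.
have ith : cintegrable (fun x => (th x)%:C) by exact: (mom_int (Cc_mom 0 cth)).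
have th0 x : 0 <= th x by exact: psi_ge0.
have cm x : cmod (th x)%:C = th x by rewrite cmod_real ger0_norm.
have irth : mu.-integrable setT (EFin \o th).
  by have := integrable_cmod ith; under eq_fun do rewrite cm.
have I0 : 0 < \int[mu]_x th x.
  rewrite lt_def Rintegral_ge0 // andbT; apply/eqP => Iz.
  have cont : continuous th by move=> x; apply: differentiable_continuous; exact: (smooth_diff tth.1).
  have aez := nonneg_integral_eq0 (differentiable_measurable (smooth_diff tth.1)) th0 Iz irth.
  have cont0 : continuous (fun _ : E3 R => 0 : R) by exact: cst_continuous.
  have := congr1 (@^~ 0) (continuous_ae_eq cont cont0 aez).
  by rewrite /th /scaled scaler0 addr0 psi_one ?enorm0 // => /eqP; rewrite oner_eq0.
have small x : cmod ((expi (dot xi x) - 1) * (th x)%:C) <= 2^-1 * th x.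
  rewrite cmodM cm; have [->|/psi_supp] := eqVneq (th x) 0; first by rewrite !mulr0.
  rewrite addr0 enormZ ger0_norm // => hx; rewrite ler_wpM2r //.
  have d4 : `|dot xi x| <= 4^-1.
    apply: le_trans (dot_le _ _) _; have x0 := enorm_ge0 x; have xi0 := enorm_ge0 xi.
    rewrite -(ler_pM2l (_ : 0 < 4 :> R)) // mulrA mulfV //.
    by apply: le_trans hx; rewrite ler_wpM2r.
  have := cmod_le (expi (dot xi x) - 1); rewrite ReB ImB /= subr0.
  have := cosB1_le (dot xi x); have := sin_le_norm (dot xi x).
  have -> : dot xi x ^+ 2 = `|dot xi x| ^+ 2 by rewrite real_normK ?num_real.
  have := normr_ge0 (dot xi x); move: d4.
  set t := `|dot xi x|; set a := `|sin _|; set b := `|cos _ - 1| => d4 t0 h1 h2 h3.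
  have : t ^+ 2 <= 4^-1 * t by rewrite expr2 ler_wpM2r.
  by lra.
apply/eqP; rewrite inv_fourierE => /eqP; rewrite mulf_eq0 => /orP[/eqP|/eqP hz].
  by move/(congr1 (@complex.Re R)) => /= /eqP; rewrite gt_eqF // c0_gt0.
have i1 := cintegrable_expi xi ith.
have E : cintegral (fun x => (expi (dot xi x) - 1) * (th x)%:C) = - (\int[mu]_x th x)%:C.
  rewrite -cintegral_real -[RHS]add0r -hz -(cintegralB i1 ith).
  by apply: eq_cintegral => x; rewrite mulrBl mul1r.
have iD : cintegrable (fun x => (expi (dot xi x) - 1) * (th x)%:C).
  by have := cintegrableB i1 ith; under eq_fun do rewrite -[X in _ - X]mul1r -mulrBl.
have := cmod_cintegral iD; rewrite E cmodN cmod_real ger0_norm; last exact: ltW.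
move=> h.
have : \int[mu]_x cmod ((expi (dot xi x) - 1) * (th x)%:C) <= 2^-1 * \int[mu]_x th x.
  rewrite -RintegralZl //; apply: le_Rintegral => //; first exact: integrable_cmod.
  exact: integrable_scale.
by move=> h2; have := le_trans h h2; lra.
Qed.

(* Translates of a rescaled cutoff have the characters times a fixed function
   as transforms, so that injectivity of the Fourier transform applies. *)
Lemma test_separation K : cmeas K ->
  (forall th, test_function th -> cintegrable (fun xi => K xi * inv_fourier_fun (fun x => (th x)%:C) xi)) ->
  (forall th, test_function th -> cintegral (fun xi => K xi * inv_fourier_fun (fun x => (th x)%:C) xi) = 0) ->
  {ae mu, forall xi, K xi = 0}.
Proof.
move=> mK hi h0.
have h n : {ae mu, forall xi, K xi * inv_fourier_fun (fun x => (scaled n.+1%:R 0 x)%:C) xi = 0}.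
  have n0 : n.+1%:R != 0 :> R by rewrite pnatr_eq0.
  apply: fourier_injective; first by apply: hi; exact: scaled_test.
  move=> y; refine (etrans _ (h0 _ (scaled_test (- (n.+1%:R *: y)) n0))).
  apply: eq_cintegral => xi; rewrite -mulrA; congr (_ * _); rewrite mulrC.
  have -> : (fun x => (scaled n.+1%:R (- (n.+1%:R *: y)) x)%:C) =
      fun x => (scaled n.+1%:R 0 (x + - y))%:C.
    by apply/funext => x; rewrite /scaled addr0 scalerDr scalerN.
  rewrite (@inv_fourier_shift R (fun x => (scaled n.+1%:R 0 x)%:C)); first by rewrite dotNr opprK.
  exact: (mom_int (Cc_mom 0 (test_Cc (scaled_test 0 n0)))).
apply: aeS (ae_all h) => xi hxi; have [n hn] := transform_scaled_neq0 xi.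
by apply/eqP; have /eqP := hxi n; rewrite mulf_eq0 (negbTE hn) orbF.
Qed.

(** Transforms of test functions are Schwartz, hence legitimate arguments of T, and
    [test_separation] applies to the difference. *)
Lemma represents_unique f g T : represents f T -> represents g T ->
  {ae mu, forall x, f x = g x}.
Proof.
move=> [tf hf] [tg hg].
have sI th : test_function th -> schwartz (inv_fourier_fun (fun x => (th x)%:C)).
  by move=> tth; apply: inv_fourier_Cc_schwartz; exact: test_Cc.
have : {ae mu, forall x, f x - g x = 0}.
  apply: test_separation.
  - by apply: cmeasB; exact: tempered_meas.
  - move=> th tth; have := cintegrableB (tf _ (sI _ tth)) (tg _ (sI _ tth)).
    by under eq_fun do rewrite -mulrBl.
  - move=> th tth; have s := sI _ tth.
    have := hf _ s; rewrite hg // /of_fun => /eqP; rewrite eq_sym -subr_eq0 => /eqP <-.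
    by rewrite -(cintegralB (tf _ s) (tg _ s)); apply: eq_cintegral => x; rewrite mulrBl.
by apply: aeS => x /eqP; rewrite subr_eq0 => /eqP.
Qed.

Lemma fun_of_represents f T : represents f T -> represents (fun_of T) T.
Proof. by move=> h; rewrite /fun_of; case: xgetP => [_ _ //|/(_ f)]. Qed.

Lemma fun_of_ae f T : represents f T -> {ae mu, forall x, fun_of T x = f x}.
Proof. by move=> h; exact: (represents_unique (fun_of_represents h) h). Qed.

Lemma represents_inv_fourier F T : cintegrable F ->
  (forall phi, schwartz phi -> T phi = cintegral (fun xi => F xi * inv_fourier_fun phi xi)) ->
  represents (inv_fourier_fun F) T.
Proof.
move=> iF hT; split.
  move=> phi sphi; have [M _ hM] := inv_fourier_bounded iF.
  exact: (cintegrable_boundM (cmeas_inv_fourier iF) hM (schwartz_int sphi)).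
move=> phi sphi; rewrite hT // /of_fun (inv_fourier_mult iF (schwartz_int sphi)).
by apply: eq_cintegral => x; rewrite mulrC.
Qed.

Lemma representsD f g S T : represents f S -> represents g T ->
  represents (fun x => f x + g x) (S + T).
Proof.
move=> [tf hf] [tg hg]; split.
  by move=> phi s; have := cintegrableD (tf _ s) (tg _ s); under eq_fun do rewrite -mulrDl.
move=> phi s; rewrite fctE hf // hg // /of_fun -(cintegralD (tf _ s) (tg _ s)).
by apply: eq_cintegral => x; rewrite mulrDl.
Qed.

Lemma represents0 : represents (fun=> 0) (0 : Defs.distribution R).
Proof.
split; first by move=> phi s; under eq_fun do rewrite mul0r; exact: cintegrable0.
by move=> phi s; rewrite /of_fun; under eq_fun do rewrite mul0r; rewrite cintegral0.
Qed.

(* The Fourier transform of [T] is [G], tested against compactly supported functions. *)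
Definition density G T := (forall chi, Cc chi -> cintegrable (fun xi => G xi * chi xi)) /\
  (forall chi, Cc chi -> fourier T chi = cintegral (fun xi => G xi * chi xi)).

Lemma represents_density G T : represents G (fourier T) -> density G T.
Proof. by move=> [tG hG]; split=> chi /Cc_schwartz s; [exact: tG|exact: hG]. Qed.

Lemma densityD F G S T : density F S -> density G T -> density (fun xi => F xi + G xi) (S + T).
Proof.
move=> [iF hF] [iG hG]; split=> chi c.
  by have := cintegrableD (iF _ c) (iG _ c); under eq_fun do rewrite -mulrDl.
rewrite /fourier fctE -/(fourier S chi) -/(fourier T chi) hF // hG //.
rewrite -(cintegralD (iF _ c) (iG _ c)).
by apply: eq_cintegral => x; rewrite mulrDl.
Qed.

Lemma densityN G T : density G T -> density (fun xi => - G xi) (- T).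
Proof.
move=> [iG hG]; split=> chi c.
  by have := cintegrableN (iG _ c); under eq_fun do rewrite -mulNr.
rewrite /fourier fctE -/(fourier T chi) hG // -(cintegralN (iG _ c)).
by apply: eq_cintegral => x; rewrite mulNr.
Qed.

(** The common form of [Slow] and [Delta], whose symbols will be called [ps] and [ph]. *)
Definition filter (m : E3 R -> R) T : Defs.distribution R := inv_fourier (dmul m (fourier T)).

Lemma filter_integrable m G T : test_function m -> density G T ->
  cintegrable (fun xi => (m xi)%:C * G xi).
Proof. by move=> /test_Cc cm [iG _]; under eq_fun do rewrite mulrC; exact: iG. Qed.

Lemma filter_represents m G T : test_function m -> density G T ->
  represents (inv_fourier_fun (fun xi => (m xi)%:C * G xi)) (filter m T).
Proof.
move=> tm dG; apply: represents_inv_fourier; first exact: filter_integrable tm dG.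
move=> phi s; rewrite /filter /inv_fourier /dmul dG.2; last first.
  by apply: Cc_inv_fourier_mul => //; exact: test_Cc.
by apply: eq_cintegral => xi; rewrite mulrA [G xi * _]mulrC.
Qed.

Lemma filter_density m G T : test_function m -> density G T ->
  density (fun xi => (m xi)%:C * G xi) (filter m T).
Proof.
move=> tm dG; split=> chi c.
  have := dG.1 _ (CcMl (Cc_smooth (test_Cc tm)) c).
  by congr cintegrable; apply/funext => xi; rewrite mulrCA mulrA.
rewrite /fourier /filter /inv_fourier /dmul (inversion c) dG.2; last first.
  by apply: CcMl => //; exact: (Cc_smooth (test_Cc tm)).
by apply: eq_cintegral => xi; rewrite mulrCA mulrA.
Qed.

Lemma filter_dpd_represents m G T j : test_function m -> density G T ->
  represents (inv_fourier_fun (fun xi => 'i%C * (coord3 xi j)%:C * ((m xi)%:C * G xi)))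
    (dpd j (filter m T)).
Proof.
move=> tm dG; have cm := test_Cc tm.
have iM : cintegrable (fun xi => 'i%C * (coord3 xi j)%:C * ((m xi)%:C * G xi)).
  have cc : Cc (fun xi => 'i%C * (coord3 xi j)%:C * (m xi)%:C).
    apply: CcMl => //; apply: csmoothM; first exact: csmooth_cst.
    by apply: csmooth_real; exact: smooth_coord.
  by have := dG.1 _ cc; congr cintegrable; apply/funext => xi; ring.
apply: represents_inv_fourier => // phi s; rewrite /dpd.
have sj := schwartz_cpd j s.
rewrite (filter_represents tm dG).2 // /of_fun.
have iG := filter_integrable tm dG.
transitivity (- cintegral (fun x => cpd j phi x * inv_fourier_fun (fun xi => (m xi)%:C * G xi) x)).
  by congr (- _); apply: eq_cintegral => x; rewrite mulrC.
rewrite (inv_fourier_mult (schwartz_int sj) iG).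
have iI : cintegrable (fun xi => (m xi)%:C * G xi * inv_fourier_fun (cpd j phi) xi).
  under eq_fun do rewrite mulrC.
  have [M _ hM] := inv_fourier_bounded (schwartz_int sj).
  exact: (cintegrable_boundM (cmeas_inv_fourier (schwartz_int sj)) hM iG).
rewrite -(cintegralN iI); apply: eq_cintegral => xi.
by rewrite (inv_fourier_ibp_schwartz j xi s); ring.
Qed.

End temperate.

(** * Absolutely convergent double integrals *)

Section double_integrals.
Context {R : realType}.
Local Notation mu := (leb3 R).
Implicit Types (A B C f g H : E3 R -> R[i]) (F G : E3 R * E3 R -> R[i]) (x z a : E3 R) (j : 'I_3).

Definition NN F : \bar R := (\int[mu]_z N1 (fun x => F (z, x)))%E.
Definition dbl F := cmeas F /\ (NN F < +oo)%E.
(** An iterated rather than a product integral, so that it can be transformed slice by slice. *)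
Definition dint F : R[i] := cintegral (fun z => cintegral (fun x => F (z, x))).
Definition tker A B C : E3 R * E3 R -> R[i] := fun p => A p.1 * (B p.2 * C (- p.1 - p.2)).

Lemma triE A B C : tri A B C = NN (tker A B C). Proof. by []. Qed.

Lemma cmeas_slice F z : cmeas F -> cmeas (fun x => F (z, x)).
Proof. by move=> mF; exact: (cmeas_comp mF (measurable_pair1 z)). Qed.

Lemma measurable_N1_slice F : cmeas F -> measurable_fun setT (fun z => N1 (fun x => F (z, x))).
Proof.
move=> mF; apply: (measurable_tonelli3 (f := fun p => (cmod (F p))%:E)).
  by apply/measurable_EFinP; exact: measurable_cmod.
by move=> p; rewrite lee_fin cmod_ge0.
Qed.

Lemma N1_mono f g : cmeas f -> cmeas g -> (forall x, cmod (f x) <= cmod (g x)) -> (N1 f <= N1 g)%E.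
Proof.
move=> mf mg h; apply: ge0_le_integral => //.
- by move=> x _; rewrite lee_fin cmod_ge0.
- by apply/measurable_EFinP; exact: measurable_cmod.
- by apply/measurable_EFinP; exact: measurable_cmod.
- by move=> x _; rewrite lee_fin.
Qed.

Lemma NN_mono F G : cmeas F -> cmeas G -> (forall p, cmod (F p) <= cmod (G p)) -> (NN F <= NN G)%E.
Proof.
move=> mF mG h; apply: ge0_le_integral => //.
- by move=> z _; exact: N1_ge0.
- exact: measurable_N1_slice.
- exact: measurable_N1_slice.
- by move=> z _; apply: N1_mono => //; exact: cmeas_slice.
Qed.

Lemma NNZ (c : R) F : 0 <= c -> cmeas F -> NN (fun p => c%:C * F p) = (c%:E * NN F)%E.
Proof.
move=> c0 mF; rewrite /NN -ge0_integralZl ?lee_fin //; first last.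
- by move=> z _; exact: N1_ge0.
- exact: measurable_N1_slice.
apply: eq_integral => z _; rewrite N1Z; last exact: cmeas_slice.
by rewrite cmod_real ger0_norm.
Qed.

Lemma N1_add f g : cmeas f -> cmeas g -> (N1 (fun x => (f x + g x)%R) <= N1 f + N1 g)%E.
Proof.
move=> mf mg; rewrite /N1 -ge0_integralD //.
- apply: ge0_le_integral => //.
  + by move=> x _; rewrite lee_fin cmod_ge0.
  + by apply/measurable_EFinP; apply: measurable_cmod; exact: cmeasD.
  + by apply: emeasurable_funD; apply/measurable_EFinP; exact: measurable_cmod.
  + by move=> x _; rewrite -EFinD lee_fin cmodD.
- by move=> x _; rewrite lee_fin cmod_ge0.
- by apply/measurable_EFinP; exact: measurable_cmod.
- by move=> x _; rewrite lee_fin cmod_ge0.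
- by apply/measurable_EFinP; exact: measurable_cmod.
Qed.

Lemma NN_add F G : cmeas F -> cmeas G -> (NN (fun p => (F p + G p)%R) <= NN F + NN G)%E.
Proof.
move=> mF mG; rewrite /NN -ge0_integralD //; first last.
- exact: measurable_N1_slice.
- by move=> z _; exact: N1_ge0.
- exact: measurable_N1_slice.
- by move=> z _; exact: N1_ge0.
apply: ge0_le_integral => //.
- by move=> z _; exact: N1_ge0.
- exact: (measurable_N1_slice (cmeasD mF mG)).
- by apply: emeasurable_funD; exact: measurable_N1_slice.
- by move=> z _; apply: N1_add; exact: cmeas_slice.
Qed.

Lemma dblD F G : dbl F -> dbl G -> dbl (fun p => F p + G p).
Proof.
move=> [mF fF] [mG fG]; split; first exact: cmeasD.
exact: (le_lt_trans (NN_add mF mG) (lte_add_pinfty fF fG)).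
Qed.

Lemma dbl_le (M : R) F G : cmeas F -> 0 <= M -> (forall p, cmod (F p) <= M * cmod (G p)) ->
  dbl G -> dbl F.
Proof.
move=> mF M0 h [mG fG]; split; first exact: mF.
apply: (@le_lt_trans _ _ (NN (fun p => M%:C * G p))).
  apply: NN_mono; [exact: mF|by apply: cmeasM; [exact: cmeas_cst|exact: mG]|].
  by move=> p; rewrite cmodM cmod_real (ger0_norm M0); exact: h.
rewrite (NNZ M0 mG); apply: lte_mul_pinfty; [by rewrite lee_fin|by []|exact: fG].
Qed.

Lemma dblZ (c : R[i]) F : dbl F -> dbl (fun p => c * F p).
Proof.
move=> dF; apply: (dbl_le _ (cmod_ge0 c) _ dF); last by move=> p; rewrite cmodM.
by apply: cmeasM; [exact: cmeas_cst|exact: dF.1].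
Qed.

Lemma dbl0 : dbl (fun=> 0).
Proof.
split; first exact: cmeas_cst.
rewrite /NN (eq_integral (fun=> 0%E)) ?integral0 // => z _.
by rewrite /N1 (eq_integral (fun=> 0%E)) ?integral0 // => x _; rewrite cmod0.
Qed.

Lemma dbl_sum (I : Type) (r : seq I) (F : I -> E3 R * E3 R -> R[i]) :
  (forall i, dbl (F i)) -> dbl (fun p => \sum_(i <- r) F i p).
Proof.
move=> h; elim: r => [|i r IH]; first by under eq_fun do rewrite big_nil; exact: dbl0.
by under eq_fun do rewrite big_cons; exact: (dblD (h i) IH).
Qed.

Lemma dbl_fubini F : dbl F -> [/\ {ae mu, forall z, cintegrable (fun x => F (z, x))},
  cintegrable (fun z => cintegral (fun x => F (z, x))) &
  dint F = cintegral (fun x => cintegral (fun z => F (z, x)))].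
Proof. by move=> [mF fF]; exact: (cfubini3 mF fF). Qed.

Lemma dint_swap F : dbl F -> dint F = dint (fun p => F (p.2, p.1)).
Proof. by move=> /dbl_fubini[]. Qed.

Lemma dbl_swap F : dbl F -> dbl (fun p => F (p.2, p.1)).
Proof.
move=> [mF fF]; split.
  by apply: (cmeas_comp mF); apply: measurable_fun_pair; [exact: measurable_snd|exact: measurable_fst].
have mE := (@measurable_EFinP _ _ R setT _).2 (measurable_cmod mF).
have F0 (p : E3 R * E3 R) : (0 <= (cmod (F p))%:E)%E by rewrite lee_fin cmod_ge0.
by have := tonelli3 mE F0; rewrite /NN /N1 /= => <-.
Qed.

Lemma slice_cmeas F : dbl F -> cmeas (fun z => cintegral (fun x => F (z, x))).
Proof. by move=> /dbl_fubini[_ /cintegrable_meas]. Qed.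

Lemma dintD F G : dbl F -> dbl G -> dint (fun p => F p + G p) = dint F + dint G.
Proof.
move=> dF dG; have [aF iF _] := dbl_fubini dF; have [aG iG _] := dbl_fubini dG.
rewrite /dint -(cintegralD iF iG); apply: ae_eq_cintegral.
- exact: (slice_cmeas (dblD dF dG)).
- exact: cintegrable_meas (cintegrableD iF iG).
- by apply: (aeS2 _ aF aG) => z h1 h2; exact: (cintegralD h1 h2).
Qed.

Lemma dintZ (c : R[i]) F : dbl F -> dint (fun p => c * F p) = c * dint F.
Proof.
move=> dF; have [aF iF _] := dbl_fubini dF.
rewrite /dint -(cintegralZ c iF); apply: ae_eq_cintegral.
- exact: (slice_cmeas (dblZ c dF)).
- exact: cintegrable_meas (cintegrableZ c iF).
- by apply: (aeS _ aF) => z h1; exact: (cintegralZ c h1).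
Qed.

Lemma dintB F G : dbl F -> dbl G -> dint (fun p => F p - G p) = dint F - dint G.
Proof.
move=> dF dG; have := dintD dF (dblZ (-1) dG); rewrite (dintZ _ dG) mulN1r => <-.
by congr dint; apply/funext => p; rewrite mulN1r.
Qed.

Lemma dint_sum (I : Type) (r : seq I) (F : I -> E3 R * E3 R -> R[i]) :
  (forall i, dbl (F i)) -> dint (fun p => \sum_(i <- r) F i p) = \sum_(i <- r) dint (F i).
Proof.
move=> h; elim: r => [|i r IH].
  rewrite big_nil /dint (@eq_cintegral _ _ (fun=> 0)) ?cintegral0 // => z.
  by rewrite (@eq_cintegral _ _ (fun=> 0)) ?cintegral0 // => x; rewrite big_nil.
rewrite big_cons -IH -(dintD (h i) (dbl_sum r h)).
by congr dint; apply/funext => p; rewrite big_cons.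
Qed.

Lemma dint_bound F : dbl F -> ((cmod (dint F))%:E <= NN F)%E.
Proof.
move=> dF; have [aF iF _] := dbl_fubini dF; have [mF fF] := dF.
apply: le_trans (cmod_cintegralE iF) _.
apply: ae_ge0_le_integral.
- exact: measurableT.
- by move=> z _; rewrite lee_fin cmod_ge0.
- by apply/measurable_EFinP; apply: measurable_cmod; exact: (slice_cmeas dF).
- by move=> z _; exact: N1_ge0.
- exact: (measurable_N1_slice mF).
- by apply: aeS aF => z h _; exact: cmod_cintegralE.
Qed.

Lemma dint_ae0 F : (forall z, cmeas (fun x => F (z, x))) ->
  (forall z, {ae mu, forall x, F (z, x) = 0}) -> dint F = 0.
Proof.
move=> mF h; rewrite /dint (@eq_cintegral _ _ (fun=> 0)) ?cintegral0 // => z.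
rewrite (@ae_eq_cintegral _ _ (fun=> 0)) ?cintegral0 //; exact: cmeas_cst.
Qed.

Lemma eq_dint F G : F =1 G -> dint F = dint G.
Proof. by move=> /funext ->. Qed.

(** Dominated convergence twice: in x on almost every slice, then in z with the norms of the slices
    of G as majorant. *)
Lemma dint_cvg (Fn : nat -> E3 R * E3 R -> R[i]) F G : (forall n, cmeas (Fn n)) -> cmeas F -> dbl G ->
  (forall n p, cmod (Fn n p) <= cmod (G p)) ->
  (forall p, cmod (Fn n p - F p) @[n --> \oo] --> (0 : R)) ->
  dbl F /\ cmod (dint (Fn n) - dint F) @[n --> \oo] --> (0 : R).
Proof.
move=> mFn mF dG hb hc.
have hF p : cmod (F p) <= cmod (G p) by apply: cvg_cmod_le (hc p).
have le1 (H : E3 R * E3 R -> R[i]) : cmeas H -> (forall p, cmod (H p) <= cmod (G p)) -> dbl H.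
  by move=> mH hH; apply: (dbl_le mH ler01 _ dG) => p; rewrite mul1r; exact: hH.
have dF := le1 _ mF hF; have dFn n := le1 _ (mFn n) (hb n).
split; first exact: dF.
have [aG iG _] := dbl_fubini dG.
pose b z : R := fine (N1 (fun x => G (z, x))).
have mb : measurable_fun setT b by apply: measurableT_comp => //; exact: measurable_N1_slice dG.1.
have ib : mu.-integrable setT (EFin \o b).
  apply/integrableP; split; first exact/measurable_EFinP.
  apply: le_lt_trans dG.2; apply: ge0_le_integral => //.
  - by apply: measurableT_comp => //; exact/measurable_EFinP.
  - exact: measurable_N1_slice dG.1.
  - move=> z _; rewrite /= ger0_norm ?fine_ge0 ?N1_ge0 // /b.
    by case: (N1 _) (N1_ge0 (fun x => G (z, x))) => //= *; rewrite ?leey.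
refine (@dominated_cintegral R (fun n z => cintegral (fun x => Fn n (z, x))) _ b _ _ _ ib _).
- by move=> n; exact: (slice_cmeas (dFn n)).
- exact: (slice_cmeas dF).
- apply: (aeS _ aG) => z iz.
  refine (@dominated_cintegral R (fun n x => Fn n (z, x)) _ (fun x => cmod (G (z, x))) _ _ _ _ _).
  + by move=> n; exact: (cmeas_slice z (mFn n)).
  + exact: (cmeas_slice z mF).
  + by apply: aeW => x; exact: hc.
  + exact: (integrable_cmod iz).
  + by apply: aeW => x n; exact: hb.
- apply: (aeS _ aG) => z iz n; rewrite -lee_fin /b fineK; last first.
    by rewrite (N1_fin iz).
  have iF : cintegrable (fun x => Fn n (z, x)).
    by apply: (cintegrable_le (cmeas_slice z (mFn n)) (integrable_cmod iz)) => x; exact: hb.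
  apply: le_trans (cmod_cintegralE iF) _; apply: N1_mono; [exact: (cmeas_slice z (mFn n))|exact: (cmeas_slice z dG.1)|].
  by move=> x; exact: hb.
Qed.

Lemma tker_meas A B C : cmeas A -> cmeas B -> cmeas C -> cmeas (tker A B C).
Proof. exact: tri_meas. Qed.

(** A substitution in the inner integral alone, whereas [dint_tswap] exchanges the two integrals and
    needs absolute convergence. *)
Lemma dint_rot A B C : cmeas A -> cmeas B -> cmeas C -> dint (tker A B C) = dint (tker A C B).
Proof.
move=> mA mB mC; apply: eq_cintegral => z.
have mI : cmeas (fun x => tker A B C (z, x)) by apply: cmeas_slice; exact: tker_meas.
rewrite -(cintegral_mpres (mpres_sub (- z)) mI); apply: eq_cintegral => x.
by rewrite /tker /= [B _ * _]mulrC; congr (_ * (C _ * _)); rewrite opprB addrCA subrr addr0.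
Qed.

Lemma dint_tswap A B C : dbl (tker A B C) -> dint (tker A B C) = dint (tker B A C).
Proof.
move=> d; rewrite (dint_swap d); apply: eq_dint => p.
by rewrite /tker /= mulrCA [- p.2 - p.1]addrC.
Qed.

Lemma tri_lt_L1 A B C : cintegrable A -> L2 B -> L2 C -> (tri A B C < +oo)%E.
Proof. by move=> iA lB lC; apply: le_lt_trans (tri_le iA lB lC) _; rewrite ltry. Qed.

Lemma tri_lt_bounded A B C (M : R) : cintegrable A -> cintegrable B -> cmeas C ->
  (forall x, cmod (C x) <= M) -> (tri A B C < +oo)%E.
Proof.
move=> iA iB mC hM; have mA := cintegrable_meas iA; have mB := cintegrable_meas iB.
have M0 : 0 <= M by exact: le_trans (cmod_ge0 _) (hM 0).
have := N1_prod iA (cintegrableZ M%:C iB) (fun _ _ => @cmod1 R).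
apply: le_lt_trans.
refine (@NN_mono (tker A B C) (fun p => A p.1 * (1 * (M%:C * B p.2))) _ _ _).
- exact: tker_meas.
- apply: cmeas_prodM => //; apply: cmeasM; first exact: cmeas_cst.
  by apply: cmeasM; [exact: cmeas_cst|exact: cmeas_snd].
- move=> p; rewrite /tker !cmodM cmod1 mul1r cmod_real ger0_norm // ler_wpM2l ?cmod_ge0 //.
  by rewrite mulrC ler_wpM2r ?cmod_ge0.
Qed.

End double_integrals.

(** * Real fields with half a derivative in L2 *)

Section duality.
Context {R : realType}.
Implicit Types (f g F G H K phi : E3 R -> R[i]) (x xi : E3 R) (j : 'I_3).

Lemma schwartz_meas phi : schwartz phi -> cmeas phi.
Proof. by move=> s; exact: (csmooth_meas (schwartz_smooth s)). Qed.

Lemma schwartz_L2 phi : schwartz phi -> L2 phi.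
Proof.
move=> s; have [C hC] := schwartz_poly 0 s.
have hC' x : cmod (phi x) <= C by have := hC x; rewrite expr0 mul1r.
have C0 : 0 <= C by exact: le_trans (cmod_ge0 _) (hC' 0).
apply: (L2_dom (schwartz_meas s) (integrable_scale C (integrable_cmod (schwartz_int s)))) => x.
by rewrite expr2 ler_wpM2r ?cmod_ge0.
Qed.

Lemma L2_int f : L2 f -> nn2 (fun x => f x - f x) = 0.
Proof.
move=> lf; rewrite /nn2 (@eq_Rintegral _ _ _ _ _ (fun=> 0)) ?Rintegral_cst0 //.
  by rewrite /Rintegral integral0.
by move=> x _; rewrite subrr cmod0 expr0n.
Qed.

Lemma FT2_dual H f phi : FT2 H f -> cintegrable phi -> L2 phi ->
  cintegral (fun x => f x * phi x) = cintegral (fun xi => H xi * inv_fourier_fun phi xi).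
Proof.
move=> [lH lf hf] ip lp; have [lI _] := bessel ip lp.
have bF n := (bessel (cut_int n lH) (cut_L2 n lH)).1.
have cst0 p : L2 p -> nn2 (fun x => p x - p x) @[n --> \oo] --> (0 : R).
  by move=> lp'; rewrite (L2_int lp'); exact: cvg_cst.
have P1 := pair_cvg bF (fun=> lp) lf lp hf (cst0 _ lp).
have P2 := pair_cvg (fun n => cut_L2 n lH) (fun=> lI) lH lI (cut_cvg lH) (cst0 _ lI).
apply: null_unique P1 _.
have E n : cintegral (fun x => inv_fourier_fun (cut n H) x * phi x) =
    cintegral (fun x => cut n H x * inv_fourier_fun phi x).
  rewrite -(inv_fourier_mult ip (cut_int n lH)).
  by apply: eq_cintegral => x; rewrite mulrC.
by under eq_fun do rewrite E.
Qed.

Lemma L2_tempered f : L2 f -> tempered_fun f.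
Proof. by move=> lf phi s; exact: (L2_mul lf (schwartz_L2 s)). Qed.

Lemma FT2_represents H f : FT2 H f -> represents f (inv_fourier (of_fun H)).
Proof.
move=> h; have [lH lf _] := h; split; first exact: L2_tempered.
by move=> phi s; rewrite /inv_fourier /of_fun (FT2_dual h (schwartz_int s) (schwartz_L2 s)).
Qed.

(** The symbol of (-Delta)^(1/4), hence the weight of the energy for s = 1/2. *)
Definition sq x : R := Num.sqrt (enorm x).

Lemma sq_ge0 x : 0 <= sq x. Proof. exact: sqrtr_ge0. Qed.
Lemma sq_sqr x : sq x ^+ 2 = enorm x. Proof. by rewrite sqr_sqrtr // enorm_ge0. Qed.
Lemma sqN x : sq (- x) = sq x. Proof. by rewrite /sq enormN. Qed.
Lemma sqE x (s : R) : s = 1 / 2 -> enorm x `^ s = sq x.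
Proof. by move=> ->; rewrite mul1r /sq powR12_sqrt // enorm_ge0. Qed.

Lemma measurable_sq : measurable_fun setT sq.
Proof.
apply: (measurableT_comp _ (@measurable_enorm R)).
by apply: continuous_measurable_fun; exact: sqrt_continuous.
Qed.

Lemma cmeas_sqM f : cmeas f -> cmeas (fun x => (sq x)%:C * f x).
Proof. by move=> mf; apply: cmeasM => //; apply: cmeas_real; exact: measurable_sq. Qed.

Lemma frac_lap_represents (s : R) (T : Defs.distribution R) v : 2 * s = 1 / 2 ->
  FT2 (fun xi => (sq xi)%:C * fun_of (fourier T) xi) v -> represents v (frac_lap s T).
Proof.
move=> hs h; rewrite /frac_lap (_ : (fun xi => _) = fun xi => (sq xi)%:C * fun_of (fourier T) xi).
  exact: FT2_represents.
by apply/funext => xi; rewrite (sqE _ hs).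
Qed.

End duality.

Section scalar_field.
Context {R : realType}.
Variables (psi : E3 R -> R) (u : E3 R -> R) (g : E3 R -> R[i]).
Hypothesis hpsi : LP_cutoff psi.
Local Notation mu := (leb3 R).
Local Notation U := (fun x => (u x)%:C).
Hypothesis tU : tempered_fun U.
Hypothesis hg : represents g (fourier (of_fun U)).
Implicit Types (f F G H K phi chi : E3 R -> R[i]) (x xi : E3 R) (j : 'I_3).

Lemma field_schwartz chi : schwartz chi ->
  cintegral (fun x => U x * fourier_fun chi x) = cintegral (fun xi => g xi * chi xi).
Proof. by move=> s; rewrite -[RHS](hg.2 _ s). Qed.

Lemma field_Cc chi : Cc chi ->
  cintegral (fun x => U x * chi x) = cintegral (fun xi => g xi * inv_fourier_fun chi xi).
Proof.
move=> c; rewrite -(field_schwartz (inv_fourier_Cc_schwartz c)).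
by rewrite (inversion' c).
Qed.

Lemma test_opp (th : E3 R -> R) : test_function th -> test_function (fun x => th (- x)).
Proof.
move=> t; have := test_affine 0 (_ : (-1 : R) != 0) t; rewrite oppr_eq0 oner_eq0 => /(_ isT).
by under eq_fun do rewrite addr0 scaleN1r.
Qed.

Lemma test_int (th : E3 R -> R) : test_function th -> cintegrable (fun x => (th x)%:C).
Proof. by move=> t; exact: (mom_int (Cc_mom 0 (test_Cc t))). Qed.

Lemma test_IF_schwartz (th : E3 R -> R) : test_function th ->
  schwartz (inv_fourier_fun (fun x => (th x)%:C)).
Proof. by move=> t; apply: inv_fourier_Cc_schwartz; exact: test_Cc. Qed.

Lemma fourier_opp (th : E3 R -> R) x : test_function th ->
  fourier_fun (fun y => (th (- y))%:C) x = inv_fourier_fun (fun y => (th y)%:C) x.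
Proof.
move=> t; rewrite fourierE (@inv_fourier_reflect R (fun y => (th y)%:C)) ?opprK //.
exact: test_int.
Qed.

Lemma field_test (th : E3 R -> R) : test_function th ->
  cintegral (fun x => U x * inv_fourier_fun (fun y => (th y)%:C) x) =
  cintegral (fun xi => g xi * (th (- xi))%:C).
Proof.
move=> t; rewrite -(field_schwartz (Cc_schwartz (test_Cc (test_opp t)))).
by apply: eq_cintegral => x; rewrite fourier_opp.
Qed.

Lemma g_meas : cmeas g. Proof. exact: (tempered_meas hpsi hg.1). Qed.

Lemma g_cut n : cintegrable (cut n g). Proof. exact: (tempered_cut hpsi n hg.1). Qed.

(** Both sides have the same pairing with transforms of real test functions, because the pairing of
    the real field with such a function is real. *)
Lemma field_conj : {ae mu, forall xi, g (- xi) = (g xi)^*%C}.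
Proof.
have mo : cmeas (fun xi => g (- xi)) by exact: (cmeas_mpres mpres_opp g_meas).
have key th : test_function th ->
    [/\ cintegrable (fun xi => g (- xi) * inv_fourier_fun (fun x => (th x)%:C) xi),
        cintegrable (fun xi => (g xi)^*%C * inv_fourier_fun (fun x => (th x)%:C) xi) &
        cintegral (fun xi => g (- xi) * inv_fourier_fun (fun x => (th x)%:C) xi) =
        cintegral (fun xi => (g xi)^*%C * inv_fourier_fun (fun x => (th x)%:C) xi)].
  move=> t; have s := test_IF_schwartz t; have s' := test_IF_schwartz (test_opp t).
  have ith := test_int t.
  have E1 x : inv_fourier_fun (fun x => (th (- x))%:C) x = inv_fourier_fun (fun x => (th x)%:C) (- x).
    exact: (@inv_fourier_reflect R (fun y => (th y)%:C)).
  have E2 x : (inv_fourier_fun (fun x => (th x)%:C) x)^*%C = inv_fourier_fun (fun x => (th (- x))%:C) x.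
    rewrite (inv_fourier_conj x ith); congr (inv_fourier_fun _ x); apply/funext => y.
    exact: conj_realC.
  have i1 := hg.1 _ s'.
  have i2 : cintegrable (fun xi => (g xi)^*%C * inv_fourier_fun (fun x => (th x)%:C) xi).
    have := cintegrable_conj i1; congr cintegrable; apply/funext => xi.
    by rewrite conjM -E2 conjcK.
  have i3 : cintegrable (fun xi => g (- xi) * inv_fourier_fun (fun x => (th x)%:C) xi).
    have := cintegrable_mpres mpres_opp i1; congr cintegrable; apply/funext => xi.
    by rewrite E1 opprK.
  split => //.
  transitivity (cintegral (fun xi => g xi * inv_fourier_fun (fun x => (th (- x))%:C) xi)).
    rewrite -(cintegral_mpres mpres_opp (cintegrable_meas i1)).
    by apply: eq_cintegral => xi; rewrite E1 opprK.
  transitivity ((cintegral (fun xi => g xi * inv_fourier_fun (fun x => (th (- x))%:C) xi))^*%C); last first.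
    rewrite -(cintegral_conj i1); apply: eq_cintegral => xi.
    by rewrite conjM -E2 conjcK.
  rewrite -(field_Cc (test_Cc (test_opp t))).
  rewrite (@eq_cintegral _ _ (fun x => (u x * th (- x))%:C)); last by move=> x; rewrite realCM.
  by rewrite cintegral_real conj_realC.
have : {ae mu, forall xi, g (- xi) - (g xi)^*%C = 0}.
  apply: (test_separation hpsi).
  - by apply: cmeasB => //; apply: cmeas_conj; exact: g_meas.
  - move=> th t; have [i1 i2 _] := key _ t.
    by have := cintegrableB i1 i2; under eq_fun do rewrite -mulrBl.
  - move=> th t; have [i1 i2 e] := key _ t.
    rewrite (eq_cintegral (fun xi => mulrBl _ _ _)) (cintegralB i1 i2) e subrr //.
by apply: aeS => xi /eqP; rewrite subr_eq0 => /eqP.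
Qed.

Hypothesis hL2 : L2 (fun xi => (sq xi)%:C * g xi).
(** Where |xi| > 1 the energy weight exceeds 1, so this part is square integrable, while the part
    near the origin is merely integrable. Hence the field is a bounded function plus an L2 one. *)
Definition high_part xi : R[i] := g xi - cut 1 g xi.

Lemma high_part_meas : cmeas high_part.
Proof. by apply: cmeasB; [exact: g_meas|apply: cut_meas; exact: g_meas]. Qed.

Lemma high_part_L2 : L2 high_part.
Proof.
apply: (L2_le (M := 1) high_part_meas _ hL2) => xi; rewrite mul1r /high_part cmodM cmod_real.
rewrite ger0_norm ?sq_ge0 //; have [h|h] := leP (enorm xi) 1.
  by rewrite /cut ball3_in // mul1r subrr cmod0 mulr_ge0 ?sq_ge0 ?cmod_ge0.
rewrite /cut ball3_out // mul0r subr0 ler_peMl ?cmod_ge0 //.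
by rewrite -[leLHS](@sqrtr1 R) ler_wsqrtr // ltW.
Qed.

Lemma cut_high n xi : (0 < n)%N -> cut n g xi = cut 1 g xi + cut n high_part xi.
Proof.
move=> n0; rewrite /high_part /cut; have [h|h] := leP (enorm xi) 1.
  by rewrite !ball3_in // ?mul1r ?subrr ?addr0 // (le_trans h) // ler1n.
by rewrite (@ball3_out _ 1) // !mul0r subr0 add0r.
Qed.

Lemma field_split : exists w, FT2 high_part w /\
  {ae mu, forall x, U x = inv_fourier_fun (cut 1 g) x + w x}.
Proof.
have [w hw] := FT2_exists high_part_L2; exists w; split => //.
have [_ lw _] := hw; have i1 := g_cut 1; have [M M0 hM] := inv_fourier_bounded i1.
have mU : cmeas U by exact: (tempered_meas hpsi tU).
have mI := cmeas_inv_fourier i1.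
have : {ae mu, forall x, U x - (inv_fourier_fun (cut 1 g) x + w x) = 0}.
  have ints th : test_function th -> [/\
      cintegrable (fun x => U x * inv_fourier_fun (fun y => (th y)%:C) x),
      cintegrable (fun x => inv_fourier_fun (cut 1 g) x * inv_fourier_fun (fun y => (th y)%:C) x) &
      cintegrable (fun x => w x * inv_fourier_fun (fun y => (th y)%:C) x)].
    move=> t; have s := test_IF_schwartz t; split.
    - exact: (tU s).
    - exact: (cintegrable_boundM mI hM (schwartz_int s)).
    - exact: (L2_tempered lw s).
  apply: (test_separation hpsi).
  - by apply: cmeasB => //; apply: cmeasD => //; exact: lw.1.
  - move=> th t; have [h1 h2 h3] := ints _ t.
    have := cintegrableB h1 (cintegrableD h2 h3); congr cintegrable; apply/funext => x.
    by rewrite mulrBl mulrDl.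
  - move=> th t; have [h1 h2 h3] := ints _ t; have s := test_IF_schwartz t.
    have iS := schwartz_int s.
    have IIt xi : inv_fourier_fun (inv_fourier_fun (fun y => (th y)%:C)) xi = (th (- xi))%:C.
      by have := congr1 (@^~ (- xi)) (inversion' (test_Cc t)); rewrite /= fourierE opprK.
    have ct : Cc (fun xi => (th (- xi))%:C) by exact: (test_Cc (test_opp t)).
    rewrite (@eq_cintegral _ _ (fun x => U x * inv_fourier_fun (fun y => (th y)%:C) x -
      (inv_fourier_fun (cut 1 g) x * inv_fourier_fun (fun y => (th y)%:C) x +
       w x * inv_fourier_fun (fun y => (th y)%:C) x))); last by move=> x; rewrite mulrBl mulrDl.
    rewrite (cintegralB h1 (cintegrableD h2 h3)) (cintegralD h2 h3) (field_test t).
    have -> : cintegral (fun x => inv_fourier_fun (cut 1 g) x * inv_fourier_fun (fun y => (th y)%:C) x) =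
        cintegral (fun xi => cut 1 g xi * (th (- xi))%:C).
      transitivity (cintegral (fun x => inv_fourier_fun (fun y => (th y)%:C) x * inv_fourier_fun (cut 1 g) x)).
        by apply: eq_cintegral => x; rewrite mulrC.
      by rewrite (inv_fourier_mult iS i1); apply: eq_cintegral => x; rewrite IIt.
    have -> : cintegral (fun x => w x * inv_fourier_fun (fun y => (th y)%:C) x) =
        cintegral (fun xi => high_part xi * (th (- xi))%:C).
      by rewrite (FT2_dual hw iS (schwartz_L2 s)); apply: eq_cintegral => x; rewrite IIt.
    have k1 : cintegrable (fun xi => cut 1 g xi * (th (- xi))%:C).
      under eq_fun do rewrite mulrC.
      have [C C0 hC] := Cc_bounded ct.
      exact: (cintegrable_boundM (csmooth_meas (Cc_smooth ct)) hC i1).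
    have k2 : cintegrable (fun xi => high_part xi * (th (- xi))%:C).
      exact: (L2_mul high_part_L2 (schwartz_L2 (Cc_schwartz ct))).
    rewrite -(cintegralD k1 k2); apply/eqP; rewrite subr_eq0; apply/eqP.
    by apply: eq_cintegral => xi; rewrite /high_part; ring.
by apply: aeS => x /eqP; rewrite subr_eq0 => /eqP.
Qed.

(** The field need not be in L2. The truncation error is, because the part below frequency 1 is the
    same in the field and in its truncation. *)
Lemma field_approx : exists w : nat -> E3 R -> R[i],
  [/\ forall n, L2 (w n), nn2 (w n) @[n --> \oo] --> (0 : R) &
      forall n, (0 < n)%N -> {ae mu, forall x, inv_fourier_fun (cut n g) x = U x + w n x}].
Proof.
have [v [hv aev]] := field_split; have [lh lv hc] := hv.
exists (fun n x => inv_fourier_fun (cut n high_part) x - v x); split => //.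
  by move=> n; apply: L2B => //; exact: (bessel (cut_int n lh) (cut_L2 n lh)).1.
move=> n n0; apply: aeS aev => x ->.
have -> : cut n g = fun xi => cut 1 g xi + cut n high_part xi.
  by apply/funext => xi; exact: cut_high.
rewrite (inv_fourierD x (g_cut 1) (cut_int n lh)); ring.
Qed.

End scalar_field.

Section product_of_fields.
Context {R : realType}.
Local Notation mu := (leb3 R).
Implicit Types (f F G H K A B C : E3 R -> R[i]) (x xi : E3 R) (j : 'I_3).

Lemma realC_sum (E : 'I_3 -> R) : (\sum_(j < 3) E j)%:C = \sum_(j < 3) (E j)%:C :> R[i].
Proof. exact: rmorph_sum. Qed.

Lemma nn2Z (M : R) f : L2 f -> nn2 (fun x => M%:C * f x) = M ^+ 2 * nn2 f.
Proof.
move=> lf; rewrite /nn2 -RintegralZl //; last exact: lf.2.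
by apply: eq_Rintegral => x _; rewrite cmodM cmod_real exprMn real_normK ?num_real.
Qed.

Lemma nn2_boundM B (M : R) f : cmeas B -> 0 <= M -> (forall x, cmod (B x) <= M) -> L2 f ->
  nn2 (fun x => B x * f x) <= M ^+ 2 * nn2 f.
Proof.
move=> mB M0 hM lf; rewrite -(nn2Z M lf); apply: nn2_le.
- exact: (L2_boundM mB hM lf).
- exact: L2Z.
- by move=> x; rewrite !cmodM cmod_real ger0_norm // ler_wpM2r ?cmod_ge0.
Qed.

(** A companion of [inv_fourier_trilinear] with the third factor given in physical space;
    integrability of the three functions suffices, boundedness of transforms taking the place of
    Plancherel. *)
Lemma inv_fourier_pairing A B C : cintegrable A -> cintegrable B -> cintegrable C ->
  cintegral (fun x => inv_fourier_fun A x * (inv_fourier_fun B x * C x)) =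
  c0%:C * dint (tker A B (fun eta => inv_fourier_fun C (- eta))).
Proof.
move=> iA iB iC; have [M M0 hM] := inv_fourier_bounded iB.
have iP : cintegrable (fun x => inv_fourier_fun B x * C x).
  exact: (cintegrable_boundM (cmeas_inv_fourier iB) hM iC).
have [K K0 hK] := inv_fourier_bounded iC.
transitivity (cintegral (fun x => (inv_fourier_fun B x * C x) * inv_fourier_fun A x)).
  by apply: eq_cintegral => x; rewrite mulrC.
rewrite (inv_fourier_mult iP iA).
have iN := inv_fourier_bounded iP.
have mC : cmeas (fun eta : E3 R => inv_fourier_fun C (- eta)).
  exact: (cmeas_mpres mpres_opp (cmeas_inv_fourier iC)).
have E z : A z * inv_fourier_fun (fun x => inv_fourier_fun B x * C x) z =
    c0%:C * cintegral (fun x => tker A B (fun eta => inv_fourier_fun C (- eta)) (z, x)).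
  have iBC : cintegrable (fun x => B x * inv_fourier_fun C (- (- z - x))).
    have mC' := cmeas_mpres (mpres_sub (- z)) mC.
    under eq_fun do rewrite mulrC.
    by apply: (cintegrable_boundM mC' _ iB) => x; exact: hK.
  rewrite /tker /= (cintegralZ (A z) iBC) [RHS]mulrCA; congr (_ * _).
  rewrite inv_fourierE; congr (_ * _).
  transitivity (cintegral (fun x => (expi (dot z x) * C x) * inv_fourier_fun B x)).
    by apply: eq_cintegral => x; rewrite mulrA [RHS]mulrAC.
  rewrite (inv_fourier_mult (cintegrable_expi z iC) iB).
  by apply: eq_cintegral => x; rewrite inv_fourier_modulate opprB opprK addrC.
have dT : dbl (tker A B (fun eta => inv_fourier_fun C (- eta))).
  split; first by apply: tker_meas; [exact: cintegrable_meas iA|exact: cintegrable_meas iB|exact: mC].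
  by apply: (tri_lt_bounded iA iB mC) => x; exact: hK.
have [_ iT _] := dbl_fubini dT.
rewrite /dint -(cintegralZ c0%:C iT).
by apply: eq_cintegral => z; rewrite E.
Qed.

Lemma dint_cut_cvg A B C : cmeas A -> cmeas B -> cmeas C -> dbl (tker A B C) ->
  cmod (dint (tker (cut n.+1 A) (cut n.+1 B) C) - dint (tker A B C)) @[n --> \oo] --> (0 : R).
Proof.
move=> mA mB mC d.
have mn n : cmeas (tker (cut n.+1 A) (cut n.+1 B) C).
  by apply: tker_meas; [exact: cut_meas|exact: cut_meas|exact: mC].
refine (proj2 (@dint_cvg R (fun n => tker (cut n.+1 A) (cut n.+1 B) C) _ _ mn d.1 d _ _)).
  move=> n p; rewrite /tker (cmodM (cut n.+1 A p.1)) (cmodM (cut n.+1 B p.2)) (cmodM (A p.1)) (cmodM (B p.2)).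
  have h1 := cut_le n.+1 A p.1; have h2 := cut_le n.+1 B p.2.
  by apply: (ler_pM (cmod_ge0 _) _ h1); [rewrite mulr_ge0 ?cmod_ge0|exact: (ler_wpM2r (cmod_ge0 _) h2)].
move=> p; apply: cvg_near_cst; exists (Num.bound (Num.max (enorm p.1) (enorm p.2))) => // n /= hn.
have m0 : 0 <= Num.max (enorm p.1) (enorm p.2) by rewrite le_max enorm_ge0.
have : Num.max (enorm p.1) (enorm p.2) <= n.+1%:R.
  by apply: (le_trans (ltW (archi_boundP m0))); rewrite ler_nat leqW.
rewrite ge_max => /andP[b1 b2]; rewrite /tker /cut (ball3_in b1) (ball3_in b2).
by rewrite !mul1r subrr cmod0.
Qed.

Variables (psi : E3 R -> R) (u1 u2 : E3 R -> R) (g1 g2 : E3 R -> R[i]).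
Hypothesis hpsi : LP_cutoff psi.
Hypothesis tU1 : tempered_fun (fun x => (u1 x)%:C).
Hypothesis tU2 : tempered_fun (fun x => (u2 x)%:C).
Hypothesis hg1 : represents g1 (fourier (of_fun (fun x => (u1 x)%:C))).
Hypothesis hg2 : represents g2 (fourier (of_fun (fun x => (u2 x)%:C))).
Hypothesis l1 : L2 (fun xi => (sq xi)%:C * g1 xi).
Hypothesis l2 : L2 (fun xi => (sq xi)%:C * g2 xi).
Let mg1 : cmeas g1. Proof. exact: (g_meas hpsi hg1). Qed.
Let mg2 : cmeas g2. Proof. exact: (g_meas hpsi hg2). Qed.

(** Each g splits into an integrable low part and a square integrable high part. Low-low uses the
    bound on C, low-high its L2 norm, high-high its L1 norm. *)
Lemma pair_dbl C (K : R) : cintegrable C -> L2 C -> (forall x, cmod (C x) <= K) ->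
  dbl (tker g1 g2 C).
Proof.
move=> iC lC hK; have mC := lC.1.
have c1 := g_cut hpsi hg1 1; have c2 := g_cut hpsi hg2 1.
have h1 := high_part_L2 hpsi hg1 l1; have h2 := high_part_L2 hpsi hg2 l2.
have [m1 m1'] := (cintegrable_meas c1, h1.1); have [m2 m2'] := (cintegrable_meas c2, h2.1).
have d (A B : E3 R -> R[i]) : cmeas A -> cmeas B -> (tri A B C < +oo)%E -> dbl (tker A B C).
  by move=> mA mB hh; split; [exact: tker_meas|exact: hh].
have d11 : dbl (tker (cut 1 g1) (cut 1 g2) C).
  by apply: d => //; exact: (tri_lt_bounded c1 c2 mC hK).
have d12 : dbl (tker (cut 1 g1) (high_part g2) C).
  by apply: d => //; exact: (tri_lt_L1 c1 h2 lC).
have d21 : dbl (tker (high_part g1) (cut 1 g2) C).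
  by apply: d => //; rewrite (tri_swap m1' m2 mC); exact: (tri_lt_L1 c2 h1 lC).
have d22 : dbl (tker (high_part g1) (high_part g2) C).
  apply: d => //; rewrite (tri_rot m1' m2' mC) (tri_swap m1' mC m2').
  exact: (tri_lt_L1 iC h1 h2).
have := dblD (dblD d11 d12) (dblD d21 d22); congr dbl; apply/funext => p.
by rewrite /tker /high_part; ring.
Qed.

Variable th : E3 R -> R.
Hypothesis t : test_function th.

Local Notation Ct := (fun eta => inv_fourier_fun (fun x => (th x)%:C) (- eta)).

Lemma product_dbl : dbl (tker g1 g2 Ct).
Proof.
have s := test_IF_schwartz t; have [K K0 hK] := inv_fourier_bounded (test_int t).
apply: (pair_dbl (K := K)); last by move=> x; exact: hK.
- exact: (cintegrable_mpres mpres_opp (schwartz_int s)).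
- exact: (L2_mpres mpres_opp (schwartz_L2 s)).
Qed.

(** The factor th makes both fields square integrable: one is cut to a ball containing the support
    of th, the other is multiplied by th. For truncated transforms the identity is
    [inv_fourier_pairing], and both sides pass to the limit. *)
Lemma product_field : cintegrable (fun x => (u1 x)%:C * ((u2 x)%:C * (th x)%:C)) /\
  cintegral (fun x => (u1 x)%:C * ((u2 x)%:C * (th x)%:C)) = c0%:C * dint (tker g1 g2 Ct).
Proof.
have ct := test_Cc t; have it := test_int t.
have [M M0 hM] := Cc_bounded ct; have [r hr] := ct.2.
have mt := csmooth_meas (Cc_smooth ct).
have [w1 [lw1 nw1 e1]] := field_approx hpsi tU1 hg1 l1.
have [w2 [lw2 nw2 e2]] := field_approx hpsi tU2 hg2 l2.
have mU1 := tempered_meas hpsi tU1; have mU2 := tempered_meas hpsi tU2.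
pose N := Num.bound (Num.max r 0).
have bt x : ball3 N x * (th x)%:C = (th x)%:C.
  have [h|h] := leP (enorm x) N%:R; first by rewrite ball3_in // mul1r.
  rewrite hr ?mulr0 //; apply: le_lt_trans h.
  by apply: (le_trans _ (ltW (archi_boundP _))); rewrite le_max lexx ?orbT.
pose F n x := ball3 N x * inv_fourier_fun (cut n.+1 g1) x.
pose G n x := (th x)%:C * inv_fourier_fun (cut n.+1 g2) x.
pose f x := ball3 N x * (u1 x)%:C.
pose g x := (th x)%:C * (u2 x)%:C.
have lF n : L2 (F n).
  have ic := g_cut hpsi hg1 n.+1; have [K K0 hK] := inv_fourier_bounded ic.
  rewrite /F; under eq_fun do rewrite mulrC.
  exact: (L2_boundM (cmeas_inv_fourier ic) hK (ball3_L2 N)).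
have lG n : L2 (G n).
  have ic := g_cut hpsi hg2 n.+1; have [K K0 hK] := inv_fourier_bounded ic.
  rewrite /G; under eq_fun do rewrite mulrC.
  exact: (L2_boundM (cmeas_inv_fourier ic) hK (schwartz_L2 (Cc_schwartz ct))).
have mf : cmeas f by apply: cmeasM => //; exact: ball3_meas.
have mg : cmeas g by exact: cmeasM.
have lb1 n : L2 (fun x => ball3 N x * w1 n.+1 x).
  exact: (L2_boundM (ball3_meas N) (ball3_le1 N) (lw1 n.+1)).
have lb2 n : L2 (fun x => (th x)%:C * w2 n.+1 x) by exact: (L2_boundM mt hM (lw2 n.+1)).
have aF n : {ae mu, forall x, F n x - f x = ball3 N x * w1 n.+1 x}.
  by apply: aeS (e1 n.+1 isT) => x; rewrite /F /f => ->; ring.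
have aG n : {ae mu, forall x, G n x - g x = (th x)%:C * w2 n.+1 x}.
  by apply: aeS (e2 n.+1 isT) => x; rewrite /G /g => ->; ring.
have lf : L2 f.
  apply: ae_eq_L2 mf _ (L2B (lF 0%N) (lb1 0%N)); apply: aeS (aF 0%N) => x <-.
  by rewrite opprB addrCA subrr addr0.
have lg : L2 g.
  apply: ae_eq_L2 mg _ (L2B (lG 0%N) (lb2 0%N)); apply: aeS (aG 0%N) => x <-.
  by rewrite opprB addrCA subrr addr0.
have shift (v : nat -> R) : v n @[n --> \oo] --> (0 : R) -> v n.+1 @[n --> \oo] --> (0 : R).
  by move=> h; have := cvg_shiftS v; move=> e; rewrite e.
have cF : nn2 (fun x => F n x - f x) @[n --> \oo] --> (0 : R).
  apply: null_le (shift _ nw1) => n; rewrite nn2_ge0 /=.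
  rewrite (ae_eq_nn2 (cmeasB (lF n).1 mf) (lb1 n).1 (aF n)).
  by apply: le_trans (nn2_boundM (ball3_meas N) ler01 (ball3_le1 N) (lw1 n.+1)) _; rewrite expr1n mul1r.
have cG : nn2 (fun x => G n x - g x) @[n --> \oo] --> (0 : R).
  apply: null_le (null_scale (M ^+ 2) (shift _ nw2)) => n; rewrite nn2_ge0 /=.
  rewrite (ae_eq_nn2 (cmeasB (lG n).1 mg) (lb2 n).1 (aG n)).
  exact: (nn2_boundM mt M0 hM (lw2 n.+1)).
have fgE x : f x * g x = (u1 x)%:C * ((u2 x)%:C * (th x)%:C).
  by rewrite /f /g -[in RHS]bt; ring.
split; first by have := L2_mul lf lg; congr cintegrable; apply/funext => x; rewrite fgE.
have P1 := pair_cvg lF lG lf lg cF cG; rewrite (eq_cintegral fgE) in P1.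
have mC : cmeas (fun eta : E3 R => inv_fourier_fun (fun x => (th x)%:C) (- eta)).
  exact: (cmeas_mpres mpres_opp (cmeas_inv_fourier it)).
have P2 := dint_cut_cvg mg1 mg2 mC product_dbl.
apply: null_unique P1 _.
have E n : cintegral (fun x => F n x * G n x) = c0%:C * dint (tker (cut n.+1 g1) (cut n.+1 g2) Ct).
  rewrite -(inv_fourier_pairing (g_cut hpsi hg1 n.+1) (g_cut hpsi hg2 n.+1) it).
  by apply: eq_cintegral => x; rewrite /F /G -[in RHS]bt; ring.
under eq_fun do rewrite E -mulrBr cmodM.
exact: null_scale.
Qed.

End product_of_fields.

(** * The equation on the Fourier side *)

Section navier_stokes.
Context {R : realType}.
Variables (psi : E3 R -> R) (u : 'I_3 -> E3 R -> R).
Hypothesis hpsi : LP_cutoff psi.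
Hypothesis hu : weak_solution (1 / 2) u.
Local Notation mu := (leb3 R).
Implicit Types (f F G H K : E3 R -> R[i]) (x xi : E3 R) (i j l m : 'I_3) (th : E3 R -> R).

Definition spectrum i : E3 R -> R[i] := fun_of (fourier (dist_of_field u i)).
Local Notation g := spectrum.

Lemma ae_ord3 (P : 'I_3 -> E3 R -> Prop) : (forall i, {ae mu, forall x, P i x}) ->
  {ae mu, forall x, forall i, P i x}.
Proof.
move=> h; apply: (aeS2 _ (h 0) (aeS2 (fun x a b => conj a b) (h 1) (h ord_max))) => x h0 [h1 h2] i.
have : i = 0 \/ i = 1 \/ i = ord_max.
  by case: i => -[|[|[|//]]] iP; [left|right;left|right;right]; exact: val_inj.
by move=> [->|[->|->]].
Qed.

Lemma u_tempered i : tempered_fun (fun x => (u i x)%:C). Proof. by case: hu. Qed.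

Lemma g_represents i : represents (g i) (fourier (of_fun (fun x => (u i x)%:C))).
Proof. by case: hu => _ /(_ i) [_ [f hf] _] _ _; exact: (fun_of_represents hf). Qed.

Let mg i : cmeas (g i). Proof. exact: (g_meas hpsi (g_represents i)). Qed.

Lemma cmod_sqM f xi : cmod ((sq xi)%:C * f xi) ^+ 2 = enorm xi * cmod (f xi) ^+ 2.
Proof. by rewrite cmodM cmod_real ger0_norm ?sq_ge0 // exprMn sq_sqr. Qed.

Lemma g_L2 i : L2 (fun xi => (sq xi)%:C * g i xi).
Proof.
have ms : cmeas (fun xi => (sq xi)%:C * g i xi) by exact: cmeas_sqM.
split => //; apply/integrableP; split.
  by apply/measurable_EFinP; apply: measurable_funX; exact: measurable_cmod.
case: hu => _ /(_ i) [_ _ h] _ _; apply: le_lt_trans h; rewrite le_eqVlt; apply/orP; left.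
apply/eqP; apply: eq_integral => xi _; rewrite /= ger0_norm ?sqr_ge0 // cmod_sqM.
by rewrite (_ : 2 * (1 / 2) = 1 :> R) ?powRr1 ?enorm_ge0 //; field.
Qed.

Lemma test_IF_pd th j xi : test_function th ->
  inv_fourier_fun (fun x => (pd j th x)%:C) xi =
  - ('i%C * (coord3 xi j)%:C) * inv_fourier_fun (fun x => (th x)%:C) xi.
Proof. by move=> t; rewrite -(inv_fourier_ibp_Cc j xi (test_Cc t)) cpd_real. Qed.

Lemma spectrum_div : {ae mu, forall xi, \sum_(j < 3) (coord3 xi j)%:C * g j xi = 0}.
Proof.
apply: (test_separation hpsi).
- by apply: cmeas_sum => j; apply: cmeasM => //; exact: cmeas_coord.
- move=> th t.
  have := @cintegrable_sum R _ (index_enum 'I_3) (fun j xi => 'i%C * (g j xi * inv_fourier_fun (fun x => (pd j th x)%:C) xi)).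
  rewrite (_ : (fun xi => (\sum_(j < 3) _) * _) = fun xi => \sum_(j < 3) 'i%C * (g j xi * inv_fourier_fun (fun x => (pd j th x)%:C) xi)).
    apply => j; apply: cintegrableZ; apply: (g_represents j).1; apply: test_IF_schwartz; exact: pd_test.
  apply/funext => xi; rewrite mulr_suml; apply: eq_bigr => j _; rewrite (test_IF_pd j xi t).
  have ii : 'i%C * 'i%C = -1 :> R[i] by rewrite -expr2 sqr_i.
  rewrite [RHS](_ : _ = - ('i%C * 'i%C) * ((coord3 xi j)%:C * g j xi * inv_fourier_fun (fun x => (th x)%:C) xi)).
    by rewrite ii opprK mul1r.
  by ring.
- move=> th t.
  have ip j : cintegrable (fun x => (u j x)%:C * (pd j th x)%:C).
    by apply: (u_tempered j); apply: Cc_schwartz; apply: test_Cc; exact: pd_test.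
  have ig j : cintegrable (fun xi => g j xi * inv_fourier_fun (fun x => (pd j th x)%:C) xi).
    by apply: (g_represents j).1; apply: test_IF_schwartz; exact: pd_test.
  transitivity (\sum_(j < 3) 'i%C * cintegral (fun xi => g j xi * inv_fourier_fun (fun x => (pd j th x)%:C) xi)).
    transitivity (cintegral (fun xi => \sum_(j < 3) 'i%C * (g j xi * inv_fourier_fun (fun x => (pd j th x)%:C) xi))).
      apply: eq_cintegral => xi; rewrite mulr_suml; apply: eq_bigr => j _; rewrite (test_IF_pd j xi t).
      have ii : 'i%C * 'i%C = -1 :> R[i] by rewrite -expr2 sqr_i.
      rewrite [RHS](_ : _ = - ('i%C * 'i%C) * ((coord3 xi j)%:C * g j xi * inv_fourier_fun (fun x => (th x)%:C) xi)).
        by rewrite ii opprK mul1r.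
      by ring.
    rewrite cintegral_sum; last by move=> j; apply: cintegrableZ; exact: ig.
    by apply: eq_bigr => j _; rewrite cintegralZ.
  rewrite -mulr_sumr.
  rewrite (eq_bigr (fun j => cintegral (fun x => (u j x)%:C * (pd j th x)%:C))); last first.
    by move=> j _; rewrite (field_Cc (g_represents j) (test_Cc (pd_test j t))).
  rewrite -(cintegral_sum _ ip).
  rewrite (@eq_cintegral _ _ (fun x => (\sum_(j < 3) u j x * pd j th x)%:C)); last first.
    by move=> x; rewrite realC_sum; apply: eq_bigr => j _; rewrite realCM.
  by rewrite cintegral_real; case: hu => _ _ -> // _; rewrite mulr0.
Qed.

Lemma spectrum_conj i : {ae mu, forall xi, g i (- xi) = (g i xi)^*%C}.
Proof. exact: (field_conj hpsi (g_represents i)). Qed.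

Lemma velocity_lap (s : R) i v : 2 * s = 1 / 2 -> FT2 (fun xi => (sq xi)%:C * g i xi) v ->
  represents v (vfrac_lap s (dist_of_field u) i).
Proof. by move=> hs hv; apply: frac_lap_represents; [exact: hs|exact: hv]. Qed.

(** The reflected argument is the one at which [FT2_pair] evaluates its second factor. The weighted
    transform is square integrable since the transform is bounded and has a second moment. *)
Lemma test_lap th : test_function th -> exists H w,
  [/\ FT2 H w, {ae mu, forall xi, H (- xi) = (sq xi)%:C * inv_fourier_fun (fun x => (th x)%:C) xi} &
    represents w (frac_lap (1 / 2 / 2) (of_fun (fun x => (th x)%:C)))].
Proof.
move=> t; pose T := of_fun (fun x => (th x)%:C); have s := test_IF_schwartz t.
have it := test_int t; have st := Cc_schwartz (test_Cc t).
have r : represents (fourier_fun (fun x => (th x)%:C)) (fourier T).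
  have FE : fourier_fun (fun x => (th x)%:C) = inv_fourier_fun (fun x => (th (- x))%:C).
    by apply/funext => x; rewrite fourierE (@inv_fourier_reflect R (fun y => (th y)%:C)).
  rewrite FE; apply: represents_inv_fourier; first exact: (test_int (test_opp t)).
  move=> phi sp; rewrite /fourier /T /of_fun.
  have ip := schwartz_int sp; have [M M0 hM] := inv_fourier_bounded ip.
  have mm : cmeas (fun xi => (th (- xi))%:C * inv_fourier_fun phi xi).
    apply: cmeasM; last exact: cmeas_inv_fourier.
    exact: (cintegrable_meas (test_int (test_opp t))).
  rewrite -(cintegral_mpres mpres_opp mm); apply: eq_cintegral => x.
  by rewrite opprK fourierE.
have rf := fun_of_represents r; have ae1 := fun_of_ae hpsi r.
pose H xi : R[i] := (sq xi)%:C * fun_of (fourier T) xi.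
have mf := tempered_meas hpsi rf.1.
have sF : L2 (fun xi => (sq xi)%:C * inv_fourier_fun (fun x => (th x)%:C) xi).
  have cm : cintegrable (fun xi => ((1 + enorm xi) ^+ 2)%:C * inv_fourier_fun (fun x => (th x)%:C) xi).
    exact: (schwartz_mom 2 s).
  have [M M0 hM] := inv_fourier_bounded it.
  apply: (L2_dom (cmeas_sqM (schwartz_meas s)) (integrable_scale M (integrable_cmod cm))) => xi.
  rewrite (@cmod_sqM (inv_fourier_fun (fun x => (th x)%:C))) expr2 mulrA [M * _]mulrC cmodM cmod_real.
  apply: ler_pM; rewrite ?mulr_ge0 ?enorm_ge0 ?cmod_ge0 //; apply: ler_wpM2r; first exact: cmod_ge0.
  rewrite ger0_norm ?sqr_ge0 //; have := enorm_ge0 xi; set e := enorm xi; nra.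
have aeH : {ae mu, forall xi, H (- xi) = (sq xi)%:C * inv_fourier_fun (fun x => (th x)%:C) xi}.
  have := ae_mpres mpres_opp ae1; apply: aeS => xi; rewrite /H sqN => ->.
  by rewrite fourierE opprK.
have lH : L2 H.
  apply: (ae_eq_L2 (cmeas_sqM mf) _ (L2_mpres mpres_opp sF)).
  have := ae_mpres mpres_opp aeH; apply: aeS => xi; rewrite opprK => <-; by [].
have [w hw] := FT2_exists lH; exists H, w; split; [exact: hw|exact: aeH|].
apply: frac_lap_represents; [by field|exact: hw].
Qed.

(** For a divergence free test field the pressure is evaluated at the zero function, so its term
    vanishes. [FT2_pair] treats the dissipative side and [product_field] the transport side. *)
Lemma weak_fourier (phi : 'I_3 -> E3 R -> R) : (forall i, test_function (phi i)) ->
  (forall x, \sum_(i < 3) pd i (phi i) x = 0) ->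
  (forall i, cintegrable (fun xi => (enorm xi)%:C * g i xi * inv_fourier_fun (fun x => (phi i x)%:C) xi)) /\
  \sum_(i < 3) cintegral (fun xi => (enorm xi)%:C * g i xi * inv_fourier_fun (fun x => (phi i x)%:C) xi) =
  \sum_(i < 3) \sum_(j < 3) c0%:C * dint (tker (g i) (g j)
    (fun eta => inv_fourier_fun (fun x => (pd j (phi i) x)%:C) (- eta))).
Proof.
move=> tphi dphi.
have hs : 2 * (1 / 2 / 2) = 1 / 2 :> R by field.
have V i : exists v, FT2 (fun xi => (sq xi)%:C * g i xi) v by exact: (FT2_exists (g_L2 i)).
have [v hv] := choice V.
have av i := velocity_lap hs (hv i).
have [H hH] := choice (fun i => test_lap (tphi i)).
have [w hw] := choice hH.
have lv i : L2 (v i) by case: (hv i).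
have lw i : L2 (w i) by case: (hw i) => [[]].
have ivw i := L2_mul (lv i) (lw i).
have lHo i : L2 (fun xi => H i (- xi)) by case: (hw i) => [[l _ _] _ _]; exact: (L2_mpres mpres_opp l).
have aE i : {ae mu, forall xi, (sq xi)%:C * g i xi * H i (- xi) =
    (enorm xi)%:C * g i xi * inv_fourier_fun (fun x => (phi i x)%:C) xi}.
  case: (hw i) => _ h _; apply: aeS h => xi ->; rewrite -sq_sqr expr2 realCM; ring.
have mE i : cmeas (fun xi => (enorm xi)%:C * g i xi * inv_fourier_fun (fun x => (phi i x)%:C) xi).
  apply: cmeasM; last exact: (schwartz_meas (test_IF_schwartz (tphi i))).
  by apply: cmeasM => //; apply: cmeas_real; exact: measurable_enorm.
have iH i := L2_mul (g_L2 i) (lHo i).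
split; first by move=> i; exact: (ae_eq_cintegrable (mE i) (aE i) (iH i)).
case: hu => _ _ _ [P [Plin _] /(_ phi tphi)].
have -> : (fun x => (\sum_(i < 3) pd i (phi i) x)%:C) = (fun=> 0 : R[i]).
  by apply/funext => x; rewrite dphi.
have P0 : P (fun=> 0) = 0.
  have s0 : schwartz (fun _ : E3 R => 0 : R[i]) by exact: (Cc_schwartz (test_Cc (@test0 R))).
  have := Plin 1 _ _ s0 s0; rewrite (_ : (fun x => 1 * 0 + 0) = fun=> 0); last by apply/funext => x; rewrite mulr0 addr0.
  by rewrite mul1r => /eqP; rewrite -subr_eq0 opprD addrA subrr sub0r oppr_eq0 => /eqP.
rewrite P0 addr0 => weak.
have prod i j := product_field hpsi (u_tempered i) (u_tempered j) (g_represents i) (g_represents j)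
  (g_L2 i) (g_L2 j) (pd_test j (tphi i)).
transitivity (\sum_(i < 3) cintegral (fun x => v i x * w i x)).
  apply: eq_bigr => i _; case: (hw i) => hFw _ _.
  rewrite (FT2_pair (hv i) hFw); apply/esym; apply: ae_eq_cintegral (aE i).
  - exact: (cintegrable_meas (iH i)).
  - exact: mE.
rewrite -(cintegral_sum _ ivw).
have mf (T : Defs.distribution R) f : represents f T -> cmeas (fun_of T).
  by move=> r; exact: (tempered_meas hpsi (fun_of_represents r).1).
transitivity (cintegral (fun x => \sum_(i < 3)
   fun_of (vfrac_lap (1 / 2 / 2) (dist_of_field u) i) x *
   fun_of (vfrac_lap (1 / 2 / 2) (dist_of_field phi) i) x)).
  have rw i : represents (w i) (vfrac_lap (1 / 2 / 2) (dist_of_field phi) i) by case: (hw i).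
  apply: ae_eq_cintegral.
  - exact: (cintegrable_meas (cintegrable_sum _ ivw)).
  - by apply: cmeas_sum => i; apply: cmeasM; [exact: mf (av i)|exact: mf (rw i)].
  - have a0 i := fun_of_ae hpsi (av i); have b0 i := fun_of_ae hpsi (rw i).
    have ab i : {ae mu, forall x, v i x * w i x = fun_of (vfrac_lap (1 / 2 / 2) (dist_of_field u) i) x *
        fun_of (vfrac_lap (1 / 2 / 2) (dist_of_field phi) i) x}.
      by apply: (aeS2 _ (a0 i) (b0 i)) => x e1 e2; exact: (esym (f_equal2 *%R e1 e2)).
    apply: (aeS _ (ae_ord3 ab)) => x h; apply: eq_bigr => i _; exact: h.
rewrite weak -cintegral_real.
transitivity (cintegral (fun x => \sum_(i < 3) \sum_(j < 3) (u i x)%:C * ((u j x)%:C * (pd j (phi i) x)%:C))).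
  apply: eq_cintegral => x; rewrite realC_sum; apply: eq_bigr => i _.
  by rewrite realC_sum; apply: eq_bigr => j _; rewrite !realCM mulrA.
rewrite cintegral_sum; last by move=> i; apply: cintegrable_sum => j; exact: (prod i j).1.
apply: eq_bigr => i _; rewrite cintegral_sum; last by move=> j; exact: (prod i j).1.
by apply: eq_bigr => j _; rewrite (prod i j).2.
Qed.

End navier_stokes.

(** * Elimination of the pressure and the energy identity at each frequency *)

Section spectral_equation.
Context {R : realType}.
Variables (psi : E3 R -> R) (u : 'I_3 -> E3 R -> R).
Hypothesis hpsi : LP_cutoff psi.
Hypothesis hu : weak_solution (1 / 2) u.
Local Notation mu := (leb3 R).
Local Notation g := (spectrum u).
Implicit Types (f F G H K A B C : E3 R -> R[i]) (x xi eta z : E3 R) (i j l m : 'I_3) (th : E3 R -> R).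

Let mg i : cmeas (g i). Proof. exact: (g_meas hpsi (g_represents hu i)). Qed.

Lemma inv_fourier_sum (F : 'I_3 -> E3 R -> R[i]) x : (forall j, cintegrable (F j)) ->
  inv_fourier_fun (fun xi => \sum_(j < 3) F j xi) x = \sum_(j < 3) inv_fourier_fun (F j) x.
Proof.
move=> iF; rewrite inv_fourierE; under [RHS]eq_bigr do rewrite inv_fourierE.
rewrite -mulr_sumr -cintegral_sum; last by move=> j; exact: (cintegrable_expi x (iF j)).
by congr (_ * _); apply: eq_cintegral => xi; rewrite mulr_sumr.
Qed.

(** The Leray projection times |xi|^2: a polynomial symbol, so that the corresponding test fields
    are compactly supported. *)
Definition leray i l xi : R := (i == l)%:R * dot xi xi - coord3 xi i * coord3 xi l.

(* A divergence free test field: its transform is that of [th] times the symbol [leray]. *)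
Definition solenoidal l th i x : R :=
  (i == l)%:R * (\sum_(m < 3) - 1 * pd m (pd m th) x) + pd i (pd l th) x.

Lemma solenoidal_test l th i : test_function th -> test_function (solenoidal l th i).
Proof.
move=> t; apply: testD; last by do 2 apply: pd_test.
apply: testZ; apply: (@test_sum R (fun m x => - 1 * pd m (pd m th) x)) => m.
by apply: testZ; do 2 apply: pd_test.
Qed.

Lemma solenoidal_transform l th i xi : test_function th ->
  inv_fourier_fun (fun x => (solenoidal l th i x)%:C) xi =
  (leray i l xi)%:C * inv_fourier_fun (fun x => (th x)%:C) xi.
Proof.
move=> t; have tt m k : test_function (pd m (pd k th)) by do 2 apply: pd_test.
have it m k := test_int (tt m k).
have IE m k : inv_fourier_fun (fun x => (pd m (pd k th) x)%:C) xi =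
    - (coord3 xi m * coord3 xi k)%:C * inv_fourier_fun (fun x => (th x)%:C) xi.
  rewrite (test_IF_pd m xi (pd_test k t)) (test_IF_pd k xi t) realCM.
  have ii : 'i%C * 'i%C = -1 :> R[i] by rewrite -expr2 sqr_i.
  rewrite [LHS](_ : _ = ('i%C * 'i%C) * ((coord3 xi m)%:C * (coord3 xi k)%:C * inv_fourier_fun (fun x => (th x)%:C) xi)).
    by rewrite ii mulN1r mulNr.
  by ring.
have -> : (fun x => (solenoidal l th i x)%:C) = fun x =>
   ((i == l)%:R)%:C * (\sum_(m < 3) (-1) * (pd m (pd m th) x)%:C) + (pd i (pd l th) x)%:C.
  apply/funext => x; rewrite /solenoidal rmorphD /= realCM realC_sum; congr (_ * _ + _).
  by apply: eq_bigr => m _; rewrite mulN1r mulN1r rmorphN.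
have iS m : cintegrable (fun x => (-1) * (pd m (pd m th) x)%:C) by exact: cintegrableZ.
rewrite inv_fourierD; [|exact: (cintegrableZ _ (cintegrable_sum _ iS))|exact: it].
rewrite (inv_fourierZ _ _ (cintegrable_sum _ iS)) (inv_fourier_sum xi iS) IE.
have -> : \sum_(m < 3) inv_fourier_fun (fun x => -1 * (pd m (pd m th) x)%:C) xi =
    (dot xi xi)%:C * inv_fourier_fun (fun x => (th x)%:C) xi.
  rewrite /dot realC_sum mulr_suml; apply: eq_bigr => m _.
  by rewrite (inv_fourierZ _ _ (it m m)) IE mulN1r mulNr opprK.
by rewrite /leray rmorphB /= !realCM; ring.
Qed.

Lemma leray_coord l xi : \sum_(i < 3) coord3 xi i * leray i l xi = 0.
Proof.
rewrite (eq_bigr (fun i => (i == l)%:R * coord3 xi i * dot xi xi - coord3 xi i * coord3 xi i * coord3 xi l)).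
  rewrite sumrB -!mulr_suml -/(dot xi xi) (bigD1 l) //= eqxx mul1r big1 ?addr0.
    by rewrite mulrC subrr.
  by move=> i /negbTE ->; rewrite mul0r.
by move=> i _; rewrite /leray; ring.
Qed.

(** Checked on the transform, where it is [leray_coord]; inversion brings it back, and no
    derivatives have to be commuted. *)
Lemma solenoidal_div l th x : test_function th ->
  \sum_(i < 3) pd i (solenoidal l th i) x = 0.
Proof.
move=> t; have ts i := solenoidal_test l i t.
pose dv x := \sum_(i < 3) pd i (solenoidal l th i) x.
have tdv : test_function dv by apply: test_sum => i; exact: pd_test.
have I0 : inv_fourier_fun (fun x => (dv x)%:C) = fun=> 0.
  apply/funext => xi.
  rewrite (_ : (fun x => (dv x)%:C) = fun x => \sum_(i < 3) (pd i (solenoidal l th i) x)%:C); last first.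
    by apply/funext => y; rewrite realC_sum.
  rewrite (@inv_fourier_sum (fun i x => (pd i (solenoidal l th i) x)%:C)); last first.
    by move=> i; apply: test_int; exact: pd_test.
  rewrite (eq_bigr (fun i => (coord3 xi i * leray i l xi)%:C * (- 'i%C * inv_fourier_fun (fun x => (th x)%:C) xi))).
    by rewrite -mulr_suml -realC_sum leray_coord mul0r.
  by move=> i _; rewrite (test_IF_pd i xi (ts i)) (solenoidal_transform l i xi t) realCM; ring.
have := congr1 (@^~ x) (inversion' (test_Cc tdv)); rewrite I0 fourierE inv_fourierE.
rewrite (@eq_cintegral _ _ (fun=> 0)) ?cintegral0 ?mulr0; last by move=> y; rewrite mulr0.
by move=> h; exact: (esym (congr1 (@complex.Re R) h)).
Qed.

Lemma cgauss_L2 : L2 (cgauss 1 : E3 R -> R[i]).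
Proof.
apply: (L2_dom (cgauss_meas 1) (integrable_cmod (cgauss_int ltr01))) => x.
by rewrite expr2 ler_piMr ?cmod_ge0 // cmod_real gtr0_norm ?gauss_gt0 // gauss_le1.
Qed.

Lemma dbl_perm A B C : cmeas A -> cmeas B -> cmeas C -> dbl (tker B C A) -> dbl (tker A B C).
Proof.
move=> mA mB mC [_ h]; split; first exact: tker_meas.
by rewrite -triE (tri_swap mA mB mC) (tri_rot mB mA mC).
Qed.

Lemma gauss_dbl i j : dbl (tker (cgauss 1) (g i) (g j)).
Proof.
apply: dbl_perm => //; first exact: cgauss_meas.
apply: (pair_dbl hpsi (g_represents hu i) (g_represents hu j) (g_L2 hpsi hu i) (g_L2 hpsi hu j) (K := 1)).
- exact: (cgauss_int ltr01).
- exact: cgauss_L2.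
- by move=> x; rewrite cmod_real gtr0_norm ?gauss_gt0 // gauss_le1.
Qed.

(* The integral of [g i xi * g j (- eta - xi)] in [xi]; it exists for almost every
   [eta] only, and the Gaussian factor makes the definition measurable. *)
Definition conv i j eta : R[i] :=
  (expquad 1 eta)%:C * cintegral (fun xi => tker (cgauss 1) (g i) (g j) (eta, xi)).

Lemma conv_meas i j : cmeas (conv i j).
Proof.
apply: cmeasM; last exact: (slice_cmeas (gauss_dbl i j)).
by apply: cmeas_real; apply: differentiable_measurable; exact: (expquad_pd 1).1.
Qed.

Lemma expquad_cgauss x : (expquad 1 x)%:C * cgauss 1 x = 1 :> R[i].
Proof. by rewrite /cgauss -realCM /gauss /expquad -expRD (_ : _ + _ = 0) ?expR0 //; ring. Qed.

(** For almost every eta the inner integral converges, and then the Gaussian in [conv] cancels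
    against its reciprocal. *)
Lemma conv_dint i j C : cmeas C -> dbl (tker C (g i) (g j)) ->
  cintegrable (fun eta => C eta * conv i j eta) /\
  dint (tker C (g i) (g j)) = cintegral (fun eta => C eta * conv i j eta).
Proof.
move=> mC0 d; have [aC iC _] := dbl_fubini d; have [aW iW _] := dbl_fubini (gauss_dbl i j).
have ae1 : {ae mu, forall eta, cintegral (fun xi => tker C (g i) (g j) (eta, xi)) = C eta * conv i j eta}.
  apply: (aeS _ aW) => eta iw.
  have ig : cintegrable (fun xi => g i xi * g j (- eta - xi)).
    have := cintegrableZ (expquad 1 eta)%:C iw; congr cintegrable; apply/funext => xi.
    by rewrite /tker /= mulrA expquad_cgauss mul1r.
  by rewrite /conv /tker /= (cintegralZ (C eta) ig) (cintegralZ (cgauss 1 eta) ig); congr (_ * _); rewrite mulrA expquad_cgauss mul1r.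
have mC : cmeas (fun eta => C eta * conv i j eta).
  by apply: cmeasM; [exact: mC0|exact: conv_meas].
split; first exact: (ae_eq_cintegrable mC ae1 iC).
by apply: ae_eq_cintegral ae1; [exact: (cintegrable_meas iC)|exact: mC].
Qed.

(** The equation at frequency -eta without its pressure: [conv] at eta is the convolution of the two
    transforms at -eta, and the derivative there has symbol -i eta_j. *)
Definition residual i eta : R[i] :=
  (enorm eta)%:C * g i (- eta) - 'i%C * c0%:C * (\sum_(j < 3) (coord3 eta j)%:C * conv i j eta).

Lemma residual_meas i : cmeas (residual i).
Proof.
apply: cmeasB.
  apply: cmeasM; first by apply: cmeas_real; exact: measurable_enorm.
  exact: (cmeas_mpres mpres_opp (mg i)).
apply: cmeasM; first exact: cmeas_cst.
by apply: cmeas_sum => j; apply: cmeasM; [exact: cmeas_coord|exact: conv_meas].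
Qed.

Lemma measurable_leray i l : measurable_fun setT (leray i l).
Proof.
apply: measurable_funB.
  by apply: measurable_funM; [exact: measurable_cst|apply: measurable_dot; exact: measurable_id].
by apply: measurable_funM; exact: measurable_coord3.
Qed.

Lemma leray_residual l : {ae mu, forall eta, \sum_(i < 3) (leray i l eta)%:C * residual i eta = 0}.
Proof.
have mK : cmeas (fun eta => \sum_(i < 3) (leray i l eta)%:C * residual i eta).
  by apply: cmeas_sum => i; apply: cmeasM; [apply: cmeas_real; exact: measurable_leray|exact: residual_meas].
have key th : test_function th ->
   cintegrable (fun eta => (\sum_(i < 3) (leray i l eta)%:C * residual i eta) * inv_fourier_fun (fun x => (th x)%:C) eta) /\
   cintegral (fun eta => (\sum_(i < 3) (leray i l eta)%:C * residual i eta) * inv_fourier_fun (fun x => (th x)%:C) eta) = 0.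
  (* The test function is reflected because the residual lives at -eta. *)
  move=> t; have t' := test_opp t.
  have ts i := solenoidal_test l i t'.
  have [iL weak] := weak_fourier hpsi hu ts (fun x => solenoidal_div l x t').
  have IFo xi : inv_fourier_fun (fun x => (th (- x))%:C) xi = inv_fourier_fun (fun x => (th x)%:C) (- xi).
    exact: (@inv_fourier_reflect R (fun y => (th y)%:C) xi (test_int t)).
  have lerayN i eta : leray i l (- eta) = leray i l eta.
    by rewrite /leray dotNl dotNr !coord3N mulrNN opprK.
  pose L i eta := (enorm eta)%:C * g i (- eta) * ((leray i l eta)%:C * inv_fourier_fun (fun x => (th x)%:C) eta).
  pose C i j eta : R[i] := 'i%C * (coord3 eta j)%:C * ((leray i l eta)%:C * inv_fourier_fun (fun x => (th x)%:C) eta).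
  have LE i eta : L i eta = (enorm (- eta))%:C * g i (- eta) *
      inv_fourier_fun (fun x => (solenoidal l (fun y => th (- y)) i x)%:C) (- eta).
    by rewrite (solenoidal_transform l i _ t') IFo opprK lerayN enormN.
  have iLL i : cintegrable (L i).
    have := cintegrable_mpres mpres_opp (iL i); congr cintegrable; apply/funext => eta.
    by rewrite LE.
  have ELL i : cintegral (L i) = cintegral (fun xi => (enorm xi)%:C * g i xi *
      inv_fourier_fun (fun x => (solenoidal l (fun y => th (- y)) i x)%:C) xi).
    by rewrite -(cintegral_mpres mpres_opp (cintegrable_meas (iL i))); apply: eq_cintegral => eta; rewrite LE.
  have CE i j : (fun eta => inv_fourier_fun (fun x => (pd j (solenoidal l (fun y => th (- y)) i) x)%:C) (- eta)) = C i j.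
    apply/funext => eta; rewrite (test_IF_pd j (- eta) (ts i)) (solenoidal_transform l i _ t') IFo opprK lerayN coord3N.
    by rewrite /C rmorphN; ring.
  have dC i j : dbl (tker (g i) (g j) (C i j)).
    rewrite -CE; exact: (product_dbl hpsi (g_represents hu i) (g_represents hu j)
      (g_L2 hpsi hu i) (g_L2 hpsi hu j) (pd_test j (ts i))).
  have mC i j : cmeas (C i j).
    apply: cmeasM; first by apply: cmeasM; [exact: cmeas_cst|exact: cmeas_coord].
    apply: cmeasM; first by apply: cmeas_real; exact: measurable_leray.
    exact: (schwartz_meas (test_IF_schwartz t)).
  have dC' i j : dbl (tker (C i j) (g i) (g j)) by exact: dbl_perm (dC i j).
  have dC2 i j : dbl (tker (g i) (C i j) (g j)).
    by split; [exact: tker_meas|rewrite -triE (tri_rot (mg i) (mC i j) (mg j)); exact: (dC i j).2].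
  have cv i j := conv_dint (mC i j) (dC' i j).
  have E eta : (\sum_(i < 3) (leray i l eta)%:C * residual i eta) * inv_fourier_fun (fun x => (th x)%:C) eta =
      \sum_(i < 3) (L i eta - \sum_(j < 3) c0%:C * (C i j eta * conv i j eta)).
    rewrite mulr_suml; apply: eq_bigr => i _; rewrite /residual /L mulrBr mulrBl; congr (_ - _); first by ring.
    by rewrite !mulr_sumr mulr_suml; apply: eq_bigr => j _; rewrite /C; ring.
  have iS i : cintegrable (fun eta => \sum_(j < 3) c0%:C * (C i j eta * conv i j eta)).
    by apply: cintegrable_sum => j; apply: cintegrableZ; exact: (cv i j).1.
  have iD i := cintegrableB (iLL i) (iS i).
  split; first by rewrite (funext E); exact: (cintegrable_sum _ iD).
  rewrite (eq_cintegral E) (cintegral_sum _ iD).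
  rewrite (eq_bigr (fun i => cintegral (L i) - \sum_(j < 3) c0%:C * dint (tker (g i) (g j) (C i j)))); last first.
    move=> i _; rewrite (cintegralB (iLL i) (iS i)); congr (_ - _).
    rewrite cintegral_sum; last by move=> j; apply: cintegrableZ; exact: (cv i j).1.
    apply: eq_bigr => j _; rewrite (cintegralZ _ (cv i j).1) -(cv i j).2.
    by rewrite (dint_rot (mg i) (mg j) (mC i j)) (dint_tswap (dC2 i j)).
  rewrite sumrB; under eq_bigr do rewrite ELL.
  rewrite weak; apply/eqP; rewrite subr_eq0; apply/eqP.
  by apply: eq_bigr => i _; apply: eq_bigr => j _; rewrite CE.
apply: (test_separation hpsi mK) => th t; first exact: (key th t).1.
exact: (key th t).2.
Qed.

(** Since eta . g = 0, contraction with g turns [leray] into multiplication by |eta|^2; dividing by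
    it leaves the unprojected equation paired with g. Being an identity for almost every frequency,
    the projected equation can be multiplied by g although u is no admissible test field. *)
Lemma spectral_energy : {ae mu, forall eta,
  (enorm eta * \sum_(i < 3) cmod (g i eta) ^+ 2)%:C =
  'i%C * c0%:C * \sum_(i < 3) \sum_(j < 3) (coord3 eta j)%:C * g i eta * conv i j eta}.
Proof.
have a1 := ae_ord3 leray_residual; have a2 := ae_ord3 (spectrum_conj hpsi hu).
apply: (aeS2 _ a1 (aeS2 (fun x a b => conj a b) a2 (spectrum_div hpsi hu))) => eta h1 [h2 h3].
(* At the origin the division by |eta|^2 is impossible, but both sides vanish. *)
have [e0|e0] := eqVneq (enorm eta) 0.
  rewrite e0 mul0r (enorm_eq0 e0) big1 ?mulr0 // => i _; rewrite big1 // => j _.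
  by rewrite (_ : coord3 0 j = 0) ?mul0r // /coord3 (tnth_nth 0); case: j => -[|[|[|//]]].
have S : \sum_(i < 3) residual i eta * g i eta = 0.
  have : (dot eta eta)%:C * \sum_(i < 3) residual i eta * g i eta = 0.
    transitivity (\sum_(l < 3) (\sum_(i < 3) (leray i l eta)%:C * residual i eta) * g l eta +
      (\sum_(i < 3) (coord3 eta i)%:C * residual i eta) * (\sum_(l < 3) (coord3 eta l)%:C * g l eta)).
      rewrite mulr_sumr [X in _ + X]mulr_sumr -big_split /=; apply: eq_bigr => l _.
      rewrite [X in X + _]mulr_suml [X in _ + X]mulr_suml -big_split /=.
      rewrite (eq_bigr (fun i => ((i == l)%:R)%:C * (residual i eta * (dot eta eta)%:C * g l eta))); last first.
        by move=> i _; rewrite /leray rmorphB /= !realCM; ring.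
      rewrite (bigD1 l) //= eqxx mul1r big1 ?addr0; first by ring.
      by move=> i /negbTE ->; rewrite mul0r.
    by rewrite h3 mulr0 addr0 big1 // => l _; rewrite h1 mul0r.
  move=> /eqP; rewrite mulf_eq0 => /orP[/eqP|/eqP //].
  by move/(congr1 (@complex.Re R)) => /= /eqP; rewrite -enorm_sqr sqrf_eq0 (negbTE e0).
have -> : (enorm eta * \sum_(i < 3) cmod (g i eta) ^+ 2)%:C =
    \sum_(i < 3) (enorm eta)%:C * g i (- eta) * g i eta.
  rewrite realCM realC_sum mulr_sumr; apply: eq_bigr => i _.
  by rewrite -mulC_conj h2 -mulrA [g i eta * _]mulrC.
apply/eqP; rewrite -subr_eq0; apply/eqP; refine (etrans _ S).
rewrite mulr_sumr -sumrB; apply: eq_bigr => i _; rewrite /residual mulrBl; congr (_ - _).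
by rewrite !mulr_sumr mulr_suml; apply: eq_bigr => j _; ring.
Qed.

End spectral_equation.

(** * The truncated energy as a trilinear form *)

Section energy_identity.
Context {R : realType}.
Variables (psi : E3 R -> R) (u : 'I_3 -> E3 R -> R).
Hypothesis hpsi : LP_cutoff psi.
Hypothesis hu : weak_solution (1 / 2) u.
Local Notation mu := (leb3 R).
Local Notation g := (spectrum u).
Implicit Types (f F G H K A B C : E3 R -> R[i]) (x xi eta z : E3 R) (i j l m : 'I_3).
Implicit Types (chi : E3 R -> R).

Let mg i : cmeas (g i). Proof. exact: (g_meas hpsi (g_represents hu i)). Qed.

Definition weighted i xi : R[i] := (sq xi)%:C * g i xi.
Local Notation G := weighted.

Lemma weighted_L2 i : L2 (G i). Proof. exact: (g_L2 hpsi hu i). Qed.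
Let mG i : cmeas (G i). Proof. exact: (weighted_L2 i).1. Qed.

Lemma sqD x y : sq (x + y) <= sq x + sq y.
Proof.
have h0 : 0 <= sq x + sq y by rewrite addr_ge0 ?sq_ge0.
rewrite -[leRHS]ger0_norm // -[leRHS]sqrtr_sqr /sq ler_wsqrtr //.
apply: le_trans (enormD x y) _; rewrite -/(sq x) -/(sq y) -!sq_sqr.
by have := sq_ge0 x; have := sq_ge0 y; set a := sq x; set b := sq y; nra.
Qed.

Lemma dbl_permC A B C : cmeas A -> cmeas B -> cmeas C -> dbl (tker C A B) -> dbl (tker A B C).
Proof.
move=> mA mB mC [_ h]; split; first exact: tker_meas.
by rewrite -triE (tri_rot mA mB mC) (tri_swap mA mC mB).
Qed.

Lemma dbl_rot A B C : cmeas A -> cmeas B -> cmeas C -> dbl (tker A B C) -> dbl (tker A C B).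
Proof.
by move=> mA mB mC [_ h]; split; [exact: tker_meas|rewrite -triE (tri_rot mA mC mB)].
Qed.

Lemma dbl_L1 A B C : cintegrable A -> L2 B -> L2 C -> dbl (tker A B C).
Proof.
move=> iA lB lC; split; last exact: (tri_lt_L1 iA lB lC).
by apply: tker_meas; [exact: (cintegrable_meas iA)|exact: lB.1|exact: lC.1].
Qed.

(** The third factor carries no weight and is handled by its splitting: the low part is integrable,
    the high part square integrable. *)
Lemma dbl_weighted A B k : cintegrable A -> L2 A -> L2 B -> dbl (tker A B (g k)).
Proof.
move=> iA lA lB; have ck := g_cut hpsi (g_represents hu k) 1.
have hk := high_part_L2 hpsi (g_represents hu k) (g_L2 hpsi hu k).
have d1 : dbl (tker A B (cut 1 (g k))).
  by apply: dbl_permC; [exact: lA.1|exact: lB.1|exact: (cintegrable_meas ck)|exact: dbl_L1].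
have d2 := dbl_L1 iA lB hk.
have := dblD d1 d2; congr dbl; apply/funext => p.
by rewrite /tker /high_part; ring.
Qed.

(* One half derivative of the low frequency factor is moved to the two others. *)
Lemma dbl_gradient n i a b A (M : R) : cmeas A -> 0 <= M ->
  (forall z, cmod (A z) <= M * (enorm z * cmod (cut n (g i) z))) -> dbl (tker A (g a) (g b)).
Proof.
move=> mA M0 hA; have iG := cut_int n (weighted_L2 i); have lG := cut_L2 n (weighted_L2 i).
have d1 := dbl_weighted b iG lG (weighted_L2 a).
have d2 := dbl_rot (lG.1) (mG b) (mg a) (dbl_weighted a iG lG (weighted_L2 b)).
pose ab (f : E3 R -> R[i]) x : R[i] := (cmod (f x))%:C.
have mab f : cmeas f -> cmeas (ab f) by move=> mf; apply: cmeas_real; exact: measurable_cmod.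
have cab f x : cmod (ab f x) = cmod (f x) by rewrite /ab cmod_real ger0_norm ?cmod_ge0.
have dab A' B' C' : dbl (tker A' B' C') -> cmeas A' -> cmeas B' -> cmeas C' ->
    dbl (tker (ab A') (ab B') (ab C')).
  move=> d m1 m2 m3; apply: (dbl_le (tker_meas (mab _ m1) (mab _ m2) (mab _ m3)) ler01 _ d) => p.
  rewrite mul1r le_eqVlt; apply/orP; left; apply/eqP.
  rewrite /tker (cmodM (ab A' p.1)) (cmodM (ab B' p.2)) (cmodM (A' p.1)) (cmodM (B' p.2)).
  by rewrite !cab.
have dd := dblD (dab _ _ _ d1 lG.1 (mG a) (mg b)) (dab _ _ _ d2 lG.1 (mg a) (mG b)).
apply: (dbl_le (tker_meas mA (mg a) (mg b)) M0 _ dd) => p.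
have cr (s t v s' t' v' : R) : 0 <= s -> 0 <= t -> 0 <= v -> 0 <= s' -> 0 <= t' -> 0 <= v' ->
   cmod (s%:C * (t%:C * v%:C) + s'%:C * (t'%:C * v'%:C)) = s * (t * v) + s' * (t' * v').
  move=> *; rewrite -!realCM -rmorphD /= cmod_real ger0_norm // addr_ge0 // mulr_ge0 // mulr_ge0 //.
rewrite /tker /ab cr ?cmod_ge0 // (cmodM (A p.1)) (cmodM (g a p.2)).
set e := - p.1 - p.2; have z2 : - p.1 = p.2 + e by rewrite /e addrCA subrr addr0.
have s1 : sq p.1 <= sq p.2 + sq e by rewrite -(sqN p.1) z2 sqD.
have cG k x : cmod (G k x) = sq x * cmod (g k x).
  by rewrite /weighted cmodM cmod_real ger0_norm ?sq_ge0.
have cc k x : cmod (cut n (G k) x) = sq x * cmod (cut n (g k) x).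
  rewrite /cut /weighted mulrCA [LHS]cmodM cmod_real ger0_norm ?sq_ge0 //.
rewrite cc !cG; apply: le_trans (ler_wpM2r _ (hA p.1)) _; first by rewrite mulr_ge0 ?cmod_ge0.
rewrite -[leLHS]mulrA; apply: ler_wpM2l => //; rewrite -(sq_sqr p.1).
have := sq_ge0 p.1; have := cmod_ge0 (cut n (g i) p.1); have := cmod_ge0 (g a p.2); have := cmod_ge0 (g b e).
move: s1; set s := sq p.1; set t := sq p.2; set v := sq e.
set w1 := cmod (cut n (g i) p.1); set w2 := cmod (g a p.2); set w3 := cmod (g b e).
move=> h1 h2 h3 h4 h5.
have : 0 <= (s * w1 * w2 * w3) * (t + v - s) by rewrite !mulr_ge0 // subr_ge0.
have -> : s * w1 * (t * w2 * w3) + s * w1 * (w2 * (v * w3)) = (s * w1 * w2 * w3) * (t + v) by ring.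
have -> : s ^+ 2 * w1 * (w2 * w3) = (s * w1 * w2 * w3) * s by ring.
by rewrite mulrBr subr_ge0.
Qed.

(** The transform of the j-th derivative of the i-th component filtered by chi. *)
Definition gradient chi i j z : R[i] := 'i%C * (coord3 z j)%:C * ((chi z)%:C * g i z).

Lemma gradient_meas chi i j : measurable_fun setT chi -> cmeas (gradient chi i j).
Proof.
move=> mc; apply: cmeasM; first by apply: cmeasM; [exact: cmeas_cst|exact: cmeas_coord].
by apply: cmeasM => //; exact: cmeas_real.
Qed.

Lemma mid_bound (M x q a b : R) : 0 <= x -> 0 <= a -> 0 <= b -> q <= M ->
  x * (q * a * b) <= M * (x * (a * b)).
Proof.
move=> x0 a0 b0 qM; rewrite (_ : x * (q * a * b) = q * (x * (a * b))); last by ring.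
by apply: ler_wpM2r => //; rewrite mulr_ge0 // mulr_ge0.
Qed.

Definition localized (n : nat) (M : R) chi := [/\ measurable_fun setT chi, 0 <= M,
  forall z, `|chi z| <= M & forall z, n%:R < enorm z -> chi z = 0].

Lemma gradient_bound n M chi i j z : localized n M chi ->
  cmod (gradient chi i j z) <= M * (enorm z * cmod (cut n (g i) z)).
Proof.
move=> [_ M0 hM hs]; have [h|h] := leP (enorm z) n%:R; last first.
  by rewrite /gradient hs // mul0r mulr0 cmod0 !mulr_ge0 ?enorm_ge0 ?cmod_ge0.
rewrite /cut ball3_in // mul1r /gradient !cmodM cmod_i mul1r !cmod_real.
rewrite mulrCA; apply: ler_pM; rewrite ?mulr_ge0 ?cmod_ge0 ?normr_ge0 //.
by apply: ler_wpM2r; [exact: cmod_ge0|exact: coord3_le].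
Qed.

Lemma gradient_dbl n M chi i j a b : localized n M chi -> dbl (tker (gradient chi i j) (g a) (g b)).
Proof.
move=> hl; have [mc M0 _ _] := hl.
apply: (@dbl_gradient n i a b _ M); [exact: gradient_meas|exact: M0|].
by move=> z; exact: gradient_bound.
Qed.

(** [spectral_energy] multiplied by chi and integrated; the bounded support of chi makes the
    trilinear integrals absolutely convergent, by [gradient_dbl]. *)
Lemma energy_trilinear n M chi : localized n M chi ->
  (\int[mu]_eta (chi eta * (enorm eta * \sum_(i < 3) cmod (g i eta) ^+ 2)))%:C =
  c0%:C * \sum_(i < 3) \sum_(j < 3) dint (tker (gradient chi i j) (g i) (g j)).
Proof.
move=> hl; have [mc M0 _ _] := hl.
have d i j := gradient_dbl i j i j hl.
have cv i j := conv_dint hpsi hu (gradient_meas i j mc) (d i j).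
rewrite -cintegral_real.
transitivity (cintegral (fun eta => c0%:C * \sum_(i < 3) \sum_(j < 3) gradient chi i j eta * conv u i j eta)).
  apply: ae_eq_cintegral.
  - apply: cmeas_real; apply: measurable_funM => //; apply: measurable_funM; first exact: measurable_enorm.
    by apply: measurable_sum3 => i; apply: measurable_funX; exact: measurable_cmod.
  - apply: cmeasM; first exact: cmeas_cst.
    by apply: cmeas_sum => i; apply: cmeas_sum => j; exact: (cintegrable_meas (cv i j).1).
  - apply: aeS (spectral_energy hpsi hu) => eta h; rewrite realCM h !mulr_sumr.
    apply: eq_bigr => i _; rewrite !mulr_sumr; apply: eq_bigr => j _.
    by rewrite /gradient; ring.
rewrite cintegralZ; last by apply: cintegrable_sum => i; apply: cintegrable_sum => j; exact: (cv i j).1.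
congr (_ * _); rewrite cintegral_sum; last by move=> i; apply: cintegrable_sum => j; exact: (cv i j).1.
apply: eq_bigr => i _; rewrite cintegral_sum; last by move=> j; exact: (cv i j).1.
by apply: eq_bigr => j _; rewrite (cv i j).2.
Qed.

Lemma coordNN z x j : coord3 (- z - x) j = - (coord3 z j + coord3 x j).
Proof. by rewrite coord3D !coord3N opprD. Qed.

(* By antisymmetry in the first two frequencies and incompressibility. *)
Lemma transport_cancel n M chi : localized n M chi ->
  \sum_(i < 3) \sum_(j < 3) dint (tker (gradient chi i j) (fun x => (chi x)%:C * g i x) (g j)) = 0.
Proof.
move=> hl; have [mc M0 hM _] := hl.
pose c i x := (chi x)%:C * g i x.
have mcg i : cmeas (c i) by apply: cmeasM => //; exact: cmeas_real.
have d i j : dbl (tker (gradient chi i j) (c i) (g j)).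
  apply: (dbl_le (tker_meas (gradient_meas i j mc) (mcg i) (mg j)) M0 _ (gradient_dbl i j i j hl)) => p.
  rewrite /tker (cmodM (gradient chi i j p.1)) (cmodM (c i p.2)) [X in _ <= M * X]cmodM (cmodM (g i p.2)) /c (cmodM (chi p.2)%:C) cmod_real.
  by apply: mid_bound; rewrite ?cmod_ge0 ?hM.
set S := \sum_(i < 3) _.
have E1 : S = dint (fun p => \sum_(i < 3) \sum_(j < 3) tker (gradient chi i j) (c i) (g j) p).
  rewrite (@dint_sum R _ (index_enum 'I_3) (fun i p => \sum_(j < 3) tker (gradient chi i j) (c i) (g j) p)).
    by apply: eq_bigr => i _; rewrite (@dint_sum R _ (index_enum 'I_3) (fun j => tker (gradient chi i j) (c i) (g j))).
  by move=> i; apply: dbl_sum => j; exact: d.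
have dS : dbl (fun p => \sum_(i < 3) \sum_(j < 3) tker (gradient chi i j) (c i) (g j) p).
  by apply: dbl_sum => i; apply: dbl_sum => j; exact: d.
(* Adding the integrand with z and x exchanged puts (z + x)_j next to g_j(-z - x), which sums over j
   to minus the divergence symbol at -z - x. *)
have SS : S + S = 0.
  rewrite {2}E1 (dint_swap dS) E1 -(dintD dS (dbl_swap dS)); apply: dint_ae0.
    by move=> z; exact: (cmeas_slice z (cmeasD dS.1 (dbl_swap dS).1)).
  move=> z; have := ae_mpres (mpres_sub (- z)) (spectrum_div hpsi hu); apply: aeS => x h.
  transitivity (\sum_(i < 3) (- 'i%C * (c i z * c i x)) * (\sum_(j < 3) (coord3 (- z - x) j)%:C * g j (- z - x))).
    rewrite -big_split /=; apply: eq_bigr => i _; rewrite mulr_sumr -big_split /=; apply: eq_bigr => j _.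
    rewrite /tker /gradient /= [- x - z]addrC coordNN -/(c i z) -/(c i x) rmorphN rmorphD /=.
    by rewrite /c; ring.
  by rewrite h; rewrite big1 // => i _; rewrite mulr0.
have : S *+ 2 = 0 by rewrite mulr2n.
by move/eqP; rewrite mulrn_eq0 /= => /eqP.
Qed.

Lemma energy_high n M chi : localized n M chi ->
  (\int[mu]_eta (chi eta * (enorm eta * \sum_(i < 3) cmod (g i eta) ^+ 2)))%:C =
  c0%:C * \sum_(i < 3) \sum_(j < 3)
    dint (tker (gradient chi i j) (fun x => (1 - chi x)%:C * g i x) (g j)).
Proof.
move=> hl; have [mc M0 hM _] := hl.
refine (etrans (energy_trilinear hl) (congr1 ( *%R c0%:C) _)).
rewrite -[RHS]addr0 -[X in _ = _ + X](transport_cancel hl) -big_split /=; apply: eq_bigr => i _.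
rewrite -big_split /=; apply: eq_bigr => j _.
have d1 := gradient_dbl i j i j hl.
have d2 : dbl (tker (gradient chi i j) (fun x => (chi x)%:C * g i x) (g j)).
  have mcg : cmeas (fun x => (chi x)%:C * g i x) by apply: cmeasM => //; exact: cmeas_real.
  apply: (dbl_le (tker_meas (gradient_meas i j mc) mcg (mg j)) M0 _ d1) => p.
  rewrite /tker (cmodM (gradient chi i j p.1)) (cmodM ((chi p.2)%:C * g i p.2)) [X in _ <= M * X]cmodM (cmodM (g i p.2)) (cmodM (chi p.2)%:C) cmod_real.
  by apply: mid_bound; rewrite ?cmod_ge0 ?hM.
apply/eqP; rewrite -subr_eq; apply/eqP; rewrite -(dintB d1 d2); apply: eq_dint => p.
by rewrite /tker rmorphB rmorph1 /=; ring.
Qed.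

End energy_identity.

(** * Dyadic multipliers *)

Section dyadic.
Context {R : realType}.
Variable psi : E3 R -> R.
Hypothesis hpsi : LP_cutoff psi.
Implicit Types (x xi eta z : E3 R) (k l : int).

Definition p2 k : R := 2 ^ k.

Lemma p2_gt0 k : 0 < p2 k. Proof. exact: exprz_gt0. Qed.
Lemma p2S k : p2 (k + 1) = 2 * p2 k.
Proof. by rewrite /p2 expfzDr ?pnatr_eq0 // expr1z mulrC. Qed.
Lemma p2P k : p2 (k - 1) = p2 k / 2.
Proof. by rewrite -[in RHS](subrK 1 k) p2S mulrC mulKf // pnatr_eq0. Qed.
Lemma p2_le k l : k <= l -> p2 k <= p2 l.
Proof. by move=> kl; rewrite /p2 ler_weXz2l // ler1n. Qed.
Lemma p2N k : p2 (- k) * p2 k = 1.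
Proof. by rewrite /p2 -expfzDr ?pnatr_eq0 // addNr expr0z. Qed.
Lemma p2_nat (n : nat) : p2 n%:Z = 2 ^+ n. Proof. by []. Qed.

Lemma psi_continuous : continuous psi.
Proof. by move=> x; apply: differentiable_continuous; exact: (smooth_diff (psi_test hpsi).1). Qed.

(** The support condition allows |x| = 1, where psi vanishes by continuity along points pushed
    outwards. The strict inequalities of [ps_neq0] and [ph_neq0], and with them the disjointness of
    supports used below, rest on this. *)
Lemma psi_out x : 1 <= enorm x -> psi x = 0.
Proof.
move=> x1; pose y (n : nat) : E3 R := x + (n.+1%:R^-1 : R) *: x.
have y0 n : psi (y n) = 0.
  apply/eqP; apply/negPn/negP => /(psi_supp hpsi); rewrite /y -[X in X + _]scale1r -scalerDl enormZ leNgt => /negP; apply.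
  have h : 0 < n.+1%:R^-1 :> R by rewrite invr_gt0.
  rewrite gtr0_norm; last by rewrite addr_gt0.
  apply: (lt_le_trans _ (ler_wpM2l _ x1)); first by rewrite mulr1 ltrDl.
  by rewrite addr_ge0 // ltW.
have h : (n.+1%:R^-1 : R) @[n --> \oo] --> (0 : R) by exact: cvg_harmonic.
have h3 : (n.+1%:R^-1 : R) *: x @[n --> \oo] --> (0 : R) *: x by exact: (cvgZr_tmp h).
have h4 : x + (n.+1%:R^-1 : R) *: x @[n --> \oo] --> x + (0 : R) *: x.
  by apply: cvgD; [exact: cvg_cst|exact: h3].
have cy : y n @[n --> \oo] --> x by rewrite scale0r addr0 in h4.
have cf : psi z @[z --> x] --> psi x by exact: psi_continuous.
have c : psi (y n) @[n --> \oo] --> psi x.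
  by exact: (@cvg_comp _ _ _ y psi _ _ _ cy cf).
have E : (fun n => psi (y n)) = fun=> 0 by apply/funext => n; exact: y0.
rewrite E in c.
have c' : (fun=> 0 : R) n @[n --> \oo] --> (0 : R) by exact: cvg_cst.
exact: (cvg_unique _ c c').
Qed.

Lemma psi_bounded : exists2 M : R, 1 <= M & forall x, psi x <= M.
Proof.
have [C C0 hC] := Cc_bounded (test_Cc (psi_test hpsi)).
exists (C + 1); first by rewrite lerDr.
move=> x; have := hC x; rewrite cmod_real ger0_norm ?psi_ge0 // => h.
by rewrite (le_trans h) // lerDl.
Qed.

(** The symbol of [Slow psi k]; that of [Delta psi k] is [ph]. *)
Definition ps k xi : R := psi (2 ^ (- k) *: xi).

Lemma ps_ge0 k xi : 0 <= ps k xi. Proof. exact: (psi_ge0 hpsi). Qed.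

Lemma ps_test k : test_function (ps k).
Proof.
have := scaled_test hpsi 0 (lt0r_neq0 (p2_gt0 (- k))).
by rewrite /scaled; under eq_fun do rewrite addr0.
Qed.

Lemma ps_enorm k xi : enorm ((2 ^ (- k) : R) *: xi) = p2 (- k) * enorm xi.
Proof. by rewrite enormZ gtr0_norm // p2_gt0. Qed.

Lemma ps_in k xi : enorm xi <= p2 k / 2 -> ps k xi = 1.
Proof.
move=> h; apply: (psi_one hpsi); rewrite ps_enorm.
rewrite (_ : 1 / 2 = p2 (- k) * (p2 k / 2)); last by rewrite mulrA p2N.
by rewrite ler_wpM2l // ltW // p2_gt0.
Qed.

Lemma ps_out k xi : p2 k <= enorm xi -> ps k xi = 0.
Proof.
move=> h; apply: psi_out; rewrite ps_enorm -(p2N k).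
by rewrite ler_wpM2l // ltW // p2_gt0.
Qed.

Lemma ps_neq0 k xi : ps k xi != 0 -> enorm xi < p2 k.
Proof. by rewrite ltNge; apply: contra => h; rewrite ps_out. Qed.

Lemma ps_neq1 k xi : ps k xi != 1 -> p2 k / 2 < enorm xi.
Proof. by rewrite ltNge; apply: contra => h; rewrite ps_in. Qed.

Lemma LP_phiE k xi : LP_phi psi (2 ^ (- k) *: xi) = ps (k + 1) xi - ps k xi.
Proof.
rewrite /LP_phi /ps scalerA; congr (psi (_ *: _) - _).
by rewrite -[2^-1]/(2 ^ (- 1)) -expfzDr ?pnatr_eq0 // opprD addrC.
Qed.

Definition ph k xi : R := ps (k + 1) xi - ps k xi.

Lemma ph_neq0 k xi : ph k xi != 0 -> p2 k / 2 < enorm xi < p2 (k + 1).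
Proof.
move=> h; apply/andP; split; rewrite ltNge; apply: contra h => h; rewrite /ph.
  rewrite (ps_in h) ps_in ?subrr // p2S; apply: (le_trans h).
  by have := p2_gt0 k; lra.
rewrite (ps_out h) ps_out ?subrr //; apply: le_trans h; rewrite p2S.
by have := p2_gt0 k; lra.
Qed.

Lemma ph_test k : test_function (ph k).
Proof.
have := testD (ps_test (k + 1)) (testZ (-1) (ps_test k)).
by rewrite /ph; under eq_fun do rewrite mulN1r.
Qed.

Lemma zrangeE (a : int) (n : nat) : zrange a (a + n%:Z) = [seq a + i%:Z | i <- iota 0 n.+1].
Proof. by rewrite /zrange lerDl lez_nat leq0n (_ : a + n%:Z - a = n%:Z) ?absz_nat //; lia. Qed.

Lemma sum_iota (V : zmodType) (a : int) (f : int -> V) (m : nat) :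
  \sum_(j <- iota 0 m) (f (a + j%:Z + 1) - f (a + j%:Z)) = f (a + m%:Z) - f a.
Proof.
elim: m => [|m IH]; first by rewrite big_nil addr0 subrr.
rewrite -addn1 iotaD big_cat IH /= big_seq1 add0n.
rewrite (_ : a + (m + 1)%N%:Z = a + m%:Z + 1); last by lia.
by rewrite [LHS]addrC addrA subrK.
Qed.

(** The empty range a = b + 1 is included: in [m1E] the lower end l - 2 can equal k while the upper
    end is k - 1. *)
Lemma sum_zrange (a b : int) (f : int -> R) : a <= b + 1 ->
  \sum_(l <- zrange a b) (f (l + 1) - f l) = f (b + 1) - f a.
Proof.
move=> ab; have [h|h] := leP a b; last first.
  have -> : a = b + 1 by lia.
  by rewrite /zrange ifF ?big_nil ?subrr //; apply/negbTE; lia.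
have [n ->] : exists n : nat, b = a + n%:Z by exists `|(b - a)%R|%N; lia.
rewrite zrangeE big_map sum_iota; congr (f _ - _); lia.
Qed.

Lemma zrange4 (a : int) : zrange a (a + 3) = [:: a; a + 1; a + 2; a + 3].
Proof. by rewrite (zrangeE a 3) /= addr0. Qed.

Section frequencies.
Variables (k h : int) (z xi : E3 R).
Hypothesis hk : h <= k.
Local Notation eta := (- z - xi).
Local Notation c := (1 - ps k xi).

(** Symbols of the three fluxes: z is the frequency of the differentiated factor, eta that of the
    transporting one, xi that of the third, which carries the symbol c of u^k. In [m3] the sums over
    blocks are already carried out, as justified by [flux3_term]. *)
Definition m1 : R := \sum_(l <- zrange (k - 1) (k + 2)) \sum_(l' <- zrange (l - 2) (k - 1))
  \sum_(l'' <- zrange 0 (k - 1)) ps (l - 2) eta * ph l'' eta * ph l' z * (ph l xi * c).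
Definition m2 : R := \sum_(l <- zrange (k - 3) k) \sum_(l'' <- zrange h (k - 1))
  ph l eta * ps k eta * ph l'' z * ((\sum_(l' <- zrange (l - 2) (l + 2)) ph l' xi) * c).
Definition m3 : R := (ps k z - ps h z) * (1 - ps k eta) * c.

Lemma enorm_tri : enorm xi <= enorm z + enorm eta.
Proof.
have := enormD (- z) (- eta); rewrite !enormN.
by rewrite (_ : - z - eta = xi) // opprD !opprK addrA addNr add0r.
Qed.

Lemma enorm_tri2 : enorm eta <= enorm z + enorm xi.
Proof. by apply: le_trans (enormD _ _) _; rewrite !enormN. Qed.

Lemma enorm_tri3 : enorm z <= enorm xi + enorm eta.
Proof.
have := enormD (- xi) (- eta); rewrite !enormN.
by rewrite (_ : - xi - eta = z) // opprD !opprK addrCA addNr addr0.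
Qed.

Lemma m1E : 0 <= k -> m1 = c * (ps k eta - ps 0 eta) * (\sum_(l <- zrange (k - 1) (k + 2))
  ph l xi * ps (l - 2) eta * (ps k z - ps (l - 2) z)).
Proof.
move=> k0; rewrite /m1 mulr_sumr [LHS]big_seq [RHS]big_seq; apply: eq_bigr => l.
rewrite (_ : k + 2 = k - 1 + 3); last by rewrite -addrA.
rewrite zrange4 !inE => lk.
have lk2 : l - 2 <= k - 1 + 1.
  by rewrite subrK; case/or4P: lk => /eqP ->; lia.
have S1 := @sum_zrange (l - 2) (k - 1) (fun l => ps l z) lk2.
have S2 := @sum_zrange 0 (k - 1) (fun l => ps l eta).
rewrite subrK in S1; rewrite subrK in S2.
rewrite (eq_bigr (fun l' => ph l' z * ((ps k eta - ps 0 eta) * (ps (l - 2) eta * (ph l xi * c))))); last first.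
  move=> l' _; rewrite -(S2 k0) mulr_suml mulr_sumr; apply: eq_bigr => l'' _; rewrite /ph; ring.
by rewrite -mulr_suml S1; ring.
Qed.

Lemma m2E : m2 = c * ps k eta * (ps k z - ps h z) *
  (\sum_(l <- zrange (k - 3) k) ph l eta * (ps (l + 3) xi - ps (l - 2) xi)).
Proof.
rewrite /m2 mulr_sumr; apply: eq_bigr => l _.
have S1 := @sum_zrange h (k - 1) (fun l => ps l z); rewrite subrK in S1.
have S2 := @sum_zrange (l - 2) (l + 2) (fun l => ps l xi).
have E2 : \sum_(l' <- zrange (l - 2) (l + 2)) ph l' xi = ps (l + 3) xi - ps (l - 2) xi.
  by rewrite (_ : l + 3 = l + 2 + 1) ?S2 //; [lia|rewrite -addrA].
rewrite E2 (eq_bigr (fun l'' => ph l'' z * (ph l eta * ps k eta * ((ps (l + 3) xi - ps (l - 2) xi) * c)))).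
  by rewrite -mulr_suml (S1 hk); ring.
by move=> l'' _; ring.
Qed.

Lemma c_neq0 : c != 0 -> p2 k / 2 < enorm xi.
Proof. by rewrite subr_eq0 eq_sym; exact: ps_neq1. Qed.

Lemma low_out l : c != 0 -> l <= k - 1 -> ps l xi = 0.
Proof.
move=> c0 lk; apply: ps_out; apply: (le_trans (p2_le lk)).
by rewrite p2P ltW // c_neq0.
Qed.

(** A frequency xi in the l-th shell exceeds 2^(l-1), which two frequencies below 2^(l-2) cannot add
    up to. *)
Lemma paraproduct_cancel l : ph l xi * ps (l - 2) eta * ps (l - 2) z = 0.
Proof.
have [->|h1] := eqVneq (ph l xi) 0; first by rewrite !mul0r.
have [->|h2] := eqVneq (ps (l - 2) eta) 0; first by rewrite mulr0 mul0r.
have [->|h3] := eqVneq (ps (l - 2) z) 0; first by rewrite mulr0.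
exfalso; have /andP [h4 _] := ph_neq0 h1; have := ps_neq0 h2; have := ps_neq0 h3.
rewrite (_ : l - 2 = l - 1 - 1) ?p2P; last by lia.
by have := enorm_tri; lra.
Qed.

(** Where no common factor vanishes, |xi| < 2^(k+1): the symbols at xi are 0 below index k and 1
    above k + 1, and the one at eta is 1 at index k + 1. Abel summation over l then gives [m1] +
    [m2] = p_k(eta) p_k(z) c, and [m3] supplies the complement 1 - p_k(eta). *)
Lemma multiplier_sum : 0 <= k -> 1 <= enorm eta -> p2 h <= enorm z ->
  m1 + m2 + m3 = ps k z * c.
Proof.
move=> k0 e1 zh; rewrite m1E // m2E /m3.
have y00 : ps 0 eta = 0 by apply: ps_out; rewrite /p2 expr0z.
have zh0 : ps h z = 0 by exact: ps_out.
rewrite y00 zh0 !subr0.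
rewrite (eq_bigr (fun l => ph l xi * ps (l - 2) eta * ps k z)); last first.
  by move=> l _; rewrite mulrBr paraproduct_cancel subr0.
have [c0|c0] := eqVneq c 0; first by rewrite c0; ring.
have [ye|ye] := eqVneq (ps k eta) 0; first by rewrite ye; ring.
rewrite -mulr_suml; have [ze|ze] := eqVneq (ps k z) 0; first by rewrite ze; ring.
have ltz := ps_neq0 ze; have lte := ps_neq0 ye; have xt := enorm_tri.
have x2 : ps (k + 2) xi = 1.
  by apply: ps_in; rewrite (_ : k + 2 = k + 1 + 1) ?p2S; [lra|lia].
have x3 : ps (k + 3) xi = 1.
  by apply: ps_in; rewrite (_ : k + 3 = k + 1 + 1 + 1) ?p2S; [lra|lia].
have y1 : ps (k + 1) eta = 1 by apply: ps_in; rewrite p2S; lra.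
rewrite (_ : k + 2 = k - 1 + 3) ?zrange4; last by lia.
rewrite [X in zrange _ X](_ : k = k - 3 + 3) ?zrange4; last by lia.
rewrite !big_cons !big_nil /ph.
rewrite (_ : k - 1 + 1 = k); last by lia.
rewrite (_ : k - 1 - 2 = k - 3); last by lia.
rewrite (_ : k - 1 + 2 = k + 1); last by lia.
rewrite (_ : k - 1 + 3 = k + 2); last by lia.
rewrite (_ : k + 1 + 1 = k + 2); last by lia.
rewrite (_ : k + 1 - 2 = k - 1); last by lia.
rewrite (_ : k + 2 + 1 = k + 3); last by lia.
rewrite (_ : k + 2 - 2 = k); last by lia.
rewrite (_ : k - 3 + 1 = k - 2); last by lia.
rewrite (_ : k - 3 + 3 = k); last by lia.
rewrite (_ : k - 3 + 2 = k - 1); last by lia.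
rewrite (_ : k - 2 + 1 = k - 1); last by lia.
rewrite (_ : k - 2 + 3 = k + 1); last by lia.
rewrite (_ : k - 1 + 1 = k); last by lia.
rewrite (_ : k - 1 + 3 = k + 2); last by lia.
rewrite x2 x3 y1.
rewrite [ps (k - 3 - 2) xi]low_out //; last by lia.
rewrite [ps (k - 2 - 2) xi]low_out //; last by lia.
rewrite [ps (k - 1 - 2) xi]low_out //; last by lia.
rewrite [ps (k - 2) xi]low_out //; last by lia.
rewrite [ps (k - 1) xi]low_out //.
ring.
Qed.

(** The enlarged block acts as the identity wherever the rest is nonzero: since |z| < 2^k, either
    eta lies where the five shells add up to 1, or it is so low that 1 - p_k(eta) vanishes. The
    second case can occur for l <= k + 1 only. *)
Lemma resonance l l'' : k - 1 <= l -> l'' <= k - 1 ->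
  ph l'' z * (ph l xi * c) * ((\sum_(l' <- zrange (l - 2) (l + 2)) ph l' eta) * (1 - ps k eta)) =
  ph l'' z * (ph l xi * c) * (1 - ps k eta).
Proof.
move=> hl hl''; have [->|h1] := eqVneq (ph l'' z) 0; first by rewrite !mul0r.
have [->|h2] := eqVneq (ph l xi) 0; first by rewrite mul0r mulr0 !mul0r.
congr (_ * _); have /andP [_ hz] := ph_neq0 h1; have /andP [x1 x2] := ph_neq0 h2.
rewrite (@sum_zrange (l - 2) (l + 2) (fun l => ps l eta)); last by lia.
have hz' : enorm z < p2 k by apply: (lt_le_trans hz); apply: p2_le; lia.
have pkl : p2 k <= p2 (l + 1) by apply: p2_le; lia.
rewrite [ps (l + 2 + 1) eta]ps_in; last first.
  by rewrite p2S (_ : l + 2 = l + 1 + 1) ?p2S; [have := enorm_tri2; rewrite p2S in pkl x2; lra|lia].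
suff : ps (l - 2) eta * (1 - ps k eta) = 0 by move=> e; rewrite mulrBl e mul1r subr0.
have [lk|lk] := leP l (k + 1).
  have [->|h3] := eqVneq (ps (l - 2) eta) 0; first by rewrite mul0r.
  rewrite [ps k eta]ps_in ?subrr ?mulr0 //; apply: ltW; apply: (lt_le_trans (ps_neq0 h3)).
  by rewrite -p2P; apply: p2_le; lia.
rewrite [ps (l - 2) eta]ps_out ?mul0r //.
have : p2 k <= p2 (l - 2) by apply: p2_le; lia.
rewrite (_ : l - 2 = l - 1 - 1) ?p2P; last by lia.
by have := enorm_tri; lra.
Qed.

Lemma high_telescope (N : nat) :
  (\sum_(n <- iota 0 N) ph (k - 1 + n%:Z) xi * c) = ps (k - 1 + N%:Z) xi * c.
Proof.
rewrite -mulr_suml (@sum_iota R (k - 1) (fun l => ps l xi) N) mulrBl.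
have [->|c0] := eqVneq c 0; first by rewrite !mulr0 subrr.
by rewrite [ps (k - 1) xi]low_out ?mul0r ?subr0.
Qed.

Definition defect : R := m1 + m2 + m3 - ps k z * c.

(** In the three regions, respectively, every cutoff in z vanishes, c vanishes, or [multiplier_sum]
    applies. *)
Lemma defect_eq0 : 0 <= k ->
  p2 k <= enorm z \/ enorm xi <= p2 k / 2 \/ (1 <= enorm eta /\ p2 h <= enorm z) -> defect = 0.
Proof.
move=> k0; rewrite /defect; case=> [hz|[hx|[he hz]]]; last by rewrite multiplier_sum // subrr.
  have pz l : l <= k -> ps l z = 0.
    by move=> lk; apply: ps_out; apply: le_trans hz; exact: p2_le.
  rewrite m1E // m2E /m3 (pz k) // (pz h) // big_seq big1; first by ring.
  move=> l; rewrite (_ : k + 2 = k - 1 + 3) ?zrange4; last by lia.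
  rewrite !inE => hl; rewrite (pz (l - 2)) ?subrr ?mulr0 //.
  by case/or4P: hl => /eqP ->; lia.
by rewrite m1E // m2E /m3 (ps_in hx) subrr; ring.
Qed.

End frequencies.

(** After telescoping, [m1E] and [m2E] leave sums of four terms whatever k is, so the bound is
    uniform. *)
Lemma defect_bounded : exists2 M : R, 0 <= M & forall (k h : int) z xi, h <= k -> 0 <= k ->
  `|defect k h z xi| <= M.
Proof.
have [M M1 hM] := psi_bounded; pose B := 1 + M.
have B0 : 0 <= B by rewrite /B; lra.
have B1 : 1 <= B by rewrite /B; lra.
have b1 l x : `|ps l x| <= B.
  by rewrite ger0_norm ?ps_ge0 // (le_trans (hM _)) // /B lerDr.
have b2 l x : `|1 - ps l x| <= B.
  by apply: le_trans (ler_normB _ _) _; rewrite normr1 ger0_norm ?ps_ge0 // lerD2l; exact: hM.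
have b3 l l' x : `|ps l x - ps l' x| <= B.
  rewrite ler_norml; have := ps_ge0 l x; have := ps_ge0 l' x; have := hM (2 ^ (- l) *: x).
  have := hM (2 ^ (- l') *: x); rewrite -/(ps l x) -/(ps l' x) /B => *; apply/andP; split; lra.
have b4 l x : `|ph l x| <= B by exact: b3.
have pr (a b A' B' : R) : 0 <= A' -> `|a| <= A' -> `|b| <= B' -> `|a * b| <= A' * B'.
  by move=> A0 ha hb; rewrite normrM ler_pM.
have s4 (a : int) (f : int -> R) A' : (forall l, `|f l| <= A') -> `|\sum_(l <- zrange a (a + 3)) f l| <= A' + (A' + (A' + A')).
  move=> hf; rewrite zrange4 !big_cons big_nil addr0.
  by do 3 (apply: (le_trans (ler_normD _ _)); apply: lerD; first exact: hf).
pose T := B ^+ 3 * (B ^+ 3 + (B ^+ 3 + (B ^+ 3 + B ^+ 3))) + B ^+ 3 * (B ^+ 3 + (B ^+ 3 + (B ^+ 3 + B ^+ 3))) + B ^+ 3 + B ^+ 2.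
have Bn n : 0 <= B ^+ n by rewrite exprn_ge0.
exists T; first by rewrite !addr_ge0 // mulr_ge0 // !addr_ge0.
move=> k h z xi hk k0; rewrite /defect.
have e3 : B ^+ 3 = B * B * B by rewrite !exprS expr0; ring.
have h1 : `|m1 k z xi| <= B ^+ 3 * (B ^+ 3 + (B ^+ 3 + (B ^+ 3 + B ^+ 3))).
  rewrite (m1E z xi hk k0); apply: (pr _ _) => //.
    by apply: (@le_trans _ _ (B * B)); [exact: (pr _ _)|rewrite e3 ler_peMr // mulr_ge0].
  rewrite (_ : k + 2 = k - 1 + 3); last by lia.
  by apply: s4 => l; rewrite e3; apply: (pr _ _) => //; [rewrite mulr_ge0|exact: (pr _ _)].
have h2 : `|m2 k h z xi| <= B ^+ 3 * (B ^+ 3 + (B ^+ 3 + (B ^+ 3 + B ^+ 3))).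
  rewrite m2E //; apply: (pr _ _) => //.
    by rewrite e3; apply: (pr _ _) => //; [rewrite mulr_ge0|exact: (pr _ _)].
  rewrite [X in zrange _ X](_ : k = k - 3 + 3); last by lia.
  apply: s4 => l; apply: (@le_trans _ _ (B * B)); first by exact: (pr _ _).
  by rewrite e3 ler_peMr // mulr_ge0.
have h3 : `|m3 k h z xi| <= B ^+ 3.
  by rewrite /m3 e3; apply: (pr _ _) => //; [rewrite mulr_ge0|exact: (pr _ _)].
have h4 : `|ps k z * (1 - ps k xi)| <= B ^+ 2 by rewrite expr2; exact: (pr _ _).
apply: le_trans (ler_normB _ _) _; apply: lerD => //.
apply: le_trans (ler_normD _ _) _; apply: lerD => //.
by apply: le_trans (ler_normD _ _) _; apply: lerD.
Qed.
End dyadic.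

(** * Littlewood-Paley blocks and the three fluxes *)

Section blocks.
Context {R : realType}.
Variables (psi : E3 R -> R) (u : 'I_3 -> E3 R -> R).
Hypothesis hpsi : LP_cutoff psi.
Hypothesis hu : weak_solution (1 / 2) u.
Local Notation mu := (leb3 R).
Local Notation g := (spectrum u).
Local Notation G := (weighted u).
Local Notation T := (dist_of_field u).
Implicit Types (x xi eta z : E3 R) (i j : 'I_3) (k l : int) (p : E3 R * E3 R).

Let mg i : cmeas (g i). Proof. exact: (g_meas hpsi (g_represents hu i)). Qed.

Lemma ps_meas k : measurable_fun setT (ps psi k).
Proof. exact: (differentiable_measurable (smooth_diff (ps_test hpsi k).1)). Qed.

Lemma ph_meas k : measurable_fun setT (ph psi k).
Proof. by apply: measurable_funB; exact: ps_meas. Qed.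

Lemma hp_meas k : measurable_fun setT (fun x => 1 - ps psi k x).
Proof. by apply: measurable_funB; [exact: measurable_cst|exact: ps_meas]. Qed.

Lemma ps_bounded : exists2 M : R, 0 <= M & forall k x, `|ps psi k x| <= M.
Proof.
have [M M1 hM] := psi_bounded hpsi; exists M; first by rewrite (le_trans ler01).
by move=> k x; rewrite ger0_norm ?(ps_ge0 hpsi) // hM.
Qed.

Lemma hp_bounded : exists2 M : R, 0 <= M & forall k x, `|1 - ps psi k x| <= M.
Proof.
have [M M0 hM] := ps_bounded; exists (1 + M); first by rewrite addr_ge0.
by move=> k x; apply: le_trans (ler_normB _ _) _; rewrite normr1 lerD2l.
Qed.

Lemma ph_bounded : exists2 M : R, 0 <= M & forall k x, `|ph psi k x| <= M.
Proof.
have [M M0 hM] := ps_bounded; exists (M + M); first by rewrite addr_ge0.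
by move=> k x; apply: le_trans (ler_normB _ _) _; exact: lerD.
Qed.

(** Bounded multipliers supported away from the origin and from infinity. There g is dominated by G,
    so filtered fields are both integrable and square integrable. *)
Definition annular (m : E3 R -> R) := exists (M r : R) (n : nat),
  [/\ measurable_fun setT m, 0 < r, forall x, `|m x| <= M &
      forall x, m x != 0 -> r <= enorm x /\ enorm x <= n%:R].

Lemma annular_ph k : annular (ph psi k).
Proof.
have [M M0 hM] := ph_bounded; exists M, (p2 k / 2 : R), (Num.bound (p2 (k + 1) : R)).
split; [exact: ph_meas|by rewrite divr_gt0 // p2_gt0|exact: hM|].
move=> x /(ph_neq0 hpsi) /andP [h1 h2]; split; first exact: ltW.
by apply: ltW; apply: (lt_trans h2); apply: archi_boundP; rewrite ltW // p2_gt0.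
Qed.

Lemma annularD (a b : E3 R -> R) : annular a -> annular b -> annular (fun x => a x + b x).
Proof.
move=> [M [r [n [ma r0 hM hs]]]] [M' [r' [n' [mb r'0 hM' hs']]]].
exists (M + M'), (Num.min r r'), (maxn n n'); split.
- exact: measurable_funD.
- by rewrite lt_min r0.
- by move=> x; apply: le_trans (ler_normD _ _) _; exact: lerD.
move=> x; have [->|/hs [h1 h2] _] := eqVneq (a x) 0.
  rewrite add0r => /hs' [h1 h2]; split; first by rewrite ge_min h1 orbT.
  by rewrite (le_trans h2) // ler_nat leq_maxr.
split; first by rewrite ge_min h1.
by rewrite (le_trans h2) // ler_nat leq_maxl.
Qed.

Lemma annular0 : annular (fun=> 0).
Proof.
exists 0, 1, 0%N; split; [exact: measurable_cst|exact: ltr01|by move=> x; rewrite normr0|].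
by move=> x; rewrite eqxx.
Qed.

Lemma annular_sum (r : seq int) (a : int -> E3 R -> R) : (forall l, annular (a l)) ->
  annular (fun x => \sum_(l <- r) a l x).
Proof.
move=> h; elim: r => [|l r IH].
  have -> : (fun x => \sum_(l <- [::]) a l x) = fun=> 0 by apply/funext => x; rewrite big_nil.
  exact: annular0.
have -> : (fun x => \sum_(l0 <- l :: r) a l0 x) = fun x => a l x + \sum_(l0 <- r) a l0 x.
  by apply/funext => x; rewrite big_cons.
exact: (annularD (h l) IH).
Qed.

Lemma annularM (a b : E3 R -> R) (N : R) : annular a -> measurable_fun setT b -> (forall x, `|b x| <= N) ->
  annular (fun x => a x * b x).
Proof.
move=> [M [r [n [ma r0 hM hs]]]] mb hN; exists (M * N), r, n; split => //.
- exact: measurable_funM.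
- by move=> x; rewrite normrM ler_pM.
by move=> x; rewrite mulf_eq0 negb_or => /andP [h _]; exact: hs.
Qed.

Definition filtered (m : E3 R -> R) i xi : R[i] := (m xi)%:C * g i xi.

Lemma filtered_meas m i : measurable_fun setT m -> cmeas (filtered m i).
Proof. by move=> mm; apply: cmeasM => //; exact: cmeas_real. Qed.

Lemma annular_bound m i : annular m -> exists (K : R) (n : nat), 0 <= K /\
  forall x, cmod (filtered m i x) <= K * cmod (cut n (G i) x).
Proof.
move=> [M [r [n [mm r0 hM hs]]]]; exists (M / Num.sqrt r), n.
have M0 : 0 <= M by apply: le_trans (hM 0).
split; first by rewrite divr_ge0 // sqrtr_ge0.
move=> x; rewrite /filtered; have [->|h] := eqVneq (m x) 0.
  by rewrite mul0r cmod0 !mulr_ge0 ?cmod_ge0 // invr_ge0 sqrtr_ge0.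
have [h1 h2] := hs x h; rewrite /cut ball3_in // mul1r /weighted !cmodM !cmod_real.
rewrite (ger0_norm (sq_ge0 x)) mulrA; apply: ler_wpM2r; first exact: cmod_ge0.
have sr : 0 < Num.sqrt r by rewrite sqrtr_gt0.
apply: (le_trans (hM x)); rewrite -mulrA ler_peMr // ler_pdivlMl // mulr1.
by rewrite /sq ler_wsqrtr.
Qed.

Lemma annular_L2 m i : annular m -> L2 (filtered m i).
Proof.
move=> am; have [K [n [K0 hK]]] := annular_bound i am; have [M [r [q [mm _ _ _]]]] := am.
exact: (L2_le (filtered_meas i mm) hK (cut_L2 n (weighted_L2 hpsi hu i))).
Qed.

Lemma annular_int m i : annular m -> cintegrable (filtered m i).
Proof.
move=> am; have [K [n [K0 hK]]] := annular_bound i am; have [M [r [q [mm _ _ _]]]] := am.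
exact: (cintegrable_le (filtered_meas i mm)
  (integrable_scale K (integrable_cmod (cut_int n (weighted_L2 hpsi hu i)))) hK).
Qed.

Lemma annular_gradient_int m i j : annular m -> cintegrable (gradient u m i j).
Proof.
move=> am; have [M [r [n [mm _ _ hs]]]] := am.
apply: (cintegrable_le (gradient_meas hpsi hu i j mm)
  (integrable_scale n%:R (integrable_cmod (annular_int i am)))) => x.
rewrite /gradient -/(filtered m i x) (cmodM _ (filtered m i x)) (cmodM 'i%C) cmod_i mul1r cmod_real.
have [h|h] := eqVneq (m x) 0.
  by rewrite /filtered h mul0r cmod0 !mulr0.
apply: ler_wpM2r; first exact: cmod_ge0.
by apply: le_trans (coord3_le _ _) _; have [] := hs x h.
Qed.

Let dT i : density (g i) (T i). Proof. exact: (represents_density (g_represents hu i)). Qed.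

Lemma Slow_filter k (a : vdist R) i : Slow psi k a i = filter (ps psi k) (a i).
Proof. by []. Qed.

Lemma Delta_filter k (a : vdist R) i : Delta psi k a i = filter (ph psi k) (a i).
Proof.
have -> : ph psi k = fun x => LP_phi psi (2 ^ (- k) *: x) by apply/funext => x; rewrite LP_phiE.
by [].
Qed.

Lemma high_density k i : density (fun x => (1 - ps psi k x)%:C * g i x) (high psi k T i).
Proof.
have d1 := filter_density (ps_test hpsi k) (dT i).
have := densityD (dT i) (densityN d1); rewrite -Slow_filter.
congr density; apply/funext => x; rewrite rmorphB rmorph1; ring.
Qed.

Definition rep (m : E3 R -> R) i D := represents (inv_fourier_fun (filtered m i)) D.

Lemma rep_ext m m' i D : m =1 m' -> rep m i D -> rep m' i D.
Proof. by move=> /funext ->. Qed.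

Lemma rep_gradient l i j : represents (inv_fourier_fun (gradient u (ph psi l) i j))
  (dpd j (Delta psi l T i)).
Proof. by rewrite Delta_filter; exact: (filter_dpd_represents j (ph_test hpsi l) (dT i)). Qed.

Lemma rep_comp (m m' : E3 R -> R) i D : test_function m -> test_function m' ->
  D = filter m (filter m' (T i)) -> rep (fun x => m x * m' x) i D.
Proof.
move=> t t' ->; have := filter_represents t (filter_density t' (dT i)).
rewrite /rep /filtered; congr represents; congr inv_fourier_fun; apply/funext => x.
by rewrite rmorphM mulrA.
Qed.

Lemma rep_Slow_Delta l l' i : rep (fun x => ps psi l x * ph psi l' x) i (Slow psi l (Delta psi l' T) i).
Proof. by apply: rep_comp; [exact: (ps_test hpsi)|exact: (ph_test hpsi)|rewrite Slow_filter Delta_filter]. Qed.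

Lemma rep_Delta_Slow l l' i : rep (fun x => ph psi l x * ps psi l' x) i (Delta psi l (Slow psi l' T) i).
Proof. by apply: rep_comp; [exact: (ph_test hpsi)|exact: (ps_test hpsi)|rewrite Delta_filter]. Qed.

Lemma rep_Delta_high l k i : rep (fun x => ph psi l x * (1 - ps psi k x)) i (Delta psi l (high psi k T) i).
Proof.
rewrite Delta_filter; have := filter_represents (ph_test hpsi l) (high_density k i).
rewrite /rep /filtered; congr represents; congr inv_fourier_fun; apply/funext => x.
by rewrite rmorphM mulrA.
Qed.

Lemma annular_Delta_high l k : annular (fun x => ph psi l x * (1 - ps psi k x)).
Proof. by have [M _ hM] := hp_bounded; apply: (annularM (annular_ph l) (hp_meas k) (hM k)). Qed.

Lemma repD m m' i D D' : annular m -> annular m' -> rep m i D -> rep m' i D' ->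
  rep (fun x => m x + m' x) i (D + D').
Proof.
move=> am am' h h'; have := representsD h h'; rewrite /rep; congr represents.
apply/funext => x; rewrite -(inv_fourierD x (annular_int i am) (annular_int i am')).
refine (congr1 (fun F => inv_fourier_fun F x) _); apply/funext => xi.
by rewrite /filtered rmorphD mulrDl.
Qed.

Lemma rep0 i : rep (fun=> 0) i 0.
Proof.
have := @represents0 R; rewrite /rep; congr represents; apply/funext => x.
rewrite /inv_fourier_fun (@eq_cintegral _ _ (fun=> 0)) ?cintegral0 ?mulr0 //.
by move=> xi; rewrite /filtered mul0r mulr0.
Qed.

Lemma rep_tDelta_high l k i :
  rep (fun x => (\sum_(l' <- zrange (l - 2) (l + 2)) ph psi l' x) * (1 - ps psi k x)) i
    (tDelta psi l (high psi k T) i).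
Proof.
rewrite /tDelta; move: (zrange _ _) => r.
apply: (@rep_ext (fun x => \sum_(l' <- r) ph psi l' x * (1 - ps psi k x))).
  by move=> x; rewrite mulr_suml.
elim: r => [|l' r IH].
  rewrite big_nil; apply: rep_ext (rep0 i) => x; by rewrite big_nil.
rewrite big_cons.
apply: (@rep_ext (fun x => ph psi l' x * (1 - ps psi k x) + \sum_(l' <- r) ph psi l' x * (1 - ps psi k x))).
  by move=> x; rewrite big_cons.
apply: (repD (annular_Delta_high l' k) _ (rep_Delta_high l' k i) IH).
by apply: annular_sum => l0; exact: annular_Delta_high.
Qed.

Lemma annular_tDelta_high l k :
  annular (fun x => (\sum_(l' <- zrange (l - 2) (l + 2)) ph psi l' x) * (1 - ps psi k x)).
Proof.
have [M _ hM] := hp_bounded; apply: (annularM _ (hp_meas k) (hM k)).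
by apply: annular_sum => l'; exact: annular_ph.
Qed.

Lemma annular_Slow_Delta l l' : annular (fun x => ps psi l x * ph psi l' x).
Proof.
have [M _ hM] := ps_bounded; have := annularM (annular_ph l') (ps_meas l) (hM l).
by congr annular; apply/funext => x; rewrite mulrC.
Qed.

Lemma annular_Delta_Slow l l' : annular (fun x => ph psi l x * ps psi l' x).
Proof. by have [M _ hM] := ps_bounded; apply: (annularM (annular_ph l) (ps_meas l') (hM l')). Qed.

(* The triad kernel: [z] carries the gradient, [x] the third factor and [- z - x] the transport. *)
Definition triad i j : E3 R * E3 R -> R[i] := fun p =>
  'i%C * (coord3 p.1 j)%:C * g i p.1 * (g i p.2 * g j (- p.1 - p.2)).

Definition admissible (m : E3 R * E3 R -> R) := forall i j, dbl (fun p => (m p)%:C * triad i j p).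
Definition form (m : E3 R * E3 R -> R) : R[i] :=
  \sum_(i < 3) \sum_(j < 3) dint (fun p => (m p)%:C * triad i j p).

Definition hasint (f : E3 R -> R[i]) (c : R[i]) := cintegrable f /\ cintegral f = c.
(** Pairs an integrand in physical space with its symbol in frequency. The relation is stable under
    sums, so each flux is assembled from its blocks. *)
Definition hasform (f : E3 R -> R[i]) (m : E3 R * E3 R -> R) := admissible m /\ hasint f (c0%:C * form m).

Lemma hasint_sum (I : Type) (r : seq I) (F : I -> E3 R -> R[i]) c : (forall n, hasint (F n) (c n)) ->
  hasint (fun x => \sum_(n <- r) F n x) (\sum_(n <- r) c n).
Proof.
move=> h; have hi n := (h n).1; split; first exact: (cintegrable_sum r hi).
by rewrite (cintegral_sum r hi); apply: eq_bigr => n _; exact: (h n).2.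
Qed.

Lemma formS (I : Type) (r : seq I) (m : I -> E3 R * E3 R -> R) : (forall n, admissible (m n)) ->
  admissible (fun p => \sum_(n <- r) m n p) /\
  form (fun p => \sum_(n <- r) m n p) = \sum_(n <- r) form (m n).
Proof.
move=> h.
have E i j : (fun p => (\sum_(n <- r) m n p)%:C * triad i j p) =
    fun p => \sum_(n <- r) (m n p)%:C * triad i j p.
  by apply/funext => p; rewrite rmorph_sum mulr_suml.
split; first by move=> i j; rewrite E; apply: dbl_sum => n; exact: (h n i j).
rewrite /form [RHS]exchange_big; apply: eq_bigr => i _; rewrite [RHS]exchange_big; apply: eq_bigr => j _.
by rewrite E (dint_sum r (fun n => h n i j)).
Qed.

Lemma hasform_sum (I : Type) (r : seq I) F (m : I -> E3 R * E3 R -> R) : (forall n, hasform (F n) (m n)) ->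
  hasform (fun x => \sum_(n <- r) F n x) (fun p => \sum_(n <- r) m n p).
Proof.
move=> h; have [h1 h2] := formS r (fun n => (h n).1); split; first exact: h1.
by rewrite h2 mulr_sumr; apply: hasint_sum => n; exact: (h n).2.
Qed.

Lemma hasform_ext F F' m m' : hasform F m -> F =1 F' -> m =1 m' -> hasform F' m'.
Proof. by move=> h /funext <- /funext <-. Qed.

Lemma triadE (al be ga : E3 R -> R) i j p :
  tker (gradient u be i j) (filtered ga i) (filtered al j) p =
  (be p.1 * (ga p.2 * al (- p.1 - p.2)))%:C * triad i j p.
Proof. by rewrite /tker /gradient /filtered /triad !realCM; ring. Qed.

Lemma block_dbl (al be ga : E3 R -> R) i j : annular al -> annular be -> annular ga ->
  dbl (tker (gradient u be i j) (filtered ga i) (filtered al j)).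
Proof.
by move=> aa ab ac; exact: (dbl_L1 (annular_gradient_int i j ab) (annular_L2 i ac) (annular_L2 j aa)).
Qed.

Lemma block_adm (al be ga : E3 R -> R) : annular al -> annular be -> annular ga ->
  admissible (fun p => be p.1 * (ga p.2 * al (- p.1 - p.2))).
Proof.
move=> aa ab ac i j; have := block_dbl i j aa ab ac; congr dbl; apply/funext => p; exact: triadE.
Qed.

Definition product (al be ga : E3 R -> R) i j x : R[i] := inv_fourier_fun (filtered al j) x *
  inv_fourier_fun (gradient u be i j) x * inv_fourier_fun (filtered ga i) x.

Lemma product_hasint (al be ga : E3 R -> R) i j : annular al -> annular be -> annular ga ->
  hasint (product al be ga i j) (c0%:C * dint (tker (gradient u be i j) (filtered ga i) (filtered al j))).
Proof.
move=> aa ab ac.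
have iA := annular_gradient_int i j ab; have iB := annular_int i ac; have lB := annular_L2 i ac.
have iC := annular_int j aa; have lC := annular_L2 j aa.
have E : product al be ga i j = fun x => inv_fourier_fun (gradient u be i j) x *
    (inv_fourier_fun (filtered ga i) x * inv_fourier_fun (filtered al j) x).
  have pe (a b c : R[i]) : a * b * c = b * (c * a) by ring.
  apply/funext => x; exact: (pe _ _ _).
rewrite E; split; last exact: (inv_fourier_trilinear iA iB lB iC lC).
have [M _ hM] := inv_fourier_bounded iA.
apply: (cintegrable_boundM (cmeas_inv_fourier iA) hM).
exact: (L2_mul (bessel iB lB).1 (bessel iC lC).1).
Qed.

(** [fun_of] chooses arbitrary representatives, so the explicit transforms replace them only almost
    everywhere. *)
Lemma trilinear_ae (a b c : vdist R) (al be ga : E3 R -> R) :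
  (forall j, rep al j (a j)) -> (forall i, rep ga i (c i)) ->
  (forall i j, represents (inv_fourier_fun (gradient u be i j)) (dpd j (b i))) ->
  cmeas (trilinear a b c) /\
  {ae mu, forall x, trilinear a b c x = \sum_(i < 3) \sum_(j < 3) product al be ga i j x}.
Proof.
move=> ha hc hb; split.
  apply: cmeas_sum => i; apply: cmeas_sum => j; apply: cmeasM; first apply: cmeasM.
  - exact: (tempered_meas hpsi (fun_of_represents (ha j)).1).
  - exact: (tempered_meas hpsi (fun_of_represents (hb i j)).1).
  - exact: (tempered_meas hpsi (fun_of_represents (hc i)).1).
have h1 := ae_ord3 (fun j => fun_of_ae hpsi (ha j)).
have h2 := ae_ord3 (fun i => fun_of_ae hpsi (hc i)).
have h3 := ae_ord3 (fun i => ae_ord3 (fun j => fun_of_ae hpsi (hb i j))).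
pose Q x := (forall j, fun_of (a j) x = inv_fourier_fun (filtered al j) x) /\
  (forall i, fun_of (c i) x = inv_fourier_fun (filtered ga i) x).
have h4 : {ae mu, forall x, Q x} by refine (aeS2 _ h1 h2) => x e1 e2; exact: (conj e1 e2).
refine (aeS2 _ h4 h3) => x [e1 e2] e.
rewrite /trilinear; apply: eq_bigr => i _; apply: eq_bigr => j _.
rewrite /product.
exact: (f_equal2 *%R (f_equal2 *%R (e1 j) (e i j)) (e2 i)).
Qed.

Lemma trilinear_hasform (a b c : vdist R) (al be ga : E3 R -> R) :
  annular al -> annular be -> annular ga ->
  (forall j, rep al j (a j)) -> (forall i, rep ga i (c i)) ->
  (forall i j, represents (inv_fourier_fun (gradient u be i j)) (dpd j (b i))) ->
  hasform (trilinear a b c) (fun p => be p.1 * (ga p.2 * al (- p.1 - p.2))).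
Proof.
move=> aa ab ac ha hc hb; split; first exact: (block_adm aa ab ac).
have [mt he] := trilinear_ae ha hc hb.
have hs : hasint (fun x => \sum_(i < 3) \sum_(j < 3) product al be ga i j x)
    (\sum_(i < 3) \sum_(j < 3) c0%:C * dint (tker (gradient u be i j) (filtered ga i) (filtered al j))).
  apply: hasint_sum => i; apply: hasint_sum => j; exact: (product_hasint i j aa ab ac).
have he' : {ae mu, forall x, \sum_(i < 3) \sum_(j < 3) product al be ga i j x = trilinear a b c x}.
  by apply: aeS he => x ->.
split; first exact: (ae_eq_cintegrable mt he' hs.1).
rewrite (ae_eq_cintegral mt (cintegrable_meas hs.1) he) hs.2 /form mulr_sumr.
apply: eq_bigr => i _; rewrite mulr_sumr; apply: eq_bigr => j _.
refine (congr1 ( *%R c0%:C) _); apply: eq_dint => p; exact: triadE.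
Qed.

End blocks.

(** * Series of functions and the third flux *)

Section series_of_functions.
Context {R : realType}.
Local Notation mu := (leb3 R).
Implicit Types (x : E3 R).

(** Cauchy's criterion with countable quantifiers, so that the set where measurable functions
    converge is measurable. *)
Lemma cvgn_cauchy (v : nat -> R) : cvgn v <->
  forall k, exists N, forall m, `|v (N + m)%N - v N| <= k.+1%:R^-1.
Proof.
split=> [cv k|h].
  have k0 : 0 < k.+1%:R^-1 / 2 :> R by rewrite divr_gt0 // invr_gt0.
  have [N _ hN] := (@cvgrPdist_le _ _ _ _ _ v (limn v)).1 cv _ k0.
  exists N => m; have h1 := hN N (leqnn N); have h2 := hN (N + m)%N (leq_addr m N).
  have -> : v (N + m)%N - v N = (limn v - v N) - (limn v - v (N + m)%N) by ring.
  by apply: le_trans (ler_normB _ _) _; rewrite (splitr k.+1%:R^-1) lerD.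
apply/cauchy_cvgP; apply: cauchy_exP => e e0.
have [N hN] := h (Num.bound e^-1); exists (v N).
have he : (Num.bound e^-1).+1%:R^-1 < e.
  rewrite invf_plt ?posrE //; apply: (lt_le_trans (archi_boundP _)); rewrite ?ler_nat //.
  by rewrite invr_ge0 ltW.
exists N => // n /= Nn; rewrite /ball /= distrC.
by apply: le_lt_trans he; have := hN (n - N)%N; rewrite subnKC.
Qed.

(** Where the sequence diverges [limn] takes the default value [point], so the function is glued
    from two measurable pieces. *)
Lemma measurable_limn (v : nat -> E3 R -> R) : (forall n, measurable_fun setT (v n)) ->
  measurable_fun setT (fun x => limn (fun n => v n x)).
Proof.
move=> mv; pose E : set (E3 R) := [set x | cvgn (fun n => v n x)].
pose A k N m : set (E3 R) := [set x | `|v (N + m)%N x - v N x| <= k.+1%:R^-1].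
have EE : E = \bigcap_k \bigcup_N \bigcap_m A k N m.
  apply/seteqP; split=> x.
    by move=> /cvgn_cauchy h k _; have [N hN] := h k; exists N => // m _; exact: hN.
  by move=> h; apply/cvgn_cauchy => k; have [N _ hN] := h k I; exists N => m; exact: hN.
have mE : measurable E.
  rewrite EE; apply: bigcapT_measurable => k; apply: bigcupT_measurable => N.
  apply: bigcapT_measurable => m.
  have md : measurable_fun setT (fun x => cmod ((v (N + m)%N x - v N x)%:C)).
    by apply: measurable_cmod; apply: cmeas_real; exact: (measurable_funB (mv _) (mv _)).
  have mb := measurable_fun_ler md (measurable_cst (k.+1%:R^-1 : R)).
  have := mb measurableT [set true] I; rewrite setTI; congr measurable.
  by apply/seteqP; split => x /=; rewrite cmod_real.
have mb : measurable_fun setT (fun x : E3 R => x \in E).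
  apply: (measurable_fun_bool true); rewrite setTI (_ : _ @^-1` _ = E) //.
  by apply/seteqP; split => x /= hx; [exact: (set_mem hx)|exact: (mem_set hx)].
apply: (@measurable_fun_cvg _ _ _ _ (fun n x => if x \in E then v n x else point)).
  by move=> n; apply: measurable_fun_ifT => //; exact: measurable_cst.
move=> x _ /=; have [h|h] := boolP (x \in E); first exact: (set_mem h).
have -> : limn (fun n => v n x) = point by apply: dvgP => c; case/negP: h; exact: mem_set.
exact: cvg_cst.
Qed.

Lemma cseries_meas (F : nat -> E3 R -> R[i]) : (forall n, cmeas (F n)) ->
  cmeas (fun x => cseries (fun n => F n x)).
Proof.
move=> mF; split; rewrite /cseries /=; apply: measurable_limn => n; rewrite /series /=.
  by apply: measurable_sum => i; exact: (mF i).1.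
by apply: measurable_sum => i; exact: (mF i).2.
Qed.

Lemma summable_majorant (d : nat -> E3 R -> R) (C : R) : (forall n x, 0 <= d n x) ->
  (forall n, measurable_fun setT (d n)) ->
  (forall n, (\int[mu]_x (d n x)%:E <= (C / 2 ^+ n)%:E)%E) ->
  exists S : E3 R -> R, mu.-integrable setT (EFin \o S) /\
    {ae mu, forall x, forall n, \sum_(0 <= i < n) d i x <= S x}.
Proof.
move=> d0 md hd.
have C0 : 0 <= C.
  have : (0 <= (C / 2 ^+ 0)%:E)%E by apply: le_trans (hd 0%N); apply: integral_ge0 => x _; rewrite lee_fin.
  by rewrite lee_fin expr0 divr1.
have md' n : measurable_fun setT (EFin \o d n) by exact/measurable_EFinP.
pose T x : \bar R := (\sum_(0 <= n <oo) (d n x)%:E)%E.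
have mT : measurable_fun setT T.
  apply: (@ge0_emeasurable_sum _ _ _ _ (fun n x => (d n x)%:E) xpredT); last by move=> n _; exact: md'.
  by move=> n x _ _; rewrite lee_fin.
have T0 x : (0 <= T x)%E by apply: nneseries_ge0 => n _ _; rewrite lee_fin.
have iT : (\int[mu]_x T x <= (2 * C)%:E)%E.
  rewrite integral_nneseries //; last by move=> n x _; rewrite lee_fin.
  apply: lime_le.
    by apply: is_cvg_nneseries => n _ _; apply: integral_ge0 => x _; rewrite lee_fin.
  apply: nearW => n.
  apply: (@le_trans _ _ (\sum_(0 <= i < n) (C / 2 ^+ i)%:E)%E); first by apply: lee_sum => i _.
  rewrite sumEFin lee_fin.
  have : \sum_(0 <= i < n) C / 2 ^+ i <= 2 * C - 2 * C * (2 ^+ n)^-1 :> R.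
    elim: n => [|n IH]; first by rewrite big_geq // expr0 invr1; lra.
    rewrite big_nat_recr //= exprS invfM; move: IH.
    have [z ->] : exists z : R, (2 ^+ n)^-1 = z by eexists.
    by set s := \sum_(_ <= _ < _) _; lra.
  have : 0 < (2 ^+ n)^-1 :> R by rewrite invr_gt0 exprn_gt0.
  by move=> h1 h2; rewrite (le_trans h2) // lerBlDr lerDl !mulr_ge0 // ltW.
have intT : mu.-integrable setT T.
  apply/integrableP; split => //; under eq_integral do rewrite gee0_abs //.
  by rewrite (le_lt_trans iT) // ltry.
pose S x := fine (T x).
have S0 x : 0 <= S x by exact: fine_ge0.
have mS : measurable_fun setT S by apply: measurableT_comp.
exists S; split.
  apply/integrableP; split; first exact/measurable_EFinP.
  under eq_integral do rewrite /= ger0_norm //.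
  rewrite (le_lt_trans _ (ltry (2 * C))) //; apply: le_trans iT; apply: ge0_le_integral => //.
  - by move=> x _; rewrite lee_fin.
  - exact/measurable_EFinP.
  - by move=> x _; rewrite /S; case: (T x) (T0 x) => //= *; rewrite ?leey.
have := integrable_ae measurableT intT; apply: aeS => x /(_ I) fx n.
rewrite -lee_fin /S fineK // -sumEFin.
by apply: nneseries_lim_ge => k _ _; rewrite lee_fin.
Qed.

Lemma bounded_series (a : nat -> R) (S : R) : (forall n, \sum_(0 <= i < n) `|a i| <= S) ->
  series a n @[n --> \oo] --> limn (series a).
Proof.
move=> h; suff : cvgn (series a) by [].
apply: normed_cvg; apply: nondecreasing_is_cvgn.
  by apply: nondecreasing_series => n _ _; exact: normr_ge0.
by exists S => _ [n _ <-]; exact: h.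
Qed.

Lemma cvg_dist0 (v : nat -> R) (l : R) : v n @[n --> \oo] --> l ->
  `|v n - l| @[n --> \oo] --> (0 : R).
Proof.
move=> h; have e : v n - l @[n --> \oo] --> l - l by apply: cvgB; [exact: h|exact: cvg_cst].
by rewrite subrr in e; have e2 := cvg_norm e; rewrite normr0 in e2; exact: e2.
Qed.

Lemma cseries_cvg (a : nat -> R[i]) (S : R) : (forall n, \sum_(0 <= i < n) cmod (a i) <= S) ->
  cmod (\sum_(0 <= i < n) a i - cseries a) @[n --> \oo] --> (0 : R).
Proof.
move=> h.
have h1 n : \sum_(0 <= i < n) `|complex.Re (a i)| <= S.
  by apply: le_trans (h n); apply: ler_sum => i _; exact: Re_le_cmod.
have h2 n : \sum_(0 <= i < n) `|complex.Im (a i)| <= S.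
  by apply: le_trans (h n); apply: ler_sum => i _; exact: Im_le_cmod.
have c1 := bounded_series h1; have c2 := bounded_series h2.
have n1 : `|series (fun n => complex.Re (a n)) n - limn (series (fun n => complex.Re (a n)))| @[n --> \oo] --> (0 : R).
  exact: (cvg_dist0 c1).
have n2 : `|series (fun n => complex.Im (a n)) n - limn (series (fun n => complex.Im (a n)))| @[n --> \oo] --> (0 : R).
  exact: (cvg_dist0 c2).
apply: null_le (null_add n1 n2) => n; rewrite cmod_ge0 /=.
by apply: le_trans (cmod_le _) _; rewrite ReB ImB Re_sum Im_sum.
Qed.

(** Geometric decay of the L1 norms provides one integrable majorant for all partial sums, hence
    convergence almost everywhere and convergence of the integrals. *)
Lemma cseries_integral (F : nat -> E3 R -> R[i]) (C : R) : (forall n, cintegrable (F n)) ->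
  (forall n, (N1 (F n) <= (C / 2 ^+ n)%:E)%E) ->
  cintegrable (fun x => cseries (fun n => F n x)) /\
  cmod (cintegral (fun x => \sum_(0 <= i < n) F i x) - cintegral (fun x => cseries (fun n => F n x)))
    @[n --> \oo] --> (0 : R).
Proof.
move=> iF hF; have mF n := cintegrable_meas (iF n).
have [S [iS hS]] := summable_majorant (fun n x => cmod_ge0 (F n x)) (fun n => measurable_cmod (mF n)) hF.
have mP n : cmeas (fun x => \sum_(0 <= i < n) F i x) by apply: cmeas_sum.
have mC := cseries_meas mF.
have cv : {ae mu, forall x, cmod (\sum_(0 <= i < n) F i x - cseries (fun n => F n x)) @[n --> \oo] --> (0 : R)}.
  by apply: aeS hS => x h; exact: (cseries_cvg h).
have dm : {ae mu, forall x, forall n, cmod (\sum_(0 <= i < n) F i x) <= S x}.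
  by apply: aeS hS => x h n; apply: le_trans (h n); exact: cmod_sum.
split; first exact: (dominated_N1 mP mC cv iS dm).1.
exact: (dominated_cintegral mP mC cv iS dm).
Qed.

Lemma N1_ae (f h : E3 R -> R[i]) : cmeas f -> cmeas h -> {ae mu, forall x, f x = h x} -> N1 f = N1 h.
Proof.
move=> mf mh e; apply: ge0_ae_eq_integral => //.
- by apply/measurable_EFinP; exact: measurable_cmod.
- by apply/measurable_EFinP; exact: measurable_cmod.
- by move=> x _; rewrite lee_fin cmod_ge0.
- by move=> x _; rewrite lee_fin cmod_ge0.
by apply: aeS e => x h0 _; rewrite h0.
Qed.

Lemma N1_sum (I : Type) (r : seq I) (F : I -> E3 R -> R[i]) : (forall i, cmeas (F i)) ->
  (N1 (fun x => (\sum_(i <- r) F i x)%R) <= \sum_(i <- r) N1 (F i))%E.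
Proof.
move=> mF; elim: r => [|i r IH].
  rewrite big_nil /N1; under eq_integral do rewrite big_nil cmod0; by rewrite integral0.
rewrite big_cons; under [X in N1 X]eq_fun do rewrite big_cons.
by apply: (le_trans (N1_add (mF i) (cmeas_sum r mF))); exact: leeD2l.
Qed.
End series_of_functions.

Section third_flux.
Context {R : realType}.
Variables (psi : E3 R -> R) (u : 'I_3 -> E3 R -> R).
Hypothesis hpsi : LP_cutoff psi.
Hypothesis hu : weak_solution (1 / 2) u.
Local Notation g := (spectrum u).
Implicit Types (x xi eta z : E3 R) (i j : 'I_3) (k l : int) (p : E3 R * E3 R).

Let mg i : cmeas (g i). Proof. exact: (g_meas hpsi (g_represents hu i)). Qed.

Lemma triad_meas i j : cmeas (triad u i j).
Proof.
have m1 : cmeas (fun z => 'i%C * (coord3 z j)%:C * g i z).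
  by apply: cmeasM => //; apply: cmeasM; [exact: cmeas_cst|exact: cmeas_coord].
exact: (tker_meas m1 (mg i) (mg j)).
Qed.

Lemma multiplier_meas (m : E3 R * E3 R -> R) i j : measurable_fun setT m ->
  cmeas (fun p => (m p)%:C * triad u i j p).
Proof. by move=> mm; apply: cmeasM; [exact: cmeas_real|exact: triad_meas]. Qed.

Lemma adm_le (m m' : E3 R * E3 R -> R) (K : R) : measurable_fun setT m -> 0 <= K ->
  (forall p, `|m p| <= K * `|m' p|) -> admissible u m' -> admissible u m.
Proof.
move=> mm K0 h am i j; apply: (dbl_le (multiplier_meas i j mm) K0 _ (am i j)) => p.
rewrite (cmodM (m p)%:C) (cmodM (m' p)%:C) !cmod_real mulrA.
by apply: ler_wpM2r; [exact: cmod_ge0|exact: h].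
Qed.

Lemma adm_localized n (M : R) chi : localized n M chi -> admissible u (fun p => chi p.1).
Proof.
move=> hl i j; have := gradient_dbl hpsi hu i j i j hl; congr dbl; apply/funext => p.
by rewrite /tker /gradient /triad; ring.
Qed.

Lemma localized_ph k : exists n (M : R), localized n M (ph psi k).
Proof.
have [M M0 hM] := ph_bounded hpsi; exists (Num.bound (p2 (k + 1) : R)), M.
split; [exact: (ph_meas hpsi)|exact: M0|exact: hM|].
move=> z hz; apply/eqP; apply/negPn/negP => /(ph_neq0 hpsi) /andP [_ h].
have := lt_trans h (archi_boundP (ltW (p2_gt0 (k + 1)))).
by move=> /(lt_trans hz); rewrite ltxx.
Qed.

Lemma hasform0 : hasform u (fun=> 0) (fun=> 0).
Proof.
have := @hasform_sum R u void [::] (fun _ _ => 0) (fun _ _ => 0) (fun v => match v with end).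
by move=> h; apply: (hasform_ext h) => x; rewrite big_nil.
Qed.

Lemma hasform_sum_in (I : eqType) (r : seq I) F (m : I -> E3 R * E3 R -> R) :
  (forall n, n \in r -> hasform u (F n) (m n)) ->
  hasform u (fun x => \sum_(n <- r) F n x) (fun p => \sum_(n <- r) m n p).
Proof.
move=> h.
have h' n : hasform u (if n \in r then F n else fun=> 0) (if n \in r then m n else fun=> 0).
  by case: ifP => [/h //|_]; exact: hasform0.
apply: hasform_ext (hasform_sum r h') _ _ => x /=.
  by rewrite [LHS]big_seq [RHS]big_seq; apply: eq_bigr => n ->.
by rewrite [LHS]big_seq [RHS]big_seq; apply: eq_bigr => n ->.
Qed.

(** Integrals of partial sums converge on both sides: in physical space by the decay of the L1
    norms, in frequency because the summed symbols are dominated by K |D| and eventually constant at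
    each point. The two limits therefore agree. *)
Lemma hasform_cseries (F : nat -> E3 R -> R[i]) (m : nat -> E3 R * E3 R -> R) M D (C K : R) :
  (forall n, hasform u (F n) (m n)) -> (forall n, (N1 (F n) <= (C / 2 ^+ n)%:E)%E) ->
  (forall n, measurable_fun setT (m n)) -> measurable_fun setT M -> admissible u D -> 0 <= K ->
  (forall n p, `|\sum_(0 <= i < n) m i p| <= K * `|D p|) ->
  (forall p, exists N, forall n, (N <= n)%N -> \sum_(0 <= i < n) m i p = M p) ->
  hasform u (fun x => cseries (fun n => F n x)) M.
Proof.
move=> hF hN mm mM aD K0 hD hM.
have [iC cC] := cseries_integral (fun n => (hF n).2.1) hN.
pose P n p := \sum_(0 <= i < n) m i p.
have hP n := hasform_sum (index_iota 0 n) hF.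
have mP n : measurable_fun setT (P n) by apply: measurable_sum => i; exact: mm.
have st i j : dbl (fun p => (M p)%:C * triad u i j p) /\
    cmod (dint (fun p => (P n p)%:C * triad u i j p) - dint (fun p => (M p)%:C * triad u i j p))
      @[n --> \oo] --> (0 : R).
  apply: (@dint_cvg R (fun n p => (P n p)%:C * triad u i j p) _ (fun p => K%:C * ((D p)%:C * triad u i j p))).
  - by move=> n; exact: multiplier_meas.
  - exact: multiplier_meas.
  - exact: (dblZ K%:C (aD i j)).
  - move=> n p; rewrite (cmodM (P n p)%:C) (cmodM K%:C) (cmodM (D p)%:C) !cmod_real (ger0_norm K0) mulrA.
    by apply: ler_wpM2r; [exact: cmod_ge0|exact: hD].
  - move=> p; have [N h] := hM p.
    have c0 : (0 : R) @[n --> \oo] --> (0 : R) by exact: cvg_cst.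
    apply: cvg_trans c0; apply: near_eq_cvg; exists N => // n /= Nn.
    by rewrite /P h // subrr cmod0.
have aM : admissible u M by move=> i j; exact: (st i j).1.
split; first exact: aM.
split; first exact: iC.
apply: (@null_unique R _ _ (fun n => cintegral (fun x => \sum_(0 <= i < n) F i x)) cC).
have E n : cintegral (fun x => \sum_(0 <= i < n) F i x) = c0%:C * form u (P n) by exact: (hP n).2.2.
pose d i j n := cmod (dint (fun p => (P n p)%:C * triad u i j p) - dint (fun p => (M p)%:C * triad u i j p)).
have dn : \sum_(i < 3) \sum_(j < 3) d i j n @[n --> \oo] --> (0 : R).
  apply: (@null_sum3 R (fun i n => \sum_(j < 3) d i j n)) => i; apply: (@null_sum3 R (fun j n => d i j n)) => j; exact: (st i j).2.
apply: null_le (null_scale (cmod (c0%:C : R[i])) dn) => n; rewrite cmod_ge0 /=.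
rewrite E -mulrBr (cmodM c0%:C); apply: ler_wpM2l; first exact: cmod_ge0.
rewrite /form -sumrB; apply: le_trans (cmod_sum _ _ _) _; apply: ler_sum => i _.
by rewrite -sumrB; exact: cmod_sum.
Qed.
End third_flux.

Section flux_multipliers.
Context {R : realType}.
Variables (psi : E3 R -> R) (u : 'I_3 -> E3 R -> R).
Hypothesis hpsi : LP_cutoff psi.
Hypothesis hu : weak_solution (1 / 2) u.
Local Notation mu := (leb3 R).
Local Notation G := (weighted u).
Local Notation T := (dist_of_field u).
Implicit Types (x xi eta z : E3 R) (i j : 'I_3) (k l : int) (p : E3 R * E3 R).

(** On the support of m, |g| <= r^(-1/2) |G|. *)
Lemma shell_nn2 m i (K r : R) : annular m -> (forall x, `|m x| <= K) -> 0 < r ->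
  (forall x, m x != 0 -> r <= enorm x) -> nn2 (filtered u m i) <= K ^+ 2 / r * nn2 (G i).
Proof.
move=> am hK r0 hr; have K0 : 0 <= K by apply: le_trans (hK 0).
have lG := weighted_L2 hpsi hu i.
have sr : 0 < Num.sqrt r by rewrite sqrtr_gt0.
have E : (K / Num.sqrt r) ^+ 2 = K ^+ 2 / r by rewrite exprMn exprVn sqr_sqrtr // ltW.
rewrite -E -(nn2Z (K / Num.sqrt r) lG); apply: nn2_le.
- exact: (annular_L2 hpsi hu i am).
- exact: (L2Z (K / Num.sqrt r)%:C lG).
move=> x; rewrite /filtered (cmodM (m x)%:C) (cmodM (K / Num.sqrt r)%:C) !cmod_real [X in _ <= X * _]ger0_norm; last first.
  by rewrite divr_ge0 // ltW.
have [->|h] := eqVneq (m x) 0.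
  by rewrite normr0 mul0r mulr_ge0 ?cmod_ge0 // divr_ge0 // ltW.
rewrite /weighted (cmodM (sq x)%:C) cmod_real (ger0_norm (sq_ge0 x)) mulrA.
apply: ler_wpM2r; first exact: cmod_ge0.
apply: (le_trans (hK x)); rewrite -mulrA ler_peMr // ler_pdivlMl // mulr1.
by rewrite /sq ler_wsqrtr // hr.
Qed.

Lemma product_N1 (al be ga : E3 R -> R) i j (B : R) : annular al -> annular be -> annular ga ->
  (forall x, cmod (inv_fourier_fun (gradient u be i j) x) <= B) ->
  (N1 (product u al be ga i j) <=
    (B * Num.sqrt (nn2 (filtered u ga i) * nn2 (filtered u al j)))%:E)%E.
Proof.
move=> aa ab ac hB; have B0 : 0 <= B by apply: le_trans (hB 0); exact: cmod_ge0.
have [bc1 bc2] := bessel (annular_int hpsi hu i ac) (annular_L2 hpsi hu i ac).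
have [ba1 ba2] := bessel (annular_int hpsi hu j aa) (annular_L2 hpsi hu j aa).
have ip := (product_hasint hpsi hu i j aa ab ac).1.
have im := L2_mulr bc1 ba1.
have pe (s t v : R) : 0 <= s -> 0 <= v -> t <= B -> s * t * v <= B * (v * s).
  move=> s0 v0 tB; rewrite (_ : s * t * v = t * (v * s)); last by ring.
  by apply: ler_wpM2r => //; rewrite mulr_ge0.
rewrite (N1_fin ip) lee_fin.
apply: (@le_trans _ _ (\int[mu]_x (B * (cmod (inv_fourier_fun (filtered u ga i) x) * cmod (inv_fourier_fun (filtered u al j) x))))).
  apply: le_Rintegral => //.
  - exact: (integrable_cmod ip).
  - exact: (integrable_scale B im).
  move=> x _; rewrite /product (cmodM (_ * _)) (cmodM (inv_fourier_fun (filtered u al j) x)).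
  exact: (pe _ _ _ (cmod_ge0 _) (cmod_ge0 _) (hB x)).
rewrite RintegralZl //; apply: ler_wpM2l => //.
apply: le_trans (cauchy_schwarz bc1 ba1) _.
exact: (ler_wsqrtr (ler_pM (nn2_ge0 _) (nn2_ge0 _) bc2 ba2)).
Qed.

Lemma trilinear_N1 (a b c : vdist R) (al be ga : E3 R -> R) (B : 'I_3 -> 'I_3 -> R) :
  annular al -> annular be -> annular ga ->
  (forall j, rep u al j (a j)) -> (forall i, rep u ga i (c i)) ->
  (forall i j, represents (inv_fourier_fun (gradient u be i j)) (dpd j (b i))) ->
  (forall i j x, cmod (inv_fourier_fun (gradient u be i j) x) <= B i j) ->
  (N1 (trilinear a b c) <=
   (\sum_(i < 3) \sum_(j < 3) B i j * Num.sqrt (nn2 (filtered u ga i) * nn2 (filtered u al j)))%:E)%E.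
Proof.
move=> aa ab ac ha hc hb hB; have [mt he] := trilinear_ae hpsi ha hc hb.
have mp i j : cmeas (product u al be ga i j).
  exact: (cintegrable_meas (product_hasint hpsi hu i j aa ab ac).1).
have ms i : cmeas (fun x => \sum_(j < 3) product u al be ga i j x) by apply: cmeas_sum => j; exact: mp.
have ms2 : cmeas (fun x => \sum_(i < 3) \sum_(j < 3) product u al be ga i j x) by apply: cmeas_sum => i; exact: ms.
rewrite (N1_ae mt ms2 he).
apply: (le_trans (N1_sum (index_enum 'I_3) ms)); rewrite -sumEFin; apply: lee_sum => i _.
apply: (le_trans (N1_sum (index_enum 'I_3) (fun j => mp i j))); rewrite -sumEFin; apply: lee_sum => j _.
exact: (product_N1 aa ab ac (hB i j)).
Qed.

Lemma flux1_form k : hasform u (fun x =>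
    \sum_(l <- zrange (k - 1) (k + 2)) \sum_(l' <- zrange (l - 2) (k - 1))
    \sum_(l'' <- zrange 0 (k - 1))
      trilinear (Slow psi (l - 2) (Delta psi l'' T)) (Delta psi l' T)
                (Delta psi l (high psi k T)) x) (fun p => m1 psi k p.1 p.2).
Proof.
have h l l' l'' := trilinear_hasform hpsi hu (annular_Slow_Delta hpsi (l - 2) l'') (annular_ph hpsi l')
  (annular_Delta_high hpsi l k) (rep_Slow_Delta hpsi hu (l - 2) l'') (rep_Delta_high hpsi hu l k)
  (rep_gradient hpsi hu l').
have hs := hasform_sum (zrange (k - 1) (k + 2)) (fun l => hasform_sum (zrange (l - 2) (k - 1))
  (fun l' => hasform_sum (zrange 0 (k - 1)) (fun l'' => h l l' l''))).
apply: (hasform_ext hs) => // p; rewrite /m1.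
apply: eq_bigr => l _; apply: eq_bigr => l' _; apply: eq_bigr => l'' _; ring.
Qed.

Lemma flux2_form k : hasform u (fun x =>
    \sum_(l <- zrange (k - 3) k) \sum_(l'' <- zrange (k %/ 2)%Z (k - 1))
      trilinear (Delta psi l (Slow psi k T)) (Delta psi l'' T)
                (tDelta psi l (high psi k T)) x) (fun p => m2 psi k (k %/ 2)%Z p.1 p.2).
Proof.
have h l l'' := trilinear_hasform hpsi hu (annular_Delta_Slow hpsi l k) (annular_ph hpsi l'')
  (annular_tDelta_high hpsi l k) (rep_Delta_Slow hpsi hu l k) (rep_tDelta_high hpsi hu l k)
  (rep_gradient hpsi hu l'').
have hs := hasform_sum (zrange (k - 3) k) (fun l => hasform_sum (zrange (k %/ 2)%Z (k - 1))
  (fun l'' => h l l'')).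
apply: (hasform_ext hs) => // p; rewrite /m2.
apply: eq_bigr => l _; apply: eq_bigr => l'' _ /=; set S := (X in X * (1 - _)); ring.
Qed.

Let c3 k l l'' p : R := ph psi l'' p.1 * ((ph psi l p.2 * (1 - ps psi k p.2)) *
  ((\sum_(l' <- zrange (l - 2) (l + 2)) ph psi l' (- p.1 - p.2)) * (1 - ps psi k (- p.1 - p.2)))).

Let block_form k l'' l : hasform u (trilinear (tDelta psi l (high psi k T)) (Delta psi l'' T)
  (Delta psi l (high psi k T))) (c3 k l l'').
Proof.
exact: (trilinear_hasform hpsi hu (annular_tDelta_high hpsi l k) (annular_ph hpsi l'')
  (annular_Delta_high hpsi l k) (rep_tDelta_high hpsi hu l k) (rep_Delta_high hpsi hu l k)
  (rep_gradient hpsi hu l'')).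
Qed.

(** Both high factors live where |xi| >= 2^(l-3), so each has L2 norm O(2^(-l/2)), while the
    gradient of the fixed block is bounded. With l = k - 1 + n this is the decay 2^(-n). *)
Let block_decay k l'' : exists C : R, forall n : nat,
  (N1 (trilinear (tDelta psi (k - 1 + n%:Z) (high psi k T)) (Delta psi l'' T)
    (Delta psi (k - 1 + n%:Z) (high psi k T))) <= (C / 2 ^+ n)%:E)%E.
Proof.
have [A A0 hA] := ps_bounded hpsi; have [B B0 hB] := hp_bounded hpsi; have [P P0 hP] := ph_bounded hpsi.
pose K := (2 * A + P) * B.
have D i j := inv_fourier_bounded (annular_gradient_int hpsi hu i j (annular_ph hpsi l'')).
have [N hN] : exists N : 'I_3 -> 'I_3 -> R, forall i j, 0 <= N i j /\
    forall x, cmod (inv_fourier_fun (gradient u (ph psi l'') i j) x) <= N i j.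
  exists (fun i j => projT1 (cid2 (D i j))) => i j.
  by case: (cid2 (D i j)) => N h0 h1 /=.
exists (\sum_(i < 3) \sum_(j < 3) N i j * (K ^+ 2 / p2 (k - 4) * Num.sqrt (nn2 (G i) * nn2 (G j)))) => n.
set l := k - 1 + n%:Z.
apply: (le_trans (trilinear_N1 (annular_tDelta_high hpsi l k) (annular_ph hpsi l'')
  (annular_Delta_high hpsi l k) (rep_tDelta_high hpsi hu l k) (rep_Delta_high hpsi hu l k)
  (rep_gradient hpsi hu l'') (fun i j => (hN i j).2))).
rewrite lee_fin mulr_suml; apply: ler_sum => i _; rewrite mulr_suml; apply: ler_sum => j _.
rewrite -mulrA; apply: ler_wpM2l; first exact: (hN i j).1.
(* The lowest of the five shells in the enlarged block has index l - 2 and inner radius 2^(l-3). *)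
have r0 : 0 < p2 (l - 3) :> R by exact: p2_gt0.
have rE : p2 (l - 3) = p2 (k - 4) * 2 ^+ n :> R.
  rewrite (_ : l - 3 = k - 4 + n%:Z); last by rewrite /l; lia.
  by rewrite /p2 expfzDr ?pnatr_eq0.
have K0 : 0 <= K by rewrite mulr_ge0 // addr_ge0 // mulr_ge0.
have ga1 x : `|ph psi l x * (1 - ps psi k x)| <= K.
  rewrite normrM; apply: ler_pM => //; apply: (le_trans (hP l x)).
  by rewrite lerDr mulr_ge0.
have ga2 x : ph psi l x * (1 - ps psi k x) != 0 -> p2 (l - 3) <= enorm x.
  rewrite mulf_eq0 negb_or => /andP [/(ph_neq0 hpsi) /andP [h _] _]; apply: le_trans (ltW h).
  by rewrite -p2P; apply: p2_le; lia.
have SE x : \sum_(l' <- zrange (l - 2) (l + 2)) ph psi l' x = ps psi (l + 2 + 1) x - ps psi (l - 2) x.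
  by rewrite (@sum_zrange R (l - 2) (l + 2) (fun l => ps psi l x)) //; lia.
have al1 x : `|(\sum_(l' <- zrange (l - 2) (l + 2)) ph psi l' x) * (1 - ps psi k x)| <= K.
  rewrite normrM; apply: ler_pM => //; rewrite SE; apply: (le_trans (ler_normB _ _)).
  have := hA (l + 2 + 1) x; have := hA (l - 2) x; lra.
have al2 x : (\sum_(l' <- zrange (l - 2) (l + 2)) ph psi l' x) * (1 - ps psi k x) != 0 -> p2 (l - 3) <= enorm x.
  rewrite mulf_eq0 negb_or SE => /andP [h _]; rewrite leNgt; apply: contra h => h.
  rewrite (_ : l - 3 = l - 2 - 1) ?p2P in h; last by lia.
  rewrite (ps_in hpsi (ltW h)) (ps_in hpsi) ?subrr //.
  apply: (le_trans (ltW h)); have : p2 (l - 2) <= p2 (l + 2 + 1) :> R by apply: p2_le; lia.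
  by lra.
have n1 := shell_nn2 i (annular_Delta_high hpsi l k) ga1 r0 ga2.
have n2 := shell_nn2 j (annular_tDelta_high hpsi l k) al1 r0 al2.
have gen (a b c x y : R) : 0 <= x -> 0 <= y -> x <= c * a -> y <= c * b -> x * y <= c ^+ 2 * (a * b).
  by move=> x0 y0 hx hy; rewrite (_ : c ^+ 2 * (a * b) = (c * a) * (c * b)); [exact: ler_pM|ring].
apply: (@le_trans _ _ (Num.sqrt ((K ^+ 2 / p2 (l - 3)) ^+ 2 * (nn2 (G i) * nn2 (G j))))).
  apply: ler_wsqrtr.
  exact: (gen _ _ _ _ _ (nn2_ge0 _) (nn2_ge0 _) n1 n2).
rewrite sqrtrM ?sqr_ge0 // sqrtr_sqr ger0_norm; last by rewrite divr_ge0 ?sqr_ge0 // ltW.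
rewrite rE invfM; have gen2 (a b c d : R) : a * (b * c) * d <= a * b * d * c.
  by rewrite (_ : a * (b * c) * d = a * b * d * c) //; ring.
exact: gen2.
Qed.

(** By [resonance] and telescoping, the first n symbols add up to the limit symbol times
    p_(k-1+n)(xi), a factor equal to 1 once n is large for the given xi. *)
Lemma flux3_term k l'' : l'' <= k - 1 -> hasform u (fun x =>
   cseries (fun n => trilinear (tDelta psi (k - 1 + n%:Z) (high psi k T)) (Delta psi l'' T)
     (Delta psi (k - 1 + n%:Z) (high psi k T)) x))
  (fun p => ph psi l'' p.1 * (1 - ps psi k (- p.1 - p.2)) * (1 - ps psi k p.2)).
Proof.
move=> hl''; have [A A0 hA] := ps_bounded hpsi; have [B B0 hB] := hp_bounded hpsi.
have [C hC] := block_decay k l''.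
have P3 n p : \sum_(0 <= i < n) c3 k (k - 1 + i%:Z) l'' p =
    ph psi l'' p.1 * (1 - ps psi k (- p.1 - p.2)) * (ps psi (k - 1 + n%:Z) p.2 * (1 - ps psi k p.2)).
  rewrite -(high_telescope hpsi) mulr_sumr /index_iota subn0; apply: eq_bigr => i _.
  have hi : k - 1 <= k - 1 + i%:Z by lia.
  rewrite /c3 mulrA (resonance hpsi p.1 p.2 (lexx k) hi hl'').
  by rewrite mulrAC.
have [n0 [M0 hl0]] := localized_ph hpsi l''.
apply: (hasform_cseries hpsi hu (D := fun p => ph psi l'' p.1) (K := B * (A * B))
  (fun n => block_form k l'' (k - 1 + n%:Z)) hC).
- move=> n; rewrite /c3.
  have m1' := measurableT_comp (ph_meas hpsi l'') (@measurable_fst _ _ (E3 R) (E3 R)).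
  have m2' := measurableT_comp (ph_meas hpsi (k - 1 + n%:Z)) (@measurable_snd _ _ (E3 R) (E3 R)).
  have m3' := measurableT_comp (hp_meas hpsi k) (@measurable_snd _ _ (E3 R) (E3 R)).
  have m4' := measurableT_comp (hp_meas hpsi k) (@measurable_addNN R).
  have m5' l := measurableT_comp (ph_meas hpsi l) (@measurable_addNN R).
  apply: (measurable_funM m1'); apply: measurable_funM; first exact: (measurable_funM m2' m3').
  by apply: measurable_funM m4'; apply: measurable_sum => l; exact: m5'.
- have m1' := measurableT_comp (ph_meas hpsi l'') (@measurable_fst _ _ (E3 R) (E3 R)).
  have m3' := measurableT_comp (hp_meas hpsi k) (@measurable_snd _ _ (E3 R) (E3 R)).
  have m4' := measurableT_comp (hp_meas hpsi k) (@measurable_addNN R).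
  exact: (measurable_funM (measurable_funM m1' m4') m3').
- exact: (adm_localized hpsi hu hl0).
- by rewrite !mulr_ge0.
- move=> n p; rewrite P3 -mulrA normrM mulrC; apply: ler_wpM2r; first exact: normr_ge0.
  by rewrite !normrM; apply: ler_pM; rewrite ?mulr_ge0 //; apply: ler_pM.
move=> p; pose N := Num.bound (2 * enorm p.2 / p2 (k - 1)); exists N => n Nn.
rewrite P3 [ps psi (k - 1 + n%:Z) p.2](ps_in hpsi) ?mul1r //.
have -> : p2 (k - 1 + n%:Z) = p2 (k - 1) * 2 ^+ n :> R by rewrite /p2 expfzDr ?pnatr_eq0.
have : 2 * enorm p.2 / p2 (k - 1) <= 2 ^+ n.
  apply: (le_trans (ltW (archi_boundP _))).
    by rewrite divr_ge0 ?mulr_ge0 ?enorm_ge0 // ltW ?p2_gt0.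
  by rewrite -natrX ler_nat (leq_trans Nn) // ltnW // ltn_expl.
by rewrite ler_pdivrMr ?p2_gt0 // => h; rewrite ler_pdivlMr // mulrC (mulrC (p2 _)).
Qed.

Lemma flux3_form k : 0 <= k -> hasform u (fun x =>
    \sum_(l'' <- zrange (k %/ 2)%Z (k - 1))
      cseries (fun n => let l := k - 1 + n%:Z in
        trilinear (tDelta psi l (high psi k T)) (Delta psi l'' T)
                  (Delta psi l (high psi k T)) x)) (fun p => m3 psi k (k %/ 2)%Z p.1 p.2).
Proof.
move=> k0; have mem l'' : l'' \in zrange (k %/ 2)%Z (k - 1) -> l'' <= k - 1.
  rewrite /zrange; case: ifP => // h /mapP [n]; rewrite mem_iota add0n => /andP [_ hn] ->.
  by lia.
have hs := hasform_sum_in (fun l'' hl => flux3_term (mem l'' hl)).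
apply: (hasform_ext hs) => // p; rewrite /m3 -!mulr_suml; congr (_ * _ * _).
rewrite (@sum_zrange R (k %/ 2)%Z (k - 1) (fun l => ps psi l p.1)) ?subrK //.
by lia.
Qed.
End flux_multipliers.

(** * Frequency tails and low-frequency weights *)

Section tails.
Context {R : realType}.
Local Notation mu := (leb3 R).
Implicit Types (x xi eta z : E3 R) (A B C H : E3 R -> R[i]) (F : E3 R * E3 R -> R[i]).

Definition tail (n : nat) H x : R[i] := H x - cut n H x.

Lemma tail_L2 n H : L2 H -> L2 (tail n H).
Proof. by move=> lH; exact: (L2B lH (cut_L2 n lH)). Qed.

Lemma tail_cvg H : L2 H -> nn2 (tail n H) @[n --> \oo] --> (0 : R).
Proof. by move=> lH; apply: null_ext (cut_cvg lH) => n; exact: nn2BC. Qed.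

Lemma tail_out n H x : n%:R < enorm x -> tail n H x = H x.
Proof. by move=> h; rewrite /tail /cut ball3_out // mul0r subr0. Qed.

Lemma null_subseq (v : nat -> R) (f : nat -> nat) : (forall n, (n <= f n)%N) ->
  v n @[n --> \oo] --> (0 : R) -> v (f n) @[n --> \oo] --> (0 : R).
Proof.
move=> hf hv; apply/cvgrPdist_le => e e0.
have [N _ hN] := (@cvgrPdist_le _ _ _ _ _ v 0).1 hv e e0.
by exists N => // n /= Nn; apply: hN => /=; apply: leq_trans (hf n).
Qed.

(** On the ball of radius n the Gaussian of width n is at least e^(-1/2), so e^(1/2) times its mass
    (2 pi)^(3/2) n^3 bounds the volume; the weight |x| <= n gives the fourth power. *)
Definition ball_const : R := expR (1 / 2) * Num.sqrt (2 * pi) ^+ 3.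

Lemma ball_weight n : (0 < n)%N -> L2 (fun x => (sq x)%:C * ball3 n x) /\
  nn2 (fun x => (sq x)%:C * ball3 n x) <= ball_const * n%:R ^+ 4.
Proof.
move=> n0; have nr : 0 < n%:R :> R by rewrite ltr0n.
have ni : 0 < n%:R^-1 :> R by rewrite invr_gt0.
apply: L2E; first by apply: cmeas_sqM; exact: ball3_meas.
have K0 : 0 <= n%:R * expR (1 / 2) :> R by rewrite mulr_ge0 ?expR_ge0 // ltW.
apply: (@le_trans _ _ (\int[mu]_x ((n%:R * expR (1 / 2))%:E * (gauss n%:R^-1 x)%:E))%E).
  apply: ge0_le_integral => //.
  - by move=> x _; rewrite lee_fin sqr_ge0.
  - apply/measurable_EFinP; apply: measurable_funX; apply: measurable_cmod; apply: cmeas_sqM.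
    exact: ball3_meas.
  - by apply/measurable_EFinP; apply: measurable_funM => //; exact: measurable_gauss.
  move=> x _; rewrite -EFinM lee_fin (cmodM (sq x)%:C) cmod_real exprMn real_normK ?num_real // sq_sqr.
  have [h|h] := leP (enorm x) n%:R; last first.
    by rewrite ball3_out // cmod0 expr0n mulr0 mulr_ge0 // ltW // gauss_gt0.
  rewrite ball3_in // cmod1 expr1n mulr1 -mulrA; apply: (le_trans h).
  suff h1 : 1 <= expR (1 / 2) * gauss n%:R^-1 x by apply: ler_peMr => //; exact: ltW.
  rewrite /gauss -expRD -[leLHS]expR0 ler_expR.
  have : n%:R^-1 ^+ 2 * dot x x <= 1.
    rewrite -enorm_sqr -exprMn expr_le1 //; last by rewrite mulr_ge0 ?enorm_ge0 // ltW.
    by rewrite mulrC ler_pdivrMr // mul1r.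
  by set w := _ * dot x x; lra.
rewrite ge0_integralZl //; last first.
- by move=> x _; rewrite lee_fin ltW // gauss_gt0.
- by apply/measurable_EFinP; exact: measurable_gauss.
rewrite integral_gauss // -EFinM lee_fin invrK /ball_const exprMn.
by set a := expR _; set b := Num.sqrt _; rewrite le_eqVlt; apply/orP; left; apply/eqP; ring.
Qed.

(** Cauchy-Schwarz against |x|^(1/2) on the ball, whose squared norm is O(n^4). *)
Lemma low_L1 n H : (0 < n)%N -> L2 H -> cintegrable (fun x => (sq x)%:C * cut n H x) /\
  \int[mu]_x cmod ((sq x)%:C * cut n H x) <= n%:R ^+ 2 * Num.sqrt (ball_const * nn2 H).
Proof.
move=> n0 lH; have [lb hb] := ball_weight n0.
have E x : (sq x)%:C * cut n H x = ((sq x)%:C * ball3 n x) * H x by rewrite /cut mulrA.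
have -> : (fun x => (sq x)%:C * cut n H x) = fun x => ((sq x)%:C * ball3 n x) * H x by apply/funext.
split; first exact: (L2_mul lb lH).
have -> : \int[mu]_x cmod ((sq x)%:C * cut n H x) = \int[mu]_x (cmod ((sq x)%:C * ball3 n x) * cmod (H x)).
  by apply: eq_Rintegral => x _; rewrite E (cmodM (_ * _)).
apply: (le_trans (cauchy_schwarz lb lH)).
have nE : n%:R ^+ 2 = Num.sqrt ((n%:R ^+ 2) ^+ 2) :> R by rewrite sqrtr_sqr ger0_norm ?sqr_ge0.
rewrite nE -sqrtrM ?sqr_ge0 //.
apply: ler_wsqrtr; rewrite mulrA; apply: ler_wpM2r; first exact: nn2_ge0.
by apply: (le_trans hb); rewrite mulrC -exprM.
Qed.

Lemma NN_two F F1 F2 (K1 K2 : R) : cmeas F -> cmeas F1 -> cmeas F2 -> 0 <= K1 -> 0 <= K2 ->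
  (forall p, cmod (F p) <= K1 * cmod (F1 p) + K2 * cmod (F2 p)) ->
  (NN F <= K1%:E * NN F1 + K2%:E * NN F2)%E.
Proof.
move=> mF m1 m2 k1 k2 h; pose ab (f : E3 R * E3 R -> R[i]) p : R[i] := (cmod (f p))%:C.
have mab f : cmeas f -> cmeas (ab f) by move=> mf; apply: cmeas_real; exact: measurable_cmod.
have NNab f : NN (ab f) = NN f.
  apply: eq_integral => z _; apply: eq_integral => x _; congr EFin.
  by rewrite /ab cmod_real ger0_norm ?cmod_ge0.
have mz K f : cmeas f -> cmeas (fun p => K%:C * ab f p).
  by move=> mf; apply: cmeasM; [exact: cmeas_cst|exact: mab].
apply: (@le_trans _ _ (NN (fun p => K1%:C * ab F1 p + K2%:C * ab F2 p)%R)).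
  apply: (NN_mono mF (cmeasD (mz K1 F1 m1) (mz K2 F2 m2))) => p; apply: (le_trans (h p)).
  rewrite /ab -!realCM -rmorphD cmod_real; exact: ler_norm.
apply: (le_trans (NN_add (mz K1 F1 m1) (mz K2 F2 m2))).
by rewrite (NNZ k1 (mab _ m1)) (NNZ k2 (mab _ m2)) !NNab.
Qed.
End tails.

(** * The defect of the multiplier identity tends to zero *)

Section defect_limit.
Context {R : realType}.
Variables (psi : E3 R -> R) (u : 'I_3 -> E3 R -> R).
Hypothesis hpsi : LP_cutoff psi.
Hypothesis hu : weak_solution (1 / 2) u.
Local Notation mu := (leb3 R).
Local Notation g := (spectrum u).
Local Notation G := (weighted u).
Implicit Types (x xi eta z : E3 R) (i j : 'I_3) (p : E3 R * E3 R).

Let mg i : cmeas (g i). Proof. exact: (g_meas hpsi (g_represents hu i)). Qed.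

Lemma admB (m m' : E3 R * E3 R -> R) : admissible u m -> admissible u m' ->
  admissible u (fun p => m p - m' p) /\ form u (fun p => m p - m' p) = form u m - form u m'.
Proof.
move=> a a'.
have E i j : (fun p => (m p - m' p)%:C * triad u i j p) =
   fun p => (m p)%:C * triad u i j p - (m' p)%:C * triad u i j p.
  by apply/funext => p; rewrite rmorphB mulrBl.
split.
  move=> i j; rewrite E; have := dblD (a i j) (dblZ (-1) (a' i j)); congr dbl.
  by apply/funext => p; rewrite mulN1r.
rewrite /form -sumrB; apply: eq_bigr => i _; rewrite -sumrB; apply: eq_bigr => j _.
by rewrite E (dintB (a i j) (a' i j)).
Qed.

Lemma admD (m m' : E3 R * E3 R -> R) : admissible u m -> admissible u m' ->
  admissible u (fun p => m p + m' p) /\ form u (fun p => m p + m' p) = form u m + form u m'.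
Proof.
move=> a a'.
have E i j : (fun p => (m p + m' p)%:C * triad u i j p) =
   fun p => (m p)%:C * triad u i j p + (m' p)%:C * triad u i j p.
  by apply/funext => p; rewrite rmorphD mulrDl.
split; first by move=> i j; rewrite E; exact: (dblD (a i j) (a' i j)).
rewrite /form -big_split; apply: eq_bigr => i _; rewrite -big_split; apply: eq_bigr => j _.
by rewrite E (dintD (a i j) (a' i j)).
Qed.

Lemma form_bound (m : E3 R * E3 R -> R) (e : 'I_3 -> 'I_3 -> R) : admissible u m ->
  (forall i j, (NN (fun p => ((m p)%:C * triad u i j p)%R) <= (e i j)%:E)%E) ->
  cmod (form u m) <= \sum_(i < 3) \sum_(j < 3) e i j.
Proof.
move=> a h; rewrite /form; apply: (le_trans (cmod_sum _ _ _)); apply: ler_sum => i _.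
apply: (le_trans (cmod_sum _ _ _)); apply: ler_sum => j _.
by rewrite -lee_fin; apply: (le_trans (dint_bound (a i j))).
Qed.

Lemma weightedE i x : cmod (G i x) = sq x * cmod (g i x).
Proof. by rewrite /weighted (cmodM (sq x)%:C) cmod_real ger0_norm ?sq_ge0. Qed.

Lemma triad_cmod i j p : cmod (triad u i j p) <=
  enorm p.1 * cmod (g i p.1) * (cmod (g i p.2) * cmod (g j (- p.1 - p.2))).
Proof.
rewrite /triad (cmodM ('i%C * _ * _)) (cmodM ('i%C * _)) (cmodM 'i%C) cmod_i mul1r cmod_real.
rewrite (cmodM (g i p.2)); apply: ler_wpM2r; first by rewrite mulr_ge0 ?cmod_ge0.
by apply: ler_wpM2r; [exact: cmod_ge0|exact: coord3_le].
Qed.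

(** Where the defect is nonzero, |z| < 2^k and |xi| > 2^(k-1), so G may be replaced by its tail at
    xi. The two majorants differ in how the factor |z| of the gradient is distributed over the three
    frequencies. *)
Lemma defect_pointwise : exists2 M : R, 0 <= M & forall (k : nat) i j p, (4 <= k)%N ->
  cmod ((defect psi k%:Z (k%:Z %/ 2)%Z p.1 p.2)%:C * triad u i j p) <=
  2 * M * cmod (tker (G i) (tail (2 ^ k.-1) (G i)) (cut 1 (g j)) p) +
  M / 2 ^+ k.-2 * cmod (tker (fun x => (sq x)%:C * cut (2 ^ (k %/ 2)) (G i) x)
     (tail (2 ^ k.-1) (G i)) (G j) p).
Proof.
have [M M0 hM] := defect_bounded hpsi; exists M; first exact: M0.
move=> k i j p k4.
have kz : 0 <= k%:Z by [].
have hk : (k%:Z %/ 2)%Z <= k%:Z by lia.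
have k2 : (2 <= k.-2)%N by lia.
have kk : k.-1 = k.-2.+1 by lia.
have hn : (k%:Z %/ 2)%Z = (k %/ 2)%N%:Z by lia.
have hh : (k %/ 2 <= k.-2)%N by lia.
have gen (Z s t a b c : R) : 0 <= a -> 0 <= b -> 0 <= c -> Z <= 2 * (s * t) ->
    M * (Z * a * (b * c)) <= 2 * M * (s * a * (t * b * c)).
  move=> a0 b0 c0 hZ; rewrite (_ : 2 * M * (s * a * (t * b * c)) = M * (2 * (s * t) * a * (b * c))); last by ring.
  by apply: (ler_wpM2l M0); apply: ler_wpM2r; [rewrite mulr_ge0|apply: ler_wpM2r].
set d := defect _ _ _ _ _; set h := (k%:Z %/ 2)%Z.
set t1 := tker _ _ _; set t2 := tker _ _ _.
have t10 : 0 <= 2 * M * cmod (t1 p) by rewrite !mulr_ge0 ?cmod_ge0.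
have t20 : 0 <= M / 2 ^+ k.-2 * cmod (t2 p).
  by rewrite mulr_ge0 ?cmod_ge0 // divr_ge0 // exprn_ge0.
have hd : `|d| <= M by exact: (hM _ _ p.1 p.2 hk kz).
have [d0|dn] := eqVneq d 0; first by rewrite d0 mul0r cmod0 addr_ge0.
have dz := defect_eq0 hpsi (h := h) (z := p.1) (xi := p.2) hk kz.
set z := p.1 in dz *; set xi := p.2 in dz *; set eta := - z - xi in dz *.
have zk : enorm z < p2 k%:Z by rewrite ltNge; apply: contra dn => c; apply/eqP; apply: dz; left.
have xk : p2 k%:Z / 2 < enorm xi.
  by rewrite ltNge; apply: contra dn => c; apply/eqP; apply: dz; right; left.
have pk : p2 k%:Z = 2 * 2 ^+ k.-1 :> R by rewrite p2_nat -exprS prednK // (leq_trans _ k4).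
have pk1 : 2 ^+ k.-1 = 2 * 2 ^+ k.-2 :> R by rewrite -exprS kk.
have xk1 : 2 ^+ k.-1 < enorm xi by move: xk; rewrite pk mulrC mulKf ?pnatr_eq0.
have tl : tail (2 ^ k.-1) (G i) xi = G i xi by apply: tail_out; rewrite natrX.
rewrite (cmodM d%:C) cmod_real.
have tc := triad_cmod i j p; rewrite -/z -/xi -/eta in tc.
have tt : 0 <= enorm z * cmod (g i z) * (cmod (g i xi) * cmod (g j eta)).
  by rewrite !mulr_ge0 ?cmod_ge0 ?enorm_ge0.
apply: (le_trans (ler_pM (normr_ge0 _) (cmod_ge0 _) hd tc)).
have sz := sq_ge0 z; have sx := sq_ge0 xi; have se := sq_ge0 eta.
have pw : 4 <= 2 ^+ k.-2 :> R.
  have -> : 4 = 2 ^+ 2 :> R by ring.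
  by apply: ler_weXn2l; [rewrite ler1n|exact: k2].
(* With |eta| < 1 one has |z| <= |xi| + 1 <= 4 |xi|, so |z| <= 2 |z|^(1/2) |xi|^(1/2): z and xi both
   receive their weight and eta needs none. *)
have [e1|e1] := ltP (enorm eta) 1.
  apply: (@le_trans _ _ (2 * M * cmod (t1 p))); last by rewrite lerDl.
  rewrite /t1 /tker (cmodM (G i p.1)) (cmodM (tail (2 ^ k.-1) (G i) p.2)) -/z -/xi -/eta tl !weightedE.
  rewrite /cut ball3_in; last exact: ltW.
  rewrite mul1r.
  have zx : enorm z <= 2 * (sq z * sq xi).
    have zx2 : enorm z <= enorm xi + 1.
      by apply: (le_trans (enorm_tri3 z xi)); rewrite -/eta; lra.
    have zx4 : enorm z <= 4 * enorm xi by lra.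
    have zx3 : sq z <= 2 * sq xi.
      have s4 : Num.sqrt 4 = 2 :> R by rewrite (_ : 4 = 2 ^+ 2 :> R) ?sqrtr_sqr ?ger0_norm //; ring.
      have -> : 2 * sq xi = Num.sqrt (4 * enorm xi) by rewrite sqrtrM // s4.
      exact: (ler_wsqrtr zx4).
    by rewrite -(sq_sqr z) expr2 mulrCA ler_wpM2l.
  exact: (gen _ _ _ _ _ _ (cmod_ge0 _) (cmod_ge0 _) (cmod_ge0 _) zx).
(* Otherwise |z| < 2^[k/2] <= 2^(k-2), where k >= 4 enters, so |xi| and |eta| are both at least
   2^(k-2). Inserting their weights then gains the factor 2^(-(k-2)). *)
have zh : enorm z < p2 h.
  by rewrite ltNge; apply: contra dn => c; apply/eqP; apply: dz; right; right.
apply: (@le_trans _ _ (M / 2 ^+ k.-2 * cmod (t2 p))); last by rewrite lerDr.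
have ph2 : p2 h = 2 ^+ (k %/ 2) :> R by rewrite /h hn p2_nat.
have hk2 : 2 ^+ (k %/ 2) <= 2 ^+ k.-2 :> R by apply: ler_weXn2l; [rewrite ler1n|exact: hh].
have en : 2 ^+ k.-2 <= enorm eta.
  have := enorm_tri z xi; rewrite -/eta; lra.
have sq1 (w : E3 R) : 2 ^+ k.-2 <= enorm w -> Num.sqrt (2 ^+ k.-2) <= sq w by move=> hw; rewrite /sq ler_wsqrtr.
have s1 := sq1 xi; have s2 := sq1 eta en.
have pr : 2 ^+ k.-2 <= sq xi * sq eta.
  rewrite -[leLHS](@sqr_sqrtr R) ?exprn_ge0 // expr2; apply: ler_pM; rewrite ?sqrtr_ge0 //.
  by apply: s1; lra.
rewrite /t2 /tker (cmodM ((sq p.1)%:C * cut (2 ^ (k %/ 2)) (G i) p.1)) (cmodM (sq p.1)%:C).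
rewrite (cmodM (tail (2 ^ k.-1) (G i) p.2)) -/z -/xi -/eta tl !weightedE cmod_real (ger0_norm sz).
rewrite /cut ball3_in ?mul1r ?weightedE; last by rewrite natrX -ph2 ltW.
have w0 : 0 < 2 ^+ k.-2 :> R by rewrite exprn_gt0.
have -> : M / 2 ^+ k.-2 * (sq z * (sq z * cmod (g i z)) * (sq xi * cmod (g i xi) * (sq eta * cmod (g j eta)))) =
   M * (sq z ^+ 2 * cmod (g i z) * (cmod (g i xi) * cmod (g j eta))) * ((sq xi * sq eta) / 2 ^+ k.-2) by ring.
rewrite sq_sqr ler_peMr ?mulr_ge0 ?cmod_ge0 ?enorm_ge0 //.
by rewrite ler_pdivlMr // mul1r.
Qed.

(** The first majorant is small through the tail alone. In the second, [low_L1] costs 2^(2 [k/2]),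
    which the denominator 2^(k-2) absorbs up to a factor 4, and again the tail tends to 0. *)
Lemma defect_null : (forall k : nat, (4 <= k)%N ->
    admissible u (fun p => defect psi k%:Z (k%:Z %/ 2)%Z p.1 p.2)) ->
  cmod (form u (fun p => defect psi (k + 4)%N%:Z ((k + 4)%N%:Z %/ 2)%Z p.1 p.2)) @[k --> \oo] --> (0 : R).
Proof.
move=> ad; have [M M0 hM] := defect_pointwise.
have lG i := weighted_L2 hpsi hu i.
have ck j := g_cut hpsi (g_represents hu j) 1.
have gen (P I S W N : R) : 0 < P -> 0 <= S -> 0 <= W -> I <= N * S -> N <= 4 * P ->
    M / P * (I * W) <= 4 * M * (S * W).
  move=> P0 S0 W0 hI hN; rewrite (_ : M / P * (I * W) = M * (P^-1 * I) * W); last by ring.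
  rewrite (_ : 4 * M * (S * W) = M * (4 * S) * W); last by ring.
  apply: ler_wpM2r => //; apply: ler_wpM2l => //; rewrite mulrC ler_pdivrMr //.
  by apply: (le_trans hI); rewrite mulrAC; apply: ler_wpM2r.
pose tn i k := nn2 (tail (2 ^ k.-1) (G i)).
pose e i j k := 2 * M * (\int[mu]_x cmod (cut 1 (g j) x) * Num.sqrt (nn2 (G i) * tn i k)) +
  4 * M * (Num.sqrt (ball_const * nn2 (G i)) * Num.sqrt (tn i k * nn2 (G j))).
have tn0 i : tn i (k + 4)%N @[k --> \oo] --> (0 : R).
  apply: (null_subseq (v := fun n => nn2 (tail n (G i))) _ (tail_cvg (lG i))) => k.
  by rewrite addnS /= (leq_trans _ (ltnW (ltn_expl _ _))) // leq_addr.
have e0 i j : e i j (k + 4)%N @[k --> \oo] --> (0 : R).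
  apply: null_add; apply: null_scale; apply: null_scale; apply: null_sqrt.
    exact: (null_scale (nn2 (G i)) (tn0 i)).
  by apply: null_ext (null_scale (nn2 (G j)) (tn0 i)) => k; rewrite mulrC.
have b k i j : (4 <= k)%N -> (NN (fun p => ((defect psi k%:Z (k%:Z %/ 2)%Z p.1 p.2)%:C * triad u i j p)%R) <= (e i j k)%:E)%E.
  move=> k4; have kh : (k %/ 2 * 2 <= 2 + k.-2)%N by lia.
  have lT := tail_L2 (2 ^ k.-1) (lG i).
  have h2 : (0 < 2 ^ (k %/ 2))%N by rewrite expn_gt0.
  have [iL bL] := low_L1 h2 (lG i).
  have m1 := tker_meas (lG i).1 lT.1 (cintegrable_meas (ck j)).
  have m2 := tker_meas (cintegrable_meas iL) lT.1 (lG j).1.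
  have K1 : 0 <= 2 * M by rewrite mulr_ge0.
  have K2 : 0 <= M / 2 ^+ k.-2 by rewrite divr_ge0 // exprn_ge0.
  apply: (le_trans (NN_two (ad k k4 i j).1 m1 m2 K1 K2 (fun p => hM k i j p k4))).
  rewrite -!triE (tri_rot (lG i).1 lT.1 (cintegrable_meas (ck j))) (tri_swap (lG i).1 (cintegrable_meas (ck j)) lT.1).
  apply: (le_trans (leeD (lee_wpmul2l _ (tri_le (ck j) (lG i) lT)) (lee_wpmul2l _ (tri_le iL lT (lG j))))).
  - by rewrite lee_fin.
  - by rewrite lee_fin.
  rewrite -!EFinM -EFinD lee_fin; apply: lerD => //.
  apply: (gen _ _ _ _ _ (exprn_gt0 _ (ltr0n R 2)) (sqrtr_ge0 _) (sqrtr_ge0 _) bL).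
  rewrite natrX -exprM (_ : 4 = 2 ^+ 2 :> R); last by ring.
  by rewrite -exprD; apply: ler_weXn2l; [rewrite ler1n|exact: kh].
have se : \sum_(i < 3) \sum_(j < 3) e i j (k + 4)%N @[k --> \oo] --> (0 : R).
  apply: (@null_sum3 R (fun i k => \sum_(j < 3) e i j (k + 4)%N)) => i.
  by apply: (@null_sum3 R (fun j k => e i j (k + 4)%N)) => j; exact: e0.
apply: null_le se => k; rewrite cmod_ge0 /=.
have k4 : (4 <= k + 4)%N by rewrite leq_addl.
by apply: (form_bound (ad _ k4)) => i j; exact: b.
Qed.
End defect_limit.

(** * Convergence of the truncated energy and of the fluxes *)

Section energy_limit.
Context {R : realType}.
Variables (psi : E3 R -> R) (u : 'I_3 -> E3 R -> R).
Hypothesis hpsi : LP_cutoff psi.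
Hypothesis hu : weak_solution (1 / 2) u.
Local Notation mu := (leb3 R).
Local Notation g := (spectrum u).
Local Notation G := (weighted u).
Local Notation T := (dist_of_field u).
Implicit Types (x xi eta z : E3 R) (i j : 'I_3) (p : E3 R * E3 R).

Definition total_energy : R := \sum_(i < 3) nn2 (G i).
Definition low_energy (k : int) : R :=
  \int[mu]_x (ps psi k x * (enorm x * \sum_(i < 3) cmod (g i x) ^+ 2)).

Lemma localized_ps k : exists n (M : R), localized n M (ps psi k).
Proof.
have [M M0 hM] := ps_bounded hpsi; exists (Num.bound (p2 k : R)), M.
split; [exact: (ps_meas hpsi)|exact: M0|exact: (hM k)|].
move=> z hz; apply: (ps_out hpsi); apply: ltW; apply: lt_trans hz.
by apply: archi_boundP; rewrite ltW // p2_gt0.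
Qed.

(** The symbol that the truncated energy keeps after the transport term has cancelled. *)
Let main (k : int) p : R := ps psi k p.1 * (1 - ps psi k p.2).

Lemma main_adm k : admissible u (main k).
Proof.
have [n [M hl]] := localized_ps k; have [B B0 hB] := hp_bounded hpsi.
have m1' := measurableT_comp (ps_meas hpsi k) (@measurable_fst _ _ (E3 R) (E3 R)).
have m3' := measurableT_comp (hp_meas hpsi k) (@measurable_snd _ _ (E3 R) (E3 R)).
apply: (adm_le hpsi hu (measurable_funM m1' m3') B0 _ (adm_localized hpsi hu hl)) => p.
by rewrite normrM mulrC; apply: ler_wpM2r; [exact: normr_ge0|exact: hB].
Qed.

Lemma low_energyE k : (low_energy k)%:C = c0%:C * form u (main k).
Proof.
have [n [M hl]] := localized_ps k.
refine (etrans (energy_high hpsi hu hl) (congr1 ( *%R c0%:C) _)).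
apply: eq_bigr => i _; apply: eq_bigr => j _; apply: eq_dint => p.
by rewrite /tker /gradient /triad /main !realCM; ring.
Qed.

Lemma defect_form (k : int) : 0 <= k ->
  admissible u (fun p => defect psi k (k %/ 2)%Z p.1 p.2) /\
  flux1 psi T k + flux2 psi T k + flux3 psi T k =
  (low_energy k)%:C + c0%:C * form u (fun p => defect psi k (k %/ 2)%Z p.1 p.2).
Proof.
move=> k0; have [a1 [_ f1]] := flux1_form hpsi hu k; have [a2 [_ f2]] := flux2_form hpsi hu k.
have [a3 [_ f3]] := flux3_form hpsi hu k0.
have [a12 f12] := admD a1 a2; have [a123 f123] := admD a12 a3.
have [ad fd] := admB a123 (main_adm k).
split; first exact: ad.
rewrite [flux1 _ _ _]f1 [flux2 _ _ _]f2 [flux3 _ _ _]f3 low_energyE.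
have -> : form u (fun p => defect psi k (k %/ 2)%Z p.1 p.2) =
   form u (fun p => m1 psi k p.1 p.2) + form u (fun p => m2 psi k (k %/ 2)%Z p.1 p.2) +
   form u (fun p => m3 psi k (k %/ 2)%Z p.1 p.2) - form u (main k).
  by rewrite -f12 -f123 -fd.
set x1 := form u _; set x2 := form u _; set x3 := form u _; set x4 := form u _.
by ring.
Qed.

Lemma weight_sum x : enorm x * \sum_(i < 3) cmod (g i x) ^+ 2 = \sum_(i < 3) cmod (G i x) ^+ 2.
Proof. by rewrite mulr_sumr; apply: eq_bigr => i _; rewrite /weighted cmod_sqM. Qed.

Lemma weight_integrable :
  mu.-integrable setT (EFin \o (fun x => \sum_(i < 3) cmod (G i x) ^+ 2)).
Proof.
have h i := (weighted_L2 hpsi hu i).2.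
rewrite (_ : _ \o _ = fun x => (\sum_(i < 3) (cmod (G i x) ^+ 2)%:E)%E); last first.
  by apply/funext => x; rewrite /= sumEFin.
by apply: integrable_sum => // i _; exact: h.
Qed.

Lemma integral_norm_sum (v : 'I_3 -> E3 R -> R[i]) : (forall i, L2 (v i)) ->
  (\int[mu]_x (\sum_(i < 3) cmod (v i x) ^+ 2)%:E = (\sum_(i < 3) nn2 (v i))%:E)%E.
Proof.
move=> lv; transitivity (\int[mu]_x (\sum_(i < 3) (cmod (v i x) ^+ 2)%:E))%E.
  by apply: eq_integral => x _; rewrite sumEFin.
rewrite ge0_integral_sum //.
- rewrite -sumEFin; apply: eq_bigr => i _; rewrite /nn2 /Rintegral fineK //.
  by apply: integrable_fin_num => //; exact: (lv i).2.
- by move=> i; apply/measurable_EFinP; apply: measurable_funX; exact: (measurable_cmod (lv i).1).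
by move=> i x _; rewrite lee_fin sqr_ge0.
Qed.

Lemma weight_integral : \int[mu]_x (\sum_(i < 3) cmod (G i x) ^+ 2) = total_energy.
Proof.
by rewrite /Rintegral (integral_norm_sum (weighted_L2 hpsi hu)).
Qed.

(** At each frequency the cutoff is eventually 1, and the cutoffs are uniformly bounded, so
    dominated convergence applies. *)
Lemma low_energy_cvg : `|low_energy k%:Z - total_energy| @[k --> \oo] --> (0 : R).
Proof.
have [M M0 hM] := ps_bounded hpsi.
pose w x := \sum_(i < 3) cmod (G i x) ^+ 2.
have w0 x : 0 <= w x by apply: sumr_ge0 => i _; exact: sqr_ge0.
have mw : measurable_fun setT w.
  by apply: measurable_sum3 => i; apply: measurable_funX; apply: measurable_cmod; exact: (weighted_L2 hpsi hu i).1.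
have h := @dominated_cintegral R (fun k x => (ps psi k%:Z x * w x)%:C) (fun x => (w x)%:C)
  (fun x => M * w x).
have h2 : cmod (cintegral (fun x => (ps psi k%:Z x * w x)%:C) - cintegral (fun x => (w x)%:C)) @[k --> \oo] --> (0 : R).
  apply: h.
  - by move=> n; apply: cmeas_real; apply: measurable_funM => //; exact: (ps_meas hpsi).
  - exact: cmeas_real.
  - apply: aeW => x; have c0 : (0 : R) @[n --> \oo] --> (0 : R) by exact: cvg_cst.
    apply: cvg_trans c0; apply: near_eq_cvg; exists (Num.bound (2 * enorm x)) => // n /= Nn.
    rewrite (ps_in hpsi) ?mul1r ?subrr ?cmod0 // p2_nat ler_pdivlMr // mulrC.
    apply: (le_trans (ltW (archi_boundP _))); first by rewrite mulr_ge0 ?enorm_ge0.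
    by rewrite -natrX ler_nat (leq_trans Nn) // ltnW // ltn_expl.
  - exact: (integrable_scale M weight_integrable).
  - apply: aeW => x n; rewrite cmod_real normrM (ger0_norm (w0 x)).
    by apply: ler_wpM2r => //; exact: hM.
apply: null_ext h2 => k; rewrite !cintegral_real -rmorphB cmod_real weight_integral /low_energy.
by congr (`|_ - _|); apply: eq_Rintegral => x _; rewrite weight_sum.
Qed.

(** Plancherel in the form [FT2_nn2], once the chosen representatives of the fractional Laplacian
    have been replaced by explicit ones. *)
Lemma lap_energy : (\int[mu]_x (vmod (vfrac_lap (1 / 4) T) x ^+ 2)%:E = total_energy%:E)%E.
Proof.
have s14 : 2 * (1 / 4) = 1 / 2 :> R by lra.
have V i : exists v, FT2 (G i) v /\ represents v (vfrac_lap (1 / 4) T i).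
  have [v hv] := FT2_exists (weighted_L2 hpsi hu i); exists v; split; first exact: hv.
  exact: (velocity_lap s14 hv).
have [v hv] : exists v : 'I_3 -> E3 R -> R[i], forall i, FT2 (G i) (v i) /\
    represents (v i) (vfrac_lap (1 / 4) T i).
  by exists (fun i => projT1 (cid (V i))) => i; case: (cid (V i)).
have lv i : L2 (v i) by have [[_ h _] _] := hv i.
have mf i : cmeas (fun_of (vfrac_lap (1 / 4) T i)).
  exact: (tempered_meas hpsi (fun_of_represents (hv i).2).1).
have E x : vmod (vfrac_lap (1 / 4) T) x ^+ 2 = \sum_(i < 3) cmod (fun_of (vfrac_lap (1 / 4) T i) x) ^+ 2.
  by rewrite /vmod sqr_sqrtr // sumr_ge0 // => i _; exact: sqr_ge0.
transitivity (\int[mu]_x (\sum_(i < 3) cmod (v i x) ^+ 2)%:E)%E.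
  apply: ge0_ae_eq_integral => //.
  - apply/measurable_EFinP; rewrite (_ : (fun x => _) = fun x => \sum_(i < 3) cmod (fun_of (vfrac_lap (1 / 4) T i) x) ^+ 2).
      by apply: measurable_sum3 => i; apply: measurable_funX; exact: (measurable_cmod (mf i)).
    by apply/funext.
  - apply/measurable_EFinP; apply: measurable_sum3 => i; apply: measurable_funX; exact: (measurable_cmod (lv i).1).
  - by move=> x _; rewrite lee_fin sqr_ge0.
  - by move=> x _; rewrite lee_fin sumr_ge0 // => i _; exact: sqr_ge0.
  have := ae_ord3 (fun i => fun_of_ae hpsi (hv i).2); apply: aeS => x h _.
  rewrite E; apply: (congr1 EFin); apply: eq_bigr => i _.
  by apply: (congr1 (fun z : R[i] => cmod z ^+ 2)); exact: (h i).
rewrite (integral_norm_sum lv) /total_energy; congr (_%:E).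
by apply: eq_bigr => i _; exact: (FT2_nn2 (hv i).1).
Qed.

Lemma flux_cvg : flux psi T k%:Z @[k --> \oo] --> total_energy.
Proof.
have ad k : (4 <= k)%N -> admissible u (fun p => defect psi k%:Z (k%:Z %/ 2)%Z p.1 p.2).
  by move=> k4; exact: (defect_form (k := k%:Z) isT).1.
have h1 := defect_null hpsi hu ad.
have h2 : `|low_energy (k + 4)%N%:Z - total_energy| @[k --> \oo] --> (0 : R).
  by apply: (null_subseq (v := fun k => `|low_energy k%:Z - total_energy|) _ low_energy_cvg) => n; exact: leq_addr.
(* The estimate of the defect holds from k = 4 on. *)
rewrite -(cvg_shiftn 4); apply/cvgrPdist_le => e e0.
have h3 := null_add h2 (null_scale (cmod (c0%:C : R[i])) h1).
have [N _ hN] := (@cvgrPdist_le _ _ _ _ _ _ 0).1 h3 e e0.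
exists N => // n /= Nn; have := hN n Nn; rewrite sub0r normrN => hb.
rewrite distrC /flux (defect_form (k := (n + 4)%N%:Z) isT).2 ReD.
rewrite [complex.Re (_%:C)]/= addrAC; apply: le_trans hb.
apply: le_trans (ler_normD _ _) _; apply: (@le_trans _ _ (`|low_energy (n + 4)%N%:Z - total_energy| +
   cmod (c0%:C * form u (fun p => defect psi (n + 4)%N%:Z ((n + 4)%N%:Z %/ 2)%Z p.1 p.2)))).
  by rewrite lerD2l; exact: Re_le_cmod.
by rewrite (cmodM c0%:C) ler_norm.
Qed.

Lemma energy_liminf : (\int[mu]_x (vmod (vfrac_lap (1 / 4) T) x ^+ 2)%:E
   = limn_einf (fun k : nat => (flux psi T k%:Z)%:E))%E.
Proof.
rewrite lap_energy; have h : (flux psi T k%:Z)%:E @[k --> \oo] --> total_energy%:E.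
  by apply: cvg_EFin; [exact: nearW|exact: flux_cvg].
by rewrite (cvg_limn_einf_sup h).1.
Qed.

End energy_limit.

(** * Bounded velocities *)

Section bounded_velocity.
Context {R : realType}.
Variables (psi : E3 R -> R) (u : 'I_3 -> E3 R -> R).
Hypothesis hpsi : LP_cutoff psi.
Hypothesis hu : weak_solution (1 / 2) u.
Local Notation mu := (leb3 R).
Local Notation g := (spectrum u).
Local Notation G := (weighted u).
Local Notation T := (dist_of_field u).
Implicit Types (x xi eta z : E3 R) (i j : 'I_3) (p : E3 R * E3 R) (A C : E3 R -> R[i]).

Let mg i : cmeas (g i). Proof. exact: (g_meas hpsi (g_represents hu i)). Qed.
Let mu_ i : cmeas (fun x => (u i x)%:C). Proof. exact: (tempered_meas hpsi (u_tempered hu i)). Qed.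

(** The norm with exponent +oo is the essential supremum when the space has positive measure; this
    selects that branch of its definition. *)
Lemma measure_gt0 : (0 < mu [set: E3 R])%E.
Proof.
rewrite lt0e; apply/andP; split; last by rewrite measure_ge0.
apply/negP => /eqP h; have : (\int[mu]_x (gauss 1 x)%:E = 0)%E.
  by apply: null_set_integral => //; apply/measurable_EFinP; exact: measurable_gauss.
rewrite integral_gauss // divr1 => /eqP; rewrite eqe expf_eq0 /= sqrtr_eq0 leNgt.
by rewrite mulr_gt0 // pi_gt0.
Qed.

(** The part removed in u^0 is the transform of an integrable function, hence bounded. *)
Lemma velocity_bounded :
  (Lnorm mu +oo (fun x => (vmod (high psi 0 T) x)%:E) < +oo)%E ->
  exists2 B : R, 0 <= B & forall i, {ae mu, forall x, `|u i x| <= B}.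
Proof.
rewrite unlock measure_gt0 => h.
have [K hK] : exists K : R, {ae mu, forall x, `|vmod (high psi 0 T) x| <= K}.
  exact: (@ess_supr_bounded _ _ _ mu (fun x => `|vmod (high psi 0 T) x|) h).
pose F i := filtered u (ps psi 0) i.
have d i : density (g i) (T i) by exact: (represents_density (g_represents hu i)).
have iF i : cintegrable (F i) by exact: (filter_integrable (ps_test hpsi 0) (d i)).
have B1 i := inv_fourier_bounded (iF i).
have [N hN] : exists N : 'I_3 -> R, forall i, 0 <= N i /\ forall x, cmod (inv_fourier_fun (F i) x) <= N i.
  by exists (fun i => projT1 (cid2 (B1 i))) => i; case: (cid2 (B1 i)) => N h0 h1.
have rU i : represents (fun x => (u i x)%:C) (T i) by split=> //; exact: (u_tempered hu i).
have rS i : represents (inv_fourier_fun (F i)) (Slow psi 0 T i).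
  by rewrite Slow_filter; exact: (filter_represents (ps_test hpsi 0) (d i)).
have rN i : represents (fun x => - inv_fourier_fun (F i) x) (- Slow psi 0 T i).
  have [t1 t2] := rS i; split=> [phi s|phi s].
    by have := cintegrableN (t1 _ s); congr cintegrable; apply/funext => x; rewrite mulNr.
  rewrite fctE t2 // /of_fun -(cintegralN (t1 _ s)); apply: eq_cintegral => x.
  by rewrite mulNr.
have rH i : represents (fun x => (u i x)%:C - inv_fourier_fun (F i) x) (high psi 0 T i).
  exact: (representsD (rU i) (rN i)).
have K0 : 0 <= Num.max K 0 by rewrite le_max lexx orbT.
exists (Num.max K 0 + \sum_(i < 3) N i); first by rewrite addr_ge0 // sumr_ge0 // => i _; exact: (hN i).1.
move=> i; refine (aeS2 _ hK (fun_of_ae hpsi (rH i))) => x hx e.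
rewrite -(cmod_real (u i x)) -[(u i x)%:C](subrK (inv_fourier_fun (F i) x)).
apply: (le_trans (cmodD _ _)); apply: lerD; last first.
  apply: (le_trans ((hN i).2 x)); rewrite (bigD1 i) //= lerDl sumr_ge0 // => j _; exact: (hN j).1.
rewrite -e le_max; apply/orP; left; apply: le_trans hx.
rewrite ger0_norm ?sqrtr_ge0 // /vmod -[leLHS]ger0_norm ?cmod_ge0 // -sqrtr_sqr.
apply: ler_wsqrtr; rewrite (bigD1 i) //= lerDl sumr_ge0 // => j _; exact: sqr_ge0.
Qed.

Section bound.
Variable B : R.
Hypothesis B0 : 0 <= B.
Hypothesis hB : forall i, {ae mu, forall x, `|u i x| <= B}.

(** A representative of the velocity that is bounded at every point, so that the pointwise estimates
    apply. *)
Let cu j x : R[i] := ((if `|u j x| <= B then u j x else 0)%R)%:C.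

Let cu_le j x : cmod (cu j x) <= B.
Proof. by rewrite /cu cmod_real; case: ifP => // _; rewrite normr0. Qed.

Let cu_ae j : {ae mu, forall x, cu j x = (u j x)%:C}.
Proof. by apply: aeS (hB j) => x; rewrite /cu => ->. Qed.

Let cu_meas j : cmeas (cu j).
Proof.
apply: cmeas_real; have m : measurable_fun setT (u j) by exact: (mu_ j).1.
apply: (measurable_fun_ifT _ m (measurable_cst (0 : R))).
have m2 : measurable_fun setT (fun x => cmod ((u j x)%:C : R[i])) by apply: measurable_cmod; exact: mu_.
have := measurable_fun_ler m2 (measurable_cst B).
by congr measurable_fun; apply/funext => x; rewrite cmod_real.
Qed.

(** After truncation of C and of g_j the form is an integral in physical space, by
    [inv_fourier_trilinear], and the transform of the truncated g_j is u_j plus an L2 error. The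
    first is bounded by B; the second contributes nothing in the limit, the transform of A being
    bounded. Bessel turns the remaining norms into those of A and C. *)
Lemma bounded_transport A C j : cintegrable A -> L2 A -> L2 C -> dbl (tker A C (g j)) ->
  cmod (c0%:C * dint (tker A C (g j))) <= B * Num.sqrt (nn2 A * nn2 C).
Proof.
move=> iA lA lC d.
have [w [lw nw hw]] := field_approx hpsi (u_tempered hu j) (g_represents hu j) (g_L2 hpsi hu j).
have [MA MA0 hMA] := inv_fourier_bounded iA.
pose X n := c0%:C * dint (tker A (cut n.+1 C) (cut n.+1 (g j))).
have mA := lA.1; have mC n := cut_meas n lC.1; have mgn n := cut_meas n (mg j).
have le1 n p : cmod (tker A (cut n C) (cut n (g j)) p) <= cmod (tker A C (g j) p).
  rewrite (cmodM (A p.1)) (cmodM (cut n C p.2)) [X in _ <= X](cmodM (A p.1)) (cmodM (C p.2)).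
  by apply: ler_wpM2l; [exact: cmod_ge0|apply: ler_pM; rewrite ?cmod_ge0 ?cut_le].
have dn n : dbl (tker A (cut n C) (cut n (g j))).
  apply: (dbl_le (tker_meas mA (mC n) (mgn n)) ler01 _ d) => p; rewrite mul1r; exact: le1.
have cX : cmod (dint (tker A (cut n.+1 C) (cut n.+1 (g j))) - dint (tker A C (g j))) @[n --> \oo] --> (0 : R).
  apply: (@dint_cvg R (fun n => tker A (cut n.+1 C) (cut n.+1 (g j))) _ (tker A C (g j)) _ _ d _ _).2.
  - by move=> n; exact: (dn n.+1).1.
  - exact: d.1.
  - by move=> n p; exact: le1.
  move=> p; have c0' : (0 : R) @[n --> \oo] --> (0 : R) by exact: cvg_cst.
  apply: cvg_trans c0'; apply: near_eq_cvg.
  pose N1' := Num.bound (enorm p.2); pose N2' := Num.bound (enorm (- p.1 - p.2)).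
  exists (maxn N1' N2') => // n /= hn.
  have e1 : cut n.+1 C p.2 = C p.2.
    rewrite /cut ball3_in ?mul1r //; apply: (le_trans (ltW (archi_boundP (enorm_ge0 _)))).
    by rewrite ler_nat (leq_trans (leq_maxl N1' N2')) // (leq_trans hn).
  have e2 : cut n.+1 (g j) (- p.1 - p.2) = g j (- p.1 - p.2).
    rewrite /cut ball3_in ?mul1r //; apply: (le_trans (ltW (archi_boundP (enorm_ge0 _)))).
    by rewrite ler_nat (leq_trans (leq_maxr N1' N2')) // (leq_trans hn).
  by rewrite /tker e1 e2 subrr cmod0.
pose P n x := inv_fourier_fun A x * inv_fourier_fun (cut n C) x.
have [lIA nIA] := bessel iA lA.
have lC' n := cut_L2 n lC; have iC' n := cut_int n lC.
have bC n := bessel (iC' n) (lC' n).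
have iP n : cintegrable (P n) by exact: (L2_mul lIA (bC n).1).
have lP n : L2 (P n) by exact: (L2_boundM (cmeas_inv_fourier iA) hMA (bC n).1).
have nC n : nn2 (cut n C) <= nn2 C by apply: (nn2_le (lC' n) lC) => x; exact: cut_le.
have nP n : nn2 (P n) <= MA ^+ 2 * nn2 C.
  apply: (le_trans (nn2_boundM (cmeas_inv_fourier iA) MA0 hMA (bC n).1)).
  by apply: ler_wpM2l; [exact: sqr_ge0|exact: (le_trans (bC n).2 (nC n))].
have XE n : X n = cintegral (fun x => cu j x * P n.+1 x) + cintegral (fun x => w n.+1 x * P n.+1 x).
  have i1 : cintegrable (fun x => cu j x * P n.+1 x) by exact: (cintegrable_boundM (cu_meas j) (cu_le j) (iP _)).
  have i2 : cintegrable (fun x => w n.+1 x * P n.+1 x) by exact: (L2_mul (lw _) (lP _)).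
  rewrite -(cintegralD i1 i2).
  have ig := g_cut hpsi (g_represents hu j) n.+1.
  have T1 := inv_fourier_trilinear ig iA lA (iC' n.+1) (lC' n.+1).
  have E1 : dint (tker A (cut n.+1 C) (cut n.+1 (g j))) = dint (tker (cut n.+1 (g j)) A (cut n.+1 C)).
    rewrite (dint_rot mA (mC n.+1) (mgn n.+1)); apply: dint_tswap.
    exact: (dbl_rot mA (mC n.+1) (mgn n.+1) (dn n.+1)).
  rewrite /X E1; refine (etrans (esym T1) _).
  apply: ae_eq_cintegral.
  - apply: cmeasM; first exact: (cmeas_inv_fourier ig).
    exact: (cintegrable_meas (iP n.+1)).
  - exact: (cintegrable_meas (cintegrableD i1 i2)).
  refine (aeS2 _ (hw n.+1 isT) (cu_ae j)) => x e1 e2.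
  rewrite -mulrDl; exact: (f_equal2 *%R (etrans e1 (congr1 (fun t => t + w n.+1 x) (esym e2))) erefl).
have bX n : cmod (X n) <= B * Num.sqrt (nn2 A * nn2 C) + Num.sqrt (MA ^+ 2 * nn2 C * nn2 (w n.+1)).
  rewrite XE; apply: (le_trans (cmodD _ _)); apply: lerD.
    have i1 : cintegrable (fun x => cu j x * P n.+1 x) by exact: (cintegrable_boundM (cu_meas j) (cu_le j) (iP _)).
    have im := L2_mulr lIA (bC n.+1).1.
    apply: (le_trans (cmod_cintegral i1)).
    apply: (@le_trans _ _ (\int[mu]_x (B * (cmod (inv_fourier_fun A x) * cmod (inv_fourier_fun (cut n.+1 C) x))))).
      apply: le_Rintegral => //.
      - exact: (integrable_cmod i1).
      - exact: (integrable_scale B im).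
      move=> x _; rewrite (cmodM (cu j x)) (cmodM (inv_fourier_fun A x)).
      by apply: ler_wpM2r; [rewrite mulr_ge0 ?cmod_ge0|exact: cu_le].
    rewrite RintegralZl //; apply: ler_wpM2l => //.
    apply: (le_trans (cauchy_schwarz lIA (bC n.+1).1)).
    exact: (ler_wsqrtr (ler_pM (nn2_ge0 _) (nn2_ge0 _) nIA (le_trans (bC n.+1).2 (nC n.+1)))).
  apply: (le_trans (cmod_cintegral_mul (lw n.+1) (lP n.+1))).
  rewrite [X in _ <= Num.sqrt X]mulrC.
  exact: (ler_wsqrtr (ler_wpM2l (nn2_ge0 _) (nP n.+1))).
have nw1 : nn2 (w n.+1) @[n --> \oo] --> (0 : R).
  by apply: (null_subseq (v := fun n => nn2 (w n)) _ nw) => n; exact: leqnSn.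
have tr (a b : R[i]) : cmod a <= cmod b + cmod (b - a).
  by have := cmodB b (b - a); rewrite {1}(_ : b - (b - a) = a) // opprB addrC subrK.
have nul := null_add (null_sqrt (null_scale (MA ^+ 2 * nn2 C) nw1)) (null_scale (cmod (c0%:C : R[i])) cX).
apply: (le_null _ nul) => n; rewrite addrA; apply: le_trans (lerD (bX n) (lexx _)).
rewrite /X -(cmodM c0%:C) mulrBr.
exact: tr.
Qed.

(** Relative to G, in squared norms, the gradient of the low part costs a multiple of 2^(k+1) and
    the high part gains 2^(-k). The powers cancel, and the tail of G in the high part tends to 0. *)
Lemma low_energy_null : low_energy psi u (k + 1)%N%:Z @[k --> \oo] --> (0 : R).
Proof.
have [M M0 hM] := ps_bounded hpsi; have [N N0 hN] := hp_bounded hpsi.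
have lG i := weighted_L2 hpsi hu i.
have b k i j : cmod (c0%:C * dint (tker (gradient u (ps psi (k + 1)%N%:Z) i j)
    (filtered u (fun x => 1 - ps psi (k + 1)%N%:Z x) i) (g j))) <=
    B * Num.sqrt (2 * M ^+ 2 * N ^+ 2 * nn2 (G i) * nn2 (tail (2 ^ k) (G i))).
  (* One more than k, so that 1 - p_(k+1) lives where |x| > 2^k, the range of the tail. *)
  set kz := (k + 1)%N%:Z.
  have pk : p2 kz = 2 * 2 ^+ k :> R by rewrite /kz p2_nat addn1 exprS.
  have pk0 : 0 < 2 ^+ k :> R by rewrite exprn_gt0.
  have hl : localized (2 ^ k.+1) M (ps psi kz).
    split; [exact: (ps_meas hpsi)|exact: M0|exact: (hM kz)|].
    by move=> z hz; apply: (ps_out hpsi); rewrite pk -exprS ltW // -natrX.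
  have mgr := gradient_meas hpsi hu i j (ps_meas hpsi kz).
  have sq_le (n : nat) x : enorm x <= n%:R -> sq x <= Num.sqrt n%:R by move=> h; rewrite /sq ler_wsqrtr.
  have bA x : cmod (gradient u (ps psi kz) i j x) <= M * Num.sqrt (2 ^ k.+1)%:R * cmod (cut (2 ^ k.+1) (G i) x).
    apply: (le_trans (gradient_bound u i j x hl)); rewrite -mulrA; apply: ler_wpM2l => //.
    have [h|h] := leP (enorm x) (2 ^ k.+1)%:R; last by rewrite /cut ball3_out // !mul0r cmod0 !mulr0.
    rewrite /cut ball3_in // !mul1r weightedE mulrA; apply: ler_wpM2r; first exact: cmod_ge0.
    by rewrite -sq_sqr expr2; apply: ler_wpM2r; [exact: sq_ge0|exact: sq_le].
  have iA := cintegrable_le mgr (integrable_scale (M * Num.sqrt (2 ^ k.+1)%:R)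
    (integrable_cmod (cut_int (2 ^ k.+1) (lG i)))) bA.
  have lA := L2_le mgr bA (cut_L2 (2 ^ k.+1) (lG i)).
  have nA : nn2 (gradient u (ps psi kz) i j) <= M ^+ 2 * (2 * 2 ^+ k) * nn2 (G i).
    have sE : (M * Num.sqrt (2 ^ k.+1)%:R) ^+ 2 = M ^+ 2 * (2 * 2 ^+ k).
      by rewrite exprMn sqr_sqrtr // natrX [2 ^+ k.+1]exprS.
    rewrite -sE -(nn2Z _ (lG i)); apply: (nn2_le lA (L2Z (M * Num.sqrt (2 ^ k.+1)%:R)%:C (lG i))) => x.
    apply: (le_trans (bA x)); rewrite (cmodM (_%:C)) cmod_real ger0_norm ?mulr_ge0 ?sqrtr_ge0 //.
    by apply: ler_wpM2l; [rewrite mulr_ge0 ?sqrtr_ge0|exact: cut_le].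
  have mC : cmeas (filtered u (fun x => 1 - ps psi kz x) i) by exact: (filtered_meas hpsi hu i (hp_meas hpsi kz)).
  have bC x : cmod (filtered u (fun x => 1 - ps psi kz x) i x) <= N / Num.sqrt (2 ^+ k) * cmod (tail (2 ^ k) (G i) x).
    rewrite /filtered (cmodM (_%:C)) cmod_real.
    have [->|h] := eqVneq (1 - ps psi kz x) 0.
      by rewrite normr0 mul0r mulr_ge0 ?cmod_ge0 // divr_ge0 // sqrtr_ge0.
    have hx : 2 ^+ k < enorm x.
      by have := c_neq0 hpsi h; rewrite pk mulrC mulKf ?pnatr_eq0.
    rewrite tail_out ?natrX // weightedE mulrA; apply: ler_wpM2r; first exact: cmod_ge0.
    apply: (le_trans (hN kz x)); rewrite -mulrA ler_peMr // ler_pdivlMl ?sqrtr_gt0 // mulr1.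
    by rewrite /sq ler_wsqrtr // ltW.
  have lT := tail_L2 (2 ^ k) (lG i).
  have lC := L2_le mC bC lT.
  have nC : nn2 (filtered u (fun x => 1 - ps psi kz x) i) <= N ^+ 2 / 2 ^+ k * nn2 (tail (2 ^ k) (G i)).
    have sE : (N / Num.sqrt (2 ^+ k)) ^+ 2 = N ^+ 2 / 2 ^+ k by rewrite exprMn exprVn sqr_sqrtr // ltW.
    rewrite -sE -(nn2Z _ lT); apply: (nn2_le lC (L2Z (N / Num.sqrt (2 ^+ k))%:C lT)) => x.
    apply: (le_trans (bC x)); rewrite (cmodM (_%:C) (tail _ _ x)) cmod_real ger0_norm //.
    by rewrite divr_ge0 // sqrtr_ge0.
  have d : dbl (tker (gradient u (ps psi kz) i j) (filtered u (fun x => 1 - ps psi kz x) i) (g j)).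
    apply: (dbl_le (tker_meas mgr mC (mg j)) N0 _ (gradient_dbl hpsi hu i j i j hl)) => p.
    rewrite (cmodM (gradient u (ps psi kz) i j p.1)) (cmodM (filtered u _ i p.2)) [X in _ <= N * X](cmodM (gradient u (ps psi kz) i j p.1)) (cmodM (g i p.2)).
    rewrite /filtered (cmodM (_%:C) (g i p.2)) cmod_real.
    by apply: mid_bound; [exact: cmod_ge0|exact: cmod_ge0|exact: cmod_ge0|exact: hN].
  apply: (le_trans (bounded_transport iA lA lC d)); apply: ler_wpM2l => //; apply: ler_wsqrtr.
  apply: (le_trans (ler_pM (nn2_ge0 _) (nn2_ge0 _) nA nC)).
  set a := nn2 (G i); set c := nn2 (tail _ _).
  rewrite (_ : M ^+ 2 * (2 * 2 ^+ k) * a * (N ^+ 2 / 2 ^+ k * c) = 2 * M ^+ 2 * N ^+ 2 * a * c * (2 ^+ k / 2 ^+ k)); last by ring.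
  by rewrite divff ?mulr1 // gt_eqF.
have tn i : nn2 (tail (2 ^ k) (G i)) @[k --> \oo] --> (0 : R).
  by apply: (null_subseq (v := fun n => nn2 (tail n (G i))) _ (tail_cvg (lG i))) => k; rewrite ltnW // ltn_expl.
have e0 i : B * Num.sqrt (2 * M ^+ 2 * N ^+ 2 * nn2 (G i) * nn2 (tail (2 ^ k) (G i))) @[k --> \oo] --> (0 : R).
  by apply: null_scale; apply: null_sqrt; exact: (null_scale (2 * M ^+ 2 * N ^+ 2 * nn2 (G i)) (tn i)).
have se : \sum_(i < 3) \sum_(j < 3) B * Num.sqrt (2 * M ^+ 2 * N ^+ 2 * nn2 (G i) * nn2 (tail (2 ^ k) (G i))) @[k --> \oo] --> (0 : R).
  apply: (@null_sum3 R (fun i k => \sum_(j < 3) B * Num.sqrt (2 * M ^+ 2 * N ^+ 2 * nn2 (G i) * nn2 (tail (2 ^ k) (G i))))) => i.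
  by apply: (@null_sum3 R (fun j k => B * Num.sqrt (2 * M ^+ 2 * N ^+ 2 * nn2 (G i) * nn2 (tail (2 ^ k) (G i))))) => j; exact: e0.
apply: null_le se => k; apply/andP; split.
  apply: Rintegral_ge0 => x _; rewrite mulr_ge0 ?(ps_ge0 hpsi) // mulr_ge0 ?enorm_ge0 //.
  by apply: sumr_ge0 => i _; exact: sqr_ge0.
apply: (le_trans (ler_norm _)); rewrite -cmod_real.
have [n [M' hl]] := localized_ps hpsi (k + 1)%N%:Z.
have E : (low_energy psi u (k + 1)%N%:Z)%:C = \sum_(i < 3) \sum_(j < 3)
   c0%:C * dint (tker (gradient u (ps psi (k + 1)%N%:Z) i j)
    (filtered u (fun x => 1 - ps psi (k + 1)%N%:Z x) i) (g j)).
  refine (etrans (energy_high hpsi hu hl) _); rewrite mulr_sumr; apply: eq_bigr => i _.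
  by rewrite mulr_sumr.
rewrite E; apply: (le_trans (cmod_sum _ _ _)); apply: ler_sum => i _.
by apply: (le_trans (cmod_sum _ _ _)); apply: ler_sum => j _; exact: b.
Qed.

Lemma total_energy_eq0 : total_energy u = 0.
Proof.
have h1 : `|low_energy psi u (k + 1)%N%:Z - total_energy u| @[k --> \oo] --> (0 : R).
  by apply: (null_subseq (v := fun k => `|low_energy psi u k%:Z - total_energy u|) _ (low_energy_cvg hpsi hu)) => n; exact: leq_addr.
have t0 : 0 <= total_energy u by apply: sumr_ge0 => i _; exact: nn2_ge0.
apply: (null_const t0 _ (null_add low_energy_null h1)) => k.
rewrite distrC; have := ler_norm (total_energy u - low_energy psi u (k + 1)%N%:Z).
by set a := total_energy u; set b := low_energy _ _ _; set c := `|_|; lra.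
Qed.
End bound.

(** Every Gaussian dominates the indicator of the origin, and its mass tends to 0 with its width. *)
Lemma origin_null : {ae mu, forall x, sq x != 0}.
Proof.
pose S : set (E3 R) := [set x | enorm x <= 0].
have mS : measurable S.
  have := measurable_fun_ler (@measurable_enorm R) (measurable_cst (0 : R)).
  by move=> /(_ measurableT [set true] I); rewrite setTI.
have S0 x : S x -> x = 0 by move=> h; apply: enorm_eq0; apply/eqP; rewrite eq_le h enorm_ge0.
have le e : 0 < e -> (mu S <= ((Num.sqrt (2 * pi) / e) ^+ 3)%:E)%E.
  move=> e0; rewrite -(integral_gauss e0) -[S]setIT -integral_indic //.
  apply: ge0_le_integral => //.
  - by apply/measurable_EFinP; exact: measurable_indic.
  - by apply/measurable_EFinP; exact: measurable_gauss.
  move=> x _; rewrite lee_fin indicE; have [h|_] := boolP (x \in S); last exact: ltW (gauss_gt0 _ _).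
  by rewrite (S0 x (set_mem h)) /gauss dot0l mulr0 mul0r oppr0 expR0.
exists S; split => //.
  apply/eqP; rewrite eq_le measure_ge0 andbT; apply/lee_addgt0Pr => d d0; rewrite add0e.
  pose a : R := Num.sqrt (2 * pi).
  have a0 : 0 <= a by exact: sqrtr_ge0.
  (* The minimum with 1 allows the cube to be bounded by its base. *)
  pose m := Num.min 1 d.
  have m0 : 0 < m by rewrite /m lt_min ltr01 d0.
  have m1' : m <= 1 by rewrite /m ge_min lexx.
  have md : m <= d by rewrite /m ge_min lexx orbT.
  have a1 : 0 < a + 1 by rewrite ltr_wpDl.
  have e0 : 0 < (a + 1) / m by rewrite divr_gt0.
  apply: (le_trans (le _ e0)); rewrite lee_fin.
  have q0 : 0 <= a / ((a + 1) / m) by rewrite divr_ge0 // ltW.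
  have q1 : a / ((a + 1) / m) <= m.
    by rewrite invf_div mulrA ler_pdivrMr // mulrDr mulr1 (mulrC m a) lerDl ltW.
  apply: le_trans md; apply: (le_trans _ q1); rewrite exprS ler_piMr // expr_le1 //.
  exact: (le_trans q1 m1').
move=> x /= h; rewrite /S /=; have [|c] := leP (enorm x) 0; first by [].
by exfalso; apply: h; rewrite /sq gt_eqF // sqrtr_gt0.
Qed.

(** The transform is a function, so it hides no mass at the origin: vanishing almost everywhere off
    the origin it is null, and so are both parts of the field in [field_split]. *)
Lemma energy0_velocity0 : total_energy u = 0 -> forall i, {ae mu, forall x, u i x = 0}.
Proof.
move=> h i; have lG := weighted_L2 hpsi hu i.
have n0 : nn2 (G i) = 0.
  have := h; rewrite /total_energy (bigD1 i) //= => e.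
  have p1 := nn2_ge0 (G i); have p2' : 0 <= \sum_(j < 3 | j != i) nn2 (G j) by apply: sumr_ge0 => j _; exact: nn2_ge0.
  by apply/eqP; rewrite eq_le p1 andbT; move: e p2'; set s := \sum_(_ | _) _; lra.
have zero_ae f : L2 f -> nn2 f = 0 -> {ae mu, forall x, f x = 0}.
  move=> lf e; have m := measurable_funX 2 (measurable_cmod lf.1).
  have := nonneg_integral_eq0 m (fun x => sqr_ge0 _) e lf.2.
  apply: aeS => x /eqP; rewrite sqrf_eq0 => /eqP; exact: cmod_eq0.
have g0 : {ae mu, forall x, g i x = 0}.
  refine (aeS2 _ (zero_ae _ lG n0) origin_null) => x e s.
  apply: cmod_eq0; apply/eqP; have := congr1 (@cmod R) e.
  rewrite /weighted cmodM cmod_real cmod0 => /eqP; rewrite mulf_eq0 normr_eq0 (negbTE s).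
  by [].
have [w [fw hw]] := field_split hpsi (u_tempered hu i) (g_represents hu i) (g_L2 hpsi hu i).
have [lh lw _] := fw.
have w0 : {ae mu, forall x, w x = 0}.
  apply: (zero_ae w lw); rewrite (FT2_nn2 fw).
  have -> : nn2 (high_part (g i)) = nn2 (fun=> 0).
    apply: (ae_eq_nn2 lh.1 (cmeas_cst 0)); apply: aeS g0 => x e.
    by rewrite /high_part /cut e mulr0 subrr.
  by rewrite /nn2; under eq_Rintegral do rewrite cmod0 expr0n; rewrite /Rintegral integral0.
have c0' x : inv_fourier_fun (cut 1 (g i)) x = 0.
  have ic := g_cut hpsi (g_represents hu i) 1.
  rewrite inv_fourierE (@ae_eq_cintegral R _ (fun=> 0)) ?cintegral0 ?mulr0 //.
  - by apply: cmeasM; [|exact: (cintegrable_meas ic)]; apply: cmeas_expi; apply: measurable_dot.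
  by apply: aeS g0 => xi e; rewrite /cut e !mulr0.
refine (aeS2 _ hw w0) => x e1 e2; rewrite (c0' x) e2 addr0 in e1.
by have := congr1 (@complex.Re R) e1.
Qed.

End bounded_velocity.

Theorem theorem1p4 (R : realType) (psi : E3 R -> R) (u : 'I_3 -> E3 R -> R)
    (hpsi : LP_cutoff psi)
    (hu : weak_solution (1 / 2) u)
    (hfin : (\int[leb3 R]_x
       (vmod (vfrac_lap ((1 / 2) / 2) (dist_of_field u)) x ^+ 2)%:E < +oo)%E) :
  (\int[leb3 R]_x (vmod (vfrac_lap (1 / 4) (dist_of_field u)) x ^+ 2)%:E
   = limn_einf (fun k : nat =>
       (flux psi (dist_of_field u) k%:Z)%:E))%E
  /\ ((Lnorm (leb3 R) +oo
         (fun x => (vmod (high psi 0 (dist_of_field u)) x)%:E) < +oo)%E ->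
      forall i, {ae leb3 R, forall x, u i x = 0}).
Proof.
split; first exact: (energy_liminf hpsi hu).
move=> h; have [B B0 hB] := velocity_bounded hpsi hu h.
exact: (energy0_velocity0 hpsi hu (total_energy_eq0 hpsi hu B0 hB)).
Qed.
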